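(* Let $k\ge7$, $v(x,y,\lambda)\in\mathfrak S_{c,k}$, and let $\Psi(x,y,\lambda)$ be the unique solution of the Riemann–Hilbert problem $(\lambda\in\mathbb R,\,v(x,y,\lambda))$ such that $\Psi-1,\partial_x\Psi,\partial_y\Psi$ are uniformly bounded in $L_2(\mathbb R,d\lambda)$. Then $\Psi$ satisfies $$(\partial_y-\lambda\partial_x)\Psi(x,y,\lambda)=(\partial_xQ(x,y))\Psi(x,y,\lambda)$$ with $$Q(x,y)=\frac1{2\pi i}\int_{\mathbb R}\Psi_-(x,y,\zeta)\,(v(x,y,\zeta)-1)\,d\zeta,$$ and $\Psi(x,\cdot,\lambda)\to1$ as $y\to-\infty$. Here $\partial_xQ(x,y)\in su(n)$, and for $i+j\le k-4$, $i>0$, one has $\partial_x^i\partial_y^jQ,\ \partial_yQ,\ Q\in L_\infty$, and $\partial_x^i\partial_y^jQ,\ \partial_yQ,\ Q\to0$ as $x$ or $y\to\infty$.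
   Context: Fix $n\ge1$; matrices are complex $n\times n$, $1$ is the identity matrix, $f^*$ is the conjugate transpose, $\mathbb C^\pm$ are the open upper/lower half planes, $\mathcal L_\lambda=\partial_y-\lambda\partial_x$. $\mathfrak S_{c,k}$ ($k\ge7$) is the set of matrix-valued functions $v(x,y,\lambda)$, $x,y,\lambda\in\mathbb R$, such that $\det v\equiv1$; $v=v^*>0$; and for all $i+j\le k-4$: (a) $\mathcal L_\lambda v=0$ and $v(x,y,\lambda)=v(x+\lambda y,\lambda)$ (i.e. $v$ depends only on $x+\lambda y$ and $\lambda$) for all $x,y\in\mathbb R$; (b) $\partial_x^i\partial_y^j(v-1)$ are uniformly (in $x,y$) bounded in $L_\infty\cap L_2(\mathbb R,d\lambda)\cap L_1(\mathbb R,d\lambda)$; (c) $\partial_x^i\partial_y^j(v-1)\to0$ uniformly in $L_\infty\cap L_2(\mathbb R,d\lambda)\cap L_1(\mathbb R,d\lambda)$ as $|x|$ or $|y|\to\infty$; (d) $\partial_\lambda v\in L_2(\mathbb R,d\lambda)$ with norm depending continuously on $x,y$. For $v(\lambda)$ defined on $\mathbb R$, a function $\Psi(\lambda)$ is a solution of the Riemann–Hilbert problem $(\lambda\in\mathbb R,v)$ if $$\Psi(\lambda)=1+\frac1{2\pi i}\int_{\mathbb R}\frac{\Psi_-(t)(v(t)-1)}{t-\lambda}\,dt,\qquad\lambda\in\mathbb C\setminus\mathbb R,$$ where $\Psi_\pm(\lambda)=\lim_{\tilde\lambda\to\lambda,\ \tilde\lambda\in\mathbb C^\pm}\Psi(\tilde\lambda)$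 for $\lambda\in\mathbb R$. For $v\in\mathfrak S_{c,k}$, $k\ge7$, it is a previously established fact that a unique solution $\Psi(x,y,\cdot)$ with $\Psi-1,\partial_x\Psi,\partial_y\Psi$ bounded in $L_2(\mathbb R,d\lambda)$ (boundary values on $\mathbb R$) uniformly in $x,y$ exists, and that for each fixed $\lambda\notin\mathbb R$ and $i+j\le k-4$, $\partial_x^i\partial_y^j\Psi\in L_\infty(dxdy)$ and $\partial_x^i\partial_y^j(\Psi-1)\to0$ in $L_\infty(dxdy)$ as $x$ or $y\to\infty$. *)

(* Defs.v *)
From HB Require Import structures.
From mathcomp Require Import all_boot all_order all_algebra.
From mathcomp Require Import all_classical all_reals all_analysis.
From mathcomp Require Import complex.

Set Implicit Arguments.
Unset Strict Implicit.
Unset Printing Implicit Defensive.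

Import Order.TTheory GRing.Theory Num.Theory.
Import numFieldNormedType.Exports.

Local Open Scope classical_set_scope.
Local Open Scope ring_scope.
Local Open Scope complex_scope.
Local Open Scope sesquilinear_scope.

Section Matrices.
Context {R : realType} {n : nat}.
Local Notation M := 'M[R[i]]_n.

(* Frobenius norm, with values in R. *)
Definition mxnorm (A : M) : R :=
  Num.sqrt (\sum_(i < n) \sum_(j < n) ComplexField.Normc.normc (A i j) ^+ 2).

(* In the order of R[i], 0 < z means that z is real and positive. *)
Definition posdefmx (A : M) : Prop :=
  A^t* = A /\ forall u : 'rV[R[i]]_n, u != 0 -> 0 < (u *m A *m u^t*) 0 0.

Definition su (A : M) : Prop := A^t* = - A /\ \tr A = 0.

Definition mxderivable (F : R -> M) (t : R) : Prop :=
  forall i j, derivable (fun s => complex.Re (F s i j)) t 1 /\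
              derivable (fun s => complex.Im (F s i j)) t 1.

Definition mxder (F : R -> M) (t : R) : M :=
  \matrix_(i, j) (derive1 (fun s => complex.Re (F s i j)) t +i*
                  derive1 (fun s => complex.Im (F s i j)) t).

Definition derivable_x (F : R -> R -> M) (x y : R) : Prop :=
  mxderivable (fun x' => F x' y) x.
Definition derivable_y (F : R -> R -> M) (x y : R) : Prop :=
  mxderivable (fun y' => F x y') y.
Definition Dx (F : R -> R -> M) : R -> R -> M :=
  fun x y => mxder (fun x' => F x' y) x.
Definition Dy (F : R -> R -> M) : R -> R -> M :=
  fun x y => mxder (fun y' => F x y') y.

(* d_x^i d_y^j F; the derivatives in x are taken first. *)
Definition pd (i j : nat) (F : R -> R -> M) : R -> R -> M :=
  iter j Dy (iter i Dx F).

(* The partial derivatives of F of order at most m exist everywhere. *)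
Definition pdiff (m : nat) (F : R -> R -> M) : Prop :=
  forall i j, (i + j < m)%N -> forall x y,
    derivable_x (pd i j F) x y /\ derivable_y (pd i j F) x y.

Definition mxmeasurable d (T : measurableType d) (F : T -> M) : Prop :=
  forall i j, measurable_fun [set: T] (fun t => complex.Re (F t i j)) /\
              measurable_fun [set: T] (fun t => complex.Im (F t i j)).

(* L_p(R, dlambda) norm, as an extended real; p may be +oo. *)
Definition mxLnorm (p : \bar R) (F : R -> M) : \bar R :=
  Lnorm (@lebesgue_measure R) p (fun t => (mxnorm (F t))%:E).

Definition mxintegrable (F : R -> M) : Prop :=
  forall i j,
    (@lebesgue_measure R).-integrable [set: R] (EFin \o (fun t => complex.Re (F t i j)))
    /\
    (@lebesgue_measure R).-integrable [set: R] (EFin \o (fun t => complex.Im (F t i j))).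

Definition mxintegral (F : R -> M) : M :=
  \matrix_(i, j) ((\int[@lebesgue_measure R]_t complex.Re (F t i j)) +i*
                  (\int[@lebesgue_measure R]_t complex.Im (F t i j))).

Definition twopii : R[i] := 0 +i* (2 * pi).

End Matrices.

Section Decay.
Context {R : realType}.

(* Limit 0 as |x| or |y| tends to infinity, uniformly in the other variable. *)
Definition vanish_unif (N : R -> R -> \bar R) : Prop :=
  forall e : R, 0 < e -> exists K : R, forall x y : R,
    K <= `|x| \/ K <= `|y| -> (N x y <= e%:E)%E.

(* Limit 0 as |x| tends to infinity for each y, and as |y| tends to infinity
   for each x. *)
Definition vanish_sep (N : R -> R -> \bar R) : Prop :=
  forall e : R, 0 < e ->
    (forall y : R, exists K : R, forall x : R, K <= `|x| -> (N x y <= e%:E)%E)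
    /\
    (forall x : R, exists K : R, forall y : R, K <= `|y| -> (N x y <= e%:E)%E).

End Decay.

Section ScatteringData.
Context {R : realType} {n : nat}.
Local Notation M := 'M[R[i]]_n.

(* The class of scattering data.  The decay in L_oo(R, dlambda) is required in
   x for each y and in y for each x only: for every lambda, (x, y) |->
   x + lambda y maps the half-plane K <= y onto R, so that decay of the sup norm over lambda that is
   uniform in the other variable would force v = 1.  In L_1 and L_2 the decay
   is uniform. *)
Record scatdata (k : nat) (v : R -> R -> R -> M) : Prop := {
  scat_det : forall x y l, \det (v x y l) = 1;
  scat_pos : forall x y l, posdefmx (v x y l);
  scat_travel : exists w : R -> R -> M, forall x y l, v x y l = w (x + l * y) l;
  scat_diff : forall l, pdiff (k - 4) (fun x y => v x y l);
  scat_Lax : forall x y l,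
    Dy (fun x y => v x y l) x y - l%:C *: Dx (fun x y => v x y l) x y = 0;
  scat_meas : forall i j, (i + j <= k - 4)%N -> forall x y,
    mxmeasurable (fun l => pd i j (fun x y => v x y l - 1%:M) x y);
  scat_bounded : forall i j, (i + j <= k - 4)%N ->
    forall p : \bar R, p \in [:: 1%E; 2%:E; +oo%E] ->
    exists C : R, forall x y,
      (mxLnorm p (fun l => pd i j (fun x y => v x y l - 1%:M)%R x y) <= C%:E)%E;
  scat_decay12 : forall i j, (i + j <= k - 4)%N ->
    forall p : \bar R, p \in [:: 1%E; 2%:E] ->
    vanish_unif (fun x y =>
      mxLnorm p (fun l => pd i j (fun x y => v x y l - 1%:M) x y));
  scat_decayoo : forall i j, (i + j <= k - 4)%N ->
    vanish_sep (fun x y =>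
      mxLnorm +oo%E (fun l => pd i j (fun x y => v x y l - 1%:M) x y));
  scat_dlambda : forall x y l, mxderivable (v x y) l;
  scat_dlambda_meas : forall x y, mxmeasurable (mxder (v x y));
  scat_dlambda_L2 : forall x y, (mxLnorm 2%:E (mxder (v x y)) < +oo)%E;
  scat_dlambda_cont :
    continuous (fun q : R * R => fine (mxLnorm 2%:E (mxder (v q.1 q.2))))
}.

End ScatteringData.

Section RiemannHilbert.
Context {R : realType} {n : nat}.
Local Notation M := 'M[R[i]]_n.

(* P t is the limit of Psi z as z tends to t in the open half-plane H. *)
Definition boundary_value (H : set R[i]^o) (Psi : R[i] -> M) (P : R -> M) :=
  forall t : R,
    (fun z : R[i]^o => mxnorm (Psi z - P t)) @
      within H (nbhs (t%:C : R[i]^o)) --> (0 : R).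

(* Psi solves the Riemann-Hilbert problem (lambda in R, v), with boundary
   values Psip from the upper and Psim from the lower half-plane. *)
Record rh_solution (v : R -> M) (Psi : R[i] -> M) (Psip Psim : R -> M) : Prop := {
  rh_plus : boundary_value [set z | 0 < complex.Im z] Psi Psip;
  rh_minus : boundary_value [set z | complex.Im z < 0] Psi Psim;
  rh_integrable : forall z : R[i], complex.Im z != 0 ->
    mxintegrable (fun t => (t%:C - z)^-1 *: (Psim t *m (v t - 1%:M)));
  rh_eq : forall z : R[i], complex.Im z != 0 ->
    Psi z = 1%:M + twopii^-1 *:
      mxintegral (fun t => (t%:C - z)^-1 *: (Psim t *m (v t - 1%:M)))
}.

Definition L2_unif_bounded (F : R -> R -> R -> M) : Prop :=
  (forall x y, mxmeasurable (F x y)) /\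
  exists C : R, forall x y, (mxLnorm 2%:E (F x y) <= C%:E)%E.

(* G is the partial derivative of F in x, resp. y, the difference quotients
   converging in L_2(R, dlambda). *)
Definition L2_deriv_x (F G : R -> R -> R -> M) : Prop :=
  forall x y, mxLnorm 2%:E
    (fun l => (h^-1)%:C *: (F (x + h) y l - F x y l) - G x y l) @[h --> 0^']
    --> 0%E.
Definition L2_deriv_y (F G : R -> R -> R -> M) : Prop :=
  forall x y, mxLnorm 2%:E
    (fun l => (h^-1)%:C *: (F x (y + h) l - F x y l) - G x y l) @[h --> 0^']
    --> 0%E.

Definition L2_class (P : R -> R -> R -> M) : Prop :=
  L2_unif_bounded (fun x y l => P x y l - 1%:M) /\
  exists Px Py : R -> R -> R -> M,
    [/\ L2_deriv_x P Px, L2_unif_bounded Px,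
        L2_deriv_y P Py & L2_unif_bounded Py].

Definition potential (v Psim : R -> R -> R -> M) (x y : R) : M :=
  twopii^-1 *: mxintegral (fun t => Psim x y t *m (v x y t - 1%:M)).

Definition Linfty_plane (F : R -> R -> M) : Prop :=
  mxmeasurable (fun q : R * R => F q.1 q.2) /\
  (Lnorm (@lebesgue_measure R \x @lebesgue_measure R) +oo
     (fun q : R * R => (mxnorm (F q.1 q.2))%:E) < +oo)%E.

Definition vanish_plane (F : R -> R -> M) : Prop :=
  vanish_unif (fun x y => (mxnorm (F x y))%:E).

End RiemannHilbert.

(* Main.v *)
(* Let M and P = M v be the lower and upper boundary values of Psi.  As v is hermitian,
   z |-> Psi(z) Psi(z^* )^* has no jump, so M P^* = 1 and M^* M = v^-1 is bounded.  More generally two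
   solutions satisfy Psi'(z) Psi(z^* )^* = 1 + Cauchy(M' (v' - v) M^* )(z), whence
   M' - M = T (M' (v' - v)), where T g = C_-(g M^* ) M is bounded on L_2 and C_- is the lower boundary
   value of the Cauchy integral.  Difference quotients of v then show that M is as smooth in L_2 as v
   is, with d_b M = T (M d_b v), and that d_b Psi = Cauchy(M d_b v M^* ) Psi for b = x, y.  As
   d_y v = t d_x v, the combination d_y Psi - l d_x Psi is (d_x Q) Psi with
   d_x Q = (2 pi i)^-1 \int M d_x v M^*; this matrix is skew-hermitian, and traceless because
   tr (v^-1 d_x v) is the logarithmic derivative of det v = 1.  That it is d_x Q rests on the
   antisymmetry of the Hilbert transform.

   The derivatives d_x^i d_y^j v exist pointwise, with uniform bounds in L_2.  Mean value arguments under
   the integral sign turn them into derivatives in L_2, using that multiplication by t maps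
   d_x^(i+1) d_y^j v to d_x^i d_y^(j+1) v, so that an x-derivative gives decay in t. *)
Require Import Defs.
From mathcomp Require Import all_boot all_order all_algebra.
From mathcomp Require Import all_classical all_reals all_analysis.
From mathcomp Require Import measurable_realfun ess_sup_inf perm complex ring lra zify.

Set Implicit Arguments.
Unset Strict Implicit.
Unset Printing Implicit Defensive.

Import Order.TTheory GRing.Theory Num.Theory.
Import numFieldNormedType.Exports.
Local Open Scope classical_set_scope.
Local Open Scope ring_scope.
Local Open Scope complex_scope.
Local Open Scope sesquilinear_scope.

(** A product of two Cauchy integrals of L_2 functions is the Cauchy integral of a function known
    only to be in L_1, where boundary values satisfy no norm estimate; this obstacle shapes the
    analysis. The product formula is Cotlar's identity K f K g = pi K (f H g + g H f) for the
    Hilbert transform H, and it holds because the commutator of H with multiplication by 1/(s - z)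
    has finite rank. H is built from the Poisson kernels: kernels and conjugate kernels have the
    same pairings, so convergence of Poisson integrals forces convergence of the regularised Hilbert
    transforms. Boundary values of a product are identified by weak limits, in cases where the
    product is seen to lie in L_2. The bound for T depends only on n and on a bound for v - 1, hence
    is uniform in x and y, and the induction on smoothness can run. Q is split into the integral of
    v - 1, handled in L_1, and that of (M - 1)(v - 1), a pairing in L_2. Pure y-derivatives of v
    lack decay in t and cost one order, so the count k - 5 of further derivatives is made for d_x
    Q. *)

Ltac mxexpand := rewrite ?(mulmxDl, mulmxDr, mulmxBl, mulmxBr, mulmxN, mulNmx, mulmx1, mul1mx, mulmxA);
  let i := fresh in let j := fresh in apply/matrixP => i j; rewrite !mxE; ring.

(** * Square integrable functions on the line *)

Section L2Real.
Context {R : realType}.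
Local Notation mu := (@lebesgue_measure R).
Implicit Types (f g h : R -> R) (a b : nat -> \bar R).

Lemma aeS (P Q : R -> Prop) : (forall t, P t -> Q t) ->
  {ae mu, forall t, P t} -> {ae mu, forall t, Q t}.
Proof. by move=> PQ; apply: (@filterS _ _ (ae_filter_ringOfSetsType mu)). Qed.

Lemma aeS2 (P Q S : R -> Prop) : (forall t, P t -> Q t -> S t) ->
  {ae mu, forall t, P t} -> {ae mu, forall t, Q t} -> {ae mu, forall t, S t}.
Proof. by move=> PQ; apply: (@filterS2 _ _ (ae_filter_ringOfSetsType mu)). Qed.

Lemma aeT (P : R -> Prop) : (forall t, P t) -> {ae mu, forall t, P t}.
Proof. by move=> HP; apply: (@aeS (fun=> True)) => //; exact: (@filterT _ _ (ae_filter_ringOfSetsType mu)). Qed.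

(** Convergence in the extended reals is spelled out with an explicit N, so that comparison and
    addition need no finiteness side conditions; [tends0_cvg] translates to filters. *)
Definition tends0 a := forall e : R, 0 < e ->
  exists N, forall n, (N <= n)%N -> (a n <= e%:E)%E.

Lemma tends0_le a b : (forall n, (a n <= b n)%E) -> tends0 b -> tends0 a.
Proof. by move=> ab tb e /tb[N hN]; exists N => n /hN; apply: le_trans. Qed.

Lemma tends0D a b : tends0 a -> tends0 b -> tends0 (fun n => (a n + b n)%E).
Proof.
move=> ta tb e e0.
have [N1 h1] := ta (e / 2) ltac:(lra); have [N2 h2] := tb (e / 2) ltac:(lra).
exists (maxn N1 N2) => n; rewrite geq_max => /andP[n1 n2].
have -> : e = e / 2 + e / 2 by lra.
by rewrite EFinD leeD// ?h1 ?h2.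
Qed.

Lemma tends0Z (c : R) a : 0 <= c -> (forall n, (0 <= a n)%E) ->
  tends0 a -> tends0 (fun n => (c%:E * a n)%E).
Proof.
move=> c0 a0 ta e e0.
have [N hN] := ta (e / (c + 1)) ltac:(apply: divr_gt0; lra).
exists N => n /hN an; apply: (@le_trans _ _ (c%:E * (e / (c + 1))%:E)%E).
  by apply: lee_wpmul2l => //; rewrite lee_fin.
rewrite -EFinM lee_fin mulrCA ger_pMr// ler_pdivrMr; lra.
Qed.

Lemma tends0_cvg a : (forall n, (0 <= a n)%E) ->
  tends0 a <-> a n @[n --> \oo] --> 0%E.
Proof.
move=> a0; split => [ta|].
  apply/fine_cvgP; split.
    have [N hN] := ta 1 ltr01; exists N => // n /= Nn.
    by rewrite ge0_fin_numE// (le_lt_trans (hN _ Nn)) ?ltry.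
  apply/cvgrPdist_le => e e0; have [N hN] := ta e e0; exists N => // n /= Nn.
  rewrite sub0r normrN ger0_norm ?fine_ge0//.
  by rewrite -lee_fin fineK ?hN// ge0_fin_numE// (le_lt_trans (hN _ Nn)) ?ltry.
move=> /fine_cvgP[[N1 _ h1] /cvgrPdist_le h2] e e0.
have [N2 _ h2'] := h2 e e0; exists (maxn N1 N2) => n; rewrite geq_max => /andP[n1 n2].
have := h2' n n2; rewrite /= sub0r normrN ger0_norm ?fine_ge0//.
by rewrite -lee_fin fineK//; exact: h1.
Qed.

Lemma tends0_eq0 (x : \bar R) : (0 <= x)%E -> tends0 (fun=> x) -> x = 0%E.
Proof.
move=> x0 tx; apply/eqP; rewrite eq_le x0 andbT; apply/lee_addgt0Pr => e e0.
by have [N hN] := tx e e0; rewrite add0e (hN N).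
Qed.

(** This is the square of the L_2 norm. Working with squares keeps every estimate polynomial; the
    price is a factor 2 in each triangle inequality, as in [N2D]. *)
Definition N2 f : \bar R := (\int[mu]_t (f t ^+ 2)%:E)%E.

Definition L2 f := measurable_fun setT f /\ (N2 f < +oo)%E.

Lemma N2_ge0 f : (0 <= N2 f)%E.
Proof. by apply: integral_ge0 => t _; rewrite lee_fin sqr_ge0. Qed.

Lemma measurable_sqr f : measurable_fun setT f ->
  measurable_fun setT (fun t => (f t ^+ 2)%:E).
Proof. by move=> mf; apply/measurable_EFinP; exact: measurable_funX. Qed.

Lemma ge0_le_int (F G : R -> \bar R) : (forall t, (0 <= F t)%E) ->
  measurable_fun setT F -> measurable_fun setT G -> (forall t, (F t <= G t)%E) ->
  (\int[mu]_t F t <= \int[mu]_t G t)%E.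
Proof. by move=> F0 mF mG FG; apply: ge0_le_integral. Qed.

Lemma intg_cM (c : R) f : mu.-integrable setT (EFin \o f) ->
  mu.-integrable setT (EFin \o (fun t => c * f t)).
Proof.
move=> h; have := @integrableZl _ _ _ mu setT measurableT c _ h.
by apply: eq_integrable => // t _; rewrite /= EFinM.
Qed.

Lemma intg_D f g : mu.-integrable setT (EFin \o f) -> mu.-integrable setT (EFin \o g) ->
  mu.-integrable setT (EFin \o (fun t => f t + g t)).
Proof.
move=> hf hg; have := @integrableD _ _ _ mu setT measurableT _ _ hf hg.
by apply: eq_integrable => // t _; rewrite /= EFinD.
Qed.

Lemma intg_B f g : mu.-integrable setT (EFin \o f) -> mu.-integrable setT (EFin \o g) ->
  mu.-integrable setT (EFin \o (fun t => f t - g t)).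
Proof.
move=> hf hg; have := intg_D hf (intg_cM (-1) hg).
by apply: eq_integrable => // t _; rewrite /= mulN1r.
Qed.

Lemma le_N2_ae f g : measurable_fun setT f -> measurable_fun setT g ->
  {ae mu, forall t, `|f t| <= `|g t|} -> (N2 f <= N2 g)%E.
Proof.
move=> mf mg fg; apply: ae_ge0_le_integral => //.
- by move=> t _; rewrite lee_fin sqr_ge0.
- exact: measurable_sqr.
- by move=> t _; rewrite lee_fin sqr_ge0.
- exact: measurable_sqr.
- move: fg; apply: aeS => t h _.
  by rewrite lee_fin -(real_normK (num_real (f t))) -(real_normK (num_real (g t))) lerXn2r// nnegrE.
Qed.

Lemma le_N2 f g : measurable_fun setT f -> measurable_fun setT g ->
  (forall t, `|f t| <= `|g t|) -> (N2 f <= N2 g)%E.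
Proof. by move=> mf mg fg; apply: le_N2_ae => //; exact: aeT. Qed.

Lemma N2Z (c : R) f : measurable_fun setT f ->
  N2 (fun t => c * f t) = ((c ^+ 2)%:E * N2 f)%E.
Proof.
move=> mf; rewrite /N2 -ge0_integralZl_EFin ?sqr_ge0//.
- by apply: eq_integral => t _; rewrite exprMn EFinM.
- by move=> t _; rewrite lee_fin sqr_ge0.
- exact: measurable_sqr.
Qed.

Lemma N2N f : measurable_fun setT f -> N2 (fun t => - f t) = N2 f.
Proof. by move=> mf; apply: eq_integral => t _; rewrite sqrrN. Qed.

Lemma N2D f g : measurable_fun setT f -> measurable_fun setT g ->
  (N2 (fun t => f t + g t)%R <= 2%:E * N2 f + 2%:E * N2 g)%E.
Proof.
move=> mf mg.
have m2 (u : R -> R) : measurable_fun setT u -> measurable_fun setT (fun t => (2%:E * (u t ^+ 2)%:E)%E).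
  by move=> mu_; apply: measurable_funeM; exact: measurable_sqr.
rewrite /N2 -!ge0_integralZl_EFin//; last 4 first.
- by move=> t _; rewrite lee_fin sqr_ge0.
- exact: measurable_sqr.
- by move=> t _; rewrite lee_fin sqr_ge0.
- exact: measurable_sqr.
rewrite -ge0_integralD//; last 4 first.
- by move=> t _; rewrite mule_ge0 ?lee_fin ?sqr_ge0.
- exact: m2.
- by move=> t _; rewrite mule_ge0 ?lee_fin ?sqr_ge0.
- exact: m2.
apply: ge0_le_int => //.
- by move=> t; rewrite lee_fin sqr_ge0.
- by apply: measurable_sqr; exact: measurable_funD.
- by apply: emeasurable_funD; exact: m2.
- move=> t; rewrite -!EFinM -EFinD lee_fin.
  have := sqr_ge0 (f t - g t); nra.
Qed.

Lemma L2D f g : L2 f -> L2 g -> L2 (fun t => f t + g t).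
Proof.
move=> [mf f2] [mg g2]; split; first exact: measurable_funD.
by apply: le_lt_trans (N2D mf mg) _; rewrite lte_add_pinfty// lte_mul_pinfty.
Qed.

Lemma L2Z c f : L2 f -> L2 (fun t => c * f t).
Proof.
move=> [mf f2]; split; first exact: measurable_funM.
by rewrite N2Z// lte_mul_pinfty// lee_fin sqr_ge0.
Qed.

Lemma L2N f : L2 f -> L2 (fun t => - f t).
Proof. by move=> [mf f2]; split; [exact: measurableT_comp | rewrite N2N]. Qed.

Lemma L2B f g : L2 f -> L2 g -> L2 (fun t => f t - g t).
Proof. by move=> hf /L2N hg; exact: L2D. Qed.

Lemma L2_0 : L2 (fun=> 0).
Proof.
split => //; rewrite /N2; under eq_integral do rewrite expr0n.
by rewrite integral0.
Qed.

Lemma N2B f g : measurable_fun setT f -> measurable_fun setT g ->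
  (N2 (fun t => f t - g t)%R <= 2%:E * N2 f + 2%:E * N2 g)%E.
Proof.
move=> mf mg; rewrite -(N2N mg); apply: N2D => //.
exact: measurableT_comp.
Qed.

Lemma N2_tri f g h : measurable_fun setT f -> measurable_fun setT g ->
  measurable_fun setT h ->
  (N2 (fun t => f t - h t)%R <= 2%:E * N2 (fun t => f t - g t)%R
     + 2%:E * N2 (fun t => g t - h t)%R)%E.
Proof.
move=> mf mg mh; rewrite (_ : (fun t => f t - h t) =
  (fun t => (f t - g t) + (g t - h t))); last by apply/funext => t; lra.
by apply: N2D; apply: measurable_funB.
Qed.

Lemma L2_le f g : measurable_fun setT f -> L2 g ->
  {ae mu, forall t, `|f t| <= `|g t|} -> L2 f.
Proof.
by move=> mf [mg g2] fg; split=> //; apply: le_lt_trans g2; exact: le_N2_ae.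
Qed.

Lemma L2_bM (b : R -> R) (C : R) f : measurable_fun setT b ->
  {ae mu, forall t, `|b t| <= C} -> L2 f -> L2 (fun t => b t * f t).
Proof.
move=> mb bC [mf f2]; apply: (@L2_le _ (fun t => C * f t)).
- exact: measurable_funM.
- exact: L2Z.
- move: bC; apply: aeS => t bt; rewrite !normrM ler_wpM2r//.
  by rewrite (le_trans bt)// ler_norm.
Qed.

Lemma L2M_integrable f g : L2 f -> L2 g ->
  mu.-integrable setT (EFin \o (fun t => f t * g t)).
Proof.
move=> [mf f2] [mg g2]; apply/integrableP; split.
  by apply/measurable_EFinP; exact: measurable_funM.
apply: (@le_lt_trans _ _ (N2 f + N2 g)%E); last by rewrite lte_add_pinfty.
rewrite /N2 -ge0_integralD//; last 4 first.
- by move=> t _; rewrite lee_fin sqr_ge0.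
- exact: measurable_sqr.
- by move=> t _; rewrite lee_fin sqr_ge0.
- exact: measurable_sqr.
apply: ge0_le_int => //.
- by do 2 apply: measurableT_comp => //; exact: measurable_funM.
- by apply: emeasurable_funD; exact: measurable_sqr.
- move=> t; rewrite abse_EFin -EFinD lee_fin normrM.
  rewrite -(real_normK (num_real (f t))) -(real_normK (num_real (g t))).
  have := normr_ge0 (f t); have := normr_ge0 (g t).
  have := sqr_ge0 (`|f t| - `|g t|); nra.
Qed.

Lemma L2_fin f : L2 f -> N2 f \is a fin_num.
Proof. by move=> [_ f2]; rewrite ge0_fin_numE// N2_ge0. Qed.

Lemma L2_sqr_integrable f : L2 f -> mu.-integrable setT (EFin \o (fun t => f t ^+ 2)).
Proof. by move=> hf; exact: (L2M_integrable hf hf). Qed.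

Lemma N2_Rintegral f : L2 f -> (\int[mu]_t (f t ^+ 2))%:E = N2 f.
Proof. by move=> hf; rewrite /Rintegral fineK//; exact: L2_fin. Qed.

(* Discriminant of x |-> \int (f - x g)^2. *)
Lemma L2_CS f g : L2 f -> L2 g ->
  (\int[mu]_t (f t * g t)) ^+ 2 <= (\int[mu]_t (f t ^+ 2)) * (\int[mu]_t (g t ^+ 2)).
Proof.
move=> hf hg; set I := \int[mu]_t (f t * g t); set A := \int[mu]_t _; set B := \int[mu]_t _.
have A0 : 0 <= A by apply: Rintegral_ge0 => t _; rewrite sqr_ge0.
have B0 : 0 <= B by apply: Rintegral_ge0 => t _; rewrite sqr_ge0.
have key x : 0 <= A - 2 * x * I + x ^+ 2 * B.
  have -> : A - 2 * x * I + x ^+ 2 * B = \int[mu]_t ((f t - x * g t) ^+ 2).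
    rewrite /A /I /B -!RintegralZl//; [|exact: L2_sqr_integrable|exact: L2M_integrable].
    have i1 := L2_sqr_integrable hf; have i2 := intg_cM (2 * x) (L2M_integrable hf hg).
    have i3 := intg_cM (x ^+ 2) (L2_sqr_integrable hg).
    rewrite -RintegralB// -RintegralD//; last exact: intg_B.
    by apply: eq_Rintegral => t _; ring.
  by apply: Rintegral_ge0 => t _; rewrite sqr_ge0.
have [B00|Bn0] := eqVneq B 0.
  have [->|In0] := eqVneq I 0; first by rewrite expr0n/= mulr_ge0.
  (* For B = 0 the form is affine in x, and this x gives it the value -1. *)
  have := key ((A + 1) / (2 * I)); rewrite B00 mulr0 addr0.
  suff -> : A - 2 * ((A + 1) / (2 * I)) * I = -1 by lra.
  by field.
(* The minimum of the form over x. *)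
have := key (I / B).
have -> : A - 2 * (I / B) * I + (I / B) ^+ 2 * B = A - I ^+ 2 / B by field.
by rewrite subr_ge0 ler_pdivrMr// lt_neqAle eq_sym Bn0.
Qed.

Lemma L2_pair_le f g (a b : R) : L2 f -> L2 g -> 0 <= a -> 0 <= b ->
  (N2 f <= (a ^+ 2)%:E)%E -> (N2 g <= (b ^+ 2)%:E)%E ->
  `|\int[mu]_t (f t * g t)| <= a * b.
Proof.
move=> hf hg a0 b0; rewrite -!N2_Rintegral// !lee_fin => fa gb.
rewrite -(@ler_pXn2r _ 2)// ?nnegrE ?mulr_ge0// real_normK ?num_real//.
rewrite (le_trans (L2_CS hf hg))// exprMn ler_pM//.
- by apply: Rintegral_ge0 => t _; rewrite sqr_ge0.
- by apply: Rintegral_ge0 => t _; rewrite sqr_ge0.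
Qed.

Lemma N2_dominated (u : nat -> R -> R) f g :
  (forall n, measurable_fun setT (u n)) -> measurable_fun setT f -> L2 g ->
  {ae mu, forall t, u n t @[n --> \oo] --> f t} ->
  {ae mu, forall t, forall n, `|u n t| <= g t} ->
  tends0 (fun n => N2 (fun t => u n t - f t)).
Proof.
move=> mu_ mf hg uf ug; apply/tends0_cvg; first by move=> n; exact: N2_ge0.
have fg : {ae mu, forall t, `|f t| <= g t}.
  move: uf ug; apply: aeS2 => t ut gt.
  have : `|u n t| @[n --> \oo] --> `|f t| by exact: cvg_norm.
  move=> h; rewrite -(cvg_lim _ h)//; apply: limr_le; first by apply/cvg_ex; exists `|f t|.
  by apply: nearW => n.
have Hdom : {ae mu, forall t, forall n, setT t ->
    (`|((u n t - f t) ^+ 2)%:E| <= ((2 * g t) ^+ 2)%:E)%E}.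
  move: ug fg; apply: aeS2 => t ut ft n _; rewrite abse_EFin lee_fin normrX lerXn2r ?nnegrE//.
    by rewrite mulr_ge0// (le_trans _ ft).
  by rewrite (le_trans (ler_normB _ _))// mulrDl mul1r lerD.
have Hcv : {ae mu, forall t, setT t -> ((u n t - f t) ^+ 2)%:E @[n --> \oo] --> 0%E}.
  move: uf; apply: aeS => t ut _; apply: cvg_EFin; first exact: nearW.
  rewrite [X in _ --> X](_ : _ = (f t - f t) ^+ 2); last by rewrite subrr expr0n.
  under [X in X @ _]funext do rewrite /= expr2.
  by rewrite expr2; apply: cvgM; apply: cvgB => //; exact: cvg_cst.
have [_ h _] := @dominated_convergence _ _ R mu setT measurableT
   (fun n t => ((u n t - f t) ^+ 2)%:E) (cst 0%E) (fun t => ((2 * g t) ^+ 2)%:E)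
   (fun n => measurable_sqr (measurable_funB (mu_ n) mf)) (measurable_cst _) Hcv
   (L2_sqr_integrable (L2Z 2 hg)) Hdom.
move: h; apply: cvg_trans; apply: near_eq_cvg; apply: nearW => n /=.
by apply: eq_integral => t _; rewrite subr0 normrX real_normK ?num_real.
Qed.

(** The bound is asked only eventually, so Fatou's lemma is applied to the sequence shifted by
    [N]. *)
Lemma N2_fatou (u : nat -> R -> R) f (C : \bar R) :
  (forall n, measurable_fun setT (u n)) -> measurable_fun setT f ->
  {ae mu, forall t, u n t @[n --> \oo] --> f t} ->
  (exists N, forall n, (N <= n)%N -> (N2 (u n) <= C)%E) -> (N2 f <= C)%E.
Proof.
move=> mu_ mf uf [N hN].
have := @fatou _ _ R mu setT measurableT (fun n t => (u (n + N)%N t ^+ 2)%:E).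
move=> /(_ (fun n => measurable_sqr (mu_ _))).
move=> /(_ (fun n t _ => ltac:(by rewrite lee_fin sqr_ge0))) h.
apply: (@le_trans _ _ (limn_einf (fun n => N2 (u (n + N)%N)))); last first.
  rewrite limn_einf_lim; apply: lime_le; first exact: is_cvg_einfs.
  apply: nearW => n; apply: (@le_trans _ _ (N2 (u (n + N)%N))).
    by apply: ereal_inf_lbound; exists n => /=.
  by apply: hN; rewrite leq_addl.
apply: le_trans h; apply: ae_ge0_le_integral => //.
- by move=> t _; rewrite lee_fin sqr_ge0.
- exact: measurable_sqr.
- move=> t _; rewrite limn_einf_lim; apply: lime_ge; first exact: is_cvg_einfs.
  by apply: nearW => n; apply: le_ereal_inf_tmp => _ [m _ <-]; rewrite lee_fin sqr_ge0.
- under eq_fun do rewrite -[limn_einf _]oppeK -limn_esupN.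
  apply: measurableT_comp => //; apply: measurable_fun_limn_esup => n.
  by apply: measurableT_comp => //; exact: measurable_sqr.
- move: uf; apply: aeS => t ut _.
  suff h : (u (n + N)%N t ^+ 2)%:E @[n --> \oo] --> (f t ^+ 2)%:E.
    by rewrite is_cvg_limn_einfE; [rewrite (cvg_lim _ h)| apply/cvg_ex; eexists; exact: h].
  apply: cvg_EFin; first exact: nearW.
  rewrite /= expr2; under [X in X @ _]funext do rewrite /= expr2.
  by apply: cvgM; rewrite (cvg_shiftn N (fun n => u n t)).
Qed.

End L2Real.

(** * Completeness of L_2 *)

Section RieszFischer.
Context {R : realType}.
Local Notation mu := (@lebesgue_measure R).

Lemma geometric_half_cvg (c : R) : cvgn (series (fun k => c * 2^-1 ^+ k)).
Proof.
by apply: (@is_cvg_geometric_series _ c); rewrite ger0_norm ?invr_ge0// invf_lt1// ltr1n.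
Qed.

(** Taking roots, the k-th increment is at most c 2^-k. The hypothesis is on squares because it is
    read off a sum of squares in [rapid_ae_cvg]. *)
Lemma cvg_of_summable_increments (w : nat -> R) (c : R) :
  (forall k, 4 ^+ k * (w k.+1 - w k) ^+ 2 <= c ^+ 2) -> 0 <= c -> cvgn w.
Proof.
move=> hw c0.
have dw k : `|w k.+1 - w k| <= c * 2^-1 ^+ k.
  rewrite -(@ler_pXn2r _ 2)// ?nnegrE ?mulr_ge0 ?exprn_ge0 ?invr_ge0//.
  rewrite real_normK ?num_real// exprMn -exprM mulnC exprM.
  rewrite (_ : 2^-1 ^+ 2 = (4:R)^-1); last by field.
  by rewrite exprVn ler_pdivlMr ?exprn_gt0// mulrC.
have cs : cvgn (series (fun k => w k.+1 - w k)).
  apply: normed_cvg; apply: (@series_le_cvg _ _ (fun k => c * 2^-1 ^+ k)) => //.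
  - by move=> k; rewrite normr_ge0.
  - by move=> k; rewrite mulr_ge0// exprn_ge0// invr_ge0.
  - exact: geometric_half_cvg.
have -> : w = (fun n => w 0%N + series (fun k => w k.+1 - w k) n).
  by apply/funext => n; rewrite /series/= telescope_sumr// addrC subrK.
by apply: is_cvgD => //; exact: is_cvg_cst.
Qed.

(** The rate 8^-k is chosen against the weight 4^k of [cvg_of_summable_increments]: their product
    2^-k is summable. *)
Definition rapid (u : nat -> R -> R) (s : nat -> nat) :=
  forall k m n, (s k <= m)%N -> (s k <= n)%N ->
    (N2 (fun t => u m t - u n t)%R <= ((8^-1) ^+ k)%:E)%E.

Lemma rapid_subseq (u : nat -> R -> R) :
  (forall e : R, 0 < e -> exists N, forall m n, (N <= m)%N -> (N <= n)%N ->
     (N2 (fun t => u m t - u n t)%R <= e%:E)%E) ->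
  exists s, rapid u s /\ forall k, (k <= s k)%N /\ (s k <= s k.+1)%N.
Proof.
move=> hu.
have /choice [N hN] k : exists N, forall m n, (N <= m)%N -> (N <= n)%N ->
     (N2 (fun t => u m t - u n t)%R <= ((8^-1) ^+ k)%:E)%E.
  by apply: hu; rewrite exprn_gt0// invr_gt0.
(* Partial sums dominate every [N i], increase, and are at least k thanks to the added 1. *)
exists (fun k => \sum_(i < k.+1) (N i + 1))%N; split.
  have le k : (N k <= \sum_(i < k.+1) (N i + 1))%N.
    by rewrite big_ord_recr/=; lia.
  by move=> k m n hm hn; apply: hN; apply: leq_trans (le k) _.
move=> k; split.
  elim: k => // k IH; rewrite big_ord_recr/=; apply: (@leq_trans (k + 1)); first by rewrite addn1.
  by apply: leq_add => //; rewrite addn1.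
by rewrite [leqRHS]big_ord_recr/= leq_addr.
Qed.

(** The sum of the weighted squared increments has integral at most 2, so it is finite almost
    everywhere, and at such a point the increments decay geometrically. *)
Lemma rapid_ae_cvg (u : nat -> R -> R) (s : nat -> nat) :
  (forall n, L2 (u n)) -> rapid u s -> (forall k, (s k <= s k.+1)%N) ->
  {ae mu, forall t, cvgn (fun k => u (s k) t)}.
Proof.
move=> hu rs sS.
have mu_ n : measurable_fun setT (u n) := (hu n).1.
pose d k t := 2 ^+ k * (u (s k.+1) t - u (s k) t).
have hd k : L2 (d k) by apply: L2Z; apply: L2B.
pose G t := (\sum_(0 <= k <oo) (d k t ^+ 2)%:E)%E.
have d0 k t : (0 <= (d k t ^+ 2)%:E)%E by rewrite lee_fin sqr_ge0.
have md k : measurable_fun setT (fun t => (d k t ^+ 2)%:E) by apply: measurable_sqr; case: (hd k).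
have iG : (\int[mu]_t G t <= (2:R)%:E)%E.
  rewrite integral_nneseries//.
  apply: (@le_trans _ _ (\sum_(0 <= k <oo) (2^-1 ^+ k)%:E)%E).
    apply: lee_nneseries => k _; first by move=> _; apply: N2_ge0.
    rewrite (_ : (\int[mu]_x _)%E = N2 (d k))// N2Z; last exact: measurable_funB.
    apply: (@le_trans _ _ ((2 ^+ k ^+ 2)%:E * ((8^-1) ^+ k)%:E)%E).
      by apply: lee_wpmul2l; [rewrite lee_fin sqr_ge0|exact: rs].
    rewrite -EFinM lee_fin -exprM mulnC exprM -exprMn lerXn2r ?nnegrE//; lra.
  have := @cvg_geometric_series R 1 (2^-1).
  rewrite ger0_norm ?invr_ge0// invf_lt1// ltr1n => /(_ isT) h.
  rewrite [leRHS](_ : _ = (1 * (1 - 2^-1)^-1)%:E); last by congr EFin; field.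
  rewrite le_eqVlt; apply/orP; left; apply/eqP; apply/cvg_lim => //.
  apply: cvg_EFin; first by apply: nearW => n; rewrite sumEFin.
  move: h; apply: cvg_trans; apply: near_eq_cvg; apply: nearW => n.
  by rewrite /= sumEFin /series/=; apply: eq_bigr => i _; rewrite mul1r.
have mG : measurable_fun setT G.
  by apply: ge0_emeasurable_sum => // k t _ _.
have G0 t : (0 <= G t)%E by apply: nneseries_ge0 => k _ _.
have : mu.-integrable setT G.
  apply/integrableP; split => //; under eq_integral do rewrite gee0_abs//.
  by apply: le_lt_trans iG _; rewrite ltry.
move=> /integrable_ae -/(_ measurableT); apply: aeS => t /(_ I) Gfin.
apply: (@cvg_of_summable_increments _ (Num.sqrt (fine (G t)))); last exact: sqrtr_ge0.
move=> k; rewrite sqr_sqrtr ?fine_ge0// -lee_fin fineK//.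
have h : (\sum_(0 <= i < k.+1) (d i t ^+ 2)%:E <= G t)%E.
  by apply: nneseries_lim_ge => i _.
apply: le_trans h.
rewrite big_nat_recr//= -[leLHS]add0e leeD//; first exact: sume_ge0.
by rewrite lee_fin /d exprMn -exprM mulnC exprM (_ : 2 ^+ 2 = 4 :> R)//; ring.
Qed.

Lemma L2_complete (u : nat -> R -> R) : (forall n, L2 (u n)) ->
  (forall e : R, 0 < e -> exists N, forall m n, (N <= m)%N -> (N <= n)%N ->
     (N2 (fun t => u m t - u n t)%R <= e%:E)%E) ->
  exists f, L2 f /\ tends0 (fun n => N2 (fun t => u n t - f t)).
Proof.
move=> hu cu; have [s [rs hs]] := rapid_subseq cu.
have mu_ n : measurable_fun setT (u n) := (hu n).1.
have cvu := rapid_ae_cvg hu rs (fun k => (hs k).2).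
(* The upper limit is measurable whether or not the subsequence converges at t; it is the limit
   almost everywhere. *)
pose f t := fine (limn_esup (fun k => (u (s k) t)%:E)).
have mf : measurable_fun setT f.
  apply: measurableT_comp; first exact: fine_measurable.
  by apply: measurable_fun_limn_esup => n; apply/measurable_EFinP; case: (hu (s n)).
have uf : {ae mu, forall t, u (s k) t @[k --> \oo] --> f t}.
  move: cvu; apply: aeS => t ut; rewrite /f.
  have h : (u (s k) t)%:E @[k --> \oo] --> (limn (fun k => u (s k) t))%:E.
    by apply: cvg_EFin => //; exact: nearW.
  by rewrite (cvg_limn_einf_sup h).2.
have tf : tends0 (fun n => N2 (fun t => u n t - f t)).
  (* Fatou along the subsequence carries the Cauchy estimate for u n - u (s k) over to u n - f. *)
  move=> e e0; have [N hN] := cu e e0; exists N => n Nn.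
  apply: (@N2_fatou _ (fun k t => u n t - u (s k) t)).
  - by move=> k; exact: measurable_funB.
  - exact: measurable_funB.
  - move: uf; apply: aeS => t ut; apply: cvgB => //; exact: cvg_cst.
  - by exists N => k Nk; apply: hN => //; apply: leq_trans (hs k).1.
exists f; split=> //; split=> //.
have [N hN] := tf 1 ltr01; have {hN} := hN N (leqnn N) => h1.
have [mN fN] := hu N.
rewrite (_ : f = (fun t => u N t - (u N t - f t))%R); last by apply/funext => t; lra.
apply: le_lt_trans (N2B mN _) _; first exact: measurable_funB.
rewrite lte_add_pinfty// lte_mul_pinfty//.
by apply: le_lt_trans h1 _; rewrite ltry.
Qed.

End RieszFischer.

(** * Integrals over the whole line, Fubini, and a weighted Cauchy-Schwarz inequality *)

Section IntegralTools.
Context {R : realType}.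
Local Notation mu := (@lebesgue_measure R).
Implicit Types (f g F : R -> R).

Definition symitv (n : nat) : set R := [set` `[(- n%:R)%R : R, n%:R]].

Lemma FTC_symitv f F n : (0 < n)%N -> continuous f -> (forall x, is_derive x (1:R) F (f x)) ->
  (\int[mu]_(x in symitv n) (f x)%:E = (F n%:R - F (- n%:R))%:E)%E.
Proof.
move=> n0 cf dF.
have cF x : F y @[y --> x] --> F x.
  by apply: differentiable_continuous; apply/derivable1_diffP; case: (dF x).
have h : (- n%:R : R) < n%:R.
  by have h0 : (0:R) < n%:R; [rewrite ltr0n | lra].
rewrite /symitv (@continuous_FTC2 _ f F)// ?EFinB//.
- exact: continuous_subspaceT.
- split; first by move=> x _; case: (dF x).
  + by apply: cvg_at_right_filter; exact: cF.
  + by apply: cvg_at_left_filter; exact: cF.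
- by move=> x _; rewrite derive1E derive_val.
Qed.

Lemma bigcup_symitv : \bigcup_n symitv n = [set: R].
Proof.
apply/seteqP; split=> // x _; exists (Num.truncn `|x|).+1 => //; rewrite /symitv/=.
by rewrite in_itv/= -ler_norml ltW// truncnS_gt.
Qed.

(** Monotone convergence along [-n, n]; for a nonnegative integrand the finiteness of the integral
    is a conclusion. [integral_deriv] is the signed version, by dominated convergence. *)
Lemma ge0_integral_deriv f F (a b : R) : (forall x, 0 <= f x) -> continuous f ->
  (forall x, is_derive x (1:R) F (f x)) ->
  F n%:R @[n --> \oo] --> b -> F (- n%:R) @[n --> \oo] --> a ->
  (\int[mu]_x (f x)%:E = (b - a)%:E)%E.
Proof.
move=> f0 cf dF Fb Fa.
have mf : measurable_fun setT (EFin \o f).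
  by apply/measurable_EFinP; exact: continuous_measurable_fun.
have := @ge0_nondecreasing_set_cvg_integral _ (measurableTypeR R) R symitv (EFin \o f) mu.
rewrite bigcup_symitv => h.
have {h} h1 : (\int[mu]_(x in symitv n) (f x)%:E @[n --> \oo] --> \int[mu]_x (f x)%:E)%E.
  apply: h.
  - apply/nondecreasing_seqP => n; rewrite subsetEset; apply: subset_itv; rewrite bnd_simp.
      by rewrite lerN2 ler_nat.
    by rewrite ler_nat.
  - by move=> n; exact: measurable_itv.
  - by move=> n; exact: measurable_funTS.
  - by move=> n x _; rewrite lee_fin.
have h2 : (\int[mu]_(x in symitv n) (f x)%:E @[n --> \oo] --> (b - a)%:E)%E.
  have : (F n%:R - F (- n%:R))%:E @[n --> \oo] --> (b - a)%:E.
    by apply: cvg_EFin; [exact: nearW | exact: cvgB].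
  apply: cvg_trans; apply: near_eq_cvg; exists 1%N => // n /= n1.
  by rewrite (@FTC_symitv f F n).
by apply: (cvg_unique _ h1 h2).
Qed.

Lemma symitv_cvg f : mu.-integrable setT (EFin \o f) ->
  (\int[mu]_(x in symitv n) (f x)%:E @[n --> \oo] --> \int[mu]_x (f x)%:E)%E.
Proof.
move=> fi.
pose u n := ((EFin \o f) \_ (symitv n)) : R -> \bar R.
have mf := measurable_int mu fi.
have mu_ n : measurable_fun setT (u n).
  have mI : measurable (symitv n : set (measurableTypeR R)) by exact: measurable_itv.
  exact: ((measurable_restrictT (EFin \o f) mI).1 (measurable_funTS mf)).
have H1 : {ae mu, forall x, setT x -> u n x @[n --> \oo] --> (EFin \o f) x}.
  apply: aeT => x _; apply: cvg_near_cst.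
  exists (Num.truncn `|x|).+1 => // n /= hn; rewrite /u patchE ifT// inE /symitv/= in_itv/=.
  rewrite -ler_norml ltW// (lt_le_trans (truncnS_gt _))// ler_nat//.
have H2 : {ae mu, forall x n, setT x -> (`|u n x| <= `|(EFin \o f) x|)%E}.
  by apply: aeT => x n _; rewrite /u patchE; case: ifP => // _; rewrite abse0 abse_ge0.
have [_ _ h] := @dominated_convergence _ _ R mu setT measurableT u (EFin \o f)
   (fun x => `|(EFin \o f) x|)%E mu_ mf H1 (integrable_abse fi) H2.
move: h; apply: cvg_trans; apply: near_eq_cvg; apply: nearW => n.
by rewrite /u/= [RHS]integral_mkcond.
Qed.

Lemma integral_deriv f F (a b : R) : mu.-integrable setT (EFin \o f) -> continuous f ->
  (forall x, is_derive x (1:R) F (f x)) ->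
  F n%:R @[n --> \oo] --> b -> F (- n%:R) @[n --> \oo] --> a ->
  \int[mu]_x f x = b - a.
Proof.
move=> fi cf dF Fb Fa; have h1 := symitv_cvg fi.
have h2 : (\int[mu]_(x in symitv n) (f x)%:E @[n --> \oo] --> (b - a)%:E)%E.
  have : (F n%:R - F (- n%:R))%:E @[n --> \oo] --> (b - a)%:E.
    by apply: cvg_EFin; [exact: nearW | exact: cvgB].
  apply: cvg_trans; apply: near_eq_cvg; exists 1%N => // n /= n1.
  by rewrite (@FTC_symitv f F n).
by rewrite /Rintegral (cvg_unique _ h1 h2).
Qed.

(** [Rintegral] takes [fine] of the inner integral, which alters it only where that integral is
    infinite; this is a null set by integrability on the product. *)
Lemma fubini_Rintegral (G : R -> R -> R) :
  measurable_fun setT (fun q : R * R => G q.1 q.2) ->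
  (\int[mu]_x \int[mu]_y `|G x y|%:E < +oo)%E ->
  \int[mu]_x (\int[mu]_y G x y) = \int[mu]_y (\int[mu]_x G x y).
Proof.
move=> mG hG; pose G' (q : R * R) := (G q.1 q.2)%:E.
have mG' : measurable_fun setT G' by apply/measurable_EFinP.
have iG : (mu \x mu)%E.-integrable setT G' by apply/integrable12ltyP.
have e1 : (\int[mu]_x (\int[mu]_y G x y)%:E = \int[mu]_x \int[mu]_y G' (x, y))%E.
  have mF := measurable_fubini_F iG.
  apply: ae_eq_integral => //.
  - by apply/measurable_EFinP; apply: measurableT_comp => //; exact: fine_measurable.
  - move: (ae_integrable1 iG); apply: aeS => x hx _.
    by rewrite /Rintegral fineK//; exact: integrable_fin_num.
have e2 : (\int[mu]_y (\int[mu]_x G x y)%:E = \int[mu]_y \int[mu]_x G' (x, y))%E.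
  have mF := measurable_fubini_G iG.
  apply: ae_eq_integral => //.
  - by apply/measurable_EFinP; apply: measurableT_comp => //; exact: fine_measurable.
  - move: (ae_integrable2 iG); apply: aeS => x hx _.
    by rewrite /Rintegral fineK//; exact: integrable_fin_num.
by rewrite [LHS]/Rintegral e1 (Fubini iG) -e2.
Qed.

Lemma tonelli_swap (G : R -> R -> R) : measurable_fun setT (fun q : R * R => G q.1 q.2) ->
  (forall x y, 0 <= G x y) ->
  (\int[mu]_x \int[mu]_y (G x y)%:E = \int[mu]_y \int[mu]_x (G x y)%:E)%E.
Proof.
move=> mG G0; apply: (@fubini_tonelli _ _ _ _ _ mu mu (fun q : R * R => (G q.1 q.2)%:E)).
- exact/measurable_EFinP.
- by move=> q; rewrite lee_fin.
Qed.

Lemma measurable_tonelli (G : R -> R -> R) : measurable_fun setT (fun q : R * R => G q.1 q.2) ->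
  (forall x y, 0 <= G x y) ->
  measurable_fun setT (fun x => \int[mu]_y (G x y)%:E)%E.
Proof.
move=> mG G0.
apply: (@measurable_fun_fubini_tonelli_F _ _ _ _ _ mu (fun q : R * R => (G q.1 q.2)%:E)).
- exact/measurable_EFinP.
- by move=> q; rewrite lee_fin.
Qed.

(* Cauchy-Schwarz for the measure w dmu; with W = 1 it is Jensen's inequality. *)
Lemma weighted_CS (w u : R -> R) (W : R) : 0 < W -> measurable_fun setT w ->
  measurable_fun setT u -> (forall t, 0 <= w t) -> (\int[mu]_t (w t)%:E <= W%:E)%E ->
  (((\int[mu]_t (w t * u t)) ^+ 2)%:E <= W%:E * \int[mu]_t (w t * u t ^+ 2)%:E)%E.
Proof.
move=> W0 mw mu_ w0 iw.
have mwu : measurable_fun setT (fun t => w t * u t ^+ 2).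
  by apply: measurable_funM => //; exact: measurable_funX.
have msw : measurable_fun setT (fun t => Num.sqrt (w t)).
  by apply: measurableT_comp => //; exact: continuous_measurable_fun (@sqrt_continuous R).
have [lty|] := ltP (\int[mu]_t (w t * u t ^+ 2)%:E)%E +oo%E; last first.
  by rewrite leye_eq => /eqP ->; rewrite mulry gtr0_sg// mul1e leey.
have h1 : L2 (fun t => Num.sqrt (w t)).
  split=> //; rewrite /N2; under eq_integral do rewrite sqr_sqrtr//.
  by rewrite (le_lt_trans iw)// ltry.
have h2 : L2 (fun t => Num.sqrt (w t) * u t).
  split; first exact: measurable_funM.
  by rewrite /N2; under eq_integral do rewrite exprMn sqr_sqrtr//.
have := L2_CS h1 h2.
have -> : \int[mu]_t (Num.sqrt (w t) * (Num.sqrt (w t) * u t)) = \int[mu]_t (w t * u t).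
  by apply: eq_Rintegral => t _; rewrite mulrA -expr2 sqr_sqrtr.
rewrite -lee_fin => /le_trans; apply; rewrite EFinM (N2_Rintegral h1) (N2_Rintegral h2).
have -> : N2 (fun t => Num.sqrt (w t) * u t) = (\int[mu]_t (w t * u t ^+ 2)%:E)%E.
  by apply: eq_integral => t _; rewrite exprMn sqr_sqrtr.
apply: lee_wpmul2r; first by apply: integral_ge0 => t _; rewrite lee_fin mulr_ge0// sqr_ge0.
by rewrite /N2; under eq_integral do rewrite sqr_sqrtr//.
Qed.

End IntegralTools.

(** * Poisson and conjugate Poisson kernels *)

Section Kernels.
Context {R : realType}.
Local Notation mu := (@lebesgue_measure R).
Implicit Types (e d s r t : R).

(** [hk e x] + i [pk e x] is 1/(x - i e), the Cauchy kernel at height e. Thus [pk] is pi times the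
    Poisson kernel and [hk] its conjugate; the factor 1/pi enters with [Pn] and [Hn]. *)
Definition pk e (x : R) := e / (x ^+ 2 + e ^+ 2).
Definition hk e (x : R) := x / (x ^+ 2 + e ^+ 2).

Lemma den_gt0 e x : 0 < e -> 0 < x ^+ 2 + e ^+ 2.
Proof. by move=> e0; rewrite ltr_wpDl ?sqr_ge0// exprn_gt0. Qed.

Lemma pk_ge0 e x : 0 < e -> 0 <= pk e x.
Proof. by move=> e0; rewrite divr_ge0// ltW// den_gt0. Qed.

Lemma pk_le e x : 0 < e -> pk e x <= e^-1.
Proof.
move=> e0; rewrite /pk ler_pdivrMr ?den_gt0// mulrC ler_pdivlMr//.
by rewrite -expr2 lerDr sqr_ge0.
Qed.

Lemma pk_sqr_le e x : 0 < e -> pk e x ^+ 2 <= e^-1 * pk e x.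
Proof. by move=> e0; rewrite expr2 ler_wpM2r ?pk_ge0 ?pk_le. Qed.

(** hk^2 + pk^2 = 1/(x^2 + e^2) = pk/e, which bounds the square of either kernel by an integrable
    function. *)
Lemma hk_sqr_le e x : 0 < e -> hk e x ^+ 2 <= e^-1 * pk e x.
Proof.
move=> e0; have D := den_gt0 x e0; rewrite /hk /pk mulrA mulVf ?gt_eqF// div1r.
rewrite expr_div_n ler_pdivrMr ?exprn_gt0// (expr2 (_ + _)) mulrA mulVf ?gt_eqF// mul1r.
by rewrite lerDl sqr_ge0.
Qed.

Lemma hk_le e x : 0 < e -> `|hk e x| <= e^-1.
Proof.
move=> e0; rewrite -(@ler_pXn2r _ 2)// ?nnegrE ?invr_ge0 ?(ltW e0)//.
rewrite real_normK ?num_real// (le_trans (hk_sqr_le x e0))// expr2.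
by rewrite ler_wpM2l ?pk_le// invr_ge0 ltW.
Qed.

Lemma pkN e x : pk e (- x) = pk e x.
Proof. by rewrite /pk sqrrN. Qed.

Lemma hkN e x : hk e (- x) = - hk e x.
Proof. by rewrite /hk sqrrN mulNr. Qed.

Lemma continuous_den e : continuous (fun x : R => x ^+ 2 + e ^+ 2).
Proof.
move=> x; apply: cvgD; last exact: cvg_cst.
by apply: (@exprn_continuous _ 2 x).
Qed.

Lemma continuous_pk e : 0 < e -> continuous (pk e).
Proof.
move=> e0 x; rewrite /pk; apply: cvgM; first exact: cvg_cst.
by apply: cvgV; [rewrite gt_eqF// den_gt0|exact: continuous_den].
Qed.

Lemma continuous_hk e : 0 < e -> continuous (hk e).
Proof.
move=> e0 x; rewrite /hk; apply: cvgM; first exact: cvg_id.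
by apply: cvgV; [rewrite gt_eqF// den_gt0|exact: continuous_den].
Qed.

Lemma measurable_pk e : 0 < e -> measurable_fun setT (pk e).
Proof. by move=> e0; apply: continuous_measurable_fun; exact: continuous_pk. Qed.

Lemma measurable_hk e : 0 < e -> measurable_fun setT (hk e).
Proof. by move=> e0; apply: continuous_measurable_fun; exact: continuous_hk. Qed.

Lemma cvg_natr_infty : (n%:R : R) @[n --> \oo] --> +oo.
Proof. exact: cvgr_idn. Qed.

Lemma atan_cvg_l e (c : R) : 0 < e -> atan ((n%:R - c) / e) @[n --> \oo] --> (pi / 2 : R).
Proof.
move=> e0; apply: (@cvg_comp _ _ _ (fun n : nat => (n%:R - c) / e) atan _ +oo); last exact: cvgy_atan.
apply/cvgryPge => A; near=> n.
rewrite ler_pdivlMr// lerBrDr; near: n.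
by apply: (cvgryPge _).1; exact: cvg_natr_infty.
Unshelve. all: by end_near. Qed.

Lemma is_derive_atan_aff e (c x : R) : 0 < e ->
  is_derive x (1:R) (fun y => atan ((y - c) / e)) (pk e (x - c)).
Proof.
move=> e0.
have h1 : is_derive x (1:R) (fun y : R => (y - c) / e) e^-1.
  have -> : (fun y : R => (y - c) / e) = e^-1 \*: (id - cst c).
    by apply/funext => y /=; rewrite mulrC.
  by apply: is_derive_eq; rewrite subr0 /GRing.scale/= mulr1.
have := @is_derive1_comp _ atan (fun y : R => (y - c) / e) x _ _ (is_derive1_atan _) h1.
rewrite /pk; congr is_derive; field.
by rewrite gt_eqF ?den_gt0 ?gt_eqF//.
Qed.

Lemma integral_pk e (c : R) : 0 < e -> (\int[mu]_s (pk e (s - c))%:E = pi%:E)%E.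
Proof.
move=> e0.
transitivity ((pi / 2 - - (pi / 2) : R)%:E); last by congr EFin; field.
apply: (@ge0_integral_deriv _ _ (fun y => atan ((y - c) / e))).
- by move=> x; exact: pk_ge0.
- move=> x; apply: (@continuous_comp _ _ _ (fun x => x - c) (pk e)); last exact: continuous_pk.
  by apply: cvgB; [exact: cvg_id|exact: cvg_cst].
- by move=> x; exact: is_derive_atan_aff.
- exact: atan_cvg_l.
- rewrite (_ : (fun n : nat => _) = (fun n => - atan ((n%:R - - c) / e))).
    exact: cvgN (atan_cvg_l (- c) e0).
  by apply/funext => n; rewrite -atanN; congr atan; rewrite -mulNr; congr (_ / _); ring.
Qed.

Lemma integral_pk' e (c : R) : 0 < e -> (\int[mu]_s (pk e (c - s))%:E = pi%:E)%E.
Proof.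
by move=> e0; rewrite -(integral_pk c e0); apply: eq_integral => s _; rewrite -pkN opprB.
Qed.

Lemma L2_of_le_pk (k : R -> R) e (c : R) : 0 < e -> measurable_fun setT k ->
  (forall x, k x ^+ 2 <= e^-1 * pk e x) ->
  (N2 (fun s => k (s - c))%R <= (e^-1 * pi)%:E)%E /\ (N2 (fun s => k (c - s))%R <= (e^-1 * pi)%:E)%E.
Proof.
move=> e0 mk hk_.
have ms1 : measurable_fun setT (fun s => s - c : R) by exact: measurable_funB.
have ms2 : measurable_fun setT (fun s => c - s : R) by exact: measurable_funB.
split; rewrite EFinM.
- rewrite -(integral_pk c e0) -ge0_integralZl_EFin ?invr_ge0 ?(ltW e0)//; last 2 first.
  + by move=> x _; rewrite lee_fin pk_ge0.
  + by apply/measurable_EFinP; apply: measurableT_comp => //; exact: measurable_pk.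
  apply: ge0_le_int.
  + by move=> t; rewrite lee_fin sqr_ge0.
  + by apply: measurable_sqr; apply: measurableT_comp.
  + apply: measurable_funeM; apply/measurable_EFinP; apply: measurableT_comp => //; exact: measurable_pk.
  + by move=> t; rewrite -EFinM lee_fin.
- rewrite -(integral_pk' c e0) -ge0_integralZl_EFin ?invr_ge0 ?(ltW e0)//; last 2 first.
  + by move=> x _; rewrite lee_fin pk_ge0.
  + by apply/measurable_EFinP; apply: measurableT_comp => //; exact: measurable_pk.
  apply: ge0_le_int.
  + by move=> t; rewrite lee_fin sqr_ge0.
  + by apply: measurable_sqr; apply: measurableT_comp.
  + apply: measurable_funeM; apply/measurable_EFinP; apply: measurableT_comp => //; exact: measurable_pk.
  + by move=> t; rewrite -EFinM lee_fin.
Qed.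

(* For X = t - s and Y = t - r, the integrand hh - pp is Re 1/((X + i e)(Y + i d)), whose
   antiderivative is Re ((log (X + i e) - log (Y + i d)) / (Y - X + i (d - e))). *)
Definition kker e d s r t := hk e (s - t) * hk d (r - t) - pk e (s - t) * pk d (r - t).

Definition kprim e d s r t :=
  ((s - r) * (ln ((t - s) ^+ 2 + e ^+ 2) - ln ((t - r) ^+ 2 + d ^+ 2)) / 2
   + (d - e) * (atan ((t - r) / d) - atan ((t - s) / e))) / ((s - r) ^+ 2 + (d - e) ^+ 2).

Lemma is_derive_ln_aff e (c x : R) : 0 < e ->
  is_derive x (1:R) (fun y => ln ((y - c) ^+ 2 + e ^+ 2)) (2 * hk e (x - c)).
Proof.
move=> e0.
have h1 : is_derive x (1:R) (fun y : R => (y - c) ^+ 2 + e ^+ 2) (2 * (x - c)).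
  have -> : (fun y : R => (y - c) ^+ 2 + e ^+ 2) = (id - cst c) ^+ 2 + cst (e ^+ 2).
    by apply/funext => y /=.
  apply: is_derive_eq => /=.
  by rewrite subr0 addr0 scaler1 mulr_natl expr1.
have := @is_derive1_comp _ (@ln R) (fun y : R => (y - c) ^+ 2 + e ^+ 2) x _ _ (is_derive1_ln (den_gt0 _ e0)) h1.
by rewrite /hk; congr is_derive; ring.
Qed.

Lemma is_derive_kprim e d s r t : 0 < e -> 0 < d -> (s - r) ^+ 2 + (d - e) ^+ 2 != 0 ->
  is_derive t 1 (kprim e d s r) (kker e d s r t).
Proof.
move=> e0 d0 w0.
have h1 := is_derive_ln_aff s t e0; have h2 := is_derive_ln_aff r t d0.
have h3 := is_derive_atan_aff s t e0; have h4 := is_derive_atan_aff r t d0.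
set w := (s - r) ^+ 2 + (d - e) ^+ 2 in w0 *.
have -> : kprim e d s r = ((s - r) / 2 / w) \*: ((fun y => ln ((y - s) ^+ 2 + e ^+ 2)) - (fun y => ln ((y - r) ^+ 2 + d ^+ 2)))
   + ((d - e) / w) \*: ((fun y => atan ((y - r) / d)) - (fun y => atan ((y - s) / e))).
  apply/funext => y; rewrite /kprim -/w.
  change (((s - r) * (ln ((y - s) ^+ 2 + e ^+ 2) - ln ((y - r) ^+ 2 + d ^+ 2)) / 2
   + (d - e) * (atan ((y - r) / d) - atan ((y - s) / e))) / w =
   (s - r) / 2 / w * (ln ((y - s) ^+ 2 + e ^+ 2) - ln ((y - r) ^+ 2 + d ^+ 2)) +
   (d - e) / w * (atan ((y - r) / d) - atan ((y - s) / e))).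
  by field.
apply: is_derive_eq; rewrite /kker /GRing.scale/= -[hk e (s - t)]opprK -hkN -[hk d (r - t)]opprK -hkN.
rewrite -[pk e (s - t)]pkN -[pk d (r - t)]pkN !opprB /hk /pk /w.
have D1 := den_gt0 (t - s) e0; have D2 := den_gt0 (t - r) d0; field.
by rewrite (gt_eqF D1) (gt_eqF D2) w0.
Qed.

Lemma cvg_harm (c : R) : c / n.+1%:R @[n --> \oo] --> (0:R).
Proof.
rewrite -[X in _ --> X](mulr0 c); apply: cvgM; first exact: cvg_cst.
exact: cvg_harmonic.
Qed.

(** Dividing both arguments by the same square (n + 1)^2 leaves the difference of logarithms
    unchanged and makes both arguments tend to 1. *)
Lemma ln_ratio_cvg e d (s r : R) : 0 < e -> 0 < d ->
  ln ((n%:R - s) ^+ 2 + e ^+ 2) - ln ((n%:R - r) ^+ 2 + d ^+ 2) @[n --> \oo] --> (0:R).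
Proof.
move=> e0 d0; rewrite -(cvg_shiftS (fun n : nat => ln ((n%:R - s) ^+ 2 + e ^+ 2) - ln ((n%:R - r) ^+ 2 + d ^+ 2))).
pose q (c h : R) (n : nat) := (1 - c / n.+1%:R) ^+ 2 + (h / n.+1%:R) ^+ 2.
have qc c h : q c h n @[n --> \oo] --> (1:R).
  rewrite [X in _ --> X](_ : _ = (1 - 0) ^+ 2 + 0 ^+ 2); last by ring.
  under [X in X @ _]funext do rewrite /q !expr2.
  rewrite !expr2; apply: cvgD; apply: cvgM; try exact: cvg_harm.
    by apply: cvgB; [exact: cvg_cst|exact: cvg_harm].
  by apply: cvgB; [exact: cvg_cst|exact: cvg_harm].
have h : ln (q s e n / q r d n) @[n --> \oo] --> (0:R).
  rewrite -ln1; apply: continuous_cvg; first by apply: continuous_ln.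
  rewrite [X in _ --> X](_ : _ = 1 / 1); last by rewrite divr1.
  by apply: cvgM; [exact: qc|apply: cvgV; [exact: oner_neq0|exact: qc]].
rewrite (_ : (fun n : nat => _) = (fun n => ln (q s e n / q r d n))) //.
apply/funext => n /=; have n0 : (n.+1%:R : R) != 0 by rewrite pnatr_eq0.
have D1 := den_gt0 (n.+1%:R - s) e0; have D2 := den_gt0 (n.+1%:R - r) d0.
rewrite -ln_div ?posrE//; congr ln.
have -> : q s e n = ((n.+1%:R - s) ^+ 2 + e ^+ 2) / n.+1%:R ^+ 2 by rewrite /q; field.
have -> : q r d n = ((n.+1%:R - r) ^+ 2 + d ^+ 2) / n.+1%:R ^+ 2 by rewrite /q; field.
move: ((n.+1%:R - s) ^+ 2 + e ^+ 2) ((n.+1%:R - r) ^+ 2 + d ^+ 2) D2 (n.+1%:R ^+ 2) (expf_neq0 2 n0) => A B B0 C C0.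
by field; rewrite C0 (gt_eqF B0).
Qed.

Lemma continuous_shift (k : R -> R) (c : R) : continuous k -> continuous (fun t => k (c - t)).
Proof.
move=> ck t; apply: (@continuous_comp _ _ _ (fun t => c - t) k); last exact: ck.
by apply: cvgB; [exact: cvg_cst|exact: cvg_id].
Qed.

Lemma L2_pk e (c : R) : 0 < e -> L2 (fun t => pk e (c - t)).
Proof.
move=> e0; split.
  by apply: continuous_measurable_fun; apply: continuous_shift; exact: continuous_pk.
have [_ h] := L2_of_le_pk c e0 (measurable_pk e0) (fun x => pk_sqr_le x e0).
by apply: le_lt_trans h _; rewrite ltry.
Qed.

Lemma L2_hk e (c : R) : 0 < e -> L2 (fun t => hk e (c - t)).
Proof.
move=> e0; split.
  by apply: continuous_measurable_fun; apply: continuous_shift; exact: continuous_hk.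
have [_ h] := L2_of_le_pk c e0 (measurable_hk e0) (fun x => hk_sqr_le x e0).
by apply: le_lt_trans h _; rewrite ltry.
Qed.

Lemma kker_integrable e d s r : 0 < e -> 0 < d ->
  mu.-integrable setT (EFin \o kker e d s r).
Proof.
move=> e0 d0; apply: intg_B; apply: L2M_integrable; by [apply: L2_hk|apply: L2_pk].
Qed.

Lemma continuous_kker e d s r : 0 < e -> 0 < d -> continuous (kker e d s r).
Proof.
move=> e0 d0 t; apply: cvgB; apply: cvgM; apply: continuous_shift;
  by [exact: continuous_hk|exact: continuous_pk].
Qed.

Lemma hk_cvg0 e (c : R) : 0 < e -> hk e (n%:R - c) @[n --> \oo] --> (0:R).
Proof.
move=> e0; apply/cvgrPdist_le => h h0; near=> n.
rewrite sub0r normrN.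
have nc : h^-1 <= n%:R - c.
  by rewrite lerBrDr; near: n; apply: (cvgryPge _).1; exact: cvg_natr_infty.
have nc0 : 0 < n%:R - c by rewrite (lt_le_trans _ nc)// invr_gt0.
rewrite ger0_norm; last by rewrite divr_ge0 ?(ltW nc0)// ltW// den_gt0.
rewrite /hk ler_pdivrMr ?den_gt0//.
apply: (@le_trans _ _ (h * (n%:R - c) ^+ 2)); last by rewrite ler_pM2l// lerDl sqr_ge0.
by rewrite expr2 mulrA ler_peMl ?(ltW nc0)// -ler_pdivrMl// mulr1.
Unshelve. all: by end_near. Qed.

Lemma is_derive_hk e (c x : R) : 0 < e ->
  is_derive x (1:R) (fun t => - hk e (t - c)) (kker e e c c x).
Proof.
move=> e0; have D := den_gt0 (x - c) e0.
have h1 : is_derive x (1:R) (fun y : R => (y - c) ^+ 2 + e ^+ 2) (2 * (x - c)).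
  have -> : (fun y : R => (y - c) ^+ 2 + e ^+ 2) = (id - cst c) ^+ 2 + cst (e ^+ 2).
    by apply/funext => y /=.
  apply: is_derive_eq => /=.
  by rewrite subr0 addr0 scaler1 mulr_natl expr1.
have h2 := @is_deriveV R (fun y : R => (y - c) ^+ 2 + e ^+ 2) x _ _ (lt0r_neq0 D) h1.
have -> : (fun t => - hk e (t - c)) = - ((id - cst c) * (fun y : R => ((y - c) ^+ 2 + e ^+ 2)^-1)).
  by apply/funext => y.
apply: is_derive_eq; rewrite /kker -[c - x]opprB hkN pkN /hk /pk /GRing.scale/=.
rewrite [(id - cst c) x](_ : _ = x - c)//.
by field; rewrite (gt_eqF D).
Qed.

(** Both poles of 1/((t - s + i e)(t - r + i d)) lie in the lower half plane, so the integral of its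
    real part over the line is 0. In place of residues, the antiderivative tends to 0 at both
    ends. *)
Lemma integral_kker e d s r : 0 < e -> 0 < d -> \int[mu]_t kker e d s r t = 0.
Proof.
move=> e0 d0; have ki := kker_integrable s r e0 d0; have kc := @continuous_kker e d s r e0 d0.
(* [kprim] divides by this quantity. If it vanishes the two factors coincide, and the integrand is
   the derivative of -hk. *)
have [w0|w0] := eqVneq ((s - r) ^+ 2 + (d - e) ^+ 2) 0.
  have /andP[/eqP sr /eqP de] : (s - r == 0) && (d - e == 0).
    by move/eqP : w0; rewrite paddr_eq0 ?sqr_ge0// !sqrf_eq0.
  have {sr} sr : s = r by lra.
  have {de} de : d = e by lra.
  subst d r; rewrite -[RHS](@subrr _ (0:R)).
  apply: (@integral_deriv R (kker e e s s) (fun t => - hk e (t - s)) 0 0); [exact: ki|exact: kc| | |].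
  - by move=> x; exact: is_derive_hk.
  - by rewrite -oppr0; apply: cvgN; exact: hk_cvg0.
  - rewrite (_ : (fun n : nat => _) = (fun n => hk e (n%:R - - s))); first exact: hk_cvg0.
    by apply/funext => n; rewrite -hkN; congr hk; ring.
rewrite -[RHS](@subrr _ (0:R)).
have Z (c1 c2 : R) (a b : nat -> R) : a n @[n --> \oo] --> (0:R) -> b n @[n --> \oo] --> (0:R) ->
   (c1 * a n / 2 + c2 * b n) / ((s - r) ^+ 2 + (d - e) ^+ 2) @[n --> \oo] --> (0:R).
  move=> ha hb; rewrite [X in _ --> X](_ : _ = (c1 * 0 / 2 + c2 * 0) / ((s - r) ^+ 2 + (d - e) ^+ 2)); last by ring.
  apply: cvgM; last exact: cvg_cst.
  apply: cvgD; last by apply: cvgM => //; exact: cvg_cst.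
  by apply: cvgM; [apply: cvgM => //; exact: cvg_cst|exact: cvg_cst].
have A0 (a b : R) (e' d' : R) : 0 < e' -> 0 < d' ->
    atan ((n%:R - a) / e') - atan ((n%:R - b) / d') @[n --> \oo] --> (0:R).
  by move=> ? ?; rewrite -(subrr (pi / 2)); apply: cvgB; exact: atan_cvg_l.
apply: (@integral_deriv R (kker e d s r) (kprim e d s r) 0 0); [exact: ki|exact: kc| | |].
- by move=> x; exact: is_derive_kprim.
- by apply: Z; [exact: ln_ratio_cvg|exact: A0].
(* Reflection turns the value at -n into one at n with s and r negated: the squares are even and
   [atan] is odd. *)
- rewrite (_ : (fun n : nat => _) = (fun n => ((s - r) * (ln ((n%:R - - s) ^+ 2 + e ^+ 2)
     - ln ((n%:R - - r) ^+ 2 + d ^+ 2)) / 2 + (d - e) * (atan ((n%:R - - s) / e) - atan ((n%:R - - r) / d)))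
     / ((s - r) ^+ 2 + (d - e) ^+ 2))).
    by apply: Z; [exact: ln_ratio_cvg|exact: A0].
  apply/funext => n; rewrite /kprim.
  have E (c : R) : - n%:R - c = - (n%:R - - c) by ring.
  by rewrite !E !sqrrN !mulNr !atanN; congr (_ / _); ring.
Qed.

Lemma integral_hk_pk e d s r : 0 < e -> 0 < d ->
  \int[mu]_t (hk e (s - t) * hk d (r - t)) = \int[mu]_t (pk e (s - t) * pk d (r - t)).
Proof.
move=> e0 d0; apply/eqP; rewrite -subr_eq0 -RintegralB//.
- by apply/eqP; rewrite -(integral_kker s r e0 d0).
- by apply: L2M_integrable; exact: L2_hk.
- by apply: L2M_integrable; exact: L2_pk.
Qed.

End Kernels.

(** * Convolution with square integrable kernels *)

Section Convolution.
Context {R : realType}.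
Local Notation mu := (@lebesgue_measure R).
Implicit Types (f g k : R -> R).
Local Notation intg f := (mu.-integrable setT (EFin \o f)).

(** The argument s - t, and not t - s, matches the Cauchy kernel 1/(s - z); for the odd kernel [hk]
    this fixes the sign of the Hilbert transform. *)
Definition kconv k f (t : R) := \int[mu]_s (f s * k (s - t)).

Lemma measurable_cfst (f : R -> R) : measurable_fun setT f ->
  measurable_fun setT (fun q : R * R => f q.1).
Proof. by move=> mf; exact: measurableT_comp. Qed.

Lemma measurable_csnd (f : R -> R) : measurable_fun setT f ->
  measurable_fun setT (fun q : R * R => f q.2).
Proof. by move=> mf; exact: measurableT_comp. Qed.

Lemma measurable_dif (k : R -> R) : measurable_fun setT k ->
  measurable_fun setT (fun q : R * R => k (q.1 - q.2)).
Proof. by move=> mk; apply: measurableT_comp => //; exact: measurable_funB. Qed.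

Lemma measurable_dif' (k : R -> R) : measurable_fun setT k ->
  measurable_fun setT (fun q : R * R => k (q.2 - q.1)).
Proof. by move=> mk; apply: measurableT_comp => //; exact: measurable_funB. Qed.

Lemma measurable_shl k (t : R) : measurable_fun setT k -> measurable_fun setT (fun s : R => k (s - t)).
Proof. by move=> mk; apply: measurableT_comp => //; exact: measurable_funB. Qed.

Lemma measurable_shr k (t : R) : measurable_fun setT k -> measurable_fun setT (fun s : R => k (t - s)).
Proof. by move=> mk; apply: measurableT_comp => //; exact: measurable_funB. Qed.

Lemma measurable_Rint (G : R -> R -> R) : measurable_fun setT (fun q : R * R => G q.1 q.2) ->
  measurable_fun setT (fun x => \int[mu]_y G x y).
Proof.
move=> mG; apply: measurableT_comp; first exact: fine_measurable.
have mE : measurable_fun setT (fun q : R * R => (G q.1 q.2)%:E) by exact/measurable_EFinP.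
rewrite (_ : (fun x => _) = (fun x => (\int[mu]_y (fun q : R * R => (G q.1 q.2)%:E)^\+%E (x, y)) -
   \int[mu]_y (fun q : R * R => (G q.1 q.2)%:E)^\-%E (x, y))%E); last first.
  by apply/funext => x; rewrite integralE; congr (_ - _)%E; apply: eq_integral => y _;
    rewrite ?funeposE ?funenegE.
apply: emeasurable_funB; apply: measurable_fun_fubini_tonelli_F => //.
- exact: measurable_funepos.
- exact: measurable_funeneg.
Qed.

(** What [pk e] and [hk e] have in common: the bound on k^2 makes k bounded by e^-1 and square
    integrable with squared norm at most e^-1 pi. *)
Definition goodk e k := [/\ 0 < e, measurable_fun setT k & forall x, k x ^+ 2 <= e^-1 * pk e x].

Lemma goodk_pk e : 0 < e -> goodk e (pk e).
Proof. by move=> e0; split=> //; [exact: measurable_pk|move=> x; exact: pk_sqr_le]. Qed.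

Lemma goodk_hk e : 0 < e -> goodk e (hk e).
Proof. by move=> e0; split=> //; [exact: measurable_hk|move=> x; exact: hk_sqr_le]. Qed.

Lemma goodk_le e k x : goodk e k -> `|k x| <= e^-1.
Proof.
move=> [e0 _ kx]; rewrite -(@ler_pXn2r _ 2)// ?nnegrE ?invr_ge0 ?(ltW e0)//.
rewrite real_normK ?num_real// (le_trans (kx x))// expr2.
by rewrite ler_wpM2l ?pk_le// invr_ge0 ltW.
Qed.

Lemma goodk_L2l e k c : goodk e k -> L2 (fun s => k (s - c)).
Proof.
move=> [e0 mk kx]; split; first by apply: measurableT_comp => //; exact: measurable_funB.
by have [h _] := L2_of_le_pk c e0 mk kx; apply: le_lt_trans h _; rewrite ltry.
Qed.

Lemma goodk_L2r e k c : goodk e k -> L2 (fun s => k (c - s)).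
Proof.
move=> [e0 mk kx]; split; first by apply: measurableT_comp => //; exact: measurable_funB.
by have [_ h] := L2_of_le_pk c e0 mk kx; apply: le_lt_trans h _; rewrite ltry.
Qed.

Lemma goodk_N2r e k c : goodk e k -> (N2 (fun s => k (c - s))%R <= (e^-1 * pi)%:E)%E.
Proof. by move=> [e0 mk kx]; have [_ h] := L2_of_le_pk c e0 mk kx. Qed.

Lemma kconv_intg e k f t : goodk e k -> L2 f -> intg (fun s => f s * k (s - t)).
Proof. by move=> gk hf; apply: L2M_integrable => //; exact: goodk_L2l gk. Qed.

Lemma intg_bM (b : R -> R) f (C : R) : measurable_fun setT b -> (forall t, `|b t| <= C) ->
  intg f -> intg (fun t => f t * b t).
Proof.
move=> mb bC fi; apply: (@le_integrable _ _ _ mu setT _ _ (EFin \o (fun t => C * f t))) => //.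
- apply/measurable_EFinP; apply: measurable_funM => //.
  by apply/measurable_EFinP; exact: measurable_int fi.
- move=> t _; rewrite !abse_EFin lee_fin !normrM mulrC ler_wpM2r//.
  by rewrite (le_trans (bC t))// ler_norm.
- exact: intg_cM.
Qed.

Lemma intg_mf f : intg f -> measurable_fun setT f.
Proof. by move=> fi; apply/measurable_EFinP; exact: measurable_int fi. Qed.

Lemma intg_abs_lty f : intg f -> (\int[mu]_t `|f t|%:E < +oo)%E.
Proof. by move=> /integrableP[_]. Qed.

Lemma intg_bound f : intg f -> exists2 W : R, 0 < W & (\int[mu]_t `|f t|%:E <= W%:E)%E.
Proof.
move=> fi; have f0 : (0 <= \int[mu]_t `|f t|%:E)%E by apply: integral_ge0 => t _; rewrite lee_fin.
exists (fine (\int[mu]_t `|f t|%:E) + 1)%R; first by rewrite ltr_wpDl// fine_ge0.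
rewrite EFinD fineK; last by rewrite ge0_fin_numE//; exact: intg_abs_lty.
by rewrite leeDl.
Qed.

Lemma measurable_kconv_dom k f : measurable_fun setT k -> measurable_fun setT f ->
  measurable_fun setT (fun q : R * R => f q.2 * k (q.2 - q.1)).
Proof. by move=> mk mf; apply: measurable_funM; [exact: measurable_csnd|exact: measurable_dif']. Qed.

Lemma kconv_bound e k f t : goodk e k -> intg f ->
  (((kconv k f t) ^+ 2)%:E <= ((\int[mu]_s (`|f s| * `|k (s - t)|)) ^+ 2)%:E)%E.
Proof.
move=> gk fi; have [e0 mk _] := gk.
have mks := measurable_shl t mk.
have hi : intg (fun s => f s * k (s - t)).
  by apply: (@intg_bM _ _ e^-1) => // s; exact: goodk_le gk.
rewrite lee_fin -[leLHS]real_normK ?num_real//.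
rewrite ler_pXn2r ?nnegrE//; last by apply: Rintegral_ge0 => s _; rewrite mulr_ge0.
apply: le_trans (le_normr_Rintegral _ hi) _ => //.
rewrite le_eqVlt; apply/orP; left; apply/eqP.
by apply: eq_Rintegral => s _; rewrite normrM.
Qed.

(** Young's inequality for L_1 and L_2: Cauchy-Schwarz with the weight |f|, then Tonelli, where the
    integral of k^2 in t is at most e^-1 pi. *)
Lemma kconv_abs_dom e k f : goodk e k -> intg f ->
  exists2 C : R, 0 < C & (\int[mu]_t ((\int[mu]_s (`|f s| * `|k (s - t)|)) ^+ 2)%:E <= C%:E)%E.
Proof.
move=> gk fi; have [e0 mk _] := gk; have [W W0 fW] := intg_bound fi; have mf := intg_mf fi.
have mnf : measurable_fun setT (fun s => `|f s|) by exact: measurableT_comp.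
have mnk : measurable_fun setT (fun x => `|k x|) by exact: measurableT_comp.
have m2 : measurable_fun setT (fun q : R * R => `|f q.2| * `|k (q.2 - q.1)| ^+ 2).
  apply: measurable_funM; first exact: (measurable_csnd mnf).
  by apply: measurable_funX; exact: (measurable_dif' mnk).
have P0 (t s : R) : 0 <= `|f s| * `|k (s - t)| ^+ 2 by rewrite mulr_ge0// sqr_ge0.
have mT := measurable_tonelli (G := fun t s => `|f s| * `|k (s - t)| ^+ 2) m2 P0.
exists (W * (W * (e^-1 * pi))).
  by rewrite !mulr_gt0 ?invr_gt0// pi_gt0.
apply: (@le_trans _ _ (\int[mu]_t (W%:E * \int[mu]_s (`|f s| * `|k (s - t)| ^+ 2)%:E))%E).
  apply: ge0_le_int.
  - by move=> t; rewrite lee_fin sqr_ge0.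
  - apply: measurable_sqr.
    have hm : measurable_fun setT (fun q : R * R => `|f q.2| * `|k (q.2 - q.1)|).
      by apply: measurable_funM; [exact: (measurable_csnd mnf)|exact: (measurable_dif' mnk)].
    have := measurable_tonelli (G := fun t s => `|f s| * `|k (s - t)|) hm (fun t s => mulr_ge0 (normr_ge0 _) (normr_ge0 _)).
    by move=> h; apply: measurableT_comp h; exact: fine_measurable.
  - exact: measurable_funeM.
  - move=> t; apply: (@weighted_CS _ (fun s => `|f s|) (fun s => `|k (s - t)|) W) => //.
    exact: (measurable_shl t mnk).
rewrite ge0_integralZl_EFin ?(ltW W0)//; last by move=> t _; apply: integral_ge0 => s _; rewrite lee_fin.
rewrite (tonelli_swap m2 P0) EFinM; apply: lee_wpmul2l; first by rewrite lee_fin ltW.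
apply: (@le_trans _ _ (\int[mu]_s ((e^-1 * pi)%:E * `|f s|%:E))%E).
  apply: ge0_le_int.
  - by move=> s; apply: integral_ge0 => t _; rewrite lee_fin.
  - have ms : measurable_fun setT (fun q : R * R => `|f q.1| * `|k (q.1 - q.2)| ^+ 2).
      apply: measurable_funM; first exact: (measurable_cfst mnf).
      by apply: measurable_funX; exact: (measurable_dif mnk).
    exact: (measurable_tonelli (G := fun s t => `|f s| * `|k (s - t)| ^+ 2) ms (fun s t => P0 t s)).
  - by apply: measurable_funeM; apply/measurable_EFinP.
  - move=> s; under eq_integral do rewrite EFinM.
    rewrite ge0_integralZl_EFin//.
    + rewrite muleC; apply: lee_wpmul2r => //.
      under eq_integral do rewrite real_normK ?num_real//.
      exact: (goodk_N2r s gk).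
    + apply/measurable_EFinP; apply: measurable_funX; exact: (measurable_shr s mnk).
rewrite ge0_integralZl_EFin//.
- rewrite muleC [leRHS]EFinM; apply: lee_wpmul2r => //.
  by rewrite lee_fin mulr_ge0 ?pi_ge0// invr_ge0 ltW.
- exact/measurable_EFinP.
- by rewrite mulr_ge0 ?pi_ge0// invr_ge0 ltW.
Qed.

Lemma measurable_kconv k f : measurable_fun setT k -> measurable_fun setT f ->
  measurable_fun setT (kconv k f).
Proof.
move=> mk mf; apply: (@measurable_Rint (fun t s => f s * k (s - t))).
exact: measurable_kconv_dom.
Qed.

Lemma kconv_absL2 e k f : goodk e k -> intg f -> L2 (fun t => \int[mu]_s (`|f s| * `|k (s - t)|)).
Proof.
move=> gk fi; have [e0 mk _] := gk; have mf := intg_mf fi; split.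
  apply: (@measurable_Rint (fun t s => `|f s| * `|k (s - t)|)).
  by have := measurable_kconv_dom mk mf; move=> /(measurableT_comp (@normr_measurable R setT));
     apply: eq_measurable_fun => q _ /=; rewrite normrM.
by have [C C0 hC] := kconv_abs_dom gk fi; apply: le_lt_trans hC _; rewrite ltry.
Qed.

Lemma kconv_L2 e k f : goodk e k -> intg f -> L2 (kconv k f).
Proof.
move=> gk fi; have [e0 mk _] := gk; have mf := intg_mf fi.
apply: (@L2_le _ _ _ (measurable_kconv mk mf) (kconv_absL2 gk fi)); apply: aeT => t.
have := kconv_bound t gk fi; rewrite lee_fin => h.
by rewrite -(@ler_pXn2r _ 2)// ?nnegrE// !real_normK ?num_real.
Qed.

(* Both sides are the triple integral of f(s) g(r) k1(s-t) k2(r-t). *)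
Lemma kconv_pair e1 e2 k1 k2 f g : goodk e1 k1 -> goodk e2 k2 -> intg f -> intg g ->
  \int[mu]_t (kconv k1 f t * kconv k2 g t) =
  \int[mu]_r (g r * \int[mu]_s (f s * \int[mu]_t (k1 (s - t) * k2 (r - t)))).
Proof.
move=> g1 g2 fi gi; have [e10 mk1 _] := g1; have [e20 mk2 _] := g2.
have mf := intg_mf fi; have mg := intg_mf gi.
have A2 := kconv_L2 g1 fi; have mA := A2.1.
have gk2 t : intg (fun r => g r * k2 (r - t)).
  apply: (@intg_bM _ _ e2^-1) => //; first exact: measurable_shl.
  by move=> r; exact: goodk_le g2.
have fk1 t : intg (fun s => f s * k1 (s - t)).
  apply: (@intg_bM _ _ e1^-1) => //; first exact: measurable_shl.
  by move=> r; exact: goodk_le g1.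
transitivity (\int[mu]_t \int[mu]_r (kconv k1 f t * (g r * k2 (r - t)))).
  by apply: eq_Rintegral => t _; rewrite RintegralZl.
have Anorm2 : L2 (fun t => `|kconv k1 f t|).
  apply: (L2_le _ A2); first exact: measurableT_comp.
  by apply: aeT => t; rewrite normr_id.
have k2n2 r : L2 (fun t => `|k2 (r - t)|).
  apply: (L2_le _ (goodk_L2r r g2)).
    by apply: measurableT_comp => //; exact: measurable_shr.
  by apply: aeT => t; rewrite normr_id.
have k1n2 r : L2 (fun t => `|k1 (r - t)|).
  apply: (L2_le _ (goodk_L2r r g1)).
    by apply: measurableT_comp => //; exact: measurable_shr.
  by apply: aeT => t; rewrite normr_id.
(* [L2_pair_le] wants the bounds as squares; e^-1 pi <= (1 + e^-1 pi)^2 provides one without a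
   square root. *)
have pairb u c1 r : L2 u -> (forall t, 0 <= u t) -> 0 <= c1 -> (N2 u <= (c1 ^+ 2)%:E)%E ->
    (\int[mu]_t (u t * `|k2 (r - t)|)%:E <= (c1 * (1 + e2^-1 * pi))%:E)%E.
  move=> hu u0 c10 uc.
  have i1 := L2M_integrable hu (k2n2 r).
  have b0 : 0 <= 1 + e2^-1 * pi by rewrite addr_ge0// mulr_ge0 ?pi_ge0// invr_ge0 ltW.
  have := L2_pair_le hu (k2n2 r) c10 b0 uc.
  rewrite ger0_norm; last by apply: Rintegral_ge0 => t _; rewrite mulr_ge0.
  move=> h; rewrite -lee_fin fineK in h; first apply: h.
    have -> : N2 (fun t => `|k2 (r - t)|) = N2 (fun t => k2 (r - t)).
      by apply: eq_integral => t _; rewrite real_normK ?num_real.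
    apply: le_trans (goodk_N2r r g2) _; rewrite lee_fin.
    have : 0 <= e2^-1 * pi :> R by rewrite mulr_ge0 ?pi_ge0// invr_ge0 ltW.
    nra.
  exact: integrable_fin_num i1.
have N2c u : L2 u -> exists2 c : R, 0 <= c & (N2 u <= (c ^+ 2)%:E)%E.
  move=> hu; exists (Num.sqrt (fine (N2 u))); first exact: sqrtr_ge0.
  by rewrite sqr_sqrtr ?fine_ge0 ?N2_ge0// fineK//; exact: L2_fin.
have [c1 c10 c1P] := N2c _ Anorm2.
have m3 : measurable_fun setT (fun q : R * R => kconv k1 f q.1 * (g q.2 * k2 (q.2 - q.1))).
  by apply: measurable_funM; [exact: (measurable_cfst mA)|exact: measurable_kconv_dom].
have absM (c : R) (u : R -> R) (K : R) : (forall t, 0 <= u t) -> measurable_fun setT u ->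
    (\int[mu]_t (u t)%:E <= K%:E)%E ->
    (\int[mu]_t (`|c| * u t)%:E <= K%:E * `|c|%:E)%E.
  move=> u0 mu_ uK; under eq_integral do rewrite EFinM.
  rewrite ge0_integralZl_EFin//; first by rewrite muleC; apply: lee_wpmul2r; rewrite ?lee_fin.
  - by move=> t _; rewrite lee_fin.
  - exact/measurable_EFinP.
(* Absolute convergence for both uses of Fubini: integrating the modulus over t first leaves a
   multiple of the integrable function |u|. *)
have finI (F : R -> R -> R) (u : R -> R) (K : R) : intg u -> 0 <= K ->
    (forall r, (\int[mu]_t `|F t r|%:E <= K%:E * `|u r|%:E)%E) ->
    measurable_fun setT (fun q : R * R => F q.1 q.2) ->
    (\int[mu]_t \int[mu]_r `|F t r|%:E < +oo)%E.
  move=> iu K0 FK mF.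
  have mF' : measurable_fun setT (fun q : R * R => `|F q.1 q.2|) by exact: measurableT_comp.
  rewrite (tonelli_swap (G := fun t r => `|F t r|) mF' (fun t r => normr_ge0 _)).
  apply: (@le_lt_trans _ _ (\int[mu]_r (K%:E * `|u r|%:E))%E).
    have mFs : measurable_fun setT (fun q : R * R => F q.2 q.1).
      have ms : measurable_fun setT (fun q : R * R => (q.2, q.1)) by exact: measurable_fun_pair.
      exact: (measurableT_comp mF ms).
    apply: ge0_le_int => //.
    - by move=> r; apply: integral_ge0 => t _; rewrite lee_fin.
    - apply: (@measurable_tonelli _ (fun r t => `|F t r|)) => //; exact: measurableT_comp.
    - by apply: measurable_funeM; apply/measurable_EFinP; apply: measurableT_comp => //; exact: intg_mf.
  rewrite ge0_integralZl_EFin//.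
  - by rewrite lte_mul_pinfty ?lee_fin// intg_abs_lty.
  - by apply/measurable_EFinP; apply: measurableT_comp => //; exact: intg_mf.
rewrite (@fubini_Rintegral _ (fun t r => kconv k1 f t * (g r * k2 (r - t)))) //; last first.
  apply: (finI _ g (c1 * (1 + e2^-1 * pi))) => //.
    by rewrite mulr_ge0// addr_ge0// mulr_ge0 ?pi_ge0// invr_ge0 ltW.
  move=> r; under eq_integral do rewrite mulrCA normrM.
  apply: absM; [by []| |].
    by apply: measurableT_comp => //; apply: measurable_funM => //; exact: measurable_shr.
  by under eq_integral do rewrite normrM; exact: pairb.
apply: eq_Rintegral => r _.
transitivity (\int[mu]_t (g r * (kconv k1 f t * k2 (r - t)))).
  by apply: eq_Rintegral => t _; ring.
rewrite RintegralZl//; last by apply: L2M_integrable => //; exact: goodk_L2r g2.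
congr (_ * _).
transitivity (\int[mu]_t \int[mu]_s (k2 (r - t) * (f s * k1 (s - t)))).
  by apply: eq_Rintegral => t _; rewrite RintegralZl// mulrC.
have m4 : measurable_fun setT (fun q : R * R => k2 (r - q.1) * (f q.2 * k1 (q.2 - q.1))).
  by apply: measurable_funM; [exact: (measurable_cfst (measurable_shr r mk2))|exact: measurable_kconv_dom].
have [c2 c20 c2P] : exists2 c : R, 0 <= c & forall s, (N2 (fun t => `|k1 (s - t)|)%R <= (c ^+ 2)%:E)%E.
  exists (1 + e1^-1 * pi); first by rewrite addr_ge0// mulr_ge0 ?pi_ge0// invr_ge0 ltW.
  move=> s; have -> : N2 (fun t => `|k1 (s - t)|) = N2 (fun t => k1 (s - t)).
    by apply: eq_integral => t _; rewrite real_normK ?num_real.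
  apply: le_trans (goodk_N2r s g1) _; rewrite lee_fin.
  have : 0 <= e1^-1 * pi :> R by rewrite mulr_ge0 ?pi_ge0// invr_ge0 ltW.
  nra.
rewrite (@fubini_Rintegral _ (fun t s => k2 (r - t) * (f s * k1 (s - t)))) //; last first.
  apply: (finI _ f (c2 * (1 + e2^-1 * pi))) => //.
    by rewrite mulr_ge0// addr_ge0// mulr_ge0 ?pi_ge0// invr_ge0 ltW.
  move=> s; under eq_integral do rewrite mulrCA normrM.
  apply: absM; [by []| |].
    by apply: measurableT_comp => //; apply: measurable_funM; exact: measurable_shr.
  by under eq_integral do rewrite mulrC normrM; exact: pairb.
apply: eq_Rintegral => s _.
transitivity (\int[mu]_t (f s * (k1 (s - t) * k2 (r - t)))).
  by apply: eq_Rintegral => t _; ring.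
rewrite RintegralZl//; apply: L2M_integrable; first exact: goodk_L2r g1.
exact: goodk_L2r g2.
Qed.

Lemma kconv_hk_pk e d f g : 0 < e -> 0 < d -> intg f -> intg g ->
  \int[mu]_t (kconv (hk e) f t * kconv (hk d) g t) =
  \int[mu]_t (kconv (pk e) f t * kconv (pk d) g t).
Proof.
move=> e0 d0 fi gi.
apply: (etrans (kconv_pair (goodk_hk e0) (goodk_hk d0) fi gi)).
apply: (etrans _ (esym (kconv_pair (goodk_pk e0) (goodk_pk d0) fi gi))).
apply: eq_Rintegral => r _; apply: (congr1 (fun z => g r * z)).
apply: eq_Rintegral => s _; apply: (congr1 (fun z => f s * z)); exact: integral_hk_pk.
Qed.

End Convolution.

(** * Comparison of the two convolutions in L_2 *)

Section PoissonHilbert.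
Context {R : realType}.
Local Notation mu := (@lebesgue_measure R).
Implicit Types (f g k : R -> R).
Local Notation intg f := (mu.-integrable setT (EFin \o f)).

Lemma kconvD e k f g t : goodk e k -> L2 f -> L2 g ->
  kconv k (fun s => f s + g s) t = kconv k f t + kconv k g t.
Proof.
move=> gk hf hg; rewrite /kconv -RintegralD//; [|exact: kconv_intg gk hf|exact: kconv_intg gk hg].
by apply: eq_Rintegral => s _; rewrite mulrDl.
Qed.

Lemma kconvZ e k (c : R) f t : goodk e k -> L2 f ->
  kconv k (fun s => c * f s) t = c * kconv k f t.
Proof.
move=> gk hf; rewrite /kconv -RintegralZl//; last exact: kconv_intg gk hf.
by apply: eq_Rintegral => s _; rewrite mulrA.
Qed.

Lemma kconvB e k f g t : goodk e k -> L2 f -> L2 g ->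
  kconv k (fun s => f s - g s) t = kconv k f t - kconv k g t.
Proof.
move=> gk hf hg; rewrite /kconv -RintegralB//; [|exact: kconv_intg gk hf|exact: kconv_intg gk hg].
by apply: eq_Rintegral => s _; rewrite mulrBl.
Qed.

(** Cauchy-Schwarz with the weight pk, of mass pi in s, followed by Tonelli, where pk has mass pi in
    t; hence pi^2. *)
Lemma N2_kconv_pk e f : 0 < e -> L2 f ->
  (N2 (kconv (pk e) f) <= (pi ^+ 2)%:E * N2 f)%E.
Proof.
move=> e0 hf; have mf := hf.1; have mk := measurable_pk e0.
pose G (t s : R) := pk e (s - t) * f s ^+ 2.
have mG : measurable_fun setT (fun q : R * R => G q.1 q.2).
  apply: measurable_funM; first exact: (measurable_dif' mk).
  by apply: measurable_funX; exact: (measurable_csnd mf).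
have G0 t s : 0 <= G t s by rewrite mulr_ge0 ?pk_ge0// sqr_ge0.
have mT := measurable_tonelli mG G0.
apply: (@le_trans _ _ (\int[mu]_t (pi%:E * \int[mu]_s (G t s)%:E))%E).
  apply: ge0_le_int.
  - by move=> t; rewrite lee_fin sqr_ge0.
  - by apply: measurable_sqr; exact: measurable_kconv.
  - exact: measurable_funeM.
  - move=> t; rewrite /kconv.
    under eq_Rintegral do rewrite mulrC.
    apply: (@weighted_CS _ (fun s => pk e (s - t)) f pi (pi_gt0 R)) => //.
    + exact: measurable_shl.
    + by move=> s; exact: pk_ge0.
    + by rewrite integral_pk.
rewrite ge0_integralZl_EFin ?pi_ge0//; last by move=> t _; apply: integral_ge0 => s _; rewrite lee_fin.
rewrite (tonelli_swap mG G0) expr2 EFinM -muleA; apply: lee_wpmul2l; first by rewrite lee_fin pi_ge0.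
rewrite /N2 -ge0_integralZl_EFin ?pi_ge0//; last 2 first.
- by move=> t _; rewrite lee_fin sqr_ge0.
- exact: measurable_sqr.
apply: ge0_le_int.
- by move=> s; apply: integral_ge0 => t _; rewrite lee_fin.
- have ms : measurable_fun setT (fun q : R * R => G q.2 q.1).
    apply: measurable_funM; first exact: (measurable_dif mk).
    by apply: measurable_funX; exact: (measurable_cfst mf).
  exact: (measurable_tonelli (G := fun s t => G t s) ms (fun s t => G0 t s)).
- by apply: measurable_funeM; exact: measurable_sqr.
- move=> s; under eq_integral do rewrite /G EFinM muleC.
  rewrite ge0_integralZl_EFin ?sqr_ge0//.
  + by rewrite integral_pk' // muleC.
  + by move=> t _; rewrite lee_fin pk_ge0.
  + by apply/measurable_EFinP; exact: measurable_shr.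
Qed.

Lemma L2_kconv_pk e f : 0 < e -> L2 f -> L2 (kconv (pk e) f).
Proof.
move=> e0 hf; split; first by apply: measurable_kconv; [exact: measurable_pk|exact: hf.1].
apply: le_lt_trans (N2_kconv_pk e0 hf) _; rewrite lte_mul_pinfty ?lee_fin ?sqr_ge0//.
exact: hf.2.
Qed.

Lemma Rint_sqrB f g : L2 f -> L2 g ->
  \int[mu]_t ((f t - g t) ^+ 2) = \int[mu]_t (f t * f t) - 2 * \int[mu]_t (f t * g t) + \int[mu]_t (g t * g t).
Proof.
move=> hf hg; have h1 := L2M_integrable hf hf; have h2 := L2M_integrable hf hg.
have h3 := L2M_integrable hg hg; have h4 := intg_cM 2 h2.
rewrite -RintegralZl// -RintegralB// -RintegralD//; last exact: intg_B.
by apply: eq_Rintegral => t _; ring.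
Qed.

Lemma N2_eq f g : L2 f -> L2 g -> \int[mu]_t (f t * f t) = \int[mu]_t (g t * g t) -> N2 f = N2 g.
Proof. by move=> hf hg E; rewrite -(N2_Rintegral hf) -(N2_Rintegral hg); congr EFin. Qed.

Lemma N2_eqB f1 f2 g1 g2 : L2 f1 -> L2 f2 -> L2 g1 -> L2 g2 ->
  \int[mu]_t (f1 t * f1 t) = \int[mu]_t (g1 t * g1 t) -> \int[mu]_t (f1 t * f2 t) = \int[mu]_t (g1 t * g2 t) ->
  \int[mu]_t (f2 t * f2 t) = \int[mu]_t (g2 t * g2 t) ->
  N2 (fun t => f1 t - f2 t) = N2 (fun t => g1 t - g2 t).
Proof.
move=> h1 h2 h3 h4 e1 e2 e3; rewrite -(N2_Rintegral (L2B h1 h2)) -(N2_Rintegral (L2B h3 h4)).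
by rewrite (Rint_sqrB h1 h2) (Rint_sqrB h3 h4) e1 e2 e3.
Qed.

(** Expand both squares: the three pairings agree by [kconv_hk_pk]. The mixed pairing is why that
    identity allows two different heights. *)
Lemma N2_hk_pk_L1 e d f : 0 < e -> 0 < d -> intg f ->
  N2 (fun t => kconv (hk e) f t - kconv (hk d) f t) =
  N2 (fun t => kconv (pk e) f t - kconv (pk d) f t).
Proof.
move=> e0 d0 fi.
have h1 := kconv_L2 (goodk_hk e0) fi; have h2 := kconv_L2 (goodk_hk d0) fi.
have h3 := kconv_L2 (goodk_pk e0) fi; have h4 := kconv_L2 (goodk_pk d0) fi.
exact: (N2_eqB h1 h2 h3 h4 (kconv_hk_pk e0 e0 fi fi) (kconv_hk_pk e0 d0 fi fi) (kconv_hk_pk d0 d0 fi fi)).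
Qed.

Lemma N2_hk_L1 e f : 0 < e -> intg f -> N2 (kconv (hk e) f) = N2 (kconv (pk e) f).
Proof.
move=> e0 fi; have h1 := kconv_L2 (goodk_hk e0) fi; have h3 := kconv_L2 (goodk_pk e0) fi.
exact: (N2_eq h1 h3 (kconv_hk_pk e0 e0 fi fi)).
Qed.

(** Cutting to [-n, n] makes an L_2 function integrable, so that identities proved by Fubini apply;
    the cut is then removed by a limit. *)
Definition trunc (n : nat) f (t : R) := if `|t| <= n%:R then f t else 0.

Lemma trunc_le n f t : `|trunc n f t| <= `|f t|.
Proof. by rewrite /trunc; case: ifP => // _; rewrite normr0. Qed.

Lemma measurable_symitv n : measurable (symitv n : set (measurableTypeR R)).
Proof. exact: measurable_itv. Qed.

Lemma symitvP n (t : R) : symitv n t <-> `|t| <= n%:R.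
Proof. by rewrite /symitv/= in_itv/= -ler_norml. Qed.

Lemma truncE n f : trunc n f = f \_ (symitv n).
Proof.
apply/funext => t; rewrite /trunc patchE; have := symitvP n t.
by case: ifP => tn [h1 h2]; [rewrite mem_set//; exact: h2|rewrite memNset// => /h1].
Qed.

Lemma measurable_trunc n f : measurable_fun setT f -> measurable_fun setT (trunc n f).
Proof.
move=> mf; rewrite truncE.
exact: ((measurable_restrictT f (measurable_symitv n)).1 (measurable_funTS mf)).
Qed.

Lemma trunc_cvg f t : trunc n f t @[n --> \oo] --> f t.
Proof.
apply: cvg_near_cst; exists (Num.truncn `|t|).+1 => // n /= hn.
by rewrite /trunc ifT// ltW// (lt_le_trans (truncnS_gt _))// ler_nat.
Qed.

Lemma L2_trunc n f : L2 f -> L2 (trunc n f).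
Proof.
move=> hf; apply: (L2_le (measurable_trunc n hf.1) hf); apply: aeT => t.
exact: trunc_le.
Qed.

Lemma trunc_tends0 f : L2 f -> tends0 (fun n => N2 (fun t => trunc n f t - f t)).
Proof.
move=> hf; apply: (@N2_dominated _ _ _ (fun t => `|f t|)).
- by move=> n; apply: measurable_trunc; exact: hf.1.
- exact: hf.1.
- apply: (L2_le _ hf); first by apply: measurableT_comp => //; exact: hf.1.
  by apply: aeT => t; rewrite normr_id.
- by apply: aeT => t; exact: trunc_cvg.
- by apply: aeT => t n; exact: trunc_le.
Qed.

Lemma symitv_lty n : (mu (symitv n) < +oo)%E.
Proof. by rewrite /symitv lebesgue_measure_itv/=; case: ifP => //; rewrite -EFinD ltry. Qed.

Lemma L2_itv n : L2 (trunc n (fun=> 1)).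
Proof.
split; first by apply: measurable_trunc.
rewrite /N2; apply: (@le_lt_trans _ _ (mu (symitv n))); last exact: symitv_lty.
rewrite -[leRHS]mul1e -(integral_cst mu (measurable_symitv n)).
rewrite [leRHS]integral_mkcond le_eqVlt; apply/orP; left; apply/eqP.
apply: eq_integral => t _; rewrite truncE !patchE.
by case: ifP => _; rewrite ?expr1n ?expr0n.
Qed.

Lemma intg_trunc n f : L2 f -> intg (trunc n f).
Proof.
move=> hf; have := L2M_integrable hf (L2_itv n); apply: eq_integrable => // t _ /=.
by congr EFin; rewrite /trunc; case: ifP => _; rewrite ?mulr1 ?mulr0.
Qed.

Lemma pair_cvg (u : nat -> R -> R) f g : (forall n, L2 (u n)) -> L2 f -> L2 g ->
  tends0 (fun n => N2 (fun t => u n t - f t)) ->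
  \int[mu]_t (u n t * g t) @[n --> \oo] --> \int[mu]_t (f t * g t).
Proof.
move=> hu hf hg tu; apply/cvgrPdist_le => e e0.
pose c := Num.sqrt (fine (N2 g)) + 1.
have c0 : 0 < c by rewrite ltr_wpDl// sqrtr_ge0.
have gc : (N2 g <= (c ^+ 2)%:E)%E.
  rewrite -(fineK (L2_fin hg)) lee_fin -[leLHS]sqr_sqrtr ?fine_ge0 ?N2_ge0//.
  by rewrite lerXn2r ?nnegrE ?sqrtr_ge0 ?(ltW c0)// lerDl.
have [N hN] := tu ((e / c) ^+ 2) ltac:(by rewrite exprn_gt0// divr_gt0).
exists N => // n /= /hN h.
have d2 := L2B (hu n) hf.
have := L2_pair_le d2 hg (divr_ge0 (ltW e0) (ltW c0)) (ltW c0) h gc.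
rewrite divfK ?gt_eqF// distrC; congr (_ <= _); congr `|_|.
rewrite -RintegralB//; [|exact: L2M_integrable|exact: L2M_integrable].
by apply: eq_Rintegral => t _; rewrite mulrBl.
Qed.

Lemma kconv_trunc_cvg e k f t : goodk e k -> L2 f ->
  kconv k (trunc n f) t @[n --> \oo] --> kconv k f t.
Proof.
move=> gk hf; apply: pair_cvg => //; [by move=> n; exact: L2_trunc|exact: goodk_L2l gk|exact: trunc_tends0].
Qed.

Lemma N2_trunc_le n f : L2 f -> (N2 (trunc n f) <= N2 f)%E.
Proof.
by move=> hf; apply: le_N2; [apply: measurable_trunc; exact: hf.1|exact: hf.1|move=> t; exact: trunc_le].
Qed.

(** On the truncations of f the norms for [hk] and [pk] are equal, and Fatou passes to f. No direct
    estimate of the kernel gives a bound uniform in e, since [hk e] is not uniformly integrable at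
    infinity. *)
Lemma N2_kconv_hk e f : 0 < e -> L2 f -> (N2 (kconv (hk e) f) <= (pi ^+ 2)%:E * N2 f)%E.
Proof.
move=> e0 hf; have mk := measurable_hk e0.
apply: (@N2_fatou _ (fun n => kconv (hk e) (trunc n f))).
- by move=> n; apply: measurable_kconv => //; apply: measurable_trunc; exact: hf.1.
- by apply: measurable_kconv => //; exact: hf.1.
- by apply: aeT => t; apply: kconv_trunc_cvg hf; exact: goodk_hk.
- exists 0%N => n _; rewrite (N2_hk_L1 e0 (intg_trunc n hf)).
  apply: le_trans (N2_kconv_pk e0 (L2_trunc n hf)) _.
  by apply: lee_wpmul2l; [rewrite lee_fin sqr_ge0|exact: N2_trunc_le].
Qed.

Lemma L2_kconv_hk e f : 0 < e -> L2 f -> L2 (kconv (hk e) f).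
Proof.
move=> e0 hf; split; first by apply: measurable_kconv; [exact: measurable_hk|exact: hf.1].
apply: le_lt_trans (N2_kconv_hk e0 hf) _; rewrite lte_mul_pinfty ?lee_fin ?sqr_ge0//.
exact: hf.2.
Qed.

(** For integrable f the two sides without the factor 2 are equal; Fatou along truncations reaches
    L_2, and splitting off the truncation error with [N2D] costs the factor. *)
Lemma N2_hk_pk e d f : 0 < e -> 0 < d -> L2 f ->
  (N2 (fun t => kconv (hk e) f t - kconv (hk d) f t)%R <=
   2%:E * N2 (fun t => kconv (pk e) f t - kconv (pk d) f t)%R)%E.
Proof.
move=> e0 d0 hf; set X := N2 (fun t => kconv (pk e) f t - _).
have mf := hf.1.
have mh c : 0 < c -> measurable_fun setT (kconv (hk c) f).
  by move=> c0; apply: measurable_kconv => //; exact: measurable_hk.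
apply/lee_addgt0Pr => eta eta0.
apply: (@N2_fatou _ (fun n t => kconv (hk e) (trunc n f) t - kconv (hk d) (trunc n f) t)).
- move=> n; apply: measurable_funB; apply: measurable_kconv; by
    [exact: measurable_hk|apply: measurable_trunc].
- by apply: measurable_funB; exact: mh.
- apply: aeT => t; apply: cvgB; apply: kconv_trunc_cvg hf; exact: goodk_hk.
(* Each convolved error is then at most eta/8, and 2 (2 eta/8 + 2 eta/8) = eta. *)
have [N hN] := trunc_tends0 hf (e := eta / (8 * pi ^+ 2)) ltac:(by rewrite divr_gt0// mulr_gt0// exprn_gt0// pi_gt0).
exists N => n /hN h; have hT := L2_trunc n hf.
rewrite (N2_hk_pk_L1 e0 d0 (intg_trunc n hf)).
have he := L2B hT hf.
have mp c g : 0 < c -> L2 g -> measurable_fun setT (kconv (pk c) g).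
  by move=> c0 hg; exact: (L2_kconv_pk c0 hg).1.
have := N2D (measurable_funB (mp _ _ e0 hf) (mp _ _ d0 hf))
   (measurable_funB (mp _ _ e0 he) (mp _ _ d0 he)).
rewrite (_ : (fun t => _) = (fun t => kconv (pk e) (trunc n f) t - kconv (pk d) (trunc n f) t)); last first.
  apply/funext => t; rewrite /= (kconvB _ (goodk_pk e0) hT hf) (kconvB _ (goodk_pk d0) hT hf); ring.
move=> /le_trans; apply; rewrite -/X; apply: leeD => //.
have := N2B (mp _ _ e0 he) (mp _ _ d0 he).
have b c : 0 < c -> (N2 (kconv (pk c) (fun t => trunc n f t - f t)%R) <= (eta / 8)%:E)%E.
  move=> c0; apply: le_trans (N2_kconv_pk c0 he) _.
  apply: le_trans (lee_wpmul2l _ h) _; first by rewrite lee_fin sqr_ge0.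
  rewrite -EFinM lee_fin le_eqVlt; apply/orP; left; apply/eqP.
  have : (pi : R) ^+ 2 != 0 by rewrite expf_neq0// gt_eqF// pi_gt0.
  by move: (pi ^+ 2 : R) => q q0; field.
move=> h3; apply: (@le_trans _ _ (2%:E * (2%:E * (eta / 8)%:E + 2%:E * (eta / 8)%:E))%E).
  apply: lee_wpmul2l => //; apply: le_trans h3 _.
  by apply: leeD; apply: lee_wpmul2l => //; exact: b.
by rewrite -?EFinM -?EFinD -?EFinM -?EFinD lee_fin; lra.
Qed.

End PoissonHilbert.

(** * The Hilbert transform *)

Section HilbertTransform.
Context {R : realType}.
Local Notation mu := (@lebesgue_measure R).
Implicit Types (f g k G : R -> R).
Local Notation intg f := (mu.-integrable setT (EFin \o f)).

Definition eps (n : nat) : R := n.+1%:R^-1.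

Lemma eps_gt0 n : 0 < eps n.
Proof. by rewrite invr_gt0 ltr0n. Qed.

Lemma eps_cvg : eps n @[n --> \oo] --> (0:R).
Proof. exact: cvg_harmonic. Qed.

Definition Pn n f (t : R) := pi^-1 * kconv (pk (eps n)) f t.
Definition Hn n f (t : R) := pi^-1 * kconv (hk (eps n)) f t.

Let piN0 : (pi : R) != 0. Proof. by rewrite gt_eqF// pi_gt0. Qed.

Lemma L2_Pn n f : L2 f -> L2 (Pn n f).
Proof. by move=> hf; apply: L2Z; apply: L2_kconv_pk => //; exact: eps_gt0. Qed.

Lemma L2_Hn n f : L2 f -> L2 (Hn n f).
Proof. by move=> hf; apply: L2Z; apply: L2_kconv_hk => //; exact: eps_gt0. Qed.

Lemma N2_Pn n f : L2 f -> (N2 (Pn n f) <= N2 f)%E.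
Proof.
move=> hf; have hk := L2_kconv_pk (eps_gt0 n) hf.
rewrite /Pn N2Z; last exact: hk.1.
apply: le_trans (lee_wpmul2l _ (N2_kconv_pk (eps_gt0 n) hf)) _; first by rewrite lee_fin sqr_ge0.
by rewrite muleA -EFinM -exprMn mulVf// expr1n mul1e.
Qed.

Lemma N2_Hn n f : L2 f -> (N2 (Hn n f) <= N2 f)%E.
Proof.
move=> hf; have hk := L2_kconv_hk (eps_gt0 n) hf.
rewrite /Hn N2Z; last exact: hk.1.
apply: le_trans (lee_wpmul2l _ (N2_kconv_hk (eps_gt0 n) hf)) _; first by rewrite lee_fin sqr_ge0.
by rewrite muleA -EFinM -exprMn mulVf// expr1n mul1e.
Qed.

Lemma N2_Hn_Pn m n f : L2 f ->
  (N2 (fun t => Hn m f t - Hn n f t)%R <= 2%:E * N2 (fun t => Pn m f t - Pn n f t)%R)%E.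
Proof.
move=> hf.
have h1 := L2B (L2_kconv_hk (eps_gt0 m) hf) (L2_kconv_hk (eps_gt0 n) hf).
have h2 := L2B (L2_kconv_pk (eps_gt0 m) hf) (L2_kconv_pk (eps_gt0 n) hf).
rewrite (_ : (fun t => Hn m f t - Hn n f t) =
  (fun t => pi^-1 * (kconv (hk (eps m)) f t - kconv (hk (eps n)) f t))); last first.
  by apply/funext => t; rewrite mulrBr.
rewrite (_ : (fun t => Pn m f t - Pn n f t) =
  (fun t => pi^-1 * (kconv (pk (eps m)) f t - kconv (pk (eps n)) f t))); last first.
  by apply/funext => t; rewrite mulrBr.
rewrite (N2Z _ h1.1) (N2Z _ h2.1) muleCA; apply: lee_wpmul2l; first by rewrite lee_fin sqr_ge0.
by apply: N2_hk_pk => //; exact: eps_gt0.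
Qed.

Lemma PnB n f g t : L2 f -> L2 g -> Pn n (fun s => f s - g s) t = Pn n f t - Pn n g t.
Proof. by move=> hf hg; rewrite /Pn (kconvB _ (goodk_pk (eps_gt0 n)))// mulrBr. Qed.

(** Outside a neighbourhood of 0 the kernel at height e is at most e times a multiple of the fixed
    integrable kernel [pk 1]. *)
Lemma pk_scale (e r x : R) : 0 < e -> 0 < r -> r <= `|x| ->
  pk e x <= e * ((1 + r ^+ 2) / r ^+ 2) * pk 1 x.
Proof.
move=> e0 r0 rx; have D := den_gt0 x e0; have D1 := den_gt0 x (ltr01 : 0 < 1 :> R).
have r2 : 0 < r ^+ 2 by rewrite exprn_gt0.
have rx2 : r ^+ 2 <= x ^+ 2 by rewrite -(real_normK (num_real x)) lerXn2r// nnegrE ltW.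
rewrite /pk ler_pdivrMr// expr1n; rewrite expr1n in D1.
have -> : e * ((1 + r ^+ 2) / r ^+ 2) * (1 / (x ^+ 2 + 1)) * (x ^+ 2 + e ^+ 2) =
    e * ((1 + r ^+ 2) * (x ^+ 2 + e ^+ 2) / (r ^+ 2 * (x ^+ 2 + 1))).
  by field; rewrite (gt_eqF D1) (gt_eqF r0).
rewrite ler_peMr ?(ltW e0)// ler_pdivlMr ?mulr_gt0// mul1r.
by have := sqr_ge0 e; have := sqr_ge0 x; nra.
Qed.

(* The mass of the Poisson kernel at distance at least r is O(eps n). *)
Lemma Pn_pointwise G (K t : R) : continuous G -> (forall s, `|G s| <= K) -> L2 G ->
  Pn n G t @[n --> \oo] --> G t.
Proof.
move=> cG GK hG; apply/cvgrPdist_le => eta eta0.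
have K0 : 0 <= K := le_trans (normr_ge0 _) (GK 0).
have /cvgrPdist_le/(_ (eta / 2)) := cG t; rewrite divr_gt0// => /(_ isT).
move=> /nbhs_ballP[r /= r0 hr].
(* 2 K bounds |G t - G s|, and the other factor is the constant of [pk_scale]; a height below eta/(2
   (c + 1)) makes the far part at most eta/2. *)
pose c := 2 * K * ((1 + r ^+ 2) / r ^+ 2).
have c0 : 0 <= c by rewrite !mulr_ge0// ?invr_ge0 ?addr_ge0 ?sqr_ge0.
have /cvgrPdist_le/(_ (eta / (2 * (c + 1)))) := eps_cvg.
rewrite divr_gt0 ?mulr_gt0 ?ltr_wpDl// => /(_ isT) [N _ hN].
exists N => // n /= /hN; rewrite sub0r normrN (gtr0_norm (eps_gt0 n)) => en.
have e0 := eps_gt0 n; set e := eps n in en e0 *.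
have gk := goodk_pk e0.
have ipk (d : R) : 0 < d -> intg (fun s => pk d (s - t)).
  move=> d0; apply/integrableP; split.
    by apply/measurable_EFinP; apply: measurable_shl; exact: measurable_pk.
  rewrite (_ : (\int[mu]_x _)%E = pi%:E) ?ltry// -(integral_pk t d0).
  by apply: eq_integral => s _; rewrite /= ger0_norm// pk_ge0.
have Rpk (d : R) : 0 < d -> \int[mu]_s pk d (s - t) = pi.
  by move=> d0; rewrite /Rintegral integral_pk.
have iG := kconv_intg t gk hG.
have -> : G t - Pn n G t = pi^-1 * \int[mu]_s ((G t - G s) * pk e (s - t)).
  under eq_Rintegral do rewrite mulrBl.
  rewrite RintegralB//; last exact: (intg_cM (G t) (ipk _ e0)).
  by rewrite RintegralZl ?ipk// Rpk// mulrBr mulrCA mulVf// mulr1.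
rewrite normrM gtr0_norm ?invr_gt0 ?pi_gt0// mulrC ler_pdivrMr ?pi_gt0//.
have iD : intg (fun s => (G t - G s) * pk e (s - t)).
  have := intg_B (intg_cM (G t) (ipk _ e0)) iG.
  by apply: eq_integrable => // s _; rewrite /= mulrBl.
apply: le_trans (le_normr_Rintegral _ iD) _ => //.
apply: (@le_trans _ _ (\int[mu]_s (eta / 2 * pk e (s - t) + (e * c) * pk 1 (s - t)))).
  apply: le_Rintegral => //.
  - by have := integrable_abse iD; apply: eq_integrable => // s _.
  - by apply: intg_D; apply: intg_cM; exact: ipk.
  - move=> s _; rewrite normrM (ger0_norm (pk_ge0 _ e0)).
    have [sr|sr] := ltP `|s - t| r.
      rewrite -[leLHS]addr0 lerD//; first by rewrite ler_wpM2r ?pk_ge0//; apply: hr; rewrite /ball/= distrC.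
      by rewrite (mulr_ge0 _ (pk_ge0 _ ltr01))// mulr_ge0// ltW.
    rewrite -[leLHS]add0r lerD//; first by rewrite mulr_ge0 ?pk_ge0// divr_ge0// ltW.
    apply: (@le_trans _ _ (2 * K * pk e (s - t))).
      rewrite ler_wpM2r ?pk_ge0// (le_trans (ler_normB _ _))// mulrDl mul1r lerD//.
    rewrite /c (_ : e * _ * _ = 2 * K * (e * ((1 + r ^+ 2) / r ^+ 2) * pk 1 (s - t))); last by ring.
    by rewrite ler_wpM2l ?mulr_ge0//; exact: pk_scale.
rewrite RintegralD//; [|exact: intg_cM (ipk _ e0)|exact: intg_cM (ipk _ ltr01)].
rewrite (@RintegralZl _ _ _ mu setT _ (eta / 2) measurableT (ipk _ e0)).
rewrite (@RintegralZl _ _ _ mu setT _ (e * c) measurableT (ipk _ ltr01)).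
rewrite !Rpk// -mulrDl ler_wpM2r ?pi_ge0//.
have h1 : e * c <= eta / (2 * (c + 1)) * c by rewrite ler_wpM2r.
have h2 : eta / (2 * (c + 1)) * c <= eta / 2.
  rewrite invfM -!mulrA ler_pM2l// ler_piMr ?invr_ge0// ler_pdivrMl ?ltr_wpDl//; lra.
lra.
Qed.

Definition dense_class G := [/\ continuous G, (exists K, forall s, `|G s| <= K) &
  exists n, forall s, n%:R < `|s| -> G s = 0].

Lemma dense_class_L2 G : dense_class G -> L2 G.
Proof.
move=> [cG [K GK] [n hn]]; have mG : measurable_fun setT G by exact: continuous_measurable_fun.
apply: (L2_le mG (L2Z K (L2_itv n))); apply: aeT => t; rewrite normrM /trunc.
case: ifPn => [_|]; first by rewrite normr1 mulr1 (le_trans (GK t))// ler_norm.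
by rewrite -ltNge => /hn ->; rewrite !normr0 mulr0.
Qed.

(** Dominated convergence works only on an interval [-m, m] carrying G. The rest is controlled by
    the norm: as |Pn G| <= |G|, the squared distance is at most 2 (<G, G> - <Pn G, G>), and this
    pairing sees [-m, m] only. *)
Lemma Pn_cvg_dense G : dense_class G -> tends0 (fun n => N2 (fun t => Pn n G t - G t)).
Proof.
move=> dG; have hG := dense_class_L2 dG; have [cG [K GK] [m hm]] := dG.
have K0 : 0 <= K := le_trans (normr_ge0 _) (GK 0).
have mP n : measurable_fun setT (Pn n G) := (L2_Pn n hG).1.
have PK n t : `|Pn n G t| <= K.
  have e0 := eps_gt0 n.
  have iG := kconv_intg t (goodk_pk e0) hG.
  have ik : intg (fun s => pk (eps n) (s - t)).
    apply/integrableP; split.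
      by apply/measurable_EFinP; apply: measurable_shl; exact: measurable_pk.
    rewrite (_ : (\int[mu]_x _)%E = pi%:E) ?ltry// -(integral_pk t e0).
    by apply: eq_integral => s _; rewrite /= ger0_norm// pk_ge0.
  rewrite /Pn normrM gtr0_norm ?invr_gt0 ?pi_gt0// mulrC ler_pdivrMr ?pi_gt0//.
  apply: le_trans (le_normr_Rintegral _ iG) _ => //.
  apply: (@le_trans _ _ (\int[mu]_s (K * pk (eps n) (s - t)))).
    apply: le_Rintegral => //.
    - by have := integrable_abse iG; apply: eq_integrable => // s _.
    - exact: intg_cM.
    - by move=> s _; rewrite normrM (ger0_norm (pk_ge0 _ e0)) ler_wpM2r ?pk_ge0.
  by rewrite RintegralZl// /Rintegral integral_pk.
have t1 : tends0 (fun n => N2 (fun t => trunc m (Pn n G) t - G t)).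
  apply: (@N2_dominated _ _ _ (fun t => K * trunc m (fun=> 1) t)).
  - by move=> n; exact: measurable_trunc.
  - exact: hG.1.
  - by apply: L2Z; exact: L2_itv.
  - apply: aeT => t; rewrite /trunc; have [tm|tm] := leP; first exact: Pn_pointwise GK hG.
    by rewrite hm//; exact: cvg_cst.
  - apply: aeT => t n; rewrite /trunc; case: ifP => _; first by rewrite mulr1.
    by rewrite normr0 mulr0.
have t2 := pair_cvg (fun n => L2_trunc m (L2_Pn n hG)) hG hG t1.
have E n : \int[mu]_t (trunc m (Pn n G) t * G t) = \int[mu]_t (Pn n G t * G t).
  apply: eq_Rintegral => t _; rewrite /trunc; have [//|tm] := leP.
  by rewrite hm// !mulr0.
apply: (@tends0_le _ _ (fun n => (2 * `|\int[mu]_t (G t * G t) - \int[mu]_t (Pn n G t * G t)|)%:E)).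
  move=> n; rewrite -(N2_Rintegral (L2B (L2_Pn n hG) hG)) lee_fin Rint_sqrB//; last exact: L2_Pn.
  have := N2_Pn n hG; rewrite -(N2_Rintegral (L2_Pn n hG)) -(N2_Rintegral hG) lee_fin.
  rewrite (_ : \int[mu]_t (Pn n G t ^+ 2) = \int[mu]_t (Pn n G t * Pn n G t))//.
  rewrite (_ : \int[mu]_t (G t ^+ 2) = \int[mu]_t (G t * G t))// => h.
  have := ler_norm (\int[mu]_t (G t * G t) - \int[mu]_t (Pn n G t * G t)); lra.
move=> e e0; move/cvgrPdist_le : t2 => /(_ (e / 2)); rewrite divr_gt0// => /(_ isT)[N _ hN].
by exists N => n /hN /=; rewrite E lee_fin => ?; lra.
Qed.

(** Cut f to a bounded function on a bounded interval, approximate that in L_1 by a continuous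
    function, then clip the values and multiply by a tent. Boundedness turns L_1 closeness into L_2
    closeness. *)
Lemma dense_classP f (eta : R) : L2 f -> 0 < eta ->
  exists2 G, dense_class G & (N2 (fun t => f t - G t)%R <= eta%:E)%E.
Proof.
move=> hf eta0; have mf := hf.1.
pose cut (n : nat) (t : R) := if (`|t| <= n%:R) && (`|f t| <= n%:R) then f t else 0.
have mcut n : measurable_fun setT (cut n).
  rewrite /cut; apply: measurable_fun_ifT => //; apply: measurable_and => /=;
  by apply: measurable_fun_ler => //; exact: measurableT_comp.
have tc : tends0 (fun n => N2 (fun t => cut n t - f t)).
  apply: (@N2_dominated _ _ _ (fun t => `|f t|)) => //.
  - apply: (L2_le _ hf); first exact: measurableT_comp.
    by apply: aeT => t; rewrite normr_id.
  - apply: aeT => t; apply: cvg_near_cst.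
    exists (maxn (Num.truncn `|t|).+1 (Num.truncn `|f t|).+1) => // n /=; rewrite geq_max => /andP[h1 h2].
    rewrite /cut !ifT//; apply/andP; split; rewrite ltW// (lt_le_trans (truncnS_gt _))// ler_nat//.
  - by apply: aeT => t n; rewrite /cut; case: ifP => // _; rewrite normr0.
have [M hM] := tc (eta / 4) ltac:(lra); have {hM} hM := hM M (leqnn M).
have mE := @measurable_symitv R M.+1.
have icut : mu.-integrable (symitv M.+1) (EFin \o cut M).
  apply: (measurable_bounded_integrable mE (symitv_lty _) (measurable_funTS (mcut M))).
  exists (M%:R); split; first exact: num_real.
  move=> x Mx t _ /=; rewrite /cut; case: ifP => [/andP[_ h]|_]; first exact: le_trans h (ltW Mx).
  by rewrite normr0 (le_trans _ (ltW Mx)).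
have [g [cg ig tg]] := approximation_continuous_integrable mE (symitv_lty M.+1) icut.
have tg' : tends0 (fun n => \int[mu]_(z in symitv M.+1) `|(cut M z - g n z)%:E|)%E.
  by apply/tends0_cvg => //; move=> n; apply: integral_ge0.
have M0 : 0 <= (M%:R : R) by [].
(* The squared L_2 error will be at most 2 M times the L_1 error, hence at most eta/4. *)
have [n hn] := tg' (eta / (4 * (2 * M%:R + 1))) ltac:(by rewrite divr_gt0// mulr_gt0// ltr_wpDl ?mulr_ge0).
have {hn} hn := hn n (leqnn n).
pose clip (x : R) := Num.max (- M%:R) (Num.min M%:R x).
pose tent (t : R) := Num.max 0 (Num.min 1 (M.+1%:R - `|t|)).
pose G t := tent t * clip (g n t).
have clipM x : `|clip x| <= M%:R.
  by rewrite /clip ler_norml; apply/andP; split; [rewrite le_max lexx|rewrite ge_max ge_min lexx ?andbT; lra].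
have tent01 t : 0 <= tent t <= 1.
  by rewrite /tent le_max lexx ge_max ler01 ge_min lexx.
have ctent : continuous tent.
  move=> t; rewrite (_ : tent = (fun=> 0 : R^o) \max ((fun=> 1 : R^o) \min (fun t => M.+1%:R - `|t| : R^o)))//.
  apply: continuous_max; first exact: cst_continuous.
  apply: continuous_min; first exact: cst_continuous.
  apply: cvgB; first exact: cvg_cst.
  by apply: cvg_norm; exact: cvg_id.
have cclip : continuous (fun t => clip (g n t)).
  move=> t; rewrite (_ : (fun t => clip (g n t)) = (fun=> - M%:R : R^o) \max ((fun=> M%:R : R^o) \min (g n : R -> R^o)))//.
  apply: continuous_max; first exact: cst_continuous.
  by apply: continuous_min; [exact: cst_continuous|exact: cg].
have cG : continuous G by move=> t; apply: cvgM; [exact: ctent|exact: cclip].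
have dG : dense_class G.
  split=> //.
  - exists M%:R => s; rewrite /G normrM -[leRHS]mul1r ler_pM//.
    by have /andP[h1 h2] := tent01 s; rewrite ger0_norm.
  - exists M.+1 => s hs; rewrite /G (_ : tent s = 0) ?mul0r//.
    rewrite /tent; apply/max_idPl; rewrite ge_min; apply/orP; right; lra.
exists G => //; have mG : measurable_fun setT G by exact: continuous_measurable_fun.
have mc := mcut M.
apply: le_trans (N2_tri mf mc mG) _.
have -> : eta%:E = (2%:E * (eta / 4)%:E + 2%:E * (eta / 4)%:E)%E.
  by rewrite -!EFinM -EFinD; congr EFin; lra.
apply: leeD; apply: lee_wpmul2l => //.
  rewrite (_ : N2 _ = N2 (fun t => cut M t - f t))//.
  by apply: eq_integral => t _; rewrite -sqrrN opprB.
have mg : measurable_fun (symitv M.+1) (fun t => `|(cut M t - g n t)%:E|)%E.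
  apply: measurableT_comp => //; apply/measurable_EFinP; apply: measurable_funB.
    exact: measurable_funTS.
  by apply: measurable_funTS; exact: continuous_measurable_fun.
apply: (@le_trans _ _ (\int[mu]_(z in symitv M.+1) ((2 * M%:R)%:E * `|(cut M z - g n z)%:E|))%E).
  rewrite [leRHS]integral_mkcond; apply: ge0_le_int.
  - by move=> t; rewrite lee_fin sqr_ge0.
  - by apply: measurable_sqr; exact: measurable_funB.
  - exact: ((measurable_restrictT _ mE).1 (measurable_funeM (2 * M%:R)%:E mg)).
  - move=> t; rewrite patchE; case: ifPn => [_|].
      rewrite abse_EFin -EFinM lee_fin.
      have cl : `|cut M t| <= M%:R by rewrite /cut; case: ifP => [/andP[]//|_]; rewrite normr0.
      (* Where [tent] differs from 1, [cut M] vanishes; and clipping to [-M, M] cannot move a value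
         away from one that lies in [-M, M]. *)
      have d1 : `|cut M t - G t| <= `|cut M t - g n t|.
        have -> : cut M t - G t = tent t * (cut M t - clip (g n t)).
          rewrite mulrBr; congr (_ - _); rewrite /cut; case: ifP => [/andP[tM _]|_]; last by rewrite mulr0.
          rewrite (_ : tent t = 1) ?mul1r// /tent.
          have h : 1 <= M.+1%:R - `|t| by rewrite -natr1; lra.
          by rewrite (min_idPl h); apply/max_idPr.
        rewrite normrM (ger0_norm (andP (tent01 t)).1) -[leRHS]mul1r ler_pM// ?(andP (tent01 t)).1//.
          by case/andP: (tent01 t).
        move: cl; rewrite ler_norml => /andP[cl1 cl2].
        rewrite /clip; have [h1|h1] := leP M%:R (g n t).
          have -> : Num.max (1 *- M) M%:R = (M%:R : R) by apply/max_idPr; lra.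
          by rewrite !ler0_norm//; lra.
        have [h2|h2] := leP (- M%:R) (g n t); first by [].
        by rewrite !ger0_norm//; lra.
      have d2 : `|cut M t - G t| <= 2 * M%:R.
        rewrite (le_trans (ler_normB _ _))// mulrDl mul1r lerD// /G normrM -[leRHS]mul1r ler_pM//.
        by have /andP[h1 h2] := tent01 t; rewrite ger0_norm.
      by rewrite -(real_normK (num_real (cut M t - G t))) expr2 ler_pM.
    move=> /negP tE; rewrite lee_fin; have tM : M.+1%:R < `|t|.
      by rewrite ltNge; apply/negP => h; apply: tE; rewrite inE; apply/symitvP.
    have -> : G t = 0.
      rewrite /G (_ : tent t = 0) ?mul0r// /tent; apply/max_idPl; rewrite ge_min; apply/orP; right; lra.
    rewrite /cut ifF ?subr0 ?expr0n//; apply/negP => /andP[h _].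
    have : (M%:R : R) < M.+1%:R by rewrite ltr_nat.
    lra.
rewrite ge0_integralZl_EFin//.
apply: le_trans (lee_wpmul2l _ hn) _; first by rewrite lee_fin mulr_ge0.
rewrite -EFinM lee_fin invfM [eta * _]mulrA mulrCA ler_piMr ?divr_ge0 ?(ltW eta0)//.
by rewrite ler_pdivrMr ?mul1r ?ltr_wpDl ?mulr_ge0// lerDl.
Qed.

Lemma Pn_cvg f : L2 f -> tends0 (fun n => N2 (fun t => Pn n f t - f t)).
Proof.
move=> hf e e0; have [G dG fG] := dense_classP hf (eta := e / 12) ltac:(lra).
have hG := dense_class_L2 dG; have [N hN] := Pn_cvg_dense dG (e := e / 12) ltac:(lra).
exists N => n /hN h; have hD := L2B hf hG.
apply: le_trans (N2_tri (L2_Pn n hf).1 (L2_Pn n hG).1 hf.1) _.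
have h1 : (N2 (fun t => Pn n f t - Pn n G t)%R <= (e / 12)%:E)%E.
  rewrite (_ : (fun t => _) = Pn n (fun t => f t - G t)); last by apply/funext => t; rewrite PnB.
  exact: le_trans (N2_Pn n hD) fG.
have h2 := N2_tri (L2_Pn n hG).1 hG.1 hf.1.
have h3 : (N2 (fun t => G t - f t)%R <= (e / 12)%:E)%E.
  rewrite (_ : N2 _ = N2 (fun t => f t - G t))//.
  by apply: eq_integral => t _; rewrite -sqrrN opprB.
apply: (@le_trans _ _ (2%:E * (e / 12)%:E + 2%:E * (2%:E * (e / 12)%:E + 2%:E * (e / 12)%:E))%E).
  apply: leeD; apply: lee_wpmul2l => //; apply: le_trans h2 _.
  by apply: leeD; apply: lee_wpmul2l.
by rewrite -?EFinM -?EFinD -?EFinM -?EFinD lee_fin; lra.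
Qed.

(** The Poisson integrals converge, hence are Cauchy, and [N2_Hn_Pn] transfers this to the conjugate
    ones; completeness does the rest. *)
Lemma Hn_limit f : L2 f -> exists g, L2 g /\ tends0 (fun n => N2 (fun t => Hn n f t - g t)).
Proof.
move=> hf; apply: L2_complete; first by move=> n; exact: L2_Hn.
move=> e e0; have [N hN] := Pn_cvg hf (e := e / 8) ltac:(lra).
exists N => m n /hN hm /hN hn; apply: le_trans (N2_Hn_Pn m n hf) _.
have := N2_tri (L2_Pn m hf).1 hf.1 (L2_Pn n hf).1 => h.
have hn' : (N2 (fun t => f t - Pn n f t)%R <= (e / 8)%:E)%E.
  rewrite (_ : N2 _ = N2 (fun t => Pn n f t - f t))//.
  by apply: eq_integral => t _; rewrite -sqrrN opprB.
apply: (@le_trans _ _ (2%:E * (2%:E * (e / 8)%:E + 2%:E * (e / 8)%:E))%E).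
  apply: lee_wpmul2l => //; apply: le_trans h _.
  by apply: leeD; (apply: lee_wpmul2l; first by []); [exact: hm|exact: hn'].
by rewrite -?EFinM -?EFinD -?EFinM -?EFinD lee_fin; lra.
Qed.

(** A chosen representative of the L_2 limit, and 0 outside L_2. Its values are determined up to a
    null set, so the rules for [Hilb] hold almost everywhere. *)
Definition Hilb f : R -> R :=
  if pselect (L2 f) is left hf then projT1 (cid (Hn_limit hf)) else fun=> 0.

Lemma HilbP f : L2 f -> L2 (Hilb f) /\ tends0 (fun n => N2 (fun t => Hn n f t - Hilb f t)).
Proof.
by move=> hf; rewrite /Hilb; case: pselect => // hf'; exact: (projT2 (cid (Hn_limit hf'))).
Qed.

End HilbertTransform.

(** * Linearity, boundedness and antisymmetry of the Hilbert transform *)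

Section HilbertProperties.
Context {R : realType}.
Local Notation mu := (@lebesgue_measure R).
Implicit Types (f g k h : R -> R).
Local Notation intg f := (mu.-integrable setT (EFin \o f)).

Let piN0 : (pi : R) != 0. Proof. by rewrite gt_eqF// pi_gt0. Qed.

Lemma N2_eq0 f : measurable_fun setT f -> N2 f = 0%E -> {ae mu, forall t, f t = 0}.
Proof.
move=> mf f0; have := (ae_eq_integral_abs mu measurableT (measurable_sqr mf)).1.
have -> : (\int[mu]_x `|(f x ^+ 2)%:E| = 0)%E.
  rewrite -[RHS]f0; apply: eq_integral => t _; rewrite abse_EFin ger0_norm ?sqr_ge0//.
move=> /(_ erefl); apply: aeS => t /(_ I) [] /eqP; rewrite sqrf_eq0 => /eqP //.
Qed.

Lemma N2C f g : N2 (fun t => f t - g t) = N2 (fun t => g t - f t).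
Proof. by apply: eq_integral => t _; rewrite -sqrrN opprB. Qed.

Lemma L2_lim_unique (u : nat -> R -> R) f g : (forall n, L2 (u n)) -> L2 f -> L2 g ->
  tends0 (fun n => N2 (fun t => u n t - f t)) -> tends0 (fun n => N2 (fun t => u n t - g t)) ->
  {ae mu, forall t, f t = g t}.
Proof.
move=> hu hf hg tf tg.
have : N2 (fun t => f t - g t) = 0%E.
  apply: tends0_eq0; first exact: N2_ge0.
  apply: (@tends0_le _ _ (fun n => 2%:E * N2 (fun t => u n t - f t)%R + 2%:E * N2 (fun t => u n t - g t)%R)%E).
    move=> n; rewrite (N2C (u n) f); apply: N2_tri; [exact: hf.1|exact: (hu n).1|exact: hg.1].
  by apply: tends0D; apply: tends0Z => // n; exact: N2_ge0.
move=> /(N2_eq0 (measurable_funB hf.1 hg.1)); apply: aeS => t.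
by move=> /eqP; rewrite subr_eq0 => /eqP.
Qed.

Lemma Rint_eqae f g : measurable_fun setT f -> measurable_fun setT g ->
  {ae mu, forall t, f t = g t} -> \int[mu]_t f t = \int[mu]_t g t.
Proof.
move=> mf mg fg; congr fine; apply: ae_eq_integral => //; try exact/measurable_EFinP.
by move: fg; apply: aeS => t -> _.
Qed.

Lemma Hn_eqae n f g t : L2 f -> L2 g -> {ae mu, forall t, f t = g t} -> Hn n f t = Hn n g t.
Proof.
move=> hf hg fg; congr (_ * _); apply: Rint_eqae.
- by apply: measurable_funM; [exact: hf.1|exact: measurable_shl (measurable_hk (eps_gt0 n))].
- by apply: measurable_funM; [exact: hg.1|exact: measurable_shl (measurable_hk (eps_gt0 n))].
- by move: fg; apply: aeS => s ->.
Qed.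

Lemma tends0_N2D (u w : nat -> R -> R) f g : (forall n, L2 (u n)) -> (forall n, L2 (w n)) -> L2 f -> L2 g ->
  tends0 (fun n => N2 (fun t => u n t - f t)) -> tends0 (fun n => N2 (fun t => w n t - g t)) ->
  tends0 (fun n => N2 (fun t => (u n t + w n t) - (f t + g t))).
Proof.
move=> hu hw hf hg tu tw.
apply: (@tends0_le _ _ (fun n => 2%:E * N2 (fun t => u n t - f t)%R + 2%:E * N2 (fun t => w n t - g t)%R)%E).
  move=> n; rewrite (_ : (fun t => _) = (fun t => (u n t - f t) + (w n t - g t))); last first.
    by apply/funext => t; ring.
  by apply: N2D; apply: measurable_funB; [exact: (hu n).1|exact: hf.1|exact: (hw n).1|exact: hg.1].
by apply: tends0D; apply: tends0Z => // n; exact: N2_ge0.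
Qed.

Lemma tends0_N2Z (c : R) (u : nat -> R -> R) f : (forall n, L2 (u n)) -> L2 f ->
  tends0 (fun n => N2 (fun t => u n t - f t)) ->
  tends0 (fun n => N2 (fun t => c * u n t - c * f t)).
Proof.
move=> hu hf tu.
apply: (@tends0_le _ _ (fun n => (c ^+ 2)%:E * N2 (fun t => u n t - f t)%R)%E).
  move=> n; rewrite -N2Z; last by apply: measurable_funB; [exact: (hu n).1|exact: hf.1].
  by rewrite le_eqVlt; apply/orP; left; apply/eqP; apply: eq_integral => t _; rewrite mulrBr.
by apply: tends0Z; rewrite ?sqr_ge0// => n; exact: N2_ge0.
Qed.

Lemma L2_Hilb f : L2 f -> L2 (Hilb f).
Proof. by move=> /HilbP[]. Qed.

Lemma Hilb_cvg f : L2 f -> tends0 (fun n => N2 (fun t => Hn n f t - Hilb f t)).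
Proof. by move=> /HilbP[]. Qed.

Lemma HnD n f g t : L2 f -> L2 g -> Hn n (fun s => f s + g s) t = Hn n f t + Hn n g t.
Proof. by move=> hf hg; rewrite /Hn (kconvD _ (goodk_hk (eps_gt0 n)))// mulrDr. Qed.

Lemma HnZ n (c : R) f t : L2 f -> Hn n (fun s => c * f s) t = c * Hn n f t.
Proof. by move=> hf; rewrite /Hn (kconvZ _ _ (goodk_hk (eps_gt0 n)))// mulrCA. Qed.

Lemma HilbD f g : L2 f -> L2 g ->
  {ae mu, forall t, Hilb (fun s => f s + g s) t = Hilb f t + Hilb g t}.
Proof.
move=> hf hg; have hD := L2D hf hg.
have hn n := L2_Hn n hf; have hn' n := L2_Hn n hg.
apply: (@L2_lim_unique (fun n => Hn n (fun s => f s + g s))).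
- by move=> n; exact: L2_Hn.
- exact: L2_Hilb.
- by apply: L2D; exact: L2_Hilb.
- exact: Hilb_cvg.
- have := tends0_N2D hn hn' (L2_Hilb hf) (L2_Hilb hg) (Hilb_cvg hf) (Hilb_cvg hg).
  apply: tends0_le => n; rewrite le_eqVlt; apply/orP; left; apply/eqP.
  by apply: eq_integral => t _; rewrite HnD.
Qed.

Lemma HilbZ (c : R) f : L2 f -> {ae mu, forall t, Hilb (fun s => c * f s) t = c * Hilb f t}.
Proof.
move=> hf; have hZ := L2Z c hf.
apply: (@L2_lim_unique (fun n => Hn n (fun s => c * f s))).
- by move=> n; exact: L2_Hn.
- exact: L2_Hilb.
- by apply: L2Z; exact: L2_Hilb.
- exact: Hilb_cvg.
- have := tends0_N2Z c (fun n => L2_Hn n hf) (L2_Hilb hf) (Hilb_cvg hf).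
  apply: tends0_le => n; rewrite le_eqVlt; apply/orP; left; apply/eqP.
  by apply: eq_integral => t _; rewrite HnZ.
Qed.

Lemma Hilb_eqae f g : L2 f -> L2 g -> {ae mu, forall t, f t = g t} ->
  {ae mu, forall t, Hilb f t = Hilb g t}.
Proof.
move=> hf hg fg; apply: (@L2_lim_unique (fun n => Hn n f)).
- by move=> n; exact: L2_Hn.
- exact: L2_Hilb.
- exact: L2_Hilb.
- exact: Hilb_cvg.
- have := Hilb_cvg hg; apply: tends0_le => n; rewrite le_eqVlt; apply/orP; left; apply/eqP.
  by apply: eq_integral => t _; rewrite (Hn_eqae n t hf hg fg).
Qed.

Lemma N2_Hilb f : L2 f -> (N2 (Hilb f) <= 2%:E * N2 f)%E.
Proof.
move=> hf; apply/lee_addgt0Pr => e e0.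
have [N hN] := Hilb_cvg hf (e := e / 2) ltac:(lra).
have h := hN N (leqnn N); have hH := L2_Hn N hf.
have := N2B hH.1 (measurable_funB hH.1 (L2_Hilb hf).1).
rewrite (_ : (fun t => Hn N f t - _) = Hilb f); last by apply/funext => t /=; ring.
move=> /le_trans; apply; apply: leeD.
  by apply: lee_wpmul2l => //; exact: N2_Hn.
apply: (@le_trans _ _ (2%:E * (e / 2)%:E)%E); first by apply: lee_wpmul2l.
by rewrite -EFinM lee_fin; lra.
Qed.

Lemma pair_cvg2 (u w : nat -> R -> R) f g : (forall n, L2 (u n)) -> (forall n, L2 (w n)) ->
  L2 f -> L2 g ->
  tends0 (fun n => N2 (fun t => u n t - f t)) -> tends0 (fun n => N2 (fun t => w n t - g t)) ->
  \int[mu]_t (u n t * w n t) @[n --> \oo] --> \int[mu]_t (f t * g t).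
Proof.
move=> hu hw hf hg tu tw.
(* u w = u g + w f - f g + (u - f)(w - g) leaves two pairings with a fixed factor and one with both
   factors small. *)
have E n : \int[mu]_t (u n t * w n t) = \int[mu]_t (u n t * g t) + \int[mu]_t (w n t * f t)
    - \int[mu]_t (f t * g t) + \int[mu]_t ((u n t - f t) * (w n t - g t)).
  have i1 := L2M_integrable (hu n) hg; have i2 := L2M_integrable (hw n) hf.
  have i3 := L2M_integrable hf hg; have i4 := L2M_integrable (L2B (hu n) hf) (L2B (hw n) hg).
  rewrite -RintegralD// -RintegralB//; last exact: intg_D.
  rewrite -RintegralD//; last by apply: intg_B => //; exact: intg_D.
  by apply: eq_Rintegral => t _; ring.
rewrite (_ : (fun n => _) = (fun n => \int[mu]_t (u n t * g t) + \int[mu]_t (w n t * f t)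
    - \int[mu]_t (f t * g t) + \int[mu]_t ((u n t - f t) * (w n t - g t)))); last exact/funext.
rewrite [X in _ --> X](_ : _ = \int[mu]_t (f t * g t) + \int[mu]_t (g t * f t)
    - \int[mu]_t (f t * g t) + 0); last first.
  by rewrite addr0 addrAC subrr add0r; apply: eq_Rintegral => t _; rewrite mulrC.
apply: cvgD; last first.
  apply/cvgrPdist_le => e e0.
  have s0 : 0 < Num.sqrt e by rewrite sqrtr_gt0.
  have e2 : 0 < Num.sqrt e ^+ 2 by rewrite exprn_gt0.
  have [N1 h1] := tu _ e2; have [N2 h2] := tw _ e2.
  exists (maxn N1 N2) => // n /=; rewrite geq_max => /andP[/h1 b1 /h2 b2].
  rewrite sub0r normrN -[leRHS](sqr_sqrtr (ltW e0)) expr2.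
  by apply: L2_pair_le; [exact: L2B|exact: L2B|exact: ltW|exact: ltW|exact: b1|exact: b2].
apply: cvgB; last exact: cvg_cst.
by apply: cvgD; apply: pair_cvg.
Qed.

(* Antisymmetry of the kernel; on truncations the double integral converges absolutely. *)
Lemma Hn_antisym_L1 n f g : L2 f -> L2 g -> intg f -> intg g ->
  \int[mu]_t (f t * Hn n g t) = - \int[mu]_t (Hn n f t * g t).
Proof.
move=> hf hg fi gi; have e0 : 0 < eps n :> R := eps_gt0 n; have mh := measurable_hk e0.
have E (a b : R -> R) : L2 a -> L2 b -> \int[mu]_t (a t * Hn n b t) =
    pi^-1 * \int[mu]_t \int[mu]_s (a t * (b s * hk (eps n) (s - t))).
  move=> ha hb; have hkb := L2_kconv_hk e0 hb.
  rewrite -RintegralZl//; last first.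
    have := L2M_integrable ha hkb; apply: eq_integrable => // t _ /=; congr EFin.
    by rewrite RintegralZl//; exact: kconv_intg (goodk_hk e0) hb.
  apply: eq_Rintegral => t _; rewrite RintegralZl//; last exact: kconv_intg (goodk_hk e0) hb.
  by rewrite mulrCA.
rewrite (E _ _ hf hg).
have -> : \int[mu]_t (Hn n f t * g t) = \int[mu]_t (g t * Hn n f t).
  by apply: eq_Rintegral => t _; rewrite mulrC.
rewrite (E _ _ hg hf) -mulrN; congr (_ * _).
have mG : measurable_fun setT (fun q : R * R => f q.1 * (g q.2 * hk (eps n) (q.2 - q.1))).
  apply: measurable_funM; first exact: measurable_cfst hf.1.
  by apply: measurable_kconv_dom => //; exact: hg.1.
rewrite (@fubini_Rintegral _ (fun t s => f t * (g s * hk (eps n) (s - t)))) //.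
  have -> : forall (F : R -> R -> R), - (\int[mu]_t \int[mu]_s F t s) = -1 * (\int[mu]_t \int[mu]_s F t s).
    by move=> F; rewrite mulN1r.
  have ib r : intg (fun s => g r * (f s * hk (eps n) (s - r))).
    by apply: intg_cM; exact: kconv_intg (goodk_hk e0) hf.
  rewrite -RintegralZl//; last first.
    have := L2M_integrable hg (L2_kconv_hk e0 hf); apply: eq_integrable => // t _ /=; congr EFin.
    by rewrite RintegralZl//; exact: kconv_intg (goodk_hk e0) hf.
  apply: eq_Rintegral => r _; rewrite -RintegralZl//; apply: eq_Rintegral => s _.
  by rewrite -[r - s]opprB hkN; ring.
have gb t : intg (fun s => g s * hk (eps n) (s - t)) by exact: kconv_intg (goodk_hk e0) hg.
have [W W0 gW] := intg_bound gi.
have mng : measurable_fun setT (fun s => `|g s|) by apply: measurableT_comp => //; exact: hg.1.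
apply: (@le_lt_trans _ _ (\int[mu]_t ((W * (eps n)^-1)%:E * `|f t|%:E))%E); last first.
  have Wn : 0 <= W * (eps n)^-1 by rewrite mulr_ge0 ?(ltW W0)// invr_ge0 ltW.
  rewrite ge0_integralZl_EFin//; last first.
    by apply/measurable_EFinP; apply: measurableT_comp => //; exact: hf.1.
  by rewrite lte_mul_pinfty ?lee_fin// intg_abs_lty.
apply: ge0_le_int.
- by move=> t; apply: integral_ge0 => s _; rewrite lee_fin.
- by apply: (@measurable_tonelli _ (fun t s => `|f t * (g s * hk (eps n) (s - t))|)) => //; exact: measurableT_comp.
- by apply: measurable_funeM; apply/measurable_EFinP; apply: measurableT_comp => //; exact: hf.1.
- move=> t; apply: (@le_trans _ _ (\int[mu]_s ((`|f t| * (eps n)^-1)%:E * `|g s|%:E))%E).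
    apply: ge0_le_int => //.
    + apply/measurable_EFinP; apply: measurableT_comp => //; apply: measurable_funM => //.
      by apply: measurable_funM; [exact: hg.1|exact: measurable_shl].
    + by apply: measurable_funeM; exact/measurable_EFinP.
    + move=> s; rewrite -EFinM lee_fin normrM -mulrA ler_wpM2l// normrM mulrC ler_wpM2r//.
      exact: hk_le.
  have fe0 : 0 <= `|f t| * (eps n)^-1 by rewrite mulr_ge0// invr_ge0 ltW.
  rewrite ge0_integralZl_EFin//; last exact/measurable_EFinP.
  apply: le_trans (lee_wpmul2l _ gW) _; first by rewrite lee_fin.
  by rewrite -!EFinM lee_fin le_eqVlt; apply/orP; left; apply/eqP; ring.
Qed.

Lemma HnB n f g t : L2 f -> L2 g -> Hn n (fun s => f s - g s) t = Hn n f t - Hn n g t.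
Proof. by move=> hf hg; rewrite /Hn (kconvB _ (goodk_hk (eps_gt0 n)))// mulrBr. Qed.

(** Both sides are continuous in f and g for the L_2 norm, so the identity passes from truncations
    to all of L_2. *)
Lemma Hn_antisym n f g : L2 f -> L2 g ->
  \int[mu]_t (f t * Hn n g t) = - \int[mu]_t (Hn n f t * g t).
Proof.
move=> hf hg.
have tH k : L2 k -> tends0 (fun m => N2 (fun t => Hn n (trunc m k) t - Hn n k t)).
  move=> hk; apply: tends0_le (trunc_tends0 hk) => m.
  have hT := L2_trunc m hk; have hD := L2B hT hk.
  rewrite (_ : (fun t => _) = Hn n (fun t => trunc m k t - k t)); last by apply/funext => t; rewrite HnB.
  exact: N2_Hn.
have c1 := pair_cvg2 (fun m => L2_trunc m hf) (fun m => L2_Hn n (L2_trunc m hg)) hf (L2_Hn n hg)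
  (trunc_tends0 hf) (tH _ hg).
have c2 := pair_cvg2 (fun m => L2_Hn n (L2_trunc m hf)) (fun m => L2_trunc m hg) (L2_Hn n hf) hg
  (tH _ hf) (trunc_tends0 hg).
have c3 : - (\int[mu]_t (Hn n (trunc m f) t * trunc m g t)) @[m --> \oo] --> - (\int[mu]_t (Hn n f t * g t)).
  by apply: cvgN.
apply: (cvg_unique _ c1); first exact: Rhausdorff.
move: c3; apply: cvg_trans; apply: near_eq_cvg; apply: nearW => m /=.
apply/esym; apply: Hn_antisym_L1; by [exact: L2_trunc|exact: intg_trunc].
Qed.

Lemma Hilb_antisym f g : L2 f -> L2 g ->
  \int[mu]_t (f t * Hilb g t) = - \int[mu]_t (Hilb f t * g t).
Proof.
move=> hf hg.
have c1 := pair_cvg (fun n => L2_Hn n hg) (L2_Hilb hg) hf (Hilb_cvg hg).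
have c2 : - (\int[mu]_t (Hn n f t * g t)) @[n --> \oo] --> - (\int[mu]_t (Hilb f t * g t)).
  by apply: cvgN; apply: (pair_cvg (fun n => L2_Hn n hf) (L2_Hilb hf) hg (Hilb_cvg hf)).
have -> : \int[mu]_t (f t * Hilb g t) = \int[mu]_t (Hilb g t * f t).
  by apply: eq_Rintegral => t _; rewrite mulrC.
apply: (cvg_unique _ c1); first exact: Rhausdorff.
move: c2; apply: cvg_trans; apply: near_eq_cvg; apply: nearW => n /=.
by rewrite -Hn_antisym//; apply: eq_Rintegral => t _; rewrite mulrC.
Qed.

End HilbertProperties.

(** * Cotlar's identity for products of Cauchy integrals *)

Section CotlarIdentity.
Context {R : realType}.
Local Notation mu := (@lebesgue_measure R).
Implicit Types (f g k h p q : R -> R).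
Local Notation intg f := (mu.-integrable setT (EFin \o f)).

Let piN0 : (pi : R) != 0. Proof. by rewrite gt_eqF// pi_gt0. Qed.

Definition bfun p (C : R) := measurable_fun setT p /\ forall t, `|p t| <= C.

Lemma L2_bfun p C f : bfun p C -> L2 f -> L2 (fun t => f t * p t).
Proof.
move=> [mp pC] hf; have := L2_bM mp (aeT pC) hf.
by congr L2; apply/funext => t; rewrite mulrC.
Qed.

(** [hk e] inverts multiplication by x up to the error e pk, and that error disappears with e. *)
Lemma hk_pk e (x : R) : 0 < e -> x * hk e x = 1 - e * pk e x.
Proof. by move=> e0; have D := den_gt0 x e0; rewrite /hk /pk; field; rewrite (gt_eqF D). Qed.

Section Main.
Context (kap p1 q1 p2 q2 : R -> R) (C : R).
Hypotheses (bk : bfun kap C) (bp1 : bfun p1 C) (bq1 : bfun q1 C) (bp2 : bfun p2 C) (bq2 : bfun q2 C).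
Hypotheses (lp1 : L2 p1) (lq1 : L2 q1) (lp2 : L2 p2) (lq2 : L2 q2).
Hypothesis kapE : forall s r, kap s - kap r = (r - s) * (p1 s * q1 r + p2 s * q2 r).

(** A difference kap t - kap s contains the factor s - t, which cancels the singularity of the
    kernel. As the remaining quotient is a sum of two products, the commutator of [Hn] with kap has
    rank two, up to the error of [hk_pk]. *)
Lemma commutator_Hn n g t : L2 g ->
  kap t * Hn n g t - Hn n (fun s => g s * kap s) t =
  pi^-1 * (p1 t * \int[mu]_s (g s * q1 s) + p2 t * \int[mu]_s (g s * q2 s))
  - eps n * (p1 t * Pn n (fun s => g s * q1 s) t + p2 t * Pn n (fun s => g s * q2 s) t).
Proof.
move=> hg; have e0 : 0 < eps n :> R := eps_gt0 n.
have gk := goodk_hk e0; have gp := goodk_pk e0.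
have ik := kconv_intg t gk hg; have ik' := kconv_intg t gk (L2_bfun bk hg).
have i1 := L2M_integrable hg lq1; have i2 := L2M_integrable hg lq2.
have j1 := kconv_intg t gp (L2_bfun bq1 hg); have j2 := kconv_intg t gp (L2_bfun bq2 hg).
rewrite /Hn /Pn /kconv.
have -> : kap t * (pi^-1 * \int[mu]_s (g s * hk (eps n) (s - t)))
   - pi^-1 * \int[mu]_s (g s * kap s * hk (eps n) (s - t)) =
   pi^-1 * (\int[mu]_s (kap t * (g s * hk (eps n) (s - t))) - \int[mu]_s (g s * kap s * hk (eps n) (s - t))).
  by rewrite RintegralZl//; ring.
have -> : pi^-1 * (p1 t * \int[mu]_s (g s * q1 s) + p2 t * \int[mu]_s (g s * q2 s)) -
   eps n * (p1 t * (pi^-1 * \int[mu]_s (g s * q1 s * pk (eps n) (s - t))) +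
            p2 t * (pi^-1 * \int[mu]_s (g s * q2 s * pk (eps n) (s - t)))) =
   pi^-1 * ((\int[mu]_s (p1 t * (g s * q1 s)) + \int[mu]_s (p2 t * (g s * q2 s)))
     - (\int[mu]_s (eps n * p1 t * (g s * q1 s * pk (eps n) (s - t))) +
        \int[mu]_s (eps n * p2 t * (g s * q2 s * pk (eps n) (s - t))))).
  by rewrite !RintegralZl//; ring.
congr (_ * _); have c1 := intg_cM (p1 t) i1; have c2 := intg_cM (p2 t) i2.
have d1 := intg_cM (eps n * p1 t) j1; have d2 := intg_cM (eps n * p2 t) j2.
rewrite -RintegralB//; last exact: intg_cM.
rewrite -RintegralD// -RintegralD// -RintegralB//; [|exact: intg_D|exact: intg_D].
apply: eq_Rintegral => s _.
have -> : kap t * (g s * hk (eps n) (s - t)) - g s * kap s * hk (eps n) (s - t) =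
  g s * (kap t - kap s) * hk (eps n) (s - t) by ring.
rewrite kapE; have := hk_pk (s - t) e0 => h.
have -> : g s * ((s - t) * (p1 t * q1 s + p2 t * q2 s)) * hk (eps n) (s - t) =
  g s * (p1 t * q1 s + p2 t * q2 s) * ((s - t) * hk (eps n) (s - t)) by ring.
by rewrite h; ring.
Qed.

(** Antisymmetry rewrites the integral of kap g Hn f as minus that of f Hn (kap g), so the left side
    pairs f with the commutator applied to g. *)
Lemma cotlar_n n f g : L2 f -> L2 g ->
  \int[mu]_t (kap t * (f t * Hn n g t + g t * Hn n f t)) =
  pi^-1 * ((\int[mu]_t (f t * p1 t)) * (\int[mu]_t (g t * q1 t))
     + (\int[mu]_t (f t * p2 t)) * (\int[mu]_t (g t * q2 t)))
  - eps n * (\int[mu]_t ((f t * p1 t) * Pn n (fun s => g s * q1 s) t)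
           + \int[mu]_t ((f t * p2 t) * Pn n (fun s => g s * q2 s) t)).
Proof.
move=> hf hg; have hHg := L2_Hn n hg; have hHf := L2_Hn n hf.
have hkf := L2_bfun bk hf; have hkg := L2_bfun bk hg.
have i1 := L2M_integrable hkf hHg; have i2 := L2M_integrable hkg hHf.
transitivity (\int[mu]_t (f t * kap t * Hn n g t) + \int[mu]_t (g t * kap t * Hn n f t)).
  by rewrite -RintegralD//; apply: eq_Rintegral => t _; ring.
rewrite (Hn_antisym n hkg hf).
have hHkg := L2_Hn n hkg; have i3 := L2M_integrable hHkg hf.
apply: (etrans (esym (RintegralB measurableT i1 i3))).
have h1 := L2_bfun bp1 hf; have h2 := L2_bfun bp2 hf.
have P1 := L2_Pn n (L2_bfun bq1 hg); have P2 := L2_Pn n (L2_bfun bq2 hg).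
have j1 := L2M_integrable h1 P1; have j2 := L2M_integrable h2 P2.
have k1 := L2M_integrable hf lp1; have k2 := L2M_integrable hf lp2.
have -> : pi^-1 * ((\int[mu]_t (f t * p1 t)) * (\int[mu]_t (g t * q1 t))
     + (\int[mu]_t (f t * p2 t)) * (\int[mu]_t (g t * q2 t))) =
   \int[mu]_t (pi^-1 * (\int[mu]_t (g t * q1 t)) * (f t * p1 t))
   + \int[mu]_t (pi^-1 * (\int[mu]_t (g t * q2 t)) * (f t * p2 t)).
  by rewrite !RintegralZl//; ring.
rewrite -RintegralD//; [|exact: intg_cM|exact: intg_cM].
rewrite -[X in _ = _ - eps n * X]RintegralD// -RintegralZl//; last exact: intg_D.
rewrite -RintegralB//; last 2 first.
- by apply: intg_D; exact: intg_cM.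
- by apply: intg_cM; exact: intg_D.
apply: eq_Rintegral => t _.
have -> : f t * kap t * Hn n g t - Hn n (fun s => g s * kap s) t * f t =
   f t * (kap t * Hn n g t - Hn n (fun s => g s * kap s) t) by ring.
by rewrite commutator_Hn//; ring.
Qed.

(** The limit of [cotlar_n]: the Poisson pairings converge, so their prefactor [eps n] removes
    them. *)
Lemma cotlar_gen f g : L2 f -> L2 g ->
  pi * \int[mu]_t (kap t * (f t * Hilb g t + g t * Hilb f t)) =
  (\int[mu]_t (f t * p1 t)) * (\int[mu]_t (g t * q1 t))
     + (\int[mu]_t (f t * p2 t)) * (\int[mu]_t (g t * q2 t)).
Proof.
move=> hf hg; set X := (RHS).
have hkf := L2_bfun bk hf; have hkg := L2_bfun bk hg.
have Ef (u w : R -> R) : L2 u -> L2 w -> \int[mu]_t (kap t * (f t * w t + g t * u t)) =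
    \int[mu]_t (w t * (f t * kap t)) + \int[mu]_t (u t * (g t * kap t)).
  move=> hu hw; have i1 := L2M_integrable hw hkf; have i2 := L2M_integrable hu hkg.
  by rewrite -RintegralD//; apply: eq_Rintegral => t _; ring.
have c1 : \int[mu]_t (kap t * (f t * Hn n g t + g t * Hn n f t)) @[n --> \oo] -->
    \int[mu]_t (kap t * (f t * Hilb g t + g t * Hilb f t)).
  rewrite Ef; [|exact: L2_Hilb|exact: L2_Hilb].
  rewrite (_ : (fun n => _) = (fun n => \int[mu]_t (Hn n g t * (f t * kap t)) + \int[mu]_t (Hn n f t * (g t * kap t)))); last first.
    by apply/funext => n; rewrite Ef//; exact: L2_Hn.
  by apply: cvgD; apply: pair_cvg => //;
    [move=> n; exact: L2_Hn|exact: L2_Hilb|exact: Hilb_cvg|move=> n; exact: L2_Hn|exact: L2_Hilb|exact: Hilb_cvg].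
have c2 : pi^-1 * X - eps n * (\int[mu]_t ((f t * p1 t) * Pn n (fun s => g s * q1 s) t)
           + \int[mu]_t ((f t * p2 t) * Pn n (fun s => g s * q2 s) t)) @[n --> \oo] --> pi^-1 * X.
  rewrite [X in _ --> X](_ : _ = pi^-1 * X - 0 * (\int[mu]_t ((g t * q1 t) * (f t * p1 t))
      + \int[mu]_t ((g t * q2 t) * (f t * p2 t)))); last by rewrite mul0r subr0.
  apply: cvgB; first exact: cvg_cst.
  apply: cvgM; first exact: eps_cvg.
  have cP q p : bfun q C -> bfun p C -> \int[mu]_t ((f t * p t) * Pn n (fun s => g s * q s) t) @[n --> \oo] -->
      \int[mu]_t ((g t * q t) * (f t * p t)).
    move=> bq bp; have hq := L2_bfun bq hg; have hp := L2_bfun bp hf.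
    have := pair_cvg (fun n => L2_Pn n hq) hq hp (Pn_cvg hq).
    apply: cvg_trans; apply: near_eq_cvg; apply: nearW => n.
    by apply: eq_Rintegral => t _; rewrite mulrC.
  by apply: cvgD; exact: cP.
have -> : X = pi * (pi^-1 * X) by rewrite mulrA mulfV// mul1r.
congr (_ * _); apply: (cvg_unique _ c1); first exact: Rhausdorff.
by move: c2; apply: cvg_trans; apply: near_eq_cvg; apply: nearW => n; rewrite /X cotlar_n.
Qed.

End Main.

(* With z = x + i y, the kernel 1/(s - z) is hk y (s - x) + i pk y (s - x). *)
Lemma pkNe y (x : R) : pk (- y) x = - pk y x.
Proof. by rewrite /pk sqrrN mulNr. Qed.

Lemma hkNe y (x : R) : hk (- y) x = hk y x.
Proof. by rewrite /hk sqrrN. Qed.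

(** Real and imaginary parts of 1/(s - z) - 1/(r - z) = (r - s)/((s - z)(r - z)) for z = x + i y;
    this is the separable form that [kapE] asks for. *)
Lemma kernel_splitP (y x s r : R) : 0 < y ->
  hk y (s - x) - hk y (r - x) =
    (r - s) * (hk y (s - x) * hk y (r - x) + (- pk y (s - x)) * pk y (r - x)) /\
  pk y (s - x) - pk y (r - x) =
    (r - s) * (hk y (s - x) * pk y (r - x) + pk y (s - x) * hk y (r - x)).
Proof.
move=> y0; have D1 := den_gt0 (s - x) y0; have D2 := den_gt0 (r - x) y0.
by split; rewrite /hk /pk; field; rewrite (gt_eqF D1) (gt_eqF D2).
Qed.

(** Real and imaginary parts of the statement that the product of the integrals of f/(t - z) and
    g/(t - z) is pi times the integral of (f H g + g H f)/(t - z), z = x + i y. *)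
Lemma cotlar y x f g : y != 0 -> L2 f -> L2 g ->
  let A h := \int[mu]_t (h t * hk y (t - x)) in
  let B h := \int[mu]_t (h t * pk y (t - x)) in
  pi * \int[mu]_t (hk y (t - x) * (f t * Hilb g t + g t * Hilb f t)) = A f * A g - B f * B g /\
  pi * \int[mu]_t (pk y (t - x) * (f t * Hilb g t + g t * Hilb f t)) = A f * B g + B f * A g.
Proof.
have pos y' : 0 < y' -> L2 f -> L2 g ->
  let A h := \int[mu]_t (h t * hk y' (t - x)) in
  let B h := \int[mu]_t (h t * pk y' (t - x)) in
  pi * \int[mu]_t (hk y' (t - x) * (f t * Hilb g t + g t * Hilb f t)) = A f * A g - B f * B g /\
  pi * \int[mu]_t (pk y' (t - x) * (f t * Hilb g t + g t * Hilb f t)) = A f * B g + B f * A g.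
  move=> y0 hf hg A B.
  have bh : bfun (fun t => hk y' (t - x)) y'^-1.
    by split; [exact: measurable_shl (measurable_hk y0)|move=> t; exact: hk_le].
  have bp : bfun (fun t => pk y' (t - x)) y'^-1.
    split; first exact: measurable_shl (measurable_pk y0).
    by move=> t; rewrite ger0_norm ?pk_le// pk_ge0.
  have bpN : bfun (fun t => - pk y' (t - x)) y'^-1.
    split; first by apply: measurableT_comp => //; exact: bp.1.
    by move=> t; rewrite normrN; exact: bp.2.
  have lh := goodk_L2l x (goodk_hk y0); have lp := goodk_L2l x (goodk_pk y0); have lpN := L2N lp.
  split.
    rewrite (cotlar_gen bh bh bh bpN bp lh lh lpN lp (fun s r => (kernel_splitP x s r y0).1) hf hg).
    congr (_ + _); rewrite -mulNr; congr (_ * _).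
    have := RintegralZl (-1) measurableT (L2M_integrable hf lp).
    rewrite mulN1r => <-; apply: eq_Rintegral => t _; ring.
  exact: (cotlar_gen bp bh bp bp bh lh lp lp lh (fun s r => (kernel_splitP x s r y0).2) hf hg).
(* For y < 0 the case -y applies: as functions of the height, [hk] is even and [pk] is odd. *)
move=> yN0 hf hg; case: (ltgtP y 0) yN0 => // [y0|y0] _; last exact: pos.
have y1 : 0 < - y by rewrite oppr_gt0.
have := pos _ y1 hf hg; rewrite /= => -[h1 h2].
have EH h : \int[mu]_t (h t * hk (- y) (t - x)) = \int[mu]_t (h t * hk y (t - x)).
  by apply: eq_Rintegral => t _; rewrite hkNe.
have lp := goodk_L2l x (goodk_pk y1).
have EP h : L2 h -> \int[mu]_t (h t * pk (- y) (t - x)) = - \int[mu]_t (h t * pk y (t - x)).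
  move=> hh; have := RintegralZl (-1) measurableT (L2M_integrable hh lp).
  rewrite mulN1r => /(congr1 (fun x => - x)); rewrite opprK => <-; congr (- _).
  by apply: eq_Rintegral => t _; rewrite pkNe; ring.
rewrite !EH !EP// in h1 h2; split.
  transitivity (pi * \int[mu]_t (hk (- y) (t - x) * (f t * Hilb g t + g t * Hilb f t))).
    by congr (_ * _); apply: eq_Rintegral => t _; rewrite hkNe.
  by rewrite h1; ring.
have lp' := L2N lp.
have hD : intg (fun t => pk (- y) (t - x) * (f t * Hilb g t + g t * Hilb f t)).
  have bp : bfun (fun t => pk (- y) (t - x)) (- y)^-1.
    split; first exact: measurable_shl (measurable_pk y1).
    by move=> t; rewrite ger0_norm ?pk_le// pk_ge0.
  have := intg_D (L2M_integrable (L2_bfun bp hf) (L2_Hilb hg)) (L2M_integrable (L2_bfun bp hg) (L2_Hilb hf)).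
  by apply: eq_integrable => // t _ /=; congr EFin; ring.
have := RintegralZl (-1) measurableT hD; rewrite mulN1r => h3.
have -> : \int[mu]_t (pk y (t - x) * (f t * Hilb g t + g t * Hilb f t)) =
   - \int[mu]_t (pk (- y) (t - x) * (f t * Hilb g t + g t * Hilb f t)).
  by rewrite -h3; apply: eq_Rintegral => t _; rewrite pkNe; ring.
by rewrite mulrN h2; ring.
Qed.

(* Test against the truncated sign of D. *)
Lemma ae0_of_pairing (D : R -> R) : measurable_fun setT D ->
  (forall n (phi : R -> R), bfun phi 1 -> intg (fun t => D t * trunc n phi t) /\
     \int[mu]_t (D t * trunc n phi t) = 0) ->
  {ae mu, forall t, D t = 0}.
Proof.
move=> mD hD.
pose phi t : R := if 0 <= D t then 1 else -1.
have bphi : bfun phi 1.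
  split; first by rewrite /phi; apply: measurable_fun_ifT => //; exact: measurable_fun_ler.
  by move=> t; rewrite /phi; case: ifP => _; rewrite ?normrN normr1.
have DE t : D t * phi t = `|D t|.
  rewrite /phi; case: ifPn => h; first by rewrite mulr1 ger0_norm.
  by rewrite mulrN1 ltr0_norm// ltNge.
have key n : {ae mu, forall t, `|t| <= n%:R -> D t = 0}.
  have [iD D0] := hD n phi bphi.
  have mT := measurable_int mu iD.
  have := (ae_eq_integral_abs mu measurableT mT).1.
  have -> : (\int[mu]_x `|(EFin \o (fun t => (D t * trunc n phi t)%R)) x| = 0)%E.
    transitivity (\int[mu]_x ((EFin \o (fun t => (D t * trunc n phi t)%R)) x))%E.
      apply: eq_integral => t _; rewrite /= ger0_norm// /trunc.
      by case: ifP => _; rewrite ?mulr0// DE.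
    move: D0; rewrite /Rintegral => D0; rewrite -[LHS]fineK ?D0//; exact: integrable_fin_num.
  move=> /(_ erefl); apply: aeS => t /(_ I) [] + tn; rewrite /trunc tn DE.
  by move=> /eqP; rewrite normr_eq0 => /eqP.
have : {ae mu, forall t, forall n, `|t| <= n%:R -> D t = 0} by apply: ae_foralln.
apply: aeS => t /(_ (Num.truncn `|t|).+1); apply; exact: ltW (truncnS_gt _).
Qed.

End CotlarIdentity.

(** * Complex integrands and the Cauchy kernel *)

Section ComplexIntegrals.
Context {R : realType}.
Local Notation mu := (@lebesgue_measure R).
Local Notation intg f := (mu.-integrable setT (EFin \o f)).
Local Notation Re := complex.Re.
Local Notation Im := complex.Im.
Implicit Types (c d : R -> R[i]) (z w : R[i]).

Lemma complex_ext z w : Re z = Re w -> Im z = Im w -> z = w.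
Proof. by case: z w => [a b] [a' b'] /= -> ->. Qed.

Lemma cReD z w : Re (z + w) = Re z + Re w. Proof. by case: z w => [? ?] [? ?]. Qed.
Lemma cImD z w : Im (z + w) = Im z + Im w. Proof. by case: z w => [? ?] [? ?]. Qed.
Lemma cReN z : Re (- z) = - Re z. Proof. by case: z. Qed.
Lemma cImN z : Im (- z) = - Im z. Proof. by case: z. Qed.
Lemma cReB z w : Re (z - w) = Re z - Re w. Proof. by rewrite cReD cReN. Qed.
Lemma cImB z w : Im (z - w) = Im z - Im w. Proof. by rewrite cImD cImN. Qed.
Lemma cReM z w : Re (z * w) = Re z * Re w - Im z * Im w.
Proof. by case: z w => [? ?] [? ?]. Qed.
Lemma cImM z w : Im (z * w) = Re z * Im w + Im z * Re w.
Proof. by case: z w => [? ?] [? ?]. Qed.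

Lemma Re_sum (I : Type) (r : seq I) (P : pred I) (F : I -> R[i]) :
  Re (\sum_(i <- r | P i) F i) = \sum_(i <- r | P i) Re (F i).
Proof. by apply: (big_morph _ cReD). Qed.
Lemma Im_sum (I : Type) (r : seq I) (P : pred I) (F : I -> R[i]) :
  Im (\sum_(i <- r | P i) F i) = \sum_(i <- r | P i) Im (F i).
Proof. by apply: (big_morph _ cImD). Qed.

Definition cint c : R[i] := (\int[mu]_t Re (c t)) +i* (\int[mu]_t Im (c t)).
Definition cintg c := intg (fun t => Re (c t)) /\ intg (fun t => Im (c t)).

Lemma eq_cint c d : (forall t, c t = d t) -> cint c = cint d.
Proof. by move=> cd; congr cint; apply/funext. Qed.

Lemma eq_cintg c d : (forall t, c t = d t) -> cintg c -> cintg d.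
Proof. by move=> cd; rewrite (_ : c = d)//; apply/funext. Qed.

Lemma cintgD c d : cintg c -> cintg d -> cintg (fun t => c t + d t).
Proof.
move=> [c1 c2] [d1 d2]; split.
  by have := intg_D c1 d1; apply: eq_integrable => // t _; rewrite /= cReD.
by have := intg_D c2 d2; apply: eq_integrable => // t _; rewrite /= cImD.
Qed.

Lemma cintD c d : cintg c -> cintg d -> cint (fun t => c t + d t) = cint c + cint d.
Proof.
move=> [c1 c2] [d1 d2]; apply: complex_ext; rewrite ?cReD ?cImD /=.
  by rewrite -RintegralD//; apply: eq_Rintegral => t _; rewrite cReD.
by rewrite -RintegralD//; apply: eq_Rintegral => t _; rewrite cImD.
Qed.

Lemma cintgZ z c : cintg c -> cintg (fun t => z * c t).
Proof.
move=> [c1 c2]; split.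
  have := intg_B (intg_cM (Re z) c1) (intg_cM (Im z) c2).
  by apply: eq_integrable => // t _; rewrite /= cReM.
have := intg_D (intg_cM (Re z) c2) (intg_cM (Im z) c1).
by apply: eq_integrable => // t _; rewrite /= cImM.
Qed.

Lemma cintZ z c : cintg c -> cint (fun t => z * c t) = z * cint c.
Proof.
move=> [c1 c2]; apply: complex_ext; rewrite ?cReM ?cImM /=.
  rewrite -!RintegralZl// -RintegralB//; [|exact: intg_cM|exact: intg_cM].
  by apply: eq_Rintegral => t _; rewrite cReM.
rewrite -!RintegralZl// -RintegralD//; [|exact: intg_cM|exact: intg_cM].
by apply: eq_Rintegral => t _; rewrite cImM.
Qed.

Lemma cintg0 : cintg (fun=> 0).
Proof. by split; exact: integrable0. Qed.

Lemma cint0 : cint (fun=> 0) = 0.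
Proof. by apply: complex_ext; rewrite /= /Rintegral integral0. Qed.

Lemma cintg_sum (I : Type) (r : seq I) (F : I -> R -> R[i]) : (forall i, cintg (F i)) ->
  cintg (fun t => \sum_(i <- r) F i t).
Proof.
move=> hF; elim: r => [|i r IH].
  by apply: (eq_cintg _ cintg0) => t; rewrite big_nil.
by apply: (eq_cintg _ (cintgD (hF i) IH)) => t; rewrite big_cons.
Qed.

Lemma cint_sum (I : Type) (r : seq I) (F : I -> R -> R[i]) : (forall i, cintg (F i)) ->
  cint (fun t => \sum_(i <- r) F i t) = \sum_(i <- r) cint (F i).
Proof.
move=> hF; elim: r => [|i r IH].
  by rewrite big_nil; rewrite -[RHS]cint0; apply: eq_cint => t; rewrite big_nil.
rewrite big_cons -IH -cintD//; last exact: cintg_sum.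
by apply: eq_cint => t; rewrite big_cons.
Qed.

Definition cL2 c := L2 (fun t => Re (c t)) /\ L2 (fun t => Im (c t)).
Definition cbfun c := exists C, bfun (fun t => Re (c t)) C /\ bfun (fun t => Im (c t)) C.

Lemma eq_cL2 c d : (forall t, c t = d t) -> cL2 c -> cL2 d.
Proof. by move=> cd; rewrite (_ : c = d)//; apply/funext. Qed.

Lemma cL2M_cintg c d : cL2 c -> cL2 d -> cintg (fun t => c t * d t).
Proof.
move=> [c1 c2] [d1 d2]; split.
  have := intg_B (L2M_integrable c1 d1) (L2M_integrable c2 d2).
  by apply: eq_integrable => // t _; rewrite /= cReM.
have := intg_D (L2M_integrable c1 d2) (L2M_integrable c2 d1).
by apply: eq_integrable => // t _; rewrite /= cImM.
Qed.

Lemma bfun_intg (p f : R -> R) C : bfun p C -> intg f -> intg (fun t => p t * f t).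
Proof.
move=> [mp pC] fi; have := intg_bM mp pC fi.
by apply: eq_integrable => // t _; rewrite /= mulrC.
Qed.

Lemma cbfun_cintg c d : cbfun c -> cintg d -> cintg (fun t => c t * d t).
Proof.
move=> [C [b1 b2]] [d1 d2]; split.
  have := intg_B (bfun_intg b1 d1) (bfun_intg b2 d2).
  by apply: eq_integrable => // t _; rewrite /= cReM.
have := intg_D (bfun_intg b1 d2) (bfun_intg b2 d1).
by apply: eq_integrable => // t _; rewrite /= cImM.
Qed.

Definition ckern z (t : R) : R[i] := (t%:C - z)^-1.

Lemma ckernE z t : ckern z t =
  hk (Im z) (t - Re z) +i* pk (Im z) (t - Re z).
Proof.
case: z => x y; rewrite /ckern /hk /pk; apply: complex_ext => /=;
  by rewrite sub0r sqrrN ?opprK ?mulNr ?opprK.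
Qed.

(** The kernel estimates need a positive height; |y| serves both half planes, since [hk] depends on
    y^2 and [pk] changes sign only. *)
Lemma ckern_norm_pos (y : R) : y != 0 -> goodk `|y| (hk y) /\ goodk `|y| (pk y).
Proof.
move=> y0; have n0 : 0 < `|y| by rewrite normr_gt0.
have [g1 g2] := (goodk_hk n0, goodk_pk n0).
have s2 : `|y| ^+ 2 = y ^+ 2 by rewrite real_normK ?num_real.
have e1 : hk `|y| = hk y by apply/funext => x; rewrite /hk s2.
split; first by rewrite -e1.
case: (ltP 0 y) => hy; first by rewrite gtr0_norm// in g2 *.
have e2 : pk y = (fun x => - pk `|y| x).
  by apply/funext => x; rewrite ler0_norm// /pk sqrrN mulNr opprK.
split=> //; first by rewrite e2; apply: measurableT_comp => //; exact: measurable_pk.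
by move=> x; rewrite e2 sqrrN; exact: pk_sqr_le.
Qed.

Lemma ckern_cL2 z : Im z != 0 -> cL2 (ckern z).
Proof.
move=> /ckern_norm_pos[g1 g2]; split.
  by under [X in L2 X]funext do rewrite ckernE /=; exact: goodk_L2l g1.
by under [X in L2 X]funext do rewrite ckernE /=; exact: goodk_L2l g2.
Qed.

Lemma goodk_bfun e k x : goodk e k -> bfun (fun t : R => k (t - x)) e^-1.
Proof.
move=> gk; split; first by case: gk => _ mk _; exact: measurable_shl.
by move=> t; exact: goodk_le gk.
Qed.

Lemma ckern_cbfun z : Im z != 0 -> cbfun (ckern z).
Proof.
move=> /ckern_norm_pos[g1 g2]; exists `|Im z|^-1; split.
  by under [X in bfun X]funext do rewrite ckernE /=; exact: goodk_bfun g1.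
by under [X in bfun X]funext do rewrite ckernE /=; exact: goodk_bfun g2.
Qed.

Definition Kz z c : R[i] := cint (fun t => ckern z t * c t).
Definition cH c (t : R) : R[i] := Hilb (fun s => Re (c s)) t +i* Hilb (fun s => Im (c s)) t.

Lemma cL2_cH c : cL2 c -> cL2 (cH c).
Proof. by move=> [c1 c2]; split; exact: L2_Hilb. Qed.

Lemma Kz_dom z c : Im z != 0 -> cL2 c -> cintg (fun t => ckern z t * c t).
Proof. by move=> z0 hc; apply: cL2M_cintg => //; exact: ckern_cL2. Qed.

Lemma Kz_dom1 z c : Im z != 0 -> cintg c -> cintg (fun t => ckern z t * c t).
Proof. by move=> z0 hc; apply: cbfun_cintg => //; exact: ckern_cbfun. Qed.

Let rc (f : R -> R) : R -> R[i] := fun t => (f t)%:C.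

Lemma rc_cL2 f : L2 f -> cL2 (rc f).
Proof. by move=> hf; split => //; exact: L2_0. Qed.

Lemma rc_Kz_cotlar z (f g : R -> R) : Im z != 0 -> L2 f -> L2 g ->
  Kz z (rc f) * Kz z (rc g) = pi%:C * Kz z (rc (fun t => f t * Hilb g t + g t * Hilb f t)).
Proof.
move=> z0 hf hg; have [] := cotlar (Re z) z0 hf hg => /= h1 h2.
have E (u : R -> R) : Kz z (rc u) = (\int[mu]_t (u t * hk (Im z) (t - Re z)))
    +i* (\int[mu]_t (u t * pk (Im z) (t - Re z))).
  apply: complex_ext; rewrite /=; apply: eq_Rintegral => t _; rewrite ckernE ?cReM ?cImM /=;
  by rewrite mulr0 ?subr0 ?add0r mulrC.
rewrite !E; apply: complex_ext; rewrite ?cReM ?cImM /= mul0r ?subr0 ?addr0.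
  by rewrite -h1; congr (_ * _); apply: eq_Rintegral => t _; rewrite mulrC.
by rewrite -h2; congr (_ * _); apply: eq_Rintegral => t _; rewrite mulrC.
Qed.

Lemma KzD z c d : cintg (fun t => ckern z t * c t) -> cintg (fun t => ckern z t * d t) ->
  Kz z (fun t => c t + d t) = Kz z c + Kz z d.
Proof.
by move=> hc hd; rewrite /Kz -cintD//; apply: eq_cint => t; rewrite mulrDr.
Qed.

Lemma KzZ z w c : cintg (fun t => ckern z t * c t) -> Kz z (fun t => w * c t) = w * Kz z c.
Proof. by move=> hc; rewrite /Kz -cintZ//; apply: eq_cint => t; rewrite mulrCA. Qed.

Lemma cH_intg c d : cL2 c -> cL2 d -> cintg (fun t => c t * cH d t + d t * cH c t).
Proof. by move=> hc hd; apply: cintgD; apply: cL2M_cintg => //; exact: cL2_cH. Qed.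

Lemma bilinear_expand (a1 a2 b1 b2 h11 h12 h21 h22 p i : R[i]) :
  a1 * b1 = p * h11 -> a1 * b2 = p * h12 -> a2 * b1 = p * h21 -> a2 * b2 = p * h22 ->
  (a1 + i * a2) * (b1 + i * b2) = p * (h11 + i * h12 + i * (h21 + i * h22)).
Proof.
move=> e11 e12 e21 e22.
have -> : (a1 + i * a2) * (b1 + i * b2) = a1 * b1 + i * (a1 * b2) + i * (a2 * b1 + i * (a2 * b2)) by ring.
by rewrite e11 e12 e21 e22; ring.
Qed.

(** Both sides are complex bilinear, so the real identity [rc_Kz_cotlar] for the four pairs of real
    and imaginary parts recombines. *)
Lemma Kz_cotlar z c d : Im z != 0 -> cL2 c -> cL2 d ->
  Kz z c * Kz z d = pi%:C * Kz z (fun t => c t * cH d t + d t * cH c t).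
Proof.
move=> z0 [c1 c2] [d1 d2].
pose h (f g : R -> R) t := f t * Hilb g t + g t * Hilb f t.
have hi f g : L2 f -> L2 g -> cintg (fun t => ckern z t * rc (h f g) t).
  move=> hf hg; apply: Kz_dom1 => //; split; last exact: integrable0.
  by apply: intg_D; apply: L2M_integrable => //; exact: L2_Hilb.
have split2 (e : R -> R[i]) : cL2 e -> Kz z e = Kz z (rc (fun t => Re (e t))) + 'i * Kz z (rc (fun t => Im (e t))).
  move=> [e1 e2]; have k1 := Kz_dom z0 (rc_cL2 e1); have k2 := Kz_dom z0 (rc_cL2 e2).
  rewrite -KzZ// -KzD//; last by apply: (eq_cintg _ (cintgZ 'i k2)) => t; rewrite mulrCA.
  by congr Kz; apply/funext => t; apply: complex_ext; rewrite ?cReD ?cImD ?cReM ?cImM /=; ring.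
rewrite (split2 c)// (split2 d)//.
have -> : Kz z (fun t => c t * cH d t + d t * cH c t) =
  Kz z (rc (h (fun t => Re (c t)) (fun t => Re (d t)))) + 'i * Kz z (rc (h (fun t => Re (c t)) (fun t => Im (d t))))
  + 'i * (Kz z (rc (h (fun t => Im (c t)) (fun t => Re (d t)))) + 'i * Kz z (rc (h (fun t => Im (c t)) (fun t => Im (d t))))).
  have k11 := hi _ _ c1 d1; have k12 := hi _ _ c1 d2; have k21 := hi _ _ c2 d1; have k22 := hi _ _ c2 d2.
  have Zi u : cintg (fun t => ckern z t * u t) -> cintg (fun t => ckern z t * ('i * u t)).
    by move=> hu; apply: (eq_cintg _ (cintgZ 'i hu)) => t; rewrite mulrCA.
  have Di (u w : R -> R[i]) : cintg (fun t => ckern z t * u t) -> cintg (fun t => ckern z t * w t) ->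
      cintg (fun t => ckern z t * (u t + w t)).
    by move=> hu hw; apply: (eq_cintg _ (cintgD hu hw)) => t; rewrite mulrDr.
  have comb (u1 u2 u3 u4 : R -> R[i]) : cintg (fun t => ckern z t * u1 t) ->
      cintg (fun t => ckern z t * u2 t) -> cintg (fun t => ckern z t * u3 t) ->
      cintg (fun t => ckern z t * u4 t) ->
      Kz z (fun t => u1 t + 'i * u2 t + 'i * (u3 t + 'i * u4 t)) =
      Kz z u1 + 'i * Kz z u2 + 'i * (Kz z u3 + 'i * Kz z u4).
    move=> v1 v2 v3 v4; have i2 := Zi _ v2; have i4 := Zi _ v4.
    have d1' := Di _ _ v1 i2; have d2' := Di _ _ v3 i4; have d3 := Zi _ d2'.
    apply: (etrans (KzD d1' d3)); congr (_ + _).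
      by apply: (etrans (KzD v1 i2)); congr (_ + _); exact: KzZ.
    apply: (etrans (KzZ 'i d2')); congr (_ * _).
    by apply: (etrans (KzD v3 i4)); congr (_ + _); exact: KzZ.
  apply: (etrans _ (comb _ _ _ _ k11 k12 k21 k22)).
  by congr Kz; apply/funext => t; apply: complex_ext; rewrite ?cReD ?cImD ?cReM ?cImM /= /h; ring.
have := rc_Kz_cotlar z0 c1 d1; have := rc_Kz_cotlar z0 c1 d2.
have := rc_Kz_cotlar z0 c2 d1; have := rc_Kz_cotlar z0 c2 d2; rewrite -/(h _ _).
rewrite -!/(h _ _) => e22 e21 e12 e11.
exact: bilinear_expand e11 e12 e21 e22.
Qed.

End ComplexIntegrals.

(** * Square integrable matrix functions *)

Section MatrixL2.
Context {R : realType} {n : nat}.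
Local Notation mu := (@lebesgue_measure R).
Local Notation intg f := (mu.-integrable setT (EFin \o f)).
Local Notation Re := complex.Re.
Local Notation Im := complex.Im.
Local Notation M := 'M[R[i]]_n.
Implicit Types (A B : M) (F G : R -> M).

(** The squared Frobenius norm, the pointwise counterpart of [mN2]; bounds on matrices are stated
    through it to avoid square roots. *)
Definition q A : R := mxnorm A ^+ 2.

Lemma normc_sqr (z : R[i]) : ComplexField.Normc.normc z ^+ 2 = Re z ^+ 2 + Im z ^+ 2.
Proof. by case: z => a b /=; rewrite sqr_sqrtr// addr_ge0 ?sqr_ge0. Qed.

Lemma qE A : q A = \sum_(i < n) \sum_(j < n) (Re (A i j) ^+ 2 + Im (A i j) ^+ 2).
Proof.
rewrite /q /mxnorm sqr_sqrtr; last by do 2 apply: sumr_ge0 => ? _; rewrite sqr_ge0.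
by do 2 apply: eq_bigr => ? _; exact: normc_sqr.
Qed.

Lemma q_ge0 A : 0 <= q A. Proof. exact: sqr_ge0. Qed.

Lemma mxnorm_ge0 A : 0 <= mxnorm A. Proof. exact: sqrtr_ge0. Qed.

Lemma q_entry A i j : Re (A i j) ^+ 2 + Im (A i j) ^+ 2 <= q A.
Proof.
rewrite qE (bigD1 i)//= (bigD1 j)//= -addrA lerDl addr_ge0//.
  by apply: sumr_ge0 => k _; rewrite addr_ge0 ?sqr_ge0.
by do 2 apply: sumr_ge0 => ? _; rewrite addr_ge0 ?sqr_ge0.
Qed.

Lemma q_Re A i j : Re (A i j) ^+ 2 <= q A.
Proof. by apply: le_trans (q_entry A i j); rewrite lerDl sqr_ge0. Qed.

Lemma q_Im A i j : Im (A i j) ^+ 2 <= q A.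
Proof. by apply: le_trans (q_entry A i j); rewrite lerDr sqr_ge0. Qed.

Lemma qD A B : q (A + B) <= 2 * q A + 2 * q B.
Proof.
rewrite !qE !mulr_sumr -big_split/=; apply: ler_sum => i _.
rewrite !mulr_sumr -big_split/=; apply: ler_sum => j _.
rewrite mxE cReD cImD.
have := sqr_ge0 (Re (A i j) - Re (B i j)); have := sqr_ge0 (Im (A i j) - Im (B i j)); nra.
Qed.

Lemma qN A : q (- A) = q A.
Proof. by rewrite !qE; do 2 apply: eq_bigr => ? _; rewrite mxE cReN cImN !sqrrN. Qed.

Lemma qB A B : q (A - B) <= 2 * q A + 2 * q B.
Proof. by rewrite -(qN B); exact: qD. Qed.

Lemma qC A B : q (A - B) = q (B - A).
Proof. by rewrite -qN opprB. Qed.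

Lemma q0 : q 0 = 0.
Proof.
by rewrite qE big1// => i _; rewrite big1// => j _; rewrite mxE expr0n/= addr0.
Qed.

Lemma q_eq0 A : q A = 0 -> A = 0.
Proof.
move=> A0; apply/matrixP => i j; rewrite mxE.
have := q_entry A i j; rewrite A0 => h.
have h1 := sqr_ge0 (Re (A i j)); have h2 := sqr_ge0 (Im (A i j)).
apply: complex_ext => /=; apply/eqP; rewrite -sqrf_eq0; apply/eqP; lra.
Qed.

Lemma qZ (z : R[i]) A : q (z *: A) = (Re z ^+ 2 + Im z ^+ 2) * q A.
Proof.
rewrite !qE !mulr_sumr; apply: eq_bigr => i _; rewrite !mulr_sumr; apply: eq_bigr => j _.
by rewrite mxE cReM cImM; ring.
Qed.

Lemma sqr_sum_le (x : 'I_n -> R) : (\sum_i x i) ^+ 2 <= n%:R * \sum_i x i ^+ 2.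
Proof.
have : 0 <= \sum_i \sum_j (x i - x j) ^+ 2 by do 2 apply: sumr_ge0 => ? _; rewrite sqr_ge0.
have -> : \sum_i \sum_j (x i - x j) ^+ 2 = \sum_i \sum_j (x i ^+ 2 + x j ^+ 2 - 2 * (x i * x j)).
  by do 2 apply: eq_bigr => ? _; ring.
have -> : \sum_i \sum_j (x i ^+ 2 + x j ^+ 2 - 2 * (x i * x j)) =
   2 * (n%:R * \sum_i x i ^+ 2) - 2 * (\sum_i x i) ^+ 2.
  under eq_bigr do rewrite big_split/= big_split/= sumr_const card_ord sumrN -!mulr_sumr.
  rewrite big_split/= big_split/= sumr_const card_ord sumrN -mulr_sumr -mulr_suml expr2.
  rewrite -sumrMnl; under eq_bigr do rewrite -mulr_natl.
  rewrite -mulr_sumr -mulr_natl; move: (\sum_i x i ^+ 2) (\sum_i x i) => a b; ring.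
lra.
Qed.

Lemma qM A B : q (A *m B) <= 2 * n%:R * (q A * q B).
Proof.
have E i j : Re ((A *m B) i j) ^+ 2 + Im ((A *m B) i j) ^+ 2 <=
    2 * n%:R * \sum_k (Re (A i k) ^+ 2 + Im (A i k) ^+ 2) * (Re (B k j) ^+ 2 + Im (B k j) ^+ 2).
  rewrite mxE Re_sum Im_sum.
  apply: (@le_trans _ _ (n%:R * \sum_k Re (A i k * B k j) ^+ 2 + n%:R * \sum_k Im (A i k * B k j) ^+ 2)).
    by apply: lerD; exact: sqr_sum_le.
  rewrite -mulrDr -big_split/= [2 * _]mulrC -mulrA ler_wpM2l// mulr_sumr; apply: ler_sum => k _.
  rewrite cReM cImM.
  have -> : (Re (A i k) * Re (B k j) - Im (A i k) * Im (B k j)) ^+ 2 +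
     (Re (A i k) * Im (B k j) + Im (A i k) * Re (B k j)) ^+ 2 =
     (Re (A i k) ^+ 2 + Im (A i k) ^+ 2) * (Re (B k j) ^+ 2 + Im (B k j) ^+ 2) by ring.
  by rewrite ler_peMl ?ler1n// mulr_ge0// addr_ge0 ?sqr_ge0.
have SB k : \sum_j (Re (B k j) ^+ 2 + Im (B k j) ^+ 2) <= q B.
  rewrite qE [leRHS](bigD1 k)//= lerDl; do 2 apply: sumr_ge0 => ? _.
  by rewrite addr_ge0 ?sqr_ge0.
rewrite (qE (A *m B)) (qE A) mulr_suml mulr_sumr; apply: ler_sum => i _.
apply: (@le_trans _ _ (\sum_j (2 * n%:R * \sum_k (Re (A i k) ^+ 2 + Im (A i k) ^+ 2) * (Re (B k j) ^+ 2 + Im (B k j) ^+ 2)))).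
  by apply: ler_sum => j _; exact: E.
rewrite -mulr_sumr ler_wpM2l ?mulr_ge0// exchange_big/= mulr_suml; apply: ler_sum => k _.
by rewrite -mulr_sumr ler_wpM2l ?SB// addr_ge0 ?sqr_ge0.
Qed.

Lemma adjE A i j : (A^t*) i j = (A j i)^*.
Proof. by rewrite !mxE. Qed.

Lemma cRe_conj (z : R[i]) : Re (z^*)%C = Re z. Proof. by case: z. Qed.
Lemma cIm_conj (z : R[i]) : Im (z^*)%C = - Im z. Proof. by case: z. Qed.

Lemma q_adj A : q (A^t*) = q A.
Proof.
rewrite !qE exchange_big/=; do 2 apply: eq_bigr => ? _.
by rewrite adjE cRe_conj cIm_conj sqrrN.
Qed.

Lemma measurable_q F : mxmeasurable F -> measurable_fun setT (fun t => q (F t)).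
Proof.
move=> mF; under eq_fun do rewrite qE.
apply: measurable_sum => i; apply: measurable_sum => j.
by have [h1 h2] := mF i j; apply: measurable_funD; exact: measurable_funX.
Qed.

Lemma mxmeasurableD F G : mxmeasurable F -> mxmeasurable G -> mxmeasurable (fun t => F t + G t).
Proof.
move=> mF mG i j; have [f1 f2] := mF i j; have [g1 g2] := mG i j; split.
  by under eq_fun do rewrite mxE cReD; exact: measurable_funD.
by under eq_fun do rewrite mxE cImD; exact: measurable_funD.
Qed.

Lemma mxmeasurableN F : mxmeasurable F -> mxmeasurable (fun t => - F t).
Proof.
move=> mF i j; have [f1 f2] := mF i j; split.
  by under eq_fun do rewrite mxE cReN; exact: measurableT_comp.
by under eq_fun do rewrite mxE cImN; exact: measurableT_comp.
Qed.

Lemma mxmeasurableB F G : mxmeasurable F -> mxmeasurable G -> mxmeasurable (fun t => F t - G t).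
Proof. by move=> mF /mxmeasurableN; exact: mxmeasurableD. Qed.

Lemma mxmeasurable_cst A : mxmeasurable (fun _ : R => A).
Proof. by move=> i j; split; exact: measurable_cst. Qed.

Lemma mxmeasurableM F G : mxmeasurable F -> mxmeasurable G -> mxmeasurable (fun t => F t *m G t).
Proof.
move=> mF mG i j; split.
  under eq_fun do rewrite mxE Re_sum; apply: measurable_sum => k.
  have [f1 f2] := mF i k; have [g1 g2] := mG k j.
  by under eq_fun do rewrite cReM; apply: measurable_funB; exact: measurable_funM.
under eq_fun do rewrite mxE Im_sum; apply: measurable_sum => k.
have [f1 f2] := mF i k; have [g1 g2] := mG k j.
by under eq_fun do rewrite cImM; apply: measurable_funD; exact: measurable_funM.
Qed.

Lemma mxmeasurableZ (c : R -> R[i]) F : measurable_fun setT (fun t => Re (c t)) ->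
  measurable_fun setT (fun t => Im (c t)) -> mxmeasurable F -> mxmeasurable (fun t => c t *: F t).
Proof.
move=> c1 c2 mF i j; have [f1 f2] := mF i j; split.
  by under eq_fun do rewrite mxE cReM; apply: measurable_funB; exact: measurable_funM.
by under eq_fun do rewrite mxE cImM; apply: measurable_funD; exact: measurable_funM.
Qed.

Lemma mxmeasurable_adj F : mxmeasurable F -> mxmeasurable (fun t => (F t)^t*).
Proof.
move=> mF i j; have [f1 f2] := mF j i; split.
  by under eq_fun do rewrite adjE cRe_conj.
by under eq_fun do rewrite adjE cIm_conj; exact: measurableT_comp.
Qed.

Definition mN2 F : \bar R := (\int[mu]_t (q (F t))%:E)%E.

Definition mL2 F := mxmeasurable F /\ (mN2 F < +oo)%E.

Lemma mN2_ge0 F : (0 <= mN2 F)%E.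
Proof. by apply: integral_ge0 => t _; rewrite lee_fin q_ge0. Qed.

Lemma mN2_le_int F (g : R -> R) : mxmeasurable F -> measurable_fun setT g ->
  {ae mu, forall t, q (F t) <= g t} -> (forall t, 0 <= g t) -> (mN2 F <= \int[mu]_t (g t)%:E)%E.
Proof.
move=> mF mg h g0; apply: ae_ge0_le_integral => //.
- by move=> t _; rewrite lee_fin q_ge0.
- by apply/measurable_EFinP; exact: measurable_q.
- by move=> t _; rewrite lee_fin.
- exact/measurable_EFinP.
- by move: h; apply: aeS => t ht _; rewrite lee_fin.
Qed.

Lemma mN2_int2 (c d : R) F G : 0 <= c -> 0 <= d -> mxmeasurable F -> mxmeasurable G ->
  (\int[mu]_t (c * q (F t) + d * q (G t))%:E = c%:E * mN2 F + d%:E * mN2 G)%E.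
Proof.
move=> c0 d0 mF mG; have m1 := measurable_q mF; have m2 := measurable_q mG.
rewrite /mN2 -!ge0_integralZl_EFin//; last 4 first.
- by move=> t _; rewrite lee_fin q_ge0.
- exact/measurable_EFinP.
- by move=> t _; rewrite lee_fin q_ge0.
- exact/measurable_EFinP.
rewrite -ge0_integralD//.
- by move=> t _; rewrite mule_ge0 ?lee_fin ?q_ge0.
- by apply: measurable_funeM; exact/measurable_EFinP.
- by move=> t _; rewrite mule_ge0 ?lee_fin ?q_ge0.
- by apply: measurable_funeM; exact/measurable_EFinP.
Qed.

Lemma mN2D F G : mxmeasurable F -> mxmeasurable G ->
  (mN2 (fun t => F t + G t)%R <= 2%:E * mN2 F + 2%:E * mN2 G)%E.
Proof.
move=> mF mG; rewrite -mN2_int2//; apply: mN2_le_int.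
- exact: mxmeasurableD.
- by apply: measurable_funD; apply: measurable_funM => //; exact: measurable_q.
- by apply: aeT => t; exact: qD.
- by move=> t; rewrite addr_ge0// mulr_ge0 ?q_ge0.
Qed.

Lemma mN2N F : mN2 (fun t => - F t) = mN2 F.
Proof. by apply: eq_integral => t _; rewrite qN. Qed.

Lemma mN2B F G : mxmeasurable F -> mxmeasurable G ->
  (mN2 (fun t => F t - G t)%R <= 2%:E * mN2 F + 2%:E * mN2 G)%E.
Proof. by move=> mF mG; rewrite -(mN2N G); apply: mN2D => //; exact: mxmeasurableN. Qed.

Lemma mN2_scale F G (c : R) : 0 <= c -> mxmeasurable F -> mxmeasurable G ->
  {ae mu, forall t, q (F t) <= c * q (G t)} -> (mN2 F <= c%:E * mN2 G)%E.
Proof.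
move=> c0 mF mG h.
rewrite /mN2 -ge0_integralZl_EFin//; last 2 first.
- by move=> t _; rewrite lee_fin q_ge0.
- by apply/measurable_EFinP; exact: measurable_q.
apply: mN2_le_int => //.
- by apply: measurable_funM => //; exact: measurable_q.
- by move=> t; rewrite mulr_ge0 ?q_ge0.
Qed.

Lemma mL2_scale F G (c : R) : 0 <= c -> mxmeasurable F -> mL2 G ->
  {ae mu, forall t, q (F t) <= c * q (G t)} -> mL2 F.
Proof.
move=> c0 mF [mG G2] h; split=> //; apply: le_lt_trans (mN2_scale c0 mF mG h) _.
by rewrite lte_mul_pinfty.
Qed.

Lemma mL2D F G : mL2 F -> mL2 G -> mL2 (fun t => F t + G t).
Proof.
move=> [mF F2] [mG G2]; split; first exact: mxmeasurableD.
by apply: le_lt_trans (mN2D mF mG) _; rewrite lte_add_pinfty// lte_mul_pinfty.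
Qed.

Lemma mL2N F : mL2 F -> mL2 (fun t => - F t).
Proof. by move=> [mF F2]; split; [exact: mxmeasurableN|rewrite mN2N]. Qed.

Lemma mL2B F G : mL2 F -> mL2 G -> mL2 (fun t => F t - G t).
Proof. by move=> hF /mL2N; exact: mL2D. Qed.

Lemma mL2Z (z : R[i]) F : mL2 F -> mL2 (fun t => z *: F t).
Proof.
move=> hF; apply: (@mL2_scale _ F (Re z ^+ 2 + Im z ^+ 2)) => //.
- by rewrite addr_ge0 ?sqr_ge0.
- by apply: mxmeasurableZ => //; exact: hF.1.
- by apply: aeT => t; rewrite qZ.
Qed.

Lemma mL2_adj F : mL2 F -> mL2 (fun t => (F t)^t*).
Proof.
move=> hF; apply: (@mL2_scale _ F 1) => //; first by apply: mxmeasurable_adj; exact: hF.1.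
by apply: aeT => t; rewrite q_adj mul1r.
Qed.

Lemma mL2_eqae F G : mxmeasurable G -> {ae mu, forall t, F t = G t} -> mL2 F -> mL2 G.
Proof.
by move=> mG h hF; apply: (@mL2_scale _ F 1) => //; move: h; apply: aeS => t ->; rewrite mul1r.
Qed.

Lemma mN2_eqae F G : mxmeasurable F -> mxmeasurable G -> {ae mu, forall t, F t = G t} -> mN2 F = mN2 G.
Proof.
move=> mF mG h; apply/eqP; rewrite eq_le; apply/andP; split.
  by rewrite -[leRHS]mul1e; apply: mN2_scale => //; move: h; apply: aeS => t ->; rewrite mul1r.
by rewrite -[leRHS]mul1e; apply: mN2_scale => //; move: h; apply: aeS => t ->; rewrite mul1r.
Qed.

(** C bounds the square of the norm, outside a null set. *)
Definition mbdd (C : R) F := mxmeasurable F /\ {ae mu, forall t, q (F t) <= C}.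

Lemma mN2_Mr (C : R) F G : 0 <= C -> mxmeasurable F -> mbdd C G ->
  (mN2 (fun t => F t *m G t)%R <= (2 * n%:R * C)%:E * mN2 F)%E.
Proof.
move=> C0 mF [mG GC]; apply: mN2_scale => //; first by rewrite mulr_ge0.
  exact: mxmeasurableM.
move: GC; apply: aeS => t h; apply: le_trans (qM _ _) _.
by rewrite -[leRHS]mulrA ler_wpM2l ?mulr_ge0// mulrC ler_wpM2r ?q_ge0.
Qed.

Lemma mN2_Ml (C : R) F G : 0 <= C -> mxmeasurable F -> mbdd C G ->
  (mN2 (fun t => G t *m F t)%R <= (2 * n%:R * C)%:E * mN2 F)%E.
Proof.
move=> C0 mF [mG GC]; apply: mN2_scale => //; first by rewrite mulr_ge0.
  exact: mxmeasurableM.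
move: GC; apply: aeS => t h; apply: le_trans (qM _ _) _.
by rewrite -[leRHS]mulrA ler_wpM2l ?mulr_ge0// ler_wpM2r ?q_ge0.
Qed.

Lemma mL2_Mr (C : R) F G : 0 <= C -> mL2 F -> mbdd C G -> mL2 (fun t => F t *m G t).
Proof.
move=> C0 [mF F2] hG; split; first by apply: mxmeasurableM => //; exact: hG.1.
by apply: le_lt_trans (mN2_Mr C0 mF hG) _; rewrite lte_mul_pinfty// lee_fin !mulr_ge0.
Qed.

Lemma mL2_Ml (C : R) F G : 0 <= C -> mL2 F -> mbdd C G -> mL2 (fun t => G t *m F t).
Proof.
move=> C0 [mF F2] hG; split; first by apply: mxmeasurableM => //; exact: hG.1.
by apply: le_lt_trans (mN2_Ml C0 mF hG) _; rewrite lte_mul_pinfty// lee_fin !mulr_ge0.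
Qed.

Lemma mL2_cL2 F i j : mL2 F -> cL2 (fun t => F t i j).
Proof.
move=> [mF F2]; have [m1 m2] := mF i j; split; split=> //; apply: le_lt_trans F2.
  apply: ge0_le_int; [by move=> t; rewrite lee_fin sqr_ge0|exact: measurable_sqr| |].
    by apply/measurable_EFinP; exact: measurable_q.
  by move=> t; rewrite lee_fin q_Re.
apply: ge0_le_int; [by move=> t; rewrite lee_fin sqr_ge0|exact: measurable_sqr| |].
  by apply/measurable_EFinP; exact: measurable_q.
by move=> t; rewrite lee_fin q_Im.
Qed.

Lemma N2_entry F i j : mxmeasurable F ->
  (N2 (fun t => Re (F t i j)) <= mN2 F)%E /\ (N2 (fun t => Im (F t i j)) <= mN2 F)%E.
Proof.
move=> mF; have [m1 m2] := mF i j; split.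
  apply: ge0_le_int; [by move=> t; rewrite lee_fin sqr_ge0|exact: measurable_sqr| |].
    by apply/measurable_EFinP; exact: measurable_q.
  by move=> t; rewrite lee_fin q_Re.
apply: ge0_le_int; [by move=> t; rewrite lee_fin sqr_ge0|exact: measurable_sqr| |].
  by apply/measurable_EFinP; exact: measurable_q.
by move=> t; rewrite lee_fin q_Im.
Qed.

Lemma mN2_sum F : mxmeasurable F ->
  mN2 F = (\sum_(i < n) \sum_(j < n) (N2 (fun t => Re (F t i j)) + N2 (fun t => Im (F t i j))))%E.
Proof.
move=> mF; rewrite /mN2.
transitivity (\int[mu]_t (\sum_(i < n) \sum_(j < n) ((Re (F t i j) ^+ 2)%:E + (Im (F t i j) ^+ 2)%:E)))%E.
  by apply: eq_integral => t _; rewrite qE -sumEFin; apply: eq_bigr => i _; rewrite -sumEFin.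
have m1 i j : measurable_fun setT (fun t => (Re (F t i j) ^+ 2)%:E) by apply: measurable_sqr; have [] := mF i j.
have m2 i j : measurable_fun setT (fun t => (Im (F t i j) ^+ 2)%:E) by apply: measurable_sqr; have [] := mF i j.
have p1 i j t : (0 <= (Re (F t i j) ^+ 2)%:E + (Im (F t i j) ^+ 2)%:E)%E by rewrite -EFinD lee_fin addr_ge0 ?sqr_ge0.
rewrite ge0_integral_sum//; last 2 first.
- move=> i; have -> : (fun t => \sum_(j < n) ((Re (F t i j) ^+ 2)%:E + (Im (F t i j) ^+ 2)%:E))%E =
     (fun t => (\sum_(j < n) (Re (F t i j) ^+ 2 + Im (F t i j) ^+ 2))%:E).
    by apply/funext => t; rewrite -sumEFin.
  apply/measurable_EFinP; apply: measurable_sum => j.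
  by have [f1 f2] := mF i j; apply: measurable_funD; exact: measurable_funX.
- by move=> i t _; apply: sume_ge0 => j _.
apply: eq_bigr => i _; rewrite ge0_integral_sum//; last first.
  by move=> j; apply: emeasurable_funD; [exact: m1|exact: m2].
apply: eq_bigr => j _; rewrite ge0_integralD//; first [exact: m1|exact: m2|by move=> t _; rewrite lee_fin sqr_ge0].
Qed.

Lemma cL2_mL2 F : (forall i j, cL2 (fun t => F t i j)) -> mL2 F.
Proof.
move=> h; have mF : mxmeasurable F by move=> i j; have [h1 h2] := h i j; split; [exact: h1.1|exact: h2.1].
split=> //; rewrite mN2_sum//.
have fin : (\sum_(i < n) \sum_(j < n) (N2 (fun t => Re (F t i j)) + N2 (fun t => Im (F t i j))))%E \is a fin_num.
  apply/sum_fin_numP => i _ _; apply/sum_fin_numP => j _ _.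
  by have [h1 h2] := h i j; rewrite fin_numD !L2_fin.
by rewrite ltey_eq fin.
Qed.

Definition mcv (u : nat -> R -> M) F := tends0 (fun m => mN2 (fun t => u m t - F t)).

Lemma tends0_sum (I : Type) (r : seq I) (a : I -> nat -> \bar R) : (forall i, tends0 (a i)) ->
  tends0 (fun m => \sum_(i <- r) a i m)%E.
Proof.
move=> ha; elim: r => [|i r IH] e e0.
  by exists 0%N => m _; rewrite big_nil lee_fin ltW.
have [N hN] := tends0D (ha i) IH e0; exists N => m /hN.
by rewrite big_cons.
Qed.

Lemma mcv_entries (u : nat -> R -> M) F : (forall m, mxmeasurable (u m)) -> mxmeasurable F ->
  (forall i j, tends0 (fun m => N2 (fun t => Re (u m t i j) - Re (F t i j))) /\
     tends0 (fun m => N2 (fun t => Im (u m t i j) - Im (F t i j)))) -> mcv u F.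
Proof.
move=> mu_ mF h; apply: (@tends0_le _ _ (fun m => \sum_(i < n) \sum_(j < n)
   (N2 (fun t => Re (u m t i j) - Re (F t i j))%R + N2 (fun t => Im (u m t i j) - Im (F t i j))%R))%E).
  move=> m; rewrite mN2_sum; last exact: mxmeasurableB.
  rewrite le_eqVlt; apply/orP; left; apply/eqP; do 2 apply: eq_bigr => ? _.
  by congr (_ + _)%E; apply: eq_integral => t _; rewrite !mxE ?cReB ?cImB.
apply: tends0_sum => i; apply: tends0_sum => j; have [h1 h2] := h i j; exact: tends0D.
Qed.

Lemma mcv_entry (u : nat -> R -> M) F i j : (forall m, mxmeasurable (u m)) -> mxmeasurable F -> mcv u F ->
  tends0 (fun m => N2 (fun t => Re (u m t i j) - Re (F t i j))) /\
  tends0 (fun m => N2 (fun t => Im (u m t i j) - Im (F t i j))).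
Proof.
move=> mu_ mF h; split; apply: tends0_le h => m;
  have [h1 h2] := N2_entry i j (mxmeasurableB (mu_ m) mF).
  by apply: le_trans h1; rewrite le_eqVlt; apply/orP; left; apply/eqP; apply: eq_integral => t _; rewrite !mxE cReB.
by apply: le_trans h2; rewrite le_eqVlt; apply/orP; left; apply/eqP; apply: eq_integral => t _; rewrite !mxE cImB.
Qed.

(** Countable intersections are indexed by nat, so the finite type is enumerated and the statement
    made vacuous beyond its cardinality. *)
Lemma ae_fin (I : finType) (P : I -> R -> Prop) : (forall i, {ae mu, forall t, P i t}) ->
  {ae mu, forall t, forall i, P i t}.
Proof.
move=> h; have : {ae mu, forall t, forall k : nat, forall i, nat_of_ord (enum_rank i) = k -> P i t}.
  apply: ae_foralln => k; case: (ltnP k #|I|) => hk; last first.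
    by apply: aeT => t i ik; move: hk; rewrite -ik leqNgt ltn_ord.
  move: (h (enum_val (Ordinal hk))); apply: aeS => t Pt i ik.
  rewrite -(enum_rankK i); suff -> : enum_rank i = Ordinal hk by [].
  exact: val_inj.
by apply: aeS => t ht i; exact: ht erefl.
Qed.

Lemma mx_ae F G : (forall i j, {ae mu, forall t, F t i j = G t i j}) -> {ae mu, forall t, F t = G t}.
Proof.
move=> h; have : {ae mu, forall t, forall i, forall j, F t i j = G t i j}.
  by apply: ae_fin => i; apply: ae_fin => j; exact: h.
by apply: aeS => t ht; apply/matrixP.
Qed.

(** This joins the two notions of boundary value: pointwise limits, which the Riemann-Hilbert
    problem supplies, and L_2 limits, which the operators [Cb] supply. By Fatou the distance between
    the two limits is 0. *)
Lemma mcv_pointwise (u : nat -> R -> M) F G : (forall m, mxmeasurable (u m)) -> mxmeasurable F ->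
  mxmeasurable G -> mcv u F -> (forall t, q (u m t - G t) @[m --> \oo] --> (0:R)) ->
  {ae mu, forall t, F t = G t}.
Proof.
move=> mu_ mF mG tF tG; apply: mx_ae => i j.
have [f1 f2] := mF i j; have [g1 g2] := mG i j; have [t1 t2] := mcv_entry i j mu_ mF tF.
have sq (w : nat -> R) (l : R) : (forall m, 0 <= w m) -> w m @[m --> \oo] --> (0:R) ->
    forall v : nat -> R, (forall m, (v m - l) ^+ 2 <= w m) -> v m @[m --> \oo] --> l.
  move=> w0 cw v vw; apply/cvgrPdist_le => e e0.
  have /cvgrPdist_le/(_ (e ^+ 2)) := cw; rewrite exprn_gt0// => /(_ isT)[N _ hN].
  exists N => // m /hN /=; rewrite sub0r normrN ger0_norm// => h.
  rewrite -(@ler_pXn2r _ 2)// ?nnegrE// ?(ltW e0)// real_normK ?num_real// -sqrrN opprB.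
  exact: le_trans (vw m) h.
have key (v : nat -> R -> R) (f g : R -> R) : (forall m, measurable_fun setT (v m)) ->
    measurable_fun setT f -> measurable_fun setT g ->
    tends0 (fun m => N2 (fun t => v m t - f t)) -> (forall t, v m t @[m --> \oo] --> g t) ->
    {ae mu, forall t, f t = g t}.
  move=> mv mf mg tv cv.
  have : N2 (fun t => g t - f t) = 0%E.
    apply/eqP; rewrite eq_le N2_ge0 andbT; apply/lee_addgt0Pr => e e0; rewrite add0e.
    have [N hN] := tv e e0.
    apply: (@N2_fatou _ (fun m t => v m t - f t)).
    - by move=> m; exact: measurable_funB.
    - exact: measurable_funB.
    - by apply: aeT => t; apply: cvgB; [exact: cv|exact: cvg_cst].
    - by exists N.
  move=> /(N2_eq0 (measurable_funB mg mf)); apply: aeS => t /eqP.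
  by rewrite subr_eq0 => /eqP.
have k1 : {ae mu, forall t, Re (F t i j) = Re (G t i j)}.
  apply: (key (fun m t => Re (u m t i j))) => //; first by move=> m; have [] := mu_ m i j.
  move=> t; apply: (sq (fun m => q (u m t - G t))) => // m; first exact: q_ge0.
  by have := q_Re (u m t - G t) i j; rewrite !mxE cReB.
have k2 : {ae mu, forall t, Im (F t i j) = Im (G t i j)}.
  apply: (key (fun m t => Im (u m t i j))) => //; first by move=> m; have [] := mu_ m i j.
  move=> t; apply: (sq (fun m => q (u m t - G t))) => // m; first exact: q_ge0.
  by have := q_Im (u m t - G t) i j; rewrite !mxE cImB.
by move: k1 k2; apply: aeS2 => t a b; exact: complex_ext.
Qed.

Lemma mN2_dominated (u : nat -> R -> M) (g : R -> R) : (forall m, mxmeasurable (u m)) ->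
  intg g -> {ae mu, forall t, q (u m t) @[m --> \oo] --> (0:R)} ->
  {ae mu, forall t, forall m, q (u m t) <= g t} -> tends0 (fun m => mN2 (u m)).
Proof.
move=> mu_ ig u0 ug; apply/tends0_cvg; first by move=> m; exact: mN2_ge0.
have Hd : {ae mu, forall t, forall m, setT t -> (`|(q (u m t))%:E| <= (g t)%:E)%E}.
  by move: ug; apply: aeS => t h m _; rewrite abse_EFin lee_fin ger0_norm ?q_ge0.
have Hc : {ae mu, forall t, setT t -> (q (u m t))%:E @[m --> \oo] --> (cst 0%E : R -> \bar R) t}.
  by move: u0; apply: aeS => t h _; apply: cvg_EFin => //; exact: nearW.
have mq m : measurable_fun setT (fun t => (q (u m t))%:E) by apply/measurable_EFinP; exact: measurable_q.
have [_ h _] := @dominated_convergence _ _ R mu setT measurableT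
   (fun m t => (q (u m t))%:E) (cst 0%E) (fun t => (g t)%:E) mq (measurable_cst _) Hc ig Hd.
move: h; apply: cvg_trans; apply: near_eq_cvg; apply: nearW => m /=.
by apply: eq_integral => t _; rewrite subr0 ger0_norm ?q_ge0.
Qed.

End MatrixL2.

(** * Weak limits of products *)

Section WeakLimits.
Context {R : realType}.
Local Notation mu := (@lebesgue_measure R).
Local Notation intg f := (mu.-integrable setT (EFin \o f)).
Implicit Types (a b : nat -> R -> R) (f g k : R -> R).

(** If two sequences converge in L_2, their product is controlled only in L_1. Testing against
    bounded functions supported in [-n, n] captures its limit, and by [wlim_unique] determines it
    almost everywhere. *)
Definition wlim a k := measurable_fun setT k /\ forall n (phi : R -> R), bfun phi 1 ->
  [/\ forall m, intg (fun t => a m t * trunc n phi t), intg (fun t => k t * trunc n phi t) &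
      \int[mu]_t (a m t * trunc n phi t) @[m --> \oo] --> \int[mu]_t (k t * trunc n phi t)].

Lemma bfun_trunc n phi C : 0 <= C -> bfun phi C -> bfun (trunc n phi : R -> R) C.
Proof.
move=> C0 [mp pC]; split; first exact: measurable_trunc.
by move=> t; apply: le_trans (trunc_le _ _ _) (pC t).
Qed.

Lemma L2_trunc_bfun n (phi : R -> R) C : bfun phi C -> L2 (trunc n phi).
Proof.
move=> [mp pC]; apply: (L2_le (measurable_trunc n mp) (L2Z C (L2_itv n))); apply: aeT => t.
rewrite /trunc; case: ifP => _; last by rewrite normr0.
by rewrite mulr1 (le_trans (pC t))// ler_norm.
Qed.

(** The test function is absorbed into the second factor, which stays convergent in L_2, so
    [pair_cvg2] applies. *)
Lemma wlim_prod a b f g : (forall m, L2 (a m)) -> (forall m, L2 (b m)) -> L2 f -> L2 g ->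
  tends0 (fun m => N2 (fun t => a m t - f t)) -> tends0 (fun m => N2 (fun t => b m t - g t)) ->
  wlim (fun m t => a m t * b m t) (fun t => f t * g t).
Proof.
move=> ha hb hf hg ta tb; split; first by apply: measurable_funM; [exact: hf.1|exact: hg.1].
move=> n phi hphi; have bt := bfun_trunc n ler01 hphi.
have hb' m := L2_bfun bt (hb m); have hg' := L2_bfun bt hg.
have E m : (fun t => a m t * b m t * trunc n phi t) = (fun t => a m t * (b m t * trunc n phi t)).
  by apply/funext => t; rewrite mulrA.
have E' : (fun t => f t * g t * trunc n phi t) = (fun t => f t * (g t * trunc n phi t)).
  by apply/funext => t; rewrite mulrA.
rewrite E'; under [X in X @ _ --> _]eq_fun do rewrite E.
split; [by move=> m; rewrite E; exact: L2M_integrable|exact: L2M_integrable|].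
apply: pair_cvg2 => //; apply: tends0_le tb => m; apply: le_N2.
- by apply: measurable_funB; [exact: (hb' m).1|exact: hg'.1].
- by apply: measurable_funB; [exact: (hb m).1|exact: hg.1].
- by move=> t; rewrite -mulrBl normrM ler_piMr// bt.2.
Qed.

Lemma wlim_L2 a f : (forall m, L2 (a m)) -> L2 f -> tends0 (fun m => N2 (fun t => a m t - f t)) ->
  wlim a f.
Proof.
move=> ha hf ta; split; first exact: hf.1.
move=> n phi hphi; have ht := L2_trunc_bfun n hphi.
by split; [move=> m; exact: L2M_integrable|exact: L2M_integrable|exact: pair_cvg].
Qed.

Lemma wlimD a b f g : wlim a f -> wlim b g -> wlim (fun m t => a m t + b m t) (fun t => f t + g t).
Proof.
move=> [mf hf] [mg hg]; split; first exact: measurable_funD.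
move=> n phi hphi; have [a1 a2 a3] := hf n _ hphi; have [b1 b2 b3] := hg n _ hphi.
have E m : (fun t => (a m t + b m t) * trunc n phi t) = (fun t => a m t * trunc n phi t + b m t * trunc n phi t).
  by apply/funext => t; rewrite mulrDl.
have E' : (fun t => (f t + g t) * trunc n phi t) = (fun t => f t * trunc n phi t + g t * trunc n phi t).
  by apply/funext => t; rewrite mulrDl.
rewrite E'; under [X in X @ _ --> _]eq_fun do rewrite E RintegralD//.
by split; [move=> m; rewrite E; exact: intg_D|exact: intg_D|rewrite RintegralD//; exact: cvgD].
Qed.

Lemma wlimN a f : wlim a f -> wlim (fun m t => - a m t) (fun t => - f t).
Proof.
move=> [mf hf]; split; first exact: measurableT_comp.
move=> n phi hphi; have [a1 a2 a3] := hf n _ hphi.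
have E m : (fun t => - a m t * trunc n phi t) = (fun t => -1 * (a m t * trunc n phi t)).
  by apply/funext => t; rewrite mulN1r mulNr.
have E' : (fun t => - f t * trunc n phi t) = (fun t => -1 * (f t * trunc n phi t)).
  by apply/funext => t; rewrite mulN1r mulNr.
rewrite E'; under [X in X @ _ --> _]eq_fun do rewrite E RintegralZl//.
by split; [move=> m; rewrite E; exact: intg_cM|exact: intg_cM|rewrite RintegralZl//; exact: cvgMr].
Qed.

Lemma wlim0 : wlim (fun _ _ => 0) (fun=> 0).
Proof.
by apply: wlim_L2; [move=> _; exact: L2_0|exact: L2_0|
  move=> e e0; exists 0%N => m _; rewrite (_ : N2 _ = 0%E) ?lee_fin ?ltW//;
  rewrite /N2 (eq_integral (cst 0%E)) ?integral0// => t _; rewrite subr0 expr0n].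
Qed.

Lemma wlim_sum (I : Type) (r : seq I) (a : I -> nat -> R -> R) (f : I -> R -> R) :
  (forall i, wlim (a i) (f i)) ->
  wlim (fun m t => \sum_(i <- r) a i m t) (fun t => \sum_(i <- r) f i t).
Proof.
move=> h; elim: r => [|i r IH].
  by under eq_fun do under eq_fun do rewrite big_nil; under [X in wlim _ X]eq_fun do rewrite big_nil; exact: wlim0.
under eq_fun do under eq_fun do rewrite big_cons.
by under [X in wlim _ X]eq_fun do rewrite big_cons; exact: wlimD.
Qed.

Lemma wlim_unique a f g : wlim a f -> wlim a g -> {ae mu, forall t, f t = g t}.
Proof.
move=> hf hg; have [mh hh] := wlimD hf (wlimN hg).
have : {ae mu, forall t, f t - g t = 0}.
  apply: ae0_of_pairing => // n phi hphi; have [_ h2 _] := hh n _ hphi; split=> //.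
  have [a1 f2 f3] := hf.2 n _ hphi; have [_ g2 g3] := hg.2 n _ hphi.
  have E : (fun t => (f t - g t) * trunc n phi t) = (fun t => f t * trunc n phi t - g t * trunc n phi t).
    by apply/funext => t; rewrite mulrBl.
  rewrite E RintegralB//; apply/eqP; rewrite subr_eq0; apply/eqP.
  exact: (cvg_unique _ f3 g3).
by apply: aeS => t /eqP; rewrite subr_eq0 => /eqP.
Qed.

End WeakLimits.

(** * Boundary values of Cauchy integrals *)

Section CauchyOperators.
Context {R : realType}.
Local Notation mu := (@lebesgue_measure R).
Local Notation intg f := (mu.-integrable setT (EFin \o f)).
Local Notation Re := complex.Re.
Local Notation Im := complex.Im.
Implicit Types (c d : R -> R[i]) (z w : R[i]) (s : R).

(* s = 1 and s = -1 give the boundary values of the Cauchy integral from above and below. *)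
Definition cb s c t : R[i] :=
  (s / 2 * Re (c t) + 2^-1 * Hilb (fun r => Im (c r)) t) +i*
  (s / 2 * Im (c t) - 2^-1 * Hilb (fun r => Re (c r)) t).

(** The Cauchy integral at the point t + i s [eps m], as [Kz_cbn] shows for s = 1 and s = -1; it
    tends to [cb s] in L_2. *)
Definition cbn s m c t : R[i] :=
  (s / 2 * Pn m (fun r => Re (c r)) t + 2^-1 * Hn m (fun r => Im (c r)) t) +i*
  (s / 2 * Pn m (fun r => Im (c r)) t - 2^-1 * Hn m (fun r => Re (c r)) t).

Lemma cL2_cb s c : cL2 c -> cL2 (cb s c).
Proof.
move=> [c1 c2]; have [h1 h2] := (L2_Hilb c1, L2_Hilb c2).
split; first exact: (L2D (L2Z _ c1) (L2Z _ h2)).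
exact: (L2B (L2Z _ c2) (L2Z _ h1)).
Qed.

Lemma cL2_cbn s m c : cL2 c -> cL2 (cbn s m c).
Proof.
move=> [c1 c2]; have [p1 p2] := (L2_Pn m c1, L2_Pn m c2); have [h1 h2] := (L2_Hn m c1, L2_Hn m c2).
split; first exact: (L2D (L2Z _ p1) (L2Z _ h2)).
exact: (L2B (L2Z _ p2) (L2Z _ h1)).
Qed.

Lemma twopii_inv : twopii^-1 = 0 +i* - (2 * pi)^-1 :> R[i].
Proof.
have p0 : (2 * pi : R) != 0 by rewrite gt_eqF// mulr_gt0// pi_gt0.
apply: (mulfI (_ : (twopii : R[i]) != 0)).
  by rewrite /twopii eq_complex /= eqxx.
rewrite divff; last by rewrite /twopii eq_complex /= eqxx.
by apply: complex_ext; rewrite ?cReM ?cImM /= ?mul0r ?mulr0 ?addr0// mulrN mulfV// sub0r opprK.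
Qed.

Lemma ReMt_inv z : Re (twopii^-1 * z) = (2 * pi)^-1 * Im z.
Proof. by rewrite twopii_inv cReM /= mul0r sub0r mulNr opprK. Qed.

Lemma ImMt_inv z : Im (twopii^-1 * z) = - ((2 * pi)^-1 * Re z).
Proof. by rewrite twopii_inv cImM /= mul0r add0r mulNr. Qed.

Lemma Kz_cbn s m c t : s ^+ 2 = 1 -> cL2 c ->
  twopii^-1 * Kz (t +i* (s * eps m)) c = cbn s m c t.
Proof.
move=> s2 [c1 c2]; have e0 : 0 < eps m :> R := eps_gt0 m.
have h1 r : hk (s * eps m) r = hk (eps m) r :> R by rewrite /hk exprMn s2 mul1r.
have p1 r : pk (s * eps m) r = s * pk (eps m) r :> R by rewrite /pk exprMn s2 mul1r mulrA.
have gh := goodk_hk e0; have gp := goodk_pk e0.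
have i1 := kconv_intg t gh c1; have i2 := kconv_intg t gh c2.
have i3 := kconv_intg t gp c1; have i4 := kconv_intg t gp c2.
have KR : Re (Kz (t +i* (s * eps m)) c) = kconv (hk (eps m)) (fun r => Re (c r)) t
    - s * kconv (pk (eps m)) (fun r => Im (c r)) t.
  rewrite /kconv -RintegralZl// -RintegralB//; last exact: intg_cM.
  by apply: eq_Rintegral => r _; rewrite ckernE cReM /= h1 p1; ring.
have KI : Im (Kz (t +i* (s * eps m)) c) = kconv (hk (eps m)) (fun r => Im (c r)) t
    + s * kconv (pk (eps m)) (fun r => Re (c r)) t.
  rewrite /kconv -RintegralZl// -RintegralD//; last exact: intg_cM.
  by apply: eq_Rintegral => r _; rewrite ckernE cImM /= h1 p1; ring.
by apply: complex_ext; rewrite ?ReMt_inv ?ImMt_inv /cbn /Pn /Hn ?KR ?KI /= ?KR ?KI /Pn /Hn [(2 * pi)^-1]invfM; move: (pi^-1) => p; field.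
Qed.

Lemma cbn_cvg s c : cL2 c ->
  tends0 (fun m => N2 (fun t => Re (cbn s m c t) - Re (cb s c t))) /\
  tends0 (fun m => N2 (fun t => Im (cbn s m c t) - Im (cb s c t))).
Proof.
move=> [c1 c2]; split; last first.
  rewrite (_ : (fun m => _) = (fun m => N2 (fun t => (s / 2 * Pn m (fun r => Im (c r)) t +
    - 2^-1 * Hn m (fun r => Re (c r)) t) - (s / 2 * Im (c t) + - 2^-1 * Hilb (fun r => Re (c r)) t)))).
    apply: tends0_N2D; [by move=> m; apply: L2Z; exact: L2_Pn|by move=> m; apply: L2Z; exact: L2_Hn|
      exact: L2Z|by apply: L2Z; exact: L2_Hilb| |].
      by apply: tends0_N2Z; [move=> m; exact: L2_Pn| |exact: Pn_cvg].
    by apply: tends0_N2Z; [move=> m; exact: L2_Hn|exact: L2_Hilb|exact: Hilb_cvg].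
  by apply/funext => m; congr N2; apply/funext => t /=; ring.
apply: tends0_N2D; [by move=> m; apply: L2Z; exact: L2_Pn|by move=> m; apply: L2Z; exact: L2_Hn|
      exact: L2Z|by apply: L2Z; exact: L2_Hilb| |].
  by apply: tends0_N2Z; [move=> m; exact: L2_Pn| |exact: Pn_cvg].
by apply: tends0_N2Z; [move=> m; exact: L2_Hn|exact: L2_Hilb|exact: Hilb_cvg].
Qed.

End CauchyOperators.

(** * Cauchy integrals of matrix functions *)

Section MatrixCauchy.
Context {R : realType} {n : nat}.
Local Notation mu := (@lebesgue_measure R).
Local Notation intg f := (mu.-integrable setT (EFin \o f)).
Local Notation Re := complex.Re.
Local Notation Im := complex.Im.
Local Notation M := 'M[R[i]]_n.
Implicit Types (A B : M) (F G : R -> M) (z w : R[i]) (s : R).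

Definition Cau F z : M := twopii^-1 *: mxintegral (fun t => (t%:C - z)^-1 *: F t).
Definition Cb s F t : M := \matrix_(i, j) cb s (fun r => F r i j) t.
Definition Cbn s m F t : M := \matrix_(i, j) cbn s m (fun r => F r i j) t.
(** Stated for the product with the kernel so that L_2 and L_1 densities are treated alike; [cross]
    needs the latter. *)
Definition Cdom z F := forall i j, cintg (fun t => ckern z t * F t i j).

Lemma mxintE F i j : mxintegral F i j = cint (fun t => F t i j).
Proof. by rewrite mxE. Qed.

Lemma CauE F z i j : Cau F z i j = twopii^-1 * Kz z (fun t => F t i j).
Proof. by rewrite mxE mxintE; congr (_ * _); apply: eq_cint => t; rewrite mxE. Qed.

Lemma Cdom_mL2 z F : Im z != 0 -> mL2 F -> Cdom z F.
Proof. by move=> z0 hF i j; apply: Kz_dom => //; exact: mL2_cL2. Qed.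

Lemma Cdom_L1 z F : Im z != 0 -> mxintegrable F -> Cdom z F.
Proof. by move=> z0 hF i j; apply: Kz_dom1 => //; exact: hF. Qed.

Lemma CauD z F G : Cdom z F -> Cdom z G -> Cau (fun t => F t + G t) z = Cau F z + Cau G z.
Proof.
move=> hF hG; apply/matrixP => i j; rewrite [RHS]mxE !CauE -mulrDr -KzD//.
by congr (_ * Kz _ _); apply/funext => t; rewrite mxE.
Qed.

Lemma CdomZ z w F : Cdom z F -> Cdom z (fun t => w *: F t).
Proof.
by move=> hF i j; apply: (eq_cintg _ (cintgZ w (hF i j))) => t; rewrite mxE mulrCA.
Qed.

Lemma CauZ z w F : Cdom z F -> Cau (fun t => w *: F t) z = w *: Cau F z.
Proof.
move=> hF; apply/matrixP => i j; rewrite [RHS]mxE !CauE; transitivity (twopii^-1 * Kz z (fun t => w * F t i j)).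
  by congr (_ * Kz _ _); apply/funext => t; rewrite mxE.
by rewrite KzZ// mulrCA.
Qed.

Lemma CdomD z F G : Cdom z F -> Cdom z G -> Cdom z (fun t => F t + G t).
Proof.
by move=> hF hG i j; apply: (eq_cintg _ (cintgD (hF i j) (hG i j))) => t; rewrite mxE mulrDr.
Qed.

Lemma CdomN z F : Cdom z F -> Cdom z (fun t => - F t).
Proof. by move=> /(CdomZ (-1)); congr Cdom; apply/funext => t; rewrite scaleN1r. Qed.

Lemma CauN z F : Cdom z F -> Cau (fun t => - F t) z = - Cau F z.
Proof.
move=> hF; rewrite (_ : (fun t => - F t) = (fun t => -1 *: F t)); first by rewrite CauZ// scaleN1r.
by apply/funext => t; rewrite scaleN1r.
Qed.

Lemma CauB z F G : Cdom z F -> Cdom z G -> Cau (fun t => F t - G t) z = Cau F z - Cau G z.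
Proof. by move=> hF hG; rewrite CauD ?CauN//; exact: CdomN. Qed.

Lemma Cau_eqae z F G : Im z != 0 -> mxmeasurable F -> mxmeasurable G -> {ae mu, forall t, F t = G t} ->
  Cau F z = Cau G z.
Proof.
move=> z0 mF mG FG; apply/matrixP => i j; rewrite !CauE; congr (_ * _).
have [f1 f2] := mF i j; have [g1 g2] := mG i j.
have [[k1 _] [k2 _]] := ckern_cL2 z0.
apply: complex_ext; apply: Rint_eqae.
- by under eq_fun do rewrite cReM; apply: measurable_funB; exact: measurable_funM.
- by under eq_fun do rewrite cReM; apply: measurable_funB; exact: measurable_funM.
- by move: FG; apply: aeS => t ->.
- by under eq_fun do rewrite cImM; apply: measurable_funD; exact: measurable_funM.
- by under eq_fun do rewrite cImM; apply: measurable_funD; exact: measurable_funM.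
- by move: FG; apply: aeS => t ->.
Qed.

Lemma mL2_Cb s F : mL2 F -> mL2 (Cb s F).
Proof.
move=> hF; apply: cL2_mL2 => i j; have h := cL2_cb s (mL2_cL2 i j hF).
by move: h; apply: eq_cL2 => t; rewrite mxE.
Qed.

Lemma mL2_Cbn s m F : mL2 F -> mL2 (Cbn s m F).
Proof.
move=> hF; apply: cL2_mL2 => i j; have h := cL2_cbn s m (mL2_cL2 i j hF).
by move: h; apply: eq_cL2 => t; rewrite mxE.
Qed.

Lemma Cau_Cbn s m F t : s ^+ 2 = 1 -> mL2 F -> Cau F (t +i* (s * eps m)) = Cbn s m F t.
Proof.
move=> s2 hF; apply/matrixP => i j; rewrite CauE mxE; apply: Kz_cbn => //.
exact: mL2_cL2.
Qed.

Lemma Cbn_cvg s F : mL2 F -> mcv (fun m => Cbn s m F) (Cb s F).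
Proof.
move=> hF; apply: mcv_entries.
- by move=> m; have [] := mL2_Cbn s m hF.
- by have [] := mL2_Cb s hF.
move=> i j; have [h1 h2] := cbn_cvg s (mL2_cL2 i j hF); split.
  by move: h1; congr tends0; apply/funext => m; congr N2; apply/funext => t; rewrite !mxE.
by move: h2; congr tends0; apply/funext => m; congr N2; apply/funext => t; rewrite !mxE.
Qed.

Lemma mN2_Cb s F : s ^+ 2 = 1 -> mL2 F -> (mN2 (Cb s F) <= 2%:E * mN2 F)%E.
Proof.
move=> s2 hF; rewrite !mN2_sum//; [|exact: hF.1|by have [] := mL2_Cb s hF].
rewrite ge0_sume_distrr; last by move=> i _; apply: sume_ge0 => j _; rewrite adde_ge0 ?N2_ge0.
apply: lee_sum => i _; rewrite ge0_sume_distrr; last by move=> j _; rewrite adde_ge0 ?N2_ge0.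
apply: lee_sum => j _; have [c1 c2] := mL2_cL2 i j hF.
set f := (fun t => Re (F t i j)) in c1 *; set g := (fun t => Im (F t i j)) in c2 *.
have e1 : N2 (fun t => Re (Cb s F t i j)) = N2 (fun t => s / 2 * f t + 2^-1 * Hilb g t).
  by congr N2; apply/funext => t; rewrite mxE.
have e2 : N2 (fun t => Im (Cb s F t i j)) = N2 (fun t => s / 2 * g t - 2^-1 * Hilb f t).
  by congr N2; apply/funext => t; rewrite mxE.
have [hf hg] := (L2_Hilb c1, L2_Hilb c2).
have B1 := N2D (L2Z (s / 2) c1).1 (L2Z 2^-1 hg).1.
have B2 := N2B (L2Z (s / 2) c2).1 (L2Z 2^-1 hf).1.
rewrite e1 e2; apply: (le_trans (leeD B1 B2)).
rewrite !N2Z; [|exact: hf.1|exact: c2.1|exact: hg.1|exact: c1.1].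
have := N2_Hilb c1; have := N2_Hilb c2; have F1 := L2_fin c1; have F2 := L2_fin c2.
have F3 := L2_fin hf; have F4 := L2_fin hg.
move: (N2_ge0 f) (N2_ge0 g); move: F1 F2 F3 F4.
case: (N2 f) => [a||]//; case: (N2 g) => [b||]//; case: (N2 (Hilb f)) => [c||]//; case: (N2 (Hilb g)) => [d||]//.
rewrite -!EFinM -!EFinD !lee_fin => _ _ _ _ a0 b0 h1 h2.
have -> : (s / 2) ^+ 2 = 4^-1 by rewrite expr_div_n s2; lra.
have -> : (2^-1 : R) ^+ 2 = 4^-1 by lra.
lra.
Qed.

Lemma CbD s F G : mL2 F -> mL2 G -> {ae mu, forall t, Cb s (fun r => F r + G r) t = Cb s F t + Cb s G t}.
Proof.
move=> hF hG; apply: mx_ae => i j.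
have [f1 f2] := mL2_cL2 i j hF; have [g1 g2] := mL2_cL2 i j hG.
move: (HilbD f1 g1) (HilbD f2 g2); apply: aeS2 => t h1 h2; rewrite !mxE.
have e1 : (fun r => Re ((F r + G r) i j)) = (fun r => Re (F r i j) + Re (G r i j)).
  by apply/funext => r; rewrite mxE cReD.
have e2 : (fun r => Im ((F r + G r) i j)) = (fun r => Im (F r i j) + Im (G r i j)).
  by apply/funext => r; rewrite mxE cImD.
rewrite /cb e1 e2 h1 h2 !mxE; apply: complex_ext; rewrite ?cReD ?cImD /=; ring.
Qed.

Lemma CbZ s (c : R) F : mL2 F -> {ae mu, forall t, Cb s (fun r => c%:C *: F r) t = c%:C *: Cb s F t}.
Proof.
move=> hF; apply: mx_ae => i j; have [f1 f2] := mL2_cL2 i j hF.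
move: (HilbZ c f1) (HilbZ c f2); apply: aeS2 => t h1 h2; rewrite !mxE.
have e1 : (fun r => Re ((c%:C *: F r) i j)) = (fun r => c * Re (F r i j)).
  by apply/funext => r; rewrite mxE cReM /= mul0r subr0.
have e2 : (fun r => Im ((c%:C *: F r) i j)) = (fun r => c * Im (F r i j)).
  by apply/funext => r; rewrite mxE cImM /= mul0r addr0.
rewrite /cb e1 e2 h1 h2 !mxE; apply: complex_ext; rewrite ?cReM ?cImM /=; ring.
Qed.

Lemma CbN s F : mL2 F -> {ae mu, forall t, Cb s (fun r => - F r) t = - Cb s F t}.
Proof.
move=> hF; move: (CbZ s (-1) hF); apply: aeS => t; rewrite rmorphN1 scaleN1r => <-.
by congr (Cb s _ t); apply/funext => r; rewrite scaleN1r.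
Qed.

Lemma CbB s F G : mL2 F -> mL2 G -> {ae mu, forall t, Cb s (fun r => F r - G r) t = Cb s F t - Cb s G t}.
Proof.
by move=> hF hG; move: (CbD s hF (mL2N hG)) (CbN s hG); apply: aeS2 => t -> ->.
Qed.

Lemma Cb_eqae s F G : mL2 F -> mL2 G -> {ae mu, forall t, F t = G t} ->
  {ae mu, forall t, Cb s F t = Cb s G t}.
Proof.
move=> hF hG FG; apply: mx_ae => i j.
have [f1 f2] := mL2_cL2 i j hF; have [g1 g2] := mL2_cL2 i j hG.
have e1 : {ae mu, forall t, Re (F t i j) = Re (G t i j)} by move: FG; apply: aeS => t ->.
have e2 : {ae mu, forall t, Im (F t i j) = Im (G t i j)} by move: FG; apply: aeS => t ->.
have E3 : {ae mu, forall t, Re (F t i j) = Re (G t i j) /\ Im (F t i j) = Im (G t i j)}.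
  by move: FG; apply: aeS => t ->.
have H12 : {ae mu, forall t, Hilb (fun r => Re (F r i j)) t = Hilb (fun r => Re (G r i j)) t /\
    Hilb (fun r => Im (F r i j)) t = Hilb (fun r => Im (G r i j)) t}.
  by move: (Hilb_eqae f1 g1 e1) (Hilb_eqae f2 g2 e2); apply: aeS2.
by move: E3 H12; apply: aeS2 => t [a b] [c d]; rewrite !mxE /cb a b c d.
Qed.

(** The Plemelj jump relation; with this choice of representatives it holds at every t. *)
Lemma CbE F t : F t + Cb (-1) F t = Cb 1 F t.
Proof.
apply/matrixP => i j; rewrite !mxE; apply: complex_ext; rewrite ?cReD ?cImD /=; lra.
Qed.

Lemma cb_cH s (c : R -> R[i]) t : cb s c t = (s / 2)%:C * c t - (0 +i* 2^-1) * cH c t.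
Proof. by apply: complex_ext; rewrite ?cReB ?cImB ?cReM ?cImM /=; ring. Qed.

(* The jump of the product of two Cauchy integrals, see [Cau_mul]. *)
Definition cross F G t := F t *m Cb (-1) G t + Cb 1 F t *m G t.

(** The local terms -F G/2 and F G/2 of the two boundary values cancel, and only Hilbert transforms
    remain, in the shape of Cotlar's identity. *)
Lemma crossE F G t i j : cross F G t i j = - (0 +i* 2^-1) *
   \sum_k (F t i k * cH (fun r => G r k j) t + G t k j * cH (fun r => F r i k) t).
Proof.
rewrite mxE !mxE -big_split/= mulr_sumr; apply: eq_bigr => k _.
rewrite !mxE !cb_cH; apply: complex_ext; rewrite ?cReD ?cImD ?cReM ?cImM ?cReB ?cImB ?cReM ?cImM /=.
all: by rewrite ?cReD ?cImD ?cReM ?cImM /=; field.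
Qed.

Lemma cross_intg F G : mL2 F -> mL2 G -> mxintegrable (cross F G).
Proof.
move=> hF hG i j; apply: (@eq_cintg _ (fun t => - (0 +i* 2^-1) *
   \sum_k (F t i k * cH (fun r => G r k j) t + G t k j * cH (fun r => F r i k) t))).
  by move=> t; rewrite crossE.
apply: cintgZ; apply: cintg_sum => k; apply: cH_intg; exact: mL2_cL2.
Qed.

(** Entrywise [Kz_cotlar]; the constants match because (2 pi i)^-2 pi = (2 pi i)^-1 (-i/2), and -i/2
    is the factor in [crossE]. *)
Lemma Cau_mul z F G : Im z != 0 -> mL2 F -> mL2 G -> Cau F z *m Cau G z = Cau (cross F G) z.
Proof.
move=> z0 hF hG; apply/matrixP => i j; rewrite mxE CauE.
have -> : (fun t => cross F G t i j) = (fun t => - (0 +i* 2^-1) *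
   \sum_k (F t i k * cH (fun r => G r k j) t + G t k j * cH (fun r => F r i k) t)).
  by apply/funext => t; rewrite crossE.
have hk k : cintg (fun t => ckern z t * (F t i k * cH (fun r => G r k j) t + G t k j * cH (fun r => F r i k) t)).
  by apply: Kz_dom1 => //; apply: cH_intg; exact: mL2_cL2.
have hs : cintg (fun t => ckern z t * \sum_k (F t i k * cH (fun r => G r k j) t + G t k j * cH (fun r => F r i k) t)).
  by apply: (eq_cintg _ (cintg_sum (index_enum _) hk)) => t; rewrite mulr_sumr.
rewrite KzZ//.
have -> : Kz z (fun t => \sum_k (F t i k * cH (fun r => G r k j) t + G t k j * cH (fun r => F r i k) t)) =
   \sum_k Kz z (fun t => F t i k * cH (fun r => G r k j) t + G t k j * cH (fun r => F r i k) t).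
  by rewrite /Kz -cint_sum//; apply: eq_cint => t; rewrite mulr_sumr.
rewrite mulrA mulr_sumr; apply: eq_bigr => k _; rewrite !CauE.
have := Kz_cotlar z0 (mL2_cL2 i k hF) (mL2_cL2 k j hG).
set K := Kz z (fun t => _ + _) => e.
transitivity (twopii^-1 * twopii^-1 * pi%:C * K); first by rewrite -!mulrA -e; ring.
congr (_ * _); rewrite twopii_inv; have p0 : (pi : R) != 0 by rewrite gt_eqF// pi_gt0.
apply: complex_ext; rewrite ?cReM ?cImM /= ?cReM ?cImM /=; move: p0; move: (pi : R) => p p0; field;
  by rewrite p0.
Qed.

Lemma Cau_mulE z F G : Im z != 0 -> mL2 F -> mL2 G -> mL2 (cross F G) ->
  Cau (cross F G) z = Cau F z *m Cau G z.
Proof. by move=> z0 hF hG _; rewrite Cau_mul. Qed.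

Lemma cint_conj (c : R -> R[i]) : cintg c -> cint (fun t => (c t)^*) = (cint c)^*.
Proof.
move=> [c1 c2]; apply: complex_ext; rewrite ?cRe_conj ?cIm_conj /=.
  by apply: eq_Rintegral => t _; rewrite cRe_conj.
rewrite -mulN1r -RintegralZl//; apply: eq_Rintegral => t _; by rewrite cIm_conj mulN1r.
Qed.

Lemma ckern_conj z t : ckern z t = (ckern (z^*) t)^*.
Proof. by rewrite ckernE ckernE; apply: complex_ext; rewrite ?cRe_conj ?cIm_conj /=; case: z => x y /=;
  rewrite /hk /pk sqrrN // mulNr opprK. Qed.

(** Conjugation exchanges the half planes, and the sign is that of the conjugate of 1/(2 pi i). *)
Lemma Cau_adj z F : Im z != 0 -> mL2 F -> Cau (fun t => (F t)^t*) z = - (Cau F (z^*))^t*.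
Proof.
move=> z0 hF; apply/matrixP => i j; rewrite [RHS]mxE adjE !CauE rmorphM -mulNr.
congr (_ * _).
  by rewrite twopii_inv; apply: complex_ext; rewrite ?cReN ?cImN ?cRe_conj ?cIm_conj /= ?oppr0 ?opprK.
have h : cintg (fun t => ckern (z^*) t * F t j i).
  by apply: Kz_dom; [rewrite cIm_conj oppr_eq0|exact: mL2_cL2].
by apply: (etrans _ (cint_conj h)); apply: eq_cint => t; rewrite adjE (ckern_conj z) -rmorphM.
Qed.

Lemma Cb_adj s F : mL2 F -> {ae mu, forall t, Cb s (fun r => (F r)^t*) t = - (Cb (- s) F t)^t*}.
Proof.
move=> hF; apply: mx_ae => i j; have [f1 f2] := mL2_cL2 j i hF.
move: (HilbZ (-1) f2); apply: aeS => t h; rewrite [in RHS]mxE adjE !mxE.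
have e1 : (fun r => Re (((F r)^t*) i j)) = (fun r => Re (F r j i)).
  by apply/funext => r; rewrite adjE cRe_conj.
have e2 : (fun r => Im (((F r)^t*) i j)) = (fun r => -1 * Im (F r j i)).
  by apply/funext => r; rewrite adjE cIm_conj mulN1r.
rewrite /cb e1 e2 h adjE; apply: complex_ext; rewrite ?cReN ?cImN ?cRe_conj ?cIm_conj /=; ring.
Qed.

(** The real transform is antisymmetric for the bilinear pairing without conjugation, so the real
    and the imaginary contributions cancel separately. *)
Lemma cH_antisym (c d : R -> R[i]) : cL2 c -> cL2 d ->
  cint (fun t => c t * cH d t + d t * cH c t) = 0.
Proof.
move=> hc hd; rewrite cintD; [|exact: cL2M_cintg (cL2_cH _)|exact: cL2M_cintg (cL2_cH _)].
have E (u w : R -> R[i]) : cL2 u -> cL2 w -> cint (fun t => u t * cH w t) =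
   (\int[mu]_t (Re (u t) * Hilb (fun r => Re (w r)) t) - \int[mu]_t (Im (u t) * Hilb (fun r => Im (w r)) t))
   +i* (\int[mu]_t (Re (u t) * Hilb (fun r => Im (w r)) t) + \int[mu]_t (Im (u t) * Hilb (fun r => Re (w r)) t)).
  move=> [u1 u2] [w1 w2]; apply: complex_ext => /=.
    rewrite -RintegralB//; [|by apply: L2M_integrable => //; exact: L2_Hilb|by apply: L2M_integrable => //; exact: L2_Hilb].
    by apply: eq_Rintegral => t _; rewrite cReM.
  rewrite -RintegralD//; [|by apply: L2M_integrable => //; exact: L2_Hilb|by apply: L2M_integrable => //; exact: L2_Hilb].
  by apply: eq_Rintegral => t _; rewrite cImM.
have A (f g : R -> R) : L2 f -> L2 g -> \int[mu]_t (f t * Hilb g t) = - \int[mu]_t (g t * Hilb f t).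
  by move=> hf hg; rewrite Hilb_antisym//; congr (- _); apply: eq_Rintegral => t _; rewrite mulrC.
rewrite !E//; move: hc hd => [c1 c2] [d1 d2].
rewrite (A _ _ c1 d1) (A _ _ c2 d2) (A _ _ c1 d2) (A _ _ c2 d1).
have K (a b e f : R) : ((- a - - b) +i* (- e - f)) + ((a - b) +i* (f + e)) = 0 :> R[i].
  by apply: complex_ext; rewrite ?cReD ?cImD /=; lra.
exact: K.
Qed.

Lemma mxintegral_cross F G : mL2 F -> mL2 G -> mxintegral (cross F G) = 0.
Proof.
move=> hF hG; apply/matrixP => i j; rewrite mxintE [RHS]mxE.
have -> : (fun t => cross F G t i j) = (fun t => - (0 +i* 2^-1) *
   \sum_k (F t i k * cH (fun r => G r k j) t + G t k j * cH (fun r => F r i k) t)).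
  by apply/funext => t; rewrite crossE.
have hk k : cintg (fun t => F t i k * cH (fun r => G r k j) t + G t k j * cH (fun r => F r i k) t).
  by apply: cH_intg; exact: mL2_cL2.
rewrite cintZ; last exact: cintg_sum.
by rewrite cint_sum// big1 ?mulr0// => k _; apply: cH_antisym; exact: mL2_cL2.
Qed.

(** At height [eps m] this is [Cau_mul]. The left side converges in L_2 because the cross term is
    assumed to lie there, the right side only weakly, and weak limits are unique. *)
Lemma Cb_mul F G : mL2 F -> mL2 G -> mL2 (cross F G) ->
  {ae mu, forall t, Cb (-1) (cross F G) t = Cb (-1) F t *m Cb (-1) G t}.
Proof.
move=> hF hG hK.
have s2 : (-1 : R) ^+ 2 = 1 by rewrite sqrrN expr1n.
have E m t : Cbn (-1) m (cross F G) t = Cbn (-1) m F t *m Cbn (-1) m G t.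
  by rewrite -!Cau_Cbn// Cau_mulE//= mulN1r oppr_eq0 gt_eqF// eps_gt0.
have cF i k m := mL2_cL2 i k (mL2_Cbn (-1) m hF).
have cG i k m := mL2_cL2 i k (mL2_Cbn (-1) m hG).
have cK i k m := mL2_cL2 i k (mL2_Cbn (-1) m hK).
have dF i k := mL2_cL2 i k (mL2_Cb (-1) hF).
have dG i k := mL2_cL2 i k (mL2_Cb (-1) hG).
have dK i k := mL2_cL2 i k (mL2_Cb (-1) hK).
have tF i k := mcv_entry i k (fun m => (mL2_Cbn (-1) m hF).1) (mL2_Cb (-1) hF).1 (Cbn_cvg (-1) hF).
have tG i k := mcv_entry i k (fun m => (mL2_Cbn (-1) m hG).1) (mL2_Cb (-1) hG).1 (Cbn_cvg (-1) hG).
have tK i k := mcv_entry i k (fun m => (mL2_Cbn (-1) m hK).1) (mL2_Cb (-1) hK).1 (Cbn_cvg (-1) hK).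
apply: mx_ae => i j.
have w1 := wlim_L2 (fun m => (cK i j m).1) (dK i j).1 (tK i j).1.
have w2 := wlim_L2 (fun m => (cK i j m).2) (dK i j).2 (tK i j).2.
have v1 : wlim (fun m t => Re (Cbn (-1) m (cross F G) t i j)) (fun t => Re ((Cb (-1) F t *m Cb (-1) G t) i j)).
  under eq_fun do under eq_fun do rewrite E mxE Re_sum.
  under [X in wlim _ X]eq_fun do rewrite mxE Re_sum.
  apply: wlim_sum => k.
  under eq_fun do under eq_fun do rewrite cReM.
  under [X in wlim _ X]eq_fun do rewrite cReM.
  apply: wlimD; first by apply: wlim_prod; [move=> m; exact: (cF i k m).1|move=> m; exact: (cG k j m).1|
    exact: (dF i k).1|exact: (dG k j).1|exact: (tF i k).1|exact: (tG k j).1].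
  by apply: wlimN; apply: wlim_prod; [move=> m; exact: (cF i k m).2|move=> m; exact: (cG k j m).2|
    exact: (dF i k).2|exact: (dG k j).2|exact: (tF i k).2|exact: (tG k j).2].
have v2 : wlim (fun m t => Im (Cbn (-1) m (cross F G) t i j)) (fun t => Im ((Cb (-1) F t *m Cb (-1) G t) i j)).
  under eq_fun do under eq_fun do rewrite E mxE Im_sum.
  under [X in wlim _ X]eq_fun do rewrite mxE Im_sum.
  apply: wlim_sum => k.
  under eq_fun do under eq_fun do rewrite cImM.
  under [X in wlim _ X]eq_fun do rewrite cImM.
  apply: wlimD; first by apply: wlim_prod; [move=> m; exact: (cF i k m).1|move=> m; exact: (cG k j m).2|
    exact: (dF i k).1|exact: (dG k j).2|exact: (tF i k).1|exact: (tG k j).2].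
  by apply: wlim_prod; [move=> m; exact: (cF i k m).2|move=> m; exact: (cG k j m).1|
    exact: (dF i k).2|exact: (dG k j).1|exact: (tF i k).2|exact: (tG k j).1].
by move: (wlim_unique w1 v1) (wlim_unique w2 v2); apply: aeS2 => t a b; exact: complex_ext.
Qed.

Lemma fine_mN2 F : mL2 F -> fine (mN2 F) =
  \sum_(i < n) \sum_(j < n) (\int[mu]_t (Re (F t i j) ^+ 2) + \int[mu]_t (Im (F t i j) ^+ 2)).
Proof.
move=> hF; rewrite mN2_sum; last exact: hF.1.
rewrite (_ : (\sum_(i < n) _)%E = (\sum_(i < n) \sum_(j < n)
  (\int[mu]_t (Re (F t i j) ^+ 2) + \int[mu]_t (Im (F t i j) ^+ 2)))%:E)//.
rewrite -sumEFin; apply: eq_bigr => i _; rewrite -sumEFin; apply: eq_bigr => j _.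
by have [c1 c2] := mL2_cL2 i j hF; rewrite EFinD !N2_Rintegral.
Qed.

(** Evaluation off the line is continuous on L_2, because the kernel is square integrable. It turns
    L_2 limits into limits of [Psi] at a fixed z. *)
Lemma Cau_bound z : Im z != 0 -> exists2 K : R, 0 <= K & forall F, mL2 F -> q (Cau F z) <= K * fine (mN2 F).
Proof.
move=> z0; have [k1 k2] := ckern_cL2 z0.
pose A := \int[mu]_t (Re (ckern z t) ^+ 2); pose B := \int[mu]_t (Im (ckern z t) ^+ 2).
have A0 : 0 <= A by apply: Rintegral_ge0 => t _; rewrite sqr_ge0.
have B0 : 0 <= B by apply: Rintegral_ge0 => t _; rewrite sqr_ge0.
exists (((2 * pi)^-1) ^+ 2 * (2 * (A + B))); first by rewrite mulr_ge0 ?sqr_ge0// mulr_ge0// addr_ge0.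
move=> F hF; rewrite qE fine_mN2// mulr_sumr; apply: ler_sum => i _.
rewrite mulr_sumr; apply: ler_sum => j _; have [c1 c2] := mL2_cL2 i j hF.
rewrite CauE ReMt_inv ImMt_inv sqrrN; move: (2 * pi)^-1 => p.
rewrite -[leRHS]mulrA [X in X + _]exprMn [X in _ + X]exprMn -mulrDr ler_wpM2l ?sqr_ge0//.
have KR : Re (Kz z (fun t => F t i j)) = \int[mu]_t (Re (ckern z t) * Re (F t i j)) -
    \int[mu]_t (Im (ckern z t) * Im (F t i j)).
  rewrite -RintegralB//; [|exact: L2M_integrable|exact: L2M_integrable].
  by apply: eq_Rintegral => t _; rewrite cReM.
have KI : Im (Kz z (fun t => F t i j)) = \int[mu]_t (Re (ckern z t) * Im (F t i j)) +
    \int[mu]_t (Im (ckern z t) * Re (F t i j)).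
  rewrite -RintegralD//; [|exact: L2M_integrable|exact: L2M_integrable].
  by apply: eq_Rintegral => t _; rewrite cImM.
rewrite KR KI; have := L2_CS k1 c1; have := L2_CS k2 c2; have := L2_CS k1 c2; have := L2_CS k2 c1.
rewrite -/A -/B; set a := \int[mu]_t _; set b := \int[mu]_t _; set c := \int[mu]_t _; set d := \int[mu]_t _.
set e := \int[mu]_t _; set f := \int[mu]_t _ => h1 h2 h3 h4.
have := sqr_ge0 (c - a); have := sqr_ge0 (f + e); nra.
Qed.

End MatrixCauchy.

(** * The Riemann-Hilbert problem *)

Section DetBound.
Context {F : numFieldType}.

Lemma det_bound m (A : 'M[F]_m) (k : F) : 0 <= k -> (forall i j, `|A i j| <= k) ->
  `|\det A| <= (m`!)%:R * k ^+ m.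
Proof.
move=> k0 hA; rewrite /determinant; apply: le_trans (ler_norm_sum _ _ _) _.
apply: (@le_trans _ _ (\sum_(s : {perm 'I_m}) k ^+ m)).
  apply: ler_sum => s _; rewrite normrM normrX normrN1 expr1n mul1r normr_prod.
  rewrite -[X in _ <= k ^+ X]card_ord -prodr_const; apply: ler_prod => i _.
  by rewrite normr_ge0 hA.
by rewrite sumr_const card_Sn mulr_natl.
Qed.

(** When the determinant is 1 the adjugate is the inverse, so this bounds an inverse by the entries
    of the matrix. *)
Lemma adj_bound m (A : 'M[F]_m) (k : F) i j : 0 <= k -> (forall i j, `|A i j| <= k) ->
  `|(\adj A) i j| <= (m.-1`!)%:R * k ^+ m.-1.
Proof.
move=> k0 hA; rewrite mxE /cofactor normrM normrX normrN1 expr1n mul1r.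
by apply: det_bound => // a b; rewrite !mxE.
Qed.

End DetBound.

(** * Relations between solutions, and the resolvent *)

Section RiemannHilbertTheory.
Context {R : realType} {n : nat}.
Local Notation mu := (@lebesgue_measure R).
Local Notation Re := complex.Re.
Local Notation Im := complex.Im.
Local Notation M := 'M[R[i]]_n.
Implicit Types (A B : M) (F G g : R -> M) (z w : R[i]).

Definition qcv (u : nat -> M) A := q (u m - A) @[m --> \oo] --> (0 : R).

Lemma qcv_le (u : nat -> M) A (a : nat -> R) : (forall m, q (u m - A) <= a m) ->
  a m @[m --> \oo] --> (0 : R) -> qcv u A.
Proof.
move=> ua a0; apply: (squeeze_cvgr _ (cvg_cst 0) a0).
by apply: nearW => m; rewrite q_ge0 ua.
Qed.

Lemma qcv_cst A : qcv (fun=> A) A.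
Proof. by apply: (@qcv_le _ _ (fun=> 0)); [move=> m; rewrite subrr q0|exact: cvg_cst]. Qed.

Lemma qcvD (u w : nat -> M) A B : qcv u A -> qcv w B -> qcv (fun m => u m + w m) (A + B).
Proof.
move=> hu hw; apply: (@qcv_le _ _ (fun m => 2 * q (u m - A) + 2 * q (w m - B))).
  by move=> m; rewrite opprD addrACA; exact: qD.
rewrite -[X in _ --> X](addr0 (0 : R)) -[X in _ --> X + _](mulr0 2) -[X in _ --> _ + X](mulr0 2).
by apply: cvgD; apply: cvgMr.
Qed.

Lemma qcv_adj (u : nat -> M) A : qcv u A -> qcv (fun m => (u m)^t*) (A^t*).
Proof.
move=> hu; apply: qcv_le hu => m; rewrite -(q_adj (u m - A)) le_eqVlt; apply/orP; left; apply/eqP.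
by congr q; apply/matrixP => i j; rewrite !mxE rmorphB.
Qed.

Lemma qcvM (u w : nat -> M) A B : qcv u A -> qcv w B -> qcv (fun m => u m *m w m) (A *m B).
Proof.
move=> hu hw; pose c : R := 2 * n%:R.
apply: (@qcv_le _ _ (fun m => 2 * (c * ((2 * q (u m - A) + 2 * q A) * q (w m - B)))
   + 2 * (c * (q (u m - A) * q B)))).
  move=> m; have -> : u m *m w m - A *m B = u m *m (w m - B) + (u m - A) *m B.
    by rewrite mulmxBr mulmxBl addrA subrK.
  apply: le_trans (qD _ _) _; apply: lerD.
    rewrite ler_wpM2l//; apply: le_trans (qM _ _) _; rewrite ler_wpM2l ?mulr_ge0// ler_wpM2r ?q_ge0//.
    by have := qD (u m - A) A; rewrite subrK.
  by rewrite ler_wpM2l//; exact: qM.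
have -> : (0 : R) = 2 * (c * ((2 * 0 + 2 * q A) * 0)) + 2 * (c * (0 * q B)) by ring.
apply: cvgD.
  apply: cvgMr; apply: cvgMr; apply: cvgM => //; apply: cvgD; last exact: cvg_cst.
  exact: cvgMr.
by apply: cvgMr; apply: cvgMr; apply: cvgMl.
Qed.

Lemma qcv_unique (u : nat -> M) A B : qcv u A -> qcv u B -> A = B.
Proof.
move=> hA hB; apply/eqP; rewrite -subr_eq0; apply/eqP; apply: q_eq0.
have h : qcv (fun=> A) B.
  apply: (@qcv_le _ _ (fun m => 2 * q (u m - A) + 2 * q (u m - B))).
    move=> m; rewrite -(qC A); have -> : A - B = (A - u m) + (u m - B) by rewrite addrA subrK.
    exact: qD.
  have -> : (0 : R) = 2 * 0 + 2 * 0 by ring.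
  by apply: cvgD; apply: cvgMr.
exact: (cvg_unique _ (cvg_cst _) h).
Qed.

(** On the vertical sequence t + i s [eps m] the Cauchy integral is [Cbn s m], so pointwise and L_2
    boundary values can be compared there. *)
Lemma boundary_seq (s : R) (H : set R[i]^o) (Psi : R[i] -> M) P t :
  (forall m, H (t +i* (s * eps m))) -> s ^+ 2 = 1 -> boundary_value H Psi P ->
  qcv (fun m => Psi (t +i* (s * eps m))) (P t).
Proof.
move=> hH s2 /(_ t) hP.
have cz : (t +i* (s * eps m) : R[i]^o) @[m --> \oo] --> (t%:C : R[i]^o).
  apply/cvgrPdist_lt => /= e e0; have er : e = (Re e)%:C.
    by move: e0; rewrite ltcE => /andP[/eqP h _]; apply: complex_ext => //=.
  have e1 : 0 < Re e by move: e0; rewrite ltcE => /andP[_].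
  have /cvgrPdist_lt/(_ _ e1)[N _ hN] := @eps_cvg R.
  exists N => // m /hN /=; rewrite sub0r normrN => h.
  rewrite er; have -> : `|t%:C - (t +i* (s * eps m)) : R[i]| = (`|eps m|)%:C.
    rewrite normc_def /= subrr expr0n add0r sub0r sqrrN exprMn s2 mul1r sqrtr_sqr.
    by [].
  by rewrite ltcR.
have cw : (t +i* (s * eps m) : R[i]^o) @[m --> \oo] --> within H (nbhs (t%:C : R[i]^o)).
  move=> A /= hA; have [N _ hN] := cz _ hA; exists N => // m Nm; exact: (hN m Nm (hH m)).
have cP := cvg_comp _ _ cw hP.
by rewrite /qcv -[X in _ --> X](mul0r (0 : R)) ; apply: (cvgM cP cP).
Qed.

Definition hermdet (v : R -> M) := forall t, (v t)^t* = v t /\ \det (v t) = 1.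

(* M and P are the boundary values from below and above, and V = v - 1. *)
Record rhdata (C : R) (v : R -> M) (Psi : R[i] -> M) (P Mm : R -> M) : Prop := {
  rhd_sol : rh_solution v Psi P Mm;
  rhd_P : mxmeasurable P;
  rhd_M : mL2 (fun t => Mm t - 1%:M);
  rhd_C0 : 0 <= C;
  rhd_V : mL2 (fun t => v t - 1%:M);
  rhd_bV : mbdd C (fun t => v t - 1%:M);
  rhd_v : hermdet v
}.

Lemma Im_off s (t : R) m : s ^+ 2 = 1 -> Im (t +i* (s * eps m)) != 0.
Proof.
move=> s2 /=; apply/negP; rewrite mulf_eq0 => /orP[/eqP s0|]; last by rewrite gt_eqF ?eps_gt0.
by move: s2; rewrite s0 expr0n /= => /eqP; rewrite eq_sym oner_eq0.
Qed.

Lemma sqrN1 : (-1 : R) ^+ 2 = 1. Proof. by rewrite sqrrN expr1n. Qed.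
Lemma sqr1 : (1 : R) ^+ 2 = 1. Proof. by rewrite expr1n. Qed.

Lemma mxmeasurable_sub1 F : mxmeasurable (fun t => F t - 1%:M) -> mxmeasurable F.
Proof.
move=> h; have -> : F = (fun t => (F t - 1%:M) + 1%:M) by apply/funext => t; rewrite subrK.
by apply: mxmeasurableD => //; exact: mxmeasurable_cst.
Qed.

Lemma adjM A B : (A *m B)^t* = B^t* *m A^t*.
Proof. by rewrite trmx_mul map_mxM. Qed.
Lemma adjK A : (A^t*)^t* = A.
Proof. by apply/matrixP => i j; rewrite !adjE conjcK. Qed.
Lemma adjD A B : (A + B)^t* = A^t* + B^t*.
Proof. by apply/matrixP => i j; rewrite !mxE rmorphD. Qed.
Lemma adjN A : (- A)^t* = - A^t*.
Proof. by apply/matrixP => i j; rewrite !mxE rmorphN. Qed.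
Lemma adjB A B : (A - B)^t* = A^t* - B^t*.
Proof. by rewrite adjD adjN. Qed.
Lemma adj1 : (1%:M : M)^t* = 1%:M.
Proof. by apply/matrixP => i j; rewrite !mxE eq_sym rmorph_nat. Qed.

(** The density in [Psi_adj], with D = M', A = M and w = v': after the boundary values are inserted,
    all terms cancel except the one with w - v. Hermitian symmetry of v enters here. *)
Lemma cross_adj_alg A D (v w : M) : v^t* = v -> D *m (w - 1%:M) - ((A *m (v - 1%:M))^t* +
    (D *m (w - 1%:M) *m - (A *m v - 1%:M)^t* + (D *m w - 1%:M) *m (A *m (v - 1%:M))^t*)) =
  D *m (w - v) *m A^t*.
Proof.
move=> vh; rewrite (adjM A (v - _)) (adjB v) (adjB (A *m v)) (adjM A v) adj1 vh.
move: (A^t*) => {}A; rewrite !(mulmxBl, mulmxBr, mulmxN, mulmx1, mul1mx, mulmxA).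
move: (D *m w *m v *m A) (D *m v *m A) (D *m w *m A) (D *m w) (v *m A) => X1 X2 X3 X4 X5.
by apply/matrixP => i j; rewrite !mxE; ring.
Qed.

Section OnePoint.
Variables (C : R) (v : R -> M) (Psi : R[i] -> M) (P Mm : R -> M).
Hypothesis rh : rhdata C v Psi P Mm.
Let phi t := Mm t *m (v t - 1%:M).

Lemma rh_meas : [/\ mxmeasurable Mm, mxmeasurable P & mxmeasurable v].
Proof.
split; [apply: mxmeasurable_sub1; exact: (rhd_M rh).1|exact: rhd_P rh|].
by apply: mxmeasurable_sub1; exact: (rhd_V rh).1.
Qed.

Lemma phi_mL2 : mL2 phi.
Proof.
have := mL2D (rhd_V rh) (mL2_Mr (rhd_C0 rh) (rhd_M rh) (rhd_bV rh)).
by congr mL2; apply/funext => t; rewrite mulmxBl mul1mx addrC subrK.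
Qed.

Lemma PsiE z : Im z != 0 -> Psi z = 1%:M + Cau phi z.
Proof. by move=> z0; exact: (rh_eq (rhd_sol rh) z0). Qed.

Lemma boundary_ae s (B : R -> M) (H : set R[i]^o) : s ^+ 2 = 1 -> (forall t m, H (t +i* (s * eps m))) ->
  mxmeasurable B -> boundary_value H Psi B -> {ae mu, forall t, B t - 1%:M = Cb s phi t}.
Proof.
move=> s2 hH mB hB; have ph := phi_mL2.
have E m t : Psi (t +i* (s * eps m)) - 1%:M = Cbn s m phi t.
  by rewrite PsiE; [rewrite addrC addKr Cau_Cbn|exact: Im_off].
have : {ae mu, forall t, Cb s phi t = B t - 1%:M}.
  apply: (@mcv_pointwise _ _ (fun m => Cbn s m phi)).
  - by move=> m; exact: (mL2_Cbn s m ph).1.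
  - exact: (mL2_Cb s ph).1.
  - by apply: mxmeasurableB => //; exact: mxmeasurable_cst.
  - exact: Cbn_cvg.
  - move=> t; have := qcvD (boundary_seq (hH t) s2 hB) (qcv_cst (- 1%:M)).
    by apply: cvg_trans; apply: near_eq_cvg; apply: nearW => m /=; rewrite -E.
by apply: aeS => t ->.
Qed.

Lemma M_ae : {ae mu, forall t, Mm t - 1%:M = Cb (-1) phi t}.
Proof.
have [mM _ _] := rh_meas.
apply: (boundary_ae sqrN1 _ mM (rh_minus (rhd_sol rh))).
by move=> t m /=; rewrite mulN1r oppr_lt0 eps_gt0.
Qed.

Lemma P_ae : {ae mu, forall t, P t - 1%:M = Cb 1 phi t}.
Proof.
apply: (boundary_ae sqr1 _ (rhd_P rh) (rh_plus (rhd_sol rh))).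
by move=> t m /=; rewrite mul1r eps_gt0.
Qed.

(** By the Plemelj relation P - M is the density M (v - 1). *)
Lemma PMv_ae : {ae mu, forall t, P t = Mm t *m v t}.
Proof.
move: M_ae P_ae; apply: aeS2 => t hM hP; apply/eqP; rewrite -(inj_eq (addIr (- 1%:M))); apply/eqP.
by rewrite hP -CbE -hM /phi mulmxBr mulmx1 addrA subrK.
Qed.

End OnePoint.

Section TwoPoints.
Variables (C : R) (v : R -> M) (Psi : R[i] -> M) (P Mm : R -> M).
Variables (v' : R -> M) (Psi' : R[i] -> M) (P' M' : R -> M).
Hypotheses (rh : rhdata C v Psi P Mm) (rh' : rhdata C v' Psi' P' M').
Let phi t := Mm t *m (v t - 1%:M).
Let phi' t := M' t *m (v' t - 1%:M).

Lemma conj_neq0 z : Im z != 0 -> Im (z^*) != 0.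
Proof. by rewrite cIm_conj oppr_eq0. Qed.

(** Insert 1 + Cau for both factors. By [Cau_adj] the adjoint is again a Cauchy integral, by
    [Cau_mul] so is the product, and the densities are added up with the boundary values from [P_ae]
    and [PMv_ae]. *)
Lemma Psi_adj z : Im z != 0 -> Psi' z *m (Psi (z^*))^t* =
  1%:M + Cau (fun t => M' t *m (v' t - v t) *m (Mm t)^t*) z.
Proof.
move=> z0; have ph := phi_mL2 rh; have ph' := phi_mL2 rh'.
have pa := mL2_adj ph; have [mM mP mv] := rh_meas rh; have [mM' mP' mv'] := rh_meas rh'.
have d1 := Cdom_mL2 z0 ph'; have d2 := Cdom_mL2 z0 pa; have d3 := Cdom_L1 z0 (cross_intg ph' pa).
rewrite (PsiE rh') // (PsiE rh); last exact: conj_neq0.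
rewrite adjD adj1 -[X in _ *m (_ + X)]opprK -(Cau_adj z0 ph).
rewrite mulmxBr mulmx1 mulmxDl mul1mx Cau_mul// -!addrA; congr (_ + _).
apply: (etrans (congr1 (fun X => _ - X) (esym (CauD d2 d3)))).
apply: (etrans (esym (CauB d1 (CdomD d2 d3)))).
apply: Cau_eqae => //.
- apply: mxmeasurableB; first exact: ph'.1.
  apply: mxmeasurableD; first exact: pa.1.
  apply: mxmeasurableD; apply: mxmeasurableM; [exact: ph'.1|exact: (mL2_Cb (-1) pa).1|exact: (mL2_Cb 1 ph').1|exact: pa.1].
- by apply: mxmeasurableM; [apply: mxmeasurableM => //; exact: mxmeasurableB|exact: mxmeasurable_adj].
have h1 := P_ae rh; have h2 := PMv_ae rh; have h1' := P_ae rh'; have h2' := PMv_ae rh'.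
have h3 := Cb_adj (-1) ph.
have H : {ae mu, forall t, Cb (-1) (fun r => (phi r)^t*) t = - (Mm t *m v t - 1%:M)^t*}.
  move: h3 (aeS2 (fun t h h' => conj h h') h1 h2); apply: aeS2 => t -> [a b].
  by rewrite opprK -b a.
have H' : {ae mu, forall t, Cb 1 phi' t = M' t *m v' t - 1%:M}.
  by move: h1' h2'; apply: aeS2 => t <- ->.
move: H H'; apply: aeS2 => t H H'; rewrite /cross H H' /phi /phi'.
have [vh _] := rhd_v rh t.
exact: cross_adj_alg.
Qed.

End TwoPoints.

Lemma Cau0 z : Cau (fun=> 0 : M) z = 0.
Proof.
apply/matrixP => i j; rewrite CauE mxE (_ : Kz z _ = 0) ?mulr0//.
by rewrite -[RHS](cint0 (R := R)); apply: eq_cint => t; rewrite mulr0.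
Qed.

(** With equal data the density in [Psi_adj] vanishes. Approaching t from below, the conjugate point
    approaches from above, so the limit of the constant 1 is M P^*. It holds at every t, as the
    boundary values are pointwise. *)
Lemma MPadj C v Psi P Mm t : rhdata C v Psi P Mm -> Mm t *m (P t)^t* = 1%:M.
Proof.
move=> rh; have hM : forall m, [set z : R[i] | Im z < 0] (t +i* (-1 * eps m)).
  by move=> m /=; rewrite mulN1r oppr_lt0 eps_gt0.
have hP : forall m, [set z : R[i] | 0 < Im z] (t +i* (1 * eps m)).
  by move=> m /=; rewrite mul1r eps_gt0.
have c1 := boundary_seq hM sqrN1 (rh_minus (rhd_sol rh)).
have c2 := boundary_seq hP sqr1 (rh_plus (rhd_sol rh)).
apply: (qcv_unique (qcvM c1 (qcv_adj c2))).
rewrite (_ : (fun m => _) = (fun=> 1%:M)); first exact: qcv_cst.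
apply/funext => m; have := Psi_adj rh rh (Im_off t m sqrN1).
rewrite (_ : (fun r => _) = (fun=> 0)); last by apply/funext => r; rewrite subrr mulmx0 mul0mx.
rewrite Cau0 addr0 => <-; congr (_ *m (Psi _)^t*).
by apply: complex_ext; rewrite ?cRe_conj ?cIm_conj /= ?mul1r ?mulN1r ?opprK.
Qed.

Lemma unit_ae C v Psi P Mm : rhdata C v Psi P Mm ->
  {ae mu, forall t, [/\ (P t)^t* = v t *m (Mm t)^t*, (P t)^t* *m Mm t = 1%:M &
     (Mm t)^t* *m Mm t *m v t = 1%:M]}.
Proof.
move=> rh; move: (PMv_ae rh); apply: aeS => t hP; have h := MPadj t rh.
have [vh _] := rhd_v rh t; have e : (P t)^t* = v t *m (Mm t)^t* by rewrite hP adjM vh.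
have h' : (P t)^t* *m Mm t = 1%:M by apply: mulmx1C.
by split=> //; apply: mulmx1C; rewrite mulmxA -e.
Qed.

Lemma q_tr A : (q A)%:C = \tr (A^t* *m A).
Proof.
have E i : (A^t* *m A) i i = \sum_j ((A j i)^* * A j i).
  by rewrite mxE; apply: eq_bigr => j _; rewrite adjE.
apply: complex_ext; rewrite /mxtrace ?Re_sum ?Im_sum /=.
  rewrite qE exchange_big/=; apply: eq_bigr => i _; rewrite E Re_sum; apply: eq_bigr => j _.
  by rewrite cReM cRe_conj cIm_conj; ring.
rewrite big1// => i _; rewrite E Im_sum big1// => j _.
by rewrite cImM cRe_conj cIm_conj; ring.
Qed.

(** [q] of M is the trace of M^*M, which is the adjugate of v. An entry of v - 1 has squared modulus
    at most C, so an entry of v has modulus at most C + 2, and [adj_bound] is summed over the n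
    diagonal entries. *)
Definition Mbound (C : R) : R := n%:R * ((n.-1)`!%:R * (C + 2) ^+ n.-1).

Lemma Mbound_ge0 C : 0 <= C -> 0 <= Mbound C.
Proof. by move=> C0; rewrite mulr_ge0// mulr_ge0// exprn_ge0// addr_ge0. Qed.

Lemma M_bdd C v Psi P Mm : rhdata C v Psi P Mm -> mbdd (Mbound C) Mm.
Proof.
move=> rh; have [mM _ _] := rh_meas rh; split=> //.
move: (unit_ae rh) (rhd_bV rh).2; apply: aeS2 => t [_ _ h] hV.
have [_ dv] := rhd_v rh t.
have E : (Mm t)^t* *m Mm t = \adj (v t).
  have e : v t *m \adj (v t) = 1%:M by rewrite mul_mx_adj dv.
  by rewrite -[LHS]mulmx1 -e mulmxA h mul1mx.
have C0 := rhd_C0 rh.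
have hv i j : `|v t i j| <= (C + 2)%:C.
  have -> : v t i j = (v t - 1%:M) i j + (1%:M : M) i j by rewrite [in RHS]mxE [in RHS]mxE subrK.
  apply: (le_trans (ler_normD _ _)); rewrite (_ : (C + 2)%:C = (C + 1)%:C + 1); last first.
    by apply: complex_ext; rewrite ?cReD ?cImD /=; ring.
  apply: lerD; last by rewrite mxE; case: (i == j); rewrite ?normr1 ?normr0.
  rewrite normc_def lecR; have := le_trans (q_entry (v t - 1%:M) i j) hV; set s := _ + _ => hs.
  have s0 : 0 <= s by rewrite addr_ge0 ?sqr_ge0.
  have := sqr_sqrtr s0; have := sqrtr_ge0 s; move: (Num.sqrt s) => r; nra.
rewrite -lecR q_tr E -[\tr _]ger0_norm; last by rewrite -E -q_tr ler0c q_ge0.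
rewrite /mxtrace; apply: le_trans (ler_norm_sum _ _ _) _.
have k0 : (0 : R[i]) <= (C + 2)%:C by rewrite ler0c addr_ge0.
apply: (@le_trans _ _ (\sum_(i < n) ((n.-1)`!%:R * (C + 2)%:C ^+ n.-1))).
  by apply: ler_sum => i _; apply: adj_bound.
by rewrite sumr_const card_ord /Mbound !rmorphM rmorphXn/= !rmorph_nat -[leLHS]mulr_natl.
Qed.

(* The resolvent of the problem: M' - M = Tm M (M' (v' - v)), see [M_diff]. *)
Definition Tm Mm g t := Cb (-1) (fun r => g r *m (Mm r)^t*) t *m Mm t.

Section TOperator.
Variables (C : R) (v : R -> M) (Psi : R[i] -> M) (P Mm : R -> M).
Hypothesis rh : rhdata C v Psi P Mm.

Lemma bdd_adj K F : mbdd K F -> mbdd K (fun t => (F t)^t*).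
Proof.
move=> [mF hF]; split; first exact: mxmeasurable_adj.
by move: hF; apply: aeS => t; rewrite q_adj.
Qed.

Lemma mL2_adjM g : mL2 g -> mL2 (fun r => g r *m (Mm r)^t*).
Proof.
move=> hg; apply: mL2_Mr (Mbound_ge0 (rhd_C0 rh)) hg _.
by apply: bdd_adj; exact: M_bdd rh.
Qed.

Lemma mL2_T g : mL2 g -> mL2 (Tm Mm g).
Proof.
move=> hg; apply: mL2_Mr (Mbound_ge0 (rhd_C0 rh)) _ (M_bdd rh).
by apply: mL2_Cb; exact: mL2_adjM.
Qed.

(** Each of the two multiplications, by M^* before and by M after, costs 2 n [Mbound C], and [Cb]
    costs 2. The constant involves only n and C and is thus the same for all (x, y). *)
Lemma mN2_T g : mL2 g ->
  (mN2 (Tm Mm g) <= ((2 * n%:R * Mbound C) * (2 * (2 * n%:R * Mbound C)))%:E * mN2 g)%E.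
Proof.
move=> hg; have B0 := Mbound_ge0 (rhd_C0 rh); have hg' := mL2_adjM hg.
have K0 : 0 <= 2 * n%:R * Mbound C by rewrite mulr_ge0// mulr_ge0.
apply: le_trans (mN2_Mr B0 (mL2_Cb (-1) hg').1 (M_bdd rh)) _.
rewrite [in leRHS]EFinM -[leRHS]muleA lee_wpmul2l ?lee_fin//.
apply: le_trans (mN2_Cb sqrN1 hg') _.
rewrite [in leRHS]EFinM -[leRHS]muleA lee_wpmul2l ?lee_fin//.
exact: mN2_Mr B0 hg.1 (bdd_adj (M_bdd rh)).
Qed.

Lemma TD g g' : mL2 g -> mL2 g' -> {ae mu, forall t, Tm Mm (fun r => g r + g' r) t = Tm Mm g t + Tm Mm g' t}.
Proof.
move=> hg hg'; move: (CbD (-1) (mL2_adjM hg) (mL2_adjM hg')); apply: aeS => t h.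
apply: (etrans _ (mulmxDl _ _ _)); apply: (congr1 (mulmx^~ (Mm t))); apply: (etrans _ h); congr (Cb _ _ t).
by apply/funext => r; rewrite mulmxDl.
Qed.

Lemma TZ (c : R) g : mL2 g -> {ae mu, forall t, Tm Mm (fun r => c%:C *: g r) t = c%:C *: Tm Mm g t}.
Proof.
move=> hg; move: (CbZ (-1) c (mL2_adjM hg)); apply: aeS => t h.
apply: (etrans _ (esym (scalemxAl _ _ _))); apply: (congr1 (mulmx^~ (Mm t))); apply: (etrans _ h); congr (Cb _ _ t).
by apply/funext => r; rewrite scalemxAl.
Qed.

Lemma TB g g' : mL2 g -> mL2 g' -> {ae mu, forall t, Tm Mm (fun r => g r - g' r) t = Tm Mm g t - Tm Mm g' t}.
Proof.
move=> hg hg'; move: (CbB (-1) (mL2_adjM hg) (mL2_adjM hg')); apply: aeS => t h.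
apply: (etrans _ (mulmxBl _ _ _)); apply: (congr1 (mulmx^~ (Mm t))); apply: (etrans _ h); congr (Cb _ _ t).
by apply/funext => r; rewrite mulmxBl.
Qed.

End TOperator.

(** Here A and B stand for M and M', e for [Cb (-1) G], and a, b, c for the boundary values of the
    densities in [T_diff]; the second hypothesis is the product formula. *)
Lemma T_diff_alg (a b c e A B : M) : B = A + e *m A -> a *m e = b - a + c ->
  a *m B - b *m A = c *m A.
Proof. by move=> -> h; rewrite mulmxDr mulmxA h; mxexpand. Qed.

Section Differences.
Variables (C : R) (v : R -> M) (Psi : R[i] -> M) (P Mm : R -> M).
Variables (v' : R -> M) (Psi' : R[i] -> M) (P' M' : R -> M).
Hypotheses (rh : rhdata C v Psi P Mm) (rh' : rhdata C v' Psi' P' M').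
Let dv t := v' t - v t.

Lemma mL2_dv : mL2 dv.
Proof.
have := mL2B (rhd_V rh') (rhd_V rh); congr mL2; apply/funext => t.
by rewrite opprB addrA subrK.
Qed.

Lemma mL2_Mdv : mL2 (fun t => M' t *m dv t).
Proof. exact: mL2_Ml (Mbound_ge0 (rhd_C0 rh')) mL2_dv (M_bdd rh'). Qed.

Let G t := M' t *m dv t *m (Mm t)^t*.

Lemma mL2_G : mL2 G.
Proof. exact: (mL2_adjM rh mL2_Mdv). Qed.

(** The boundary value from below of the identity [Psi_adj], taken pointwise on its left side and in
    L_2 on its right side. *)
Lemma MP_ae : {ae mu, forall t, M' t *m (P t)^t* = 1%:M + Cb (-1) G t}.
Proof.
have hG := mL2_G; have [mM' mP' mv'] := rh_meas rh'; have [mM mP mv] := rh_meas rh.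
have : {ae mu, forall t, Cb (-1) G t = M' t *m (P t)^t* - 1%:M}.
  apply: (@mcv_pointwise _ _ (fun m => Cbn (-1) m G)).
  - by move=> m; exact: (mL2_Cbn (-1) m hG).1.
  - exact: (mL2_Cb (-1) hG).1.
  - apply: mxmeasurableB; last exact: mxmeasurable_cst.
    by apply: mxmeasurableM => //; exact: mxmeasurable_adj.
  - exact: Cbn_cvg.
  - move=> t.
    have hM : forall m, [set z : R[i] | Im z < 0] (t +i* (-1 * eps m)).
      by move=> m /=; rewrite mulN1r oppr_lt0 eps_gt0.
    have hP : forall m, [set z : R[i] | 0 < Im z] (t +i* (1 * eps m)).
      by move=> m /=; rewrite mul1r eps_gt0.
    have c1 := boundary_seq hM sqrN1 (rh_minus (rhd_sol rh')).
    have c2 := boundary_seq hP sqr1 (rh_plus (rhd_sol rh)).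
    have := qcvD (qcvM c1 (qcv_adj c2)) (qcv_cst (- 1%:M)).
    apply: cvg_trans; apply: near_eq_cvg; apply: nearW => m /=.
    congr q; congr (_ - _); rewrite -(Cau_Cbn m t sqrN1 hG).
    have := Psi_adj rh rh' (Im_off t m sqrN1); rewrite /G /dv => h.
    have -> : (t +i* (1 * eps m)) = (t +i* (-1 * eps m))^*.
      by apply: complex_ext; rewrite ?cRe_conj ?cIm_conj /= ?mul1r ?mulN1r ?opprK.
    by rewrite h addrC addKr.
by apply: aeS => t ->; rewrite addrC subrK.
Qed.

Lemma M_diff : {ae mu, forall t, M' t - Mm t = Tm Mm (fun r => M' r *m dv r) t}.
Proof.
move: MP_ae (unit_ae rh); apply: aeS2 => t h [_ h1 _].
have := congr1 (mulmx^~ (Mm t)) h; rewrite -mulmxA h1 mulmx1 mulmxDl mul1mx => ->.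
by rewrite addrC addKr.
Qed.

(** The second resolvent identity for the family T. It comes from the product formula for the
    boundary values of g M'^* and of G, whose cross term collapses to an expression in L_2. *)
Lemma T_diff g : mL2 g -> {ae mu, forall t, Tm M' g t - Tm Mm g t =
  Tm Mm (fun r => Tm M' g r *m dv r) t}.
Proof.
move=> hg; pose A t := g t *m (M' t)^t*; have hA : mL2 A := mL2_adjM rh' hg.
have hG := mL2_G; have hgM := mL2_adjM rh hg; have hT := mL2_T rh' hg.
pose D t := Tm M' g t *m dv t.
have bdv : mbdd (4 * C) dv.
  split; first exact: mL2_dv.1.
  move: (rhd_bV rh).2 (rhd_bV rh').2; apply: aeS2 => t a b.
  have -> : dv t = (v' t - 1%:M) - (v t - 1%:M) by rewrite opprB addrA subrK.
  by apply: le_trans (qB _ _) _; lra.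
have hD : mL2 D by apply: mL2_Mr hT bdv; rewrite mulr_ge0// (rhd_C0 rh).
have hDM := mL2_adjM rh hD.
(* Since A = g M'^* and M'^*M' v' = 1, the factor M' v' M^* contained in G and its boundary value
   cancels the M' in A. What remains is visibly in L_2, and [Cb_mul] becomes applicable. *)
have E : {ae mu, forall t, cross A G t = g t *m (Mm t)^t* - A t + D t *m (Mm t)^t*}.
  have H1 : {ae mu, forall t, Cb (-1) G t + G t + 1%:M = M' t *m v' t *m (Mm t)^t*}.
    move: MP_ae (unit_ae rh); apply: aeS2 => t h [h1 _ _].
    rewrite addrAC [_ + 1%:M]addrC -h h1 /G /dv; mxexpand.
  move: H1 (unit_ae rh'); apply: aeS2 => t h [_ _ h2].
  have h3 : A t *m (Cb (-1) G t + G t + 1%:M) = g t *m (Mm t)^t*.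
    rewrite h /A; transitivity (g t *m ((M' t)^t* *m M' t *m v' t) *m (Mm t)^t*).
      by rewrite !mulmxA.
    by rewrite h2 mulmx1.
  rewrite -h3 /cross -CbE /D /Tm -/A /G.
  have -> : Cb (-1) A t *m M' t *m dv t *m (Mm t)^t* = Cb (-1) A t *m (M' t *m dv t *m (Mm t)^t*).
    by rewrite !mulmxA.
  move: (Cb (-1) A t) (Cb (-1) _ t) (M' t *m dv t *m _) => a b c; mxexpand.
have hS : mL2 (fun t => g t *m (Mm t)^t* - A t + D t *m (Mm t)^t*) by exact: (mL2D (mL2B hgM hA) hDM).
have hK : mL2 (cross A G).
  have mc : mxmeasurable (cross A G).
    apply: mxmeasurableD; apply: mxmeasurableM;
      [exact: hA.1|exact: (mL2_Cb (-1) hG).1|exact: (mL2_Cb 1 hA).1|exact: hG.1].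
  by apply: (mL2_eqae mc _ hS); move: E; apply: aeS => t ->.
have X1 := Cb_mul hA hG hK.
have X2 := Cb_eqae (-1) hK hS E.
have X3 := CbD (-1) (mL2B hgM hA) hDM.
have X4 := CbB (-1) hgM hA.
have Y : {ae mu, forall t, Cb (-1) A t *m Cb (-1) G t = Cb (-1) (fun r => g r *m (Mm r)^t*) t
    - Cb (-1) A t + Cb (-1) (fun r => D r *m (Mm r)^t*) t}.
  move: (aeS2 (fun t h h' => conj h h') X1 X2) (aeS2 (fun t h h' => conj h h') X3 X4).
  by apply: aeS2 => t [<- ->] [-> ->].
have Z : {ae mu, forall t, M' t = Mm t + Cb (-1) G t *m Mm t}.
  move: MP_ae (unit_ae rh); apply: aeS2 => t h [_ h1 _].
  by have := congr1 (mulmx^~ (Mm t)) h; rewrite -mulmxA h1 mulmx1 mulmxDl mul1mx.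
by move: Y Z; apply: aeS2 => t y z; exact: (T_diff_alg z y).
Qed.

End Differences.

End RiemannHilbertTheory.

(** * Mean value arguments *)

Section RealLemmas.
Context {R : realType}.
Local Notation mu := (@lebesgue_measure R).
Local Notation intg f := (mu.-integrable setT (EFin \o f)).
Implicit Types (f g : R -> R).

Lemma deriv_eps f (x d : R) : is_derive x (1:R) f d -> forall e, 0 < e ->
  exists2 r, 0 < r & forall h, `|h| < r -> `|f (x + h) - f x - d * h| <= e * `|h|.
Proof.
move=> [df fd] e e0.
have hc : h^-1 *: (f (h + x) - f x) @[h --> 0^'] --> d.
  have c : h^-1 *: (f (h *: (1:R) + x) - f x) @[h --> 0^'] --> 'D_1 f x by exact: df.
  rewrite -fd; move: c; apply: cvg_trans; apply: near_eq_cvg; apply: nearW => h.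
  by rewrite [h *: 1]mulr1.
have /cvgrPdist_le/(_ e e0) := hc.
rewrite near_withinE => -[r /= r0 hr]; exists r => // h hh.
have [->|h0] := eqVneq h 0; first by rewrite addr0 subrr mulr0 subrr !normr0 mulr0.
have := hr h; rewrite /ball/= sub0r normrN => /(_ hh h0) H.
have -> : f (x + h) - f x - d * h = - ((d - h^-1 *: (f (h + x) - f x)) * h).
  rewrite /GRing.scale/= [h + x]addrC; field; exact: h0.
by rewrite normrN normrM ler_wpM2r.
Qed.

(** Outer regularity of Lebesgue measure. *)
Lemma null_cover (P : set R) : mu.-negligible P -> forall e : R, 0 < e ->
  exists U : set R, [/\ open U, P `<=` U & (mu U <= e%:E)%E].
Proof.
move=> [D [mD D0 PD]] e e0.
have [U [oU DU hU]] := lebesgue_regularity_outer mD (eq_ind_r (fun x => x < +oo)%E (ltry 0) D0) e0.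
exists U; split => //; first exact: subset_trans DU.
have mU : measurable U by exact: open_measurable.
have e1 : mu (D `|` (U `\` D)) = (mu D + mu (U `\` D))%E.
  by apply: measureU => //; [exact: measurableD|rewrite setDIK].
by rewrite -(setDUK DU) e1 D0 add0e ltW.
Qed.

Lemma open_finI (U : nat -> set R) x K : (forall k, open (U k)) -> (forall k, U k x) ->
  exists2 r, 0 < r & forall k, (k < K)%N -> forall y, `|y - x| < r -> U k y.
Proof.
move=> oU Ux; elim: K => [|K [r r0 IH]]; first by exists 1.
have /nbhs_ballP[s /= s0 hs] := open_nbhs_nbhs (conj (oU K) (Ux K)).
exists (Num.min r s); first by rewrite lt_min r0.
move=> k; rewrite ltnS leq_eqVlt => /orP[/eqP ->|kK] y; rewrite lt_min => /andP[y1 y2].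
  by apply: hs; rewrite /ball/= distrC.
exact: IH.
Qed.

(* nu is a finite measure with infinite density on the exceptional null set, so that
   f x - (C + e) x - nu [a, x] cannot increase there either. *)
Lemma ae_deriv_le f g (C a b : R) : 0 <= C -> a < b -> (forall x : R, is_derive x (1:R) f (g x)) ->
  {ae mu, forall x, g x <= C} -> f b - f a <= C * (b - a).
Proof.
move=> C0 ab df gC; apply/ler_addgt0Pr => e0 e00.
pose e := e0 / (b - a + 1); have e_gt0 : 0 < e by rewrite divr_gt0//; lra.
have he : e * (b - a) + e = e0 by rewrite /e; field; lra.
have ex k : exists U : set R, [/\ open U, [set x | ~ (g x <= C)] `<=` U &
    (mu U <= (e / (2 ^ k.+1)%:R)%:E)%E].
  by apply: null_cover => //; rewrite divr_gt0// ltr0n expn_gt0.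
have [U hU] := choice ex.
have oU k : open (U k) by have [] := hU k.
have mU k : measurable (U k : set (measurableTypeR R)) by exact: open_measurable.
pose nu : {measure set (measurableTypeR R) -> \bar R} := mseries (fun k => mrestr mu (mU k)) 0.
have mI c : measurable (`[a, c]%classic : set (measurableTypeR R)) by exact: measurable_itv.
have nuT A : measurable A -> (nu A <= e%:E)%E.
  move=> mA; apply: le_trans (epsilon_trick0 xpredT (ltW e_gt0)); apply: lee_nneseries => // k _.
  have [_ _] := hU k; apply: le_trans; rewrite /mrestr; apply: le_measure; rewrite ?inE//.
  exact: measurableI.
pose F x := f x - f a - (C + e) * (x - a).
have cf x : f y @[y --> x] --> f x.
  by apply: differentiable_continuous; apply/derivable1_diffP; case: (df x).
have cF x : F y @[y --> x] --> F x.
  apply: cvgB; first by apply: cvgB; [exact: cf|exact: cvg_cst].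
  by apply: cvgMr; apply: cvgB; [exact: cvg_id|exact: cvg_cst].
pose P x := ((F x)%:E <= nu `[a, x]%classic)%E.
(* Induction along the interval: the supremum of [S] belongs to [S], and it cannot be smaller than b
   because any point of [S] below b can be passed. *)
pose S := [set x | a <= x <= b /\ P x].
have Sa : S a.
  split; first by rewrite lexx ltW.
  by rewrite /P /F !subrr mulr0 subr0; exact: measure_ge0.
have hS : has_sup S by split; [exists a|exists b => x [/andP[]]].
set x0 := sup S.
have ax0 : a <= x0 by apply: ub_le_sup => //; exact: hS.2.
have x0b : x0 <= b by apply: ge_sup; [exists a|move=> x [/andP[]]].
have Px0 : P x0.
  apply/lee_addgt0Pr => d d0.
  have /cvgrPdist_lt/(_ d d0) := cF x0; move=> /nbhs_ballP[r /= r0 hr].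
  have [x Sx xr] := sup_adherent r0 hS.
  have xx0 : x <= x0 by apply: ub_le_sup => //; exact: hS.2.
  have [/andP[ax xb] Px] := Sx.
  have h : `|F x0 - F x| < d by apply: hr; rewrite /ball/= ger0_norm; [rewrite ltrBlDr -ltrBlDl|rewrite subr_ge0].
  apply: (@le_trans _ _ (F x + d)%:E).
    by rewrite lee_fin; move: h; rewrite ltr_norml => /andP[_]; lra.
  rewrite EFinD leeD2r//; apply: (le_trans Px); apply: le_measure; rewrite ?inE//.
  by move=> y /=; rewrite !in_itv/= => /andP[-> /le_trans]; exact.
have x0E : x0 = b.
  apply/eqP; rewrite eq_le x0b/= leNgt; apply/negP => x0ltb.
  have step h : 0 < h -> x0 + h <= b -> P (x0 + h) -> False.
    move=> h0 hb Ph; have : S (x0 + h).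
      by split=> //; rewrite hb andbT (le_trans ax0)// lerDl ltW.
    by move=> /(ub_le_sup hS.2); rewrite -/x0 gerDl leNgt h0.
  have [gx|gx] := leP (g x0) C.
    have [r r0 hr] := deriv_eps (df x0) e_gt0.
    pose h := Num.min (r / 2) (b - x0).
    have h0 : 0 < h by rewrite lt_min; apply/andP; split; lra.
    have hr2 : h < r by apply: (@le_lt_trans _ _ (r / 2)); [rewrite ge_min lexx|lra].
    have hb : x0 + h <= b by rewrite -lerBrDl ge_min lexx orbT.
    apply: (step h) => //; rewrite /P; apply: (@le_trans _ _ (nu `[a, x0]%classic)).
      apply: le_trans Px0; rewrite lee_fin /F.
      have := hr h; rewrite gtr0_norm// => /(_ hr2); rewrite ler_norml => /andP[_].
      nra.
    apply: le_measure; rewrite ?inE//.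
    by move=> y /=; rewrite !in_itv/= => /andP[-> /le_trans]; apply; rewrite lerDl ltW.
  (* At an exceptional point, a short interval lies in the first K of the sets U k, so nu gains at
     least K h on it, while f gains at most (g x0 + 1) h. *)
  pose K := (Num.truncn (g x0 + 1)).+1.
  have gK : g x0 + 1 < K%:R by exact: truncnS_gt.
  have Ux0 k : U k x0 by have [_ + _] := hU k; apply => /=; rewrite leNgt gx.
  have [s s0 hs] := open_finI K oU Ux0.
  have [r r0 hr] := deriv_eps (df x0) ltr01.
  pose h := Num.min (Num.min (r / 2) (s / 2)) (b - x0).
  have h0 : 0 < h by rewrite !lt_min; apply/andP; split; [apply/andP; split|]; lra.
  have hr2 : h < r by apply: (@le_lt_trans _ _ (r / 2)); [rewrite !ge_min lexx|lra].
  have hs2 : h < s by apply: (@le_lt_trans _ _ (s / 2)); [rewrite !ge_min lexx orbT|lra].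
  have hb : x0 + h <= b by rewrite -lerBrDl ge_min lexx orbT.
  have mJ : measurable (`]x0, (x0 + h)]%classic : set (measurableTypeR R)) by exact: measurable_itv.
  apply: (step h) => //; rewrite /P.
  have -> : `[a, (x0 + h)]%classic = `[a, x0]%classic `|` `]x0, (x0 + h)]%classic.
    apply/seteqP; split => y /=; rewrite !in_itv/=.
      by move=> /andP[-> ->]; rewrite /= andbT; case: (leP y x0); [left|right].
    move=> [/andP[-> h1]|/andP[h1 ->]].
      by rewrite /= (le_trans h1)// lerDl ltW.
    by rewrite andbT (le_trans ax0)// ltW.
  rewrite measureU//; last first.
    apply/seteqP; split=> // y []/=; rewrite !in_itv/= => /andP[_ h1] /andP[h2 _].
    by move: (lt_le_trans h2 h1); rewrite ltxx.
  apply: (@le_trans _ _ ((F x0)%:E + (K%:R * h)%:E)%E).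
    rewrite -EFinD lee_fin /F.
    have := hr h; rewrite gtr0_norm// => /(_ hr2); rewrite ler_norml => /andP[_].
    nra.
  apply: leeD => //.
  pose J := `]x0, (x0 + h)]%classic : set (measurableTypeR R); rewrite -/J.
  apply: (@le_trans _ _ (\sum_(0 <= k < K) mrestr mu (mU k) J)%E); last first.
    by apply: nneseries_lim_ge => k _ _; exact: measure_ge0.
  rewrite (@eq_big_nat _ _ _ _ _ _ (fun=> h%:E)).
    by rewrite sumEFin lee_fin sumr_const_nat subn0 mulr_natl.
  move=> k /andP[_ kK]; rewrite /mrestr setIidl.
    by rewrite lebesgue_measure_itv/= lte_fin ltrDl h0 -EFinD addrAC subrr add0r.
  move=> y; rewrite /J/= in_itv/= => /andP[y1 y2]; apply: (hs k kK).
  by rewrite gtr0_norm ?subr_gt0// ltrBlDl (le_lt_trans y2)// ltrD2l.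
have := Px0; rewrite x0E => /le_trans/(_ (nuT _ (mI b))); rewrite lee_fin /F; nra.
Qed.

Lemma is_derive_cont f x (d : R) : is_derive x (1:R) f d -> f y @[y --> x] --> f x.
Proof. by move=> [df _]; apply: differentiable_continuous; apply/derivable1_diffP. Qed.

Lemma is_derive_within f g a b : (forall x : R, is_derive x (1:R) f (g x)) ->
  {within `[a, b], continuous f}.
Proof. by move=> df; apply: continuous_subspaceT => x; exact: is_derive_cont (df x). Qed.

Lemma deriv_mvt f g (x h : R) : (forall x : R, is_derive x (1:R) f (g x)) ->
  exists2 y, `|y - x| <= `|h| & f (x + h) - f x = h * g y.
Proof.
move=> df; have [h0|h0] := leP 0 h.
  have [|c] := @MVT_segment _ f g x (x + h) _ (fun y _ => df y) (is_derive_within df).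
    by rewrite lerDl.
  rewrite in_itv/= => /andP[c1 c2] ->; exists c; last by rewrite addrAC subrr add0r mulrC.
  by rewrite (ger0_norm h0) ger0_norm ?subr_ge0// lerBlDl.
have [|c] := @MVT_segment _ f g (x + h) x _ (fun y _ => df y) (is_derive_within df).
  by rewrite gerDl ltW.
rewrite in_itv/= => /andP[c1 c2] e; exists c.
  by rewrite (ltr0_norm h0) ler0_norm ?subr_le0//; lra.
by rewrite -opprB e; ring.
Qed.

Lemma deriv_lip f g (C x h : R) : (forall x : R, is_derive x (1:R) f (g x)) ->
  (forall x, `|g x| <= C) -> `|f (x + h) - f x| <= C * `|h|.
Proof.
move=> df gC; have [y _ ->] := deriv_mvt x h df.
by rewrite normrM mulrC ler_wpM2r.
Qed.

(** An almost everywhere bound makes f Lipschitz, and then every difference quotient, hence every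
    value of g, obeys the bound. No continuity of g enters, which matters for derivatives of top
    order. *)
Lemma ae_deriv_bound f g (C : R) : 0 <= C -> (forall x : R, is_derive x (1:R) f (g x)) ->
  {ae mu, forall x, `|g x| <= C} -> forall x, `|g x| <= C.
Proof.
move=> C0 df gC x.
have dNf y : is_derive y (1:R) (fun y => - f y) (- g y) by apply: is_deriveN.
have h1 : {ae mu, forall x, g x <= C} by move: gC; apply: aeS => t; rewrite ler_norml => /andP[].
have h2 : {ae mu, forall x, - g x <= C} by move: gC; apply: aeS => t; rewrite ler_norml => /andP[]; lra.
apply/ler_addgt0Pr => e e0; have [r r0 hr] := deriv_eps (df x) e0.
pose h := r / 2; have h0 : 0 < h by rewrite /h; lra.
have xh : x < x + h by rewrite ltrDl.
have := hr h; rewrite gtr0_norm// => /(_ ltac:(rewrite /h; lra)).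
have := ae_deriv_le C0 xh df h1; have := ae_deriv_le C0 xh dNf h2.
rewrite addrAC subrr add0r !ler_norml => a1 a2 /andP[b1 b2].
have c1 : g x * h <= (C + e) * h by lra.
have c2 : - g x * h <= (C + e) * h by lra.
by rewrite !(ler_pM2r h0) in c1 c2; apply/andP; split; lra.
Qed.

Lemma is_derive_seq f (x d : R) : (forall u : nat -> R, (forall n, u n != 0) -> u n @[n --> \oo] --> (0:R) ->
   (u n)^-1 * (f (x + u n) - f x) @[n --> \oo] --> d) -> is_derive x (1:R) f d.
Proof.
move=> H.
have c : h^-1 *: (f (h *: (1:R) + x) - f x) @[h --> 0^'] --> d.
  apply/cvgr_dnbhsP => u [u0 cu]; have := H u u0 cu.
  apply: cvg_trans; apply: near_eq_cvg; apply: nearW => n.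
  have -> // : u n *: (1:R) + x = x + u n by rewrite [u n *: _]mulr1 addrC.
split; first by apply/cvg_ex; exists d.
exact: cvg_lim c.
Qed.

Lemma deriv_seq f (x d : R) (u : nat -> R) : is_derive x (1:R) f d -> (forall n, u n != 0) ->
  u n @[n --> \oo] --> (0:R) -> (u n)^-1 * (f (x + u n) - f x) @[n --> \oo] --> d.
Proof.
move=> df u0 cu; apply/cvgrPdist_le => e e0; have [r r0 hr] := deriv_eps df e0.
have /cvgrPdist_lt/(_ r r0)[N _ hN] := cu; exists N => // n /hN /=; rewrite sub0r normrN => un.
have -> : d - (u n)^-1 * (f (x + u n) - f x) = - ((u n)^-1 * (f (x + u n) - f x - d * u n)).
  by field; exact: u0.
rewrite normrN normrM normfV mulrC ler_pdivrMr ?normr_gt0//; exact: hr.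
Qed.

Lemma Rint_dominated (u : nat -> R -> R) f g : (forall n, measurable_fun setT (u n)) ->
  measurable_fun setT f -> intg g -> {ae mu, forall t, u n t @[n --> \oo] --> f t} ->
  {ae mu, forall t, forall n, `|u n t| <= g t} ->
  intg f /\ \int[mu]_t u n t @[n --> \oo] --> \int[mu]_t f t.
Proof.
move=> mu_ mf ig uf ug.
have Hd : {ae mu, forall t, forall n, setT t -> (`|(u n t)%:E| <= (g t)%:E)%E}.
  by move: ug; apply: aeS => t h n _; rewrite abse_EFin lee_fin.
have Hc : {ae mu, forall t, setT t -> (u n t)%:E @[n --> \oo] --> (f t)%:E}.
  by move: uf; apply: aeS => t h _; apply: cvg_EFin => //; exact: nearW.
have mE n : measurable_fun setT (fun t => (u n t)%:E) by apply/measurable_EFinP.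
have mfE : measurable_fun setT (fun t => (f t)%:E) by apply/measurable_EFinP.
have [fi _ h] := @dominated_convergence _ _ R mu setT measurableT
   (fun n t => (u n t)%:E) (fun t => (f t)%:E) (fun t => (g t)%:E) mE mfE Hc ig Hd.
split=> //; apply: fine_cvg; rewrite fineK//.
exact: integrable_fin_num.
Qed.

(** Functions continuous in one variable and measurable in the other: freezing the continuous
    variable at multiples of 1/(n + 1) gives countably many measurable pieces, which converge
    pointwise. *)
Lemma cara_measurable (f : R -> R -> R) : (forall l s, f r l @[r --> s] --> f s l) ->
  (forall s, measurable_fun setT (f s)) -> measurable_fun setT (fun q : R * R => f q.1 q.2).
Proof.
move=> cf mf.
pose k n (s : R) : int := Num.floor (n.+1%:R * s).
apply: (@measurable_fun_cvg _ _ _ _ (fun n (q : R * R) => f ((k n q.1)%:~R / n.+1%:R) q.2)).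
  move=> n; pose E i : set (R * R) := if unpickle i is Some c then [set q | k n q.1 = c] else set0.
  have mE i : measurable (E i).
    rewrite /E; case: (unpickle i) => [c|]; last exact: measurable0.
    have -> : [set q : R * R | k n q.1 = c] = fst @^-1` `[(c%:~R / n.+1%:R), ((c + 1)%:~R / n.+1%:R)[%classic.
      apply/seteqP; split => -[s l] /=; rewrite in_itv/= /k.
        move=> <-; rewrite ler_pdivrMr ?ltr0n// ltr_pdivlMr ?ltr0n// [s * _]mulrC.
        by rewrite floor_le_tmp floorD1_gt.
      rewrite ler_pdivrMr ?ltr0n// ltr_pdivlMr ?ltr0n// [s * _]mulrC => h.
      exact: floor_def.
    rewrite -[X in measurable X]setTI; apply: measurable_fst => //; exact: measurable_itv.
  have -> : [set: R * R] = \bigcup_i E i.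
    apply/seteqP; split=> [q _|//]; exists (pickle (k n q.1)); first exact: I.
    by rewrite /E pickleK.
  apply/measurable_fun_bigcup => // i.
  rewrite /E; case: (unpickle i) (mE i) => [c|_]; last by apply: measurable_fun_set0.
  move=> _; apply: (@eq_measurable_fun _ _ _ _ _ (fun q : R * R => f (c%:~R / n.+1%:R) q.2)).
    by move=> q; rewrite inE /= => <-.
  by apply: measurable_funTS; apply: measurableT_comp.
move=> q _; apply: cvg_comp (cf q.2 q.1).
apply/cvgrPdist_le => e e0; have /cvgrPdist_lt/(_ e e0)[N _ hN] := @eps_cvg R.
exists N => // n /hN /=; rewrite sub0r normrN ger0_norm ?(ltW (eps_gt0 n))// => h.
apply: le_trans (ltW h); rewrite /eps /k; have n0 : 0 < n.+1%:R :> R by rewrite ltr0n.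
have h1 := floor_le_tmp (n.+1%:R * q.1); have h2 := floorD1_gt (n.+1%:R * q.1).
have -> : q.1 - (Num.floor (n.+1%:R * q.1))%:~R / n.+1%:R =
   (n.+1%:R * q.1 - (Num.floor (n.+1%:R * q.1))%:~R) / n.+1%:R.
  by field; rewrite gt_eqF.
rewrite ger0_norm ?divr_ge0 ?subr_ge0// -[leRHS]mul1r ler_wpM2r ?invr_ge0 ?(ltW n0)//.
by rewrite lerBlDl; move: h2; rewrite intrD => /ltW.
Qed.

(** Tonelli for the nonnegative excess over C: its double integral is 0 in one order, hence in the
    other. *)
Lemma ae_swap (f : R -> R -> R) (C : R) : measurable_fun setT (fun q : R * R => f q.1 q.2) ->
  (forall s, {ae mu, forall l, f s l <= C}) -> {ae mu, forall l, {ae mu, forall s, f s l <= C}}.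
Proof.
move=> mf h; pose G s l := Num.max (f s l - C) 0.
have mG : measurable_fun setT (fun q : R * R => G q.1 q.2).
  by apply: measurable_maxr; [exact: measurable_funB|exact: measurable_cst].
have G0 s l : 0 <= G s l by rewrite le_max lexx orbT.
have Gz s l : (G s l == 0) = (f s l <= C).
  rewrite /G; case: (leP (f s l) C) => h'; first by rewrite max_r ?eqxx ?subr_le0.
  by rewrite max_l ?gt_eqF ?subr_gt0 ?subr_ge0// ltW.
have mGs s : measurable_fun setT (G s) by exact: (measurableT_comp mG (measurable_pair1 s)).
have mGl l : measurable_fun setT (fun s => G s l) by exact: (measurableT_comp mG (measurable_pair2 l)).
have mG' : measurable_fun setT (fun q : R * R => G q.2 q.1).
  have -> : (fun q : R * R => G q.2 q.1) = (fun q : R * R => G q.1 q.2) \o (fun q => (q.2, q.1)) by [].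
  by apply: (measurableT_comp mG); exact: measurable_fun_pair.
have mI := @measurable_tonelli R (fun l s => G s l) mG' (fun l s => G0 s l).
have z : (\int[mu]_l \int[mu]_s (G s l)%:E = 0)%E.
  rewrite -(tonelli_swap mG)//; apply: integral0_eq => s _.
  rewrite (ae_eq_integral (cst 0%E)) ?integral0//.
  - by apply/measurable_EFinP; exact: mGs.
  - by move: (h s); apply: aeS => l; rewrite -Gz => /eqP -> _.
have : {ae mu, forall l, (\int[mu]_s (G s l)%:E = 0)%E}.
  have := (ae_eq_integral_abs mu measurableT mI).1.
  have -> : (\int[mu]_x `|\int[mu]_s (G s x)%:E|)%E = 0%E.
    by rewrite -[RHS]z; apply: eq_integral => l _; rewrite gee0_abs// integral_ge0// => s _; rewrite lee_fin.
  by move=> /(_ erefl); apply: aeS => l /(_ I).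
apply: aeS => l zl.
have mGE : measurable_fun setT (fun s => (G s l)%:E) by apply/measurable_EFinP; exact: mGl.
have := (ae_eq_integral_abs mu measurableT mGE).1.
have -> : (\int[mu]_s `|(G s l)%:E|)%E = 0%E.
  by rewrite -[RHS]zl; apply: eq_integral => s _; rewrite gee0_abs// lee_fin.
move=> /(_ erefl); apply: aeS => s /(_ I); rewrite /= => -[] /eqP.
by rewrite Gz.
Qed.

Lemma intg_itv n : intg (trunc n (fun=> 1)).
Proof.
have := intg_trunc n (@L2_itv R n); apply: eq_integrable => // l _.
by rewrite /= /trunc; case: (_ <= _).
Qed.

Section ParametricMeanValue.
Variables (f g : R -> R -> R) (B : R).
Hypothesis df : forall l s, is_derive s (1:R) (f^~ l) (g s l).
Hypothesis gB : {ae mu, forall l, forall s, `|g s l| <= B}.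
Hypothesis mf : forall s, measurable_fun setT (f s).
Hypothesis mg : forall s, measurable_fun setT (g s).

(** The mean value theorem is applied to the scalar function s -> \int (f s - f 0) phi. Pointwise in
    l the intermediate point would depend on l, and norms at a fixed s could not be used. *)
Lemma pair_mvt phi (h : R) : intg phi -> exists2 y, `|y| <= `|h| &
  \int[mu]_l ((f h l - f 0 l) * phi l) = h * \int[mu]_l (g y l * phi l).
Proof.
move=> ip; have mp : measurable_fun setT phi by exact: intg_mf.
pose Phi s := \int[mu]_l ((f s l - f 0 l) * phi l).
have ia : intg (fun l => `|phi l|) by have := integrable_abse ip; apply: eq_integrable.
have mfp s : measurable_fun setT (fun l => (f s l - f 0 l) * phi l).
  by apply: measurable_funM => //; exact: measurable_funB.
have lip s r : {ae mu, forall l, `|f (s + r) l - f s l| <= B * `|r|}.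
  by move: gB; apply: aeS => l hl; apply: (deriv_lip _ _ (df l)).
have iP s : intg (fun l => (f s l - f 0 l) * phi l).
  have ic := intg_cM (B * `|s|) ia.
  have [] := @Rint_dominated (fun=> fun l => (f s l - f 0 l) * phi l) (fun l => (f s l - f 0 l) * phi l)
    (fun l => B * `|s| * `|phi l|) _ _ ic _ _ => //.
    by apply: aeT => l; exact: cvg_cst.
  by move: (lip 0 s); apply: aeS => l; rewrite add0r => h1 _; rewrite normrM ler_wpM2r.
have dPhi s : is_derive s (1:R) Phi (\int[mu]_l (g s l * phi l)).
  apply: is_derive_seq => u u0 cu.
  have E n : (u n)^-1 * (Phi (s + u n) - Phi s) =
      \int[mu]_l ((u n)^-1 * (f (s + u n) l - f s l) * phi l).
    rewrite /Phi -RintegralB// -RintegralZl//; last first.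
      by have := intg_B (iP (s + u n)) (iP s).
    by apply: eq_Rintegral => l _; ring.
  under eq_fun do rewrite E.
  have ic := intg_cM B ia.
  apply: (Rint_dominated _ _ ic _ _).2.
  - move=> n; apply: measurable_funM => //; apply: measurable_funM => //; exact: measurable_funB.
  - exact: measurable_funM.
  - by apply: aeT => l; apply: cvgMl; exact: (deriv_seq (df l s)).
  - have : {ae mu, forall l, forall n, `|f (s + u n) l - f s l| <= B * `|u n|}.
      by apply: ae_foralln => n; exact: lip.
    apply: aeS => l h1 n; rewrite normrM ler_wpM2r// normrM normfV mulrC ler_pdivrMr ?normr_gt0//.
have [y hy e] := deriv_mvt 0 h dPhi; exists y; first by rewrite subr0 in hy.
move: e; rewrite add0r => <-; rewrite [X in _ - X](_ : Phi 0 = 0) ?subr0//.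
by rewrite /Phi; under eq_Rintegral do rewrite subrr mul0r; rewrite /Rintegral integral0.
Qed.

(** Duality: testing the increment r against its own truncation gives |r|^2 = h <g y, r>, and
    Cauchy-Schwarz divides out one factor |r|. The truncation makes r an admissible test function
    and is removed by Fatou. *)
Lemma N2_mvt (h K : R) : 0 <= K -> (forall s, `|s| <= `|h| -> (N2 (g s) <= K%:E)%E) ->
  (N2 (fun l => f h l - f 0 l)%R <= (h ^+ 2 * K)%:E)%E.
Proof.
move=> K0 hK; pose r l := f h l - f 0 l.
have mr : measurable_fun setT r by exact: measurable_funB.
have rB : {ae mu, forall l, `|r l| <= B * `|h|}.
  by move: gB; apply: aeS => l hl; have := deriv_lip 0 h (df l) hl; rewrite add0r.
have Lt n : L2 (trunc n r).
  apply: (L2_le (measurable_trunc n mr) (L2Z (B * `|h|) (L2_itv n))).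
  move: rB; apply: aeS => l hl; rewrite /trunc; case: ifP => _; last by rewrite normr0.
  by rewrite mulr1 (le_trans hl)// ler_norm.
have key n : (N2 (trunc n r) <= (h ^+ 2 * K)%:E)%E.
  have it : intg (trunc n r).
    have h1 := L2M_integrable (Lt n) (L2_itv n); move: h1; apply: eq_integrable => // l _.
    by rewrite /= /trunc; case: ifP => _; rewrite ?mulr1 ?mulr0.
  have [y hy e] := pair_mvt h it.
  have Ly : L2 (g y) by split=> //; apply: le_lt_trans (hK y hy) _; rewrite ltry.
  have E1 : \int[mu]_l ((f h l - f 0 l) * trunc n r l) = fine (N2 (trunc n r)).
    congr fine; apply: eq_integral => l _; congr EFin; rewrite /trunc -/(r l).
    by case: ifP => _; rewrite ?expr2 ?mulr0.
  have := L2_CS Ly (Lt n); have n2 := N2_Rintegral (Lt n); have y2 := N2_Rintegral Ly.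
  have Kb := hK y hy; rewrite -y2 lee_fin in Kb.
  rewrite -n2 lee_fin; move: e; rewrite E1 -n2 /= => e.
  set a := \int[mu]_l (trunc n r l ^+ 2) in e *; set b := \int[mu]_l (g y l ^+ 2) in Kb *.
  set c := \int[mu]_l _ in e *; move=> cs.
  have a0 : 0 <= a by apply: Rintegral_ge0 => t _; rewrite sqr_ge0.
  have : a ^+ 2 <= h ^+ 2 * K * a.
    rewrite e exprMn -mulrA ler_wpM2l ?sqr_ge0// (le_trans cs)// -e ler_wpM2r//.
  have [->|an] := eqVneq a 0; first by rewrite mulr_ge0 ?sqr_ge0.
  by rewrite expr2 ler_pM2r// lt_neqAle eq_sym an.
apply: (@N2_fatou _ (fun n => trunc n r)).
- by move=> n; exact: measurable_trunc.
- exact: mr.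
- by apply: aeT => l; exact: trunc_cvg.
- by exists 0%N => n _; exact: key.
Qed.

Lemma trunc_mvt (h K : R) n :
  (forall s, `|s| <= `|h| -> `|\int[mu]_l (g s l * trunc n (fun=> 1) l)| <= K) ->
  `|\int[mu]_l ((f h l - f 0 l) * trunc n (fun=> 1) l)| <= `|h| * K.
Proof.
move=> hK; have [y hy ->] := pair_mvt h (intg_itv n).
by rewrite normrM ler_wpM2l// hK.
Qed.

End ParametricMeanValue.

Lemma trunc1_le n (l : R) : `|trunc n (fun=> 1 : R) l| <= 1.
Proof. by rewrite /trunc; case: ifP; rewrite ?normr1 ?normr0. Qed.

Lemma Rint_trunc_abs r n : intg r -> `|\int[mu]_l (r l * trunc n (fun=> 1) l)| <= \int[mu]_l `|r l|.
Proof.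
move=> ir; have iy : intg (fun l => r l * trunc n (fun=> 1) l).
  apply: (@intg_bM _ (trunc n (fun=> 1)) r 1) => //; last exact: trunc1_le.
  by apply: measurable_trunc.
apply: (le_trans (le_normr_Rintegral _ iy)) => //; apply: le_Rintegral => //.
- by have := integrable_abse iy; apply: eq_integrable.
- by have := integrable_abse ir; apply: eq_integrable.
- by move=> l _; rewrite normrM ler_piMr// trunc1_le.
Qed.

Lemma Rint_trunc_le r (K : R) : intg r ->
  (forall n, `|\int[mu]_l (r l * trunc n (fun=> 1) l)| <= K) -> `|\int[mu]_l r l| <= K.
Proof.
move=> ir b.
have c : \int[mu]_l (r l * trunc n (fun=> 1) l) @[n --> \oo] --> \int[mu]_l r l.
  have ia : intg (fun l => `|r l|) by have := integrable_abse ir; apply: eq_integrable.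
  have mr : measurable_fun setT r by exact: intg_mf.
  apply: (Rint_dominated _ _ ia _ _).2 => //.
  - move=> n; apply: measurable_funM => //; by apply: measurable_trunc.
  - apply: aeT => l; rewrite -[X in _ --> X]mulr1; apply: cvgMr; exact: trunc_cvg.
  - by apply: aeT => l n; rewrite normrM ler_piMr// trunc1_le.
apply/ler_addgt0Pr => e e0; have /cvgrPdist_le/(_ e e0)[N _ /(_ N (leqnn N)) hN] := c.
rewrite -[X in `|X|](subrK (\int[mu]_l (r l * trunc N (fun=> 1) l))) addrC.
by apply: (le_trans (ler_normD _ _)); exact: lerD.
Qed.

(** Write f = pk e u with u = f (t^2 + e^2)/e and use [weighted_CS], the weight having mass pi. The
    free e lets a small norm of f outweigh a merely bounded norm of t f. *)
Lemma Rint_weighted f (e : R) : 0 < e -> measurable_fun setT f ->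
  L2 f -> L2 (fun t => t * f t) ->
  (\int[mu]_t f t) ^+ 2 <= pi * e * \int[mu]_t (f t ^+ 2) + pi / e * \int[mu]_t ((t * f t) ^+ 2).
Proof.
move=> e0 mf hf htf.
pose u t := f t * (t ^+ 2 + e ^+ 2) / e.
have E : (fun t => f t) = (fun t => pk e t * u t).
  apply/funext => t; rewrite /pk /u; have D := den_gt0 t e0; field; rewrite !gt_eqF//.
have mden : measurable_fun setT (fun t : R => t ^+ 2 + e ^+ 2).
  by apply: measurable_funD => //; exact: measurable_funX.
have mu_ : measurable_fun setT u by apply: measurable_funM => //; exact: measurable_funM.
have ip : (\int[mu]_t (pk e t)%:E <= pi%:E)%E.
  by rewrite -(integral_pk 0 e0) le_eqVlt; apply/orP; left; apply/eqP; apply: eq_integral => t _; rewrite subr0.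
have := weighted_CS (pi_gt0 _) (measurable_pk e0) mu_ (fun t => pk_ge0 t e0) ip.
have -> : \int[mu]_t (pk e t * u t) = \int[mu]_t f t by congr (Rintegral _ _ _); rewrite -E.
have -> : (\int[mu]_t (pk e t * u t ^+ 2)%:E = (e * \int[mu]_t (f t ^+ 2) + e^-1 * \int[mu]_t ((t * f t) ^+ 2))%:E)%E.
  have i1 := intg_cM e (L2_sqr_integrable hf); have i2 := intg_cM e^-1 (L2_sqr_integrable htf).
  rewrite -!RintegralZl//; [|exact: L2_sqr_integrable|exact: L2_sqr_integrable].
  rewrite -RintegralD//.
  transitivity (\int[mu]_t (e * f t ^+ 2 + e^-1 * (t * f t) ^+ 2)%:E)%E.
    apply: eq_integral => t _; congr EFin; rewrite /pk /u.
    by have D := den_gt0 t e0; field; rewrite !gt_eqF.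
  by rewrite /Rintegral fineK//; apply: integrable_fin_num => //; exact: intg_D.
by rewrite -EFinM lee_fin mulrDr !mulrA.
Qed.

End RealLemmas.

(** * Derivatives of the scattering data *)

Section MatrixDerivatives.
Context {R : realType} {n : nat}.
Local Notation mu := (@lebesgue_measure R).
Local Notation intg f := (mu.-integrable setT (EFin \o f)).
Local Notation Re := complex.Re.
Local Notation Im := complex.Im.
Local Notation M := 'M[R[i]]_n.
Implicit Types (F G : R -> M) (s c l : R).

Definition mxisd F s (A : M) := forall i j,
  is_derive s (1:R) (fun r => Re (F r i j)) (Re (A i j)) /\
  is_derive s (1:R) (fun r => Im (F r i j)) (Im (A i j)).

Lemma mxisd_derivable F s A : mxisd F s A -> mxderivable F s.
Proof.
by move=> h i j; have [h1 h2] := h i j; split; [case: h1|case: h2].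
Qed.

Lemma mxisd_der F s A : mxisd F s A -> mxder F s = A.
Proof.
move=> h; apply/matrixP => i j; rewrite mxE; have [h1 h2] := h i j.
by apply: complex_ext => /=; rewrite derive1E derive_val.
Qed.

Lemma mxderivable_isd F s : mxderivable F s -> mxisd F s (mxder F s).
Proof.
move=> h i j; have [h1 h2] := h i j; rewrite mxE; split; constructor.
- exact h1.
- by rewrite /= derive1E.
- exact h2.
- by rewrite /= derive1E.
Qed.

Lemma mxisd_ext F G s A : (forall r, F r = G r) -> mxisd F s A -> mxisd G s A.
Proof. by move=> FG; rewrite (_ : F = G)//; apply/funext. Qed.

Lemma mxder_shift F c s : mxder (fun r => F (r + c)) s = mxder F (s + c).
Proof.
have E (f : R -> R) : derive1 (fun r => f (r + c)) s = derive1 f (s + c).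
  by rewrite /derive1; under eq_fun do rewrite -addrA.
apply/matrixP => i j; rewrite !mxE; congr (_ +i* _).
  exact: (E (fun r => Re (F r i j))).
exact: (E (fun r => Im (F r i j))).
Qed.

Lemma mxder_subc F (A : M) s : mxder (fun r => F r - A) s = mxder F s.
Proof.
have E (f : R -> R) (a : R) : derive1 (fun r => f r - a) s = derive1 f s.
  by rewrite /derive1; under eq_fun do rewrite opprB addrA subrK.
apply/matrixP => i j; rewrite !mxE; congr (_ +i* _).
  apply: (etrans _ (E (fun r => Re (F r i j)) (Re (A i j)))); congr (derive1 _ s).
  by apply/funext => r; rewrite !mxE cReB.
apply: (etrans _ (E (fun r => Im (F r i j)) (Im (A i j)))); congr (derive1 _ s).
by apply/funext => r; rewrite !mxE cImB.
Qed.

Lemma mxisdZ (z : R[i]) F s A : mxisd F s A -> mxisd (fun r => z *: F r) s (z *: A).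
Proof.
move=> h i j; have [h1 h2] := h i j; split.
  rewrite (_ : (fun r => _) = (Re z \*: (fun r => Re (F r i j))) - (Im z \*: (fun r => Im (F r i j)))).
    have -> : Re ((z *: A) i j) = Re z *: Re (A i j) - Im z *: Im (A i j) by rewrite mxE cReM.
    exact: is_deriveB.
  by apply/funext => r; rewrite mxE cReM.
rewrite (_ : (fun r => _) = (Re z \*: (fun r => Im (F r i j))) + (Im z \*: (fun r => Re (F r i j)))).
  have -> : Im ((z *: A) i j) = Re z *: Im (A i j) + Im z *: Re (A i j) by rewrite mxE cImM.
  exact: is_deriveD.
by apply/funext => r; rewrite mxE cImM.
Qed.

Lemma mxisdD F G s A B : mxisd F s A -> mxisd G s B -> mxisd (fun r => F r + G r) s (A + B).
Proof.
move=> h g i j; have [h1 h2] := h i j; have [g1 g2] := g i j; split.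
  rewrite mxE cReD (_ : (fun r => _) = (fun r => Re (F r i j)) + (fun r => Re (G r i j))).
    exact: is_deriveD.
  by apply/funext => r; rewrite mxE cReD.
rewrite mxE cImD (_ : (fun r => _) = (fun r => Im (F r i j)) + (fun r => Im (G r i j))).
  exact: is_deriveD.
by apply/funext => r; rewrite mxE cImD.
Qed.

Lemma mxisd_cst (A : M) s : mxisd (fun=> A) s 0.
Proof. by move=> i j; rewrite mxE; split; exact: is_derive_cst. Qed.

Lemma mxisd_affine F c l s A : mxisd F (c + l * s) A -> mxisd (fun r => F (c + l * r)) s (l%:C *: A).
Proof.
have E (f : R -> R) d : is_derive (c + l * s) (1:R) f d -> is_derive s (1:R) (fun r => f (c + l * r)) (l * d).
  move=> df; have da : is_derive s (1:R) (fun r => c + l * r) l.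
    rewrite (_ : (fun r => _) = cst c + l \*: (id : R -> R)).
      apply: (is_derive_eq (is_deriveD (is_derive_cst c s (1:R)) (is_deriveZ l (is_derive_id s (1:R))))).
      by rewrite add0r [_ *: _]mulr1.
    by apply/funext => r.
  have := @is_derive1_comp _ f (fun r => c + l * r) s d l df da.
  by rewrite mulrC.
move=> h i j; have [h1 h2] := h i j; rewrite mxE; split.
  by rewrite cReM /= mul0r subr0; exact: (E (fun r => Re (F r i j))).
by rewrite cImM /= mul0r addr0; exact: (E (fun r => Im (F r i j))).
Qed.

End MatrixDerivatives.

(** * From norms in L_p to squares and entries *)

Section NormConversions.
Context {R : realType} {n : nat}.
Local Notation mu := (@lebesgue_measure R).
Local Notation intg f := (mu.-integrable setT (EFin \o f)).
Local Notation Re := complex.Re.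
Local Notation Im := complex.Im.
Local Notation M := 'M[R[i]]_n.
Implicit Types (F G : R -> M).

Lemma mN2_Lnorm F : mN2 F = (mxLnorm 2%:E F * mxLnorm 2%:E F)%E.
Proof.
have := @poweR_Lnorm _ _ R mu (fun t => (mxnorm (F t))%:E) 2 _.
rewrite -/(mxLnorm 2%:E F) => /(_ ltac:(by rewrite pnatr_eq0)) h.
have -> : mN2 F = (\int[mu]_x (`|(mxnorm (F x))%:E| `^ 2))%E.
  apply: eq_integral => t _; rewrite abse_EFin poweR_EFin; congr EFin.
  by rewrite powR_mulrn ?normr_ge0// real_normK ?num_real.
rewrite -h; have := Lnorm_ge0 mu 2%:E (fun t => (mxnorm (F t))%:E); rewrite -/(mxLnorm 2%:E F).
case: (mxLnorm 2%:E F) => [r||]//; last by rewrite poweRyr ?pnatr_eq0// mulyy.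
by rewrite lee_fin => r0; rewrite poweR_EFin -EFinM powR_mulrn// expr2.
Qed.

Lemma mxL2_mN2 F (C : R) : (mxLnorm 2%:E F <= C%:E)%E -> (mN2 F <= (C ^+ 2)%:E)%E.
Proof.
move=> h; have l0 := Lnorm_ge0 mu 2%:E (fun t => (mxnorm (F t))%:E).
by rewrite mN2_Lnorm expr2 EFinM; apply: lee_pmul.
Qed.

Lemma mxLoo_ae F (C : R) : (mxLnorm +oo%E F <= C%:E)%E -> {ae mu, forall t, q (F t) <= C ^+ 2}.
Proof.
rewrite /mxLnorm unlock ifT; last first.
  have : (0 < mu `]-oo, +oo[%classic)%E by rewrite lebesgue_measure_itv/= ltry.
  by rewrite set_itvNyy.
move=> /ess_supP; apply: aeS => t /=; rewrite lee_fin => h.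
by rewrite /q -(ger0_norm (mxnorm_ge0 _)) lerXn2r ?nnegrE// (le_trans _ h).
Qed.

Lemma mxL1_entry F (C : R) : mxmeasurable F -> (mxLnorm 1%E F <= C%:E)%E ->
  mxintegrable F /\ forall i j, \int[mu]_t `|Re (F t i j)| <= C /\ \int[mu]_t `|Im (F t i j)| <= C.
Proof.
move=> mF; rewrite /mxLnorm Lnorm1 => h.
have mn : measurable_fun setT (fun t => mxnorm (F t)).
  have -> : (fun t => mxnorm (F t)) = Num.sqrt \o (fun t => q (F t)).
    by apply/funext => t; rewrite /= sqrtr_sqr ger0_norm// mxnorm_ge0.
  by apply: measurableT_comp; [apply: continuous_measurable_fun; exact: sqrt_continuous|exact: measurable_q].
have E (f : R -> R) : measurable_fun setT f -> (forall t, f t ^+ 2 <= q (F t)) -> intg f /\ \int[mu]_t `|f t| <= C.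
  move=> mf fq; have le1 t : `|f t| <= mxnorm (F t).
    rewrite -(@ler_pXn2r _ 2)// ?nnegrE ?mxnorm_ge0// real_normK ?num_real//; exact: fq.
  have le2 : (\int[mu]_t `|f t|%:E <= C%:E)%E.
    apply: le_trans h; apply: ge0_le_int.
    - by move=> t; rewrite lee_fin.
    - by apply/measurable_EFinP; exact: measurableT_comp.
    - by apply: measurableT_comp => //; exact/measurable_EFinP.
    - by move=> t; rewrite abse_EFin lee_fin (ger0_norm (mxnorm_ge0 _)).
  split; first by apply/integrableP; split; [exact/measurable_EFinP|exact: le_lt_trans le2 (ltry _)].
  rewrite -lee_fin /Rintegral fineK//; rewrite ge0_fin_numE; first exact: le_lt_trans le2 (ltry _).
  by apply: integral_ge0 => t _; rewrite lee_fin.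
split=> i j; have [m1 m2] := mF i j;
  have [a1 b1] := E _ m1 (fun t => q_Re (F t) i j); have [a2 b2] := E _ m2 (fun t => q_Im (F t) i j); by split.
Qed.

End NormConversions.

(** * The profile of v and bounds off a single null set of spectral parameters *)

Section ScatteringData.
Context {R : realType} {n : nat}.
Local Notation mu := (@lebesgue_measure R).
Local Notation intg f := (mu.-integrable setT (EFin \o f)).
Local Notation Re := complex.Re.
Local Notation Im := complex.Im.
Local Notation M := 'M[R[i]]_n.
Implicit Types (p : R * R) (b : bool).

(* The direction b is x for true, y for false. *)
Definition sh b (h : R) p : R * R := if b then (p.1 + h, p.2) else (p.1, p.2 + h).
Definition incx b (i : nat) := if b then i.+1 else i.
Definition incy b (j : nat) := if b then j else j.+1.

Lemma incxy b i j : (incx b i + incy b j)%N = (i + j).+1.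
Proof. by case: b; rewrite /incx /incy ?addSn ?addnS. Qed.

Lemma sh0 b p : sh b 0 p = p.
Proof. by case: b; rewrite /sh addr0; case: p. Qed.

Lemma unif_bound (K : nat) (P : nat -> nat -> R -> Prop) :
  (forall i j c c', c <= c' -> P i j c -> P i j c') -> (forall i j, (i + j <= K)%N -> exists c, P i j c) ->
  exists2 c, 0 <= c & forall i j, (i + j <= K)%N -> P i j c.
Proof.
move=> mono ex; have : forall ij : nat * nat, exists c, (ij.1 + ij.2 <= K)%N -> P ij.1 ij.2 c.
  move=> [i j]; have [h|h] := boolP (i + j <= K)%N; first by have [c hc] := ex i j h; exists c.
  by exists 0.
(* A sum of absolute values serves as maximum over the finitely many pairs (i, j). *)
move=> /choice[c hc]; exists (\sum_(i < K.+1) \sum_(j < K.+1) `|c (nat_of_ord i, nat_of_ord j)|).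
  by do 2 apply: sumr_ge0 => ? _.
move=> i j ij; apply: (mono i j (c (i, j))); last exact: (hc (i, j)).
have hi : (i < K.+1)%N by rewrite ltnS (leq_trans _ ij)// leq_addr.
have hj : (j < K.+1)%N by rewrite ltnS (leq_trans _ ij)// leq_addl.
apply: (le_trans (ler_norm _)).
rewrite (bigD1 (Ordinal hi))//= (bigD1 (Ordinal hj))//= -addrA lerDl addr_ge0//.
  by apply: sumr_ge0.
by do 2 apply: sumr_ge0 => ? _.
Qed.

Variables (k : nat) (v : R -> R -> R -> M).
Hypotheses (hk : (7 <= k)%N) (hv : scatdata k v).
Let K := (k - 4)%N.

Definition vder i j p l : M := pd i j (fun x y => v x y l - 1%:M) p.1 p.2.
(* v(x, y, l) = v(x + l y, 0, l). *)
Definition wder m l : R -> M := iter m mxder (fun s => v s 0 l - 1%:M).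

Lemma v_travel x y l : v x y l = v (x + l * y) 0 l.
Proof. by have [w hw] := scat_travel hv; rewrite !hw mulr0 addr0. Qed.

Lemma iter_Dx m l (F : R -> R -> M) (u : R -> M) : (forall x y, F x y = u (x + l * y)) ->
  iter m Dx F = fun x y => iter m mxder u (x + l * y).
Proof.
move=> hF; elim: m => [|m IH] /=; first by apply/funext => x; apply/funext => y.
rewrite IH; apply/funext => x; apply/funext => y.
by rewrite /Dx (mxder_shift (iter m mxder u)).
Qed.

Lemma wder_S m l : wder m.+1 l = iter m.+1 mxder (fun s => v s 0 l).
Proof.
rewrite /wder !iterSr; congr iter; apply/funext => s; exact: mxder_subc.
Qed.

(** At y = 0 the x-derivatives of v are the derivatives of the profile, so [scat_diff] applies; the
    subtracted identity is visible only for m = 0. *)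
Lemma wder_isd m l s : (m < K)%N -> mxisd (wder m l) s (wder m.+1 l s).
Proof.
move=> mK.
have H : mxisd (iter m mxder (fun s => v s 0 l)) s (wder m.+1 l s).
  have [+ _] := @scat_diff _ _ _ _ hv l m 0%N ltac:(by rewrite addn0) s 0.
  have e : pd m 0 (fun x y => v x y l) = fun x y => iter m mxder (fun s => v s 0 l) (x + l * y).
    by apply: iter_Dx => x y; exact: v_travel.
  rewrite /derivable_x e wder_S iterS.
  under eq_fun do rewrite mulr0 addr0.
  exact: mxderivable_isd.
case: m mK H => [|m] mK H; last by rewrite wder_S.
rewrite -[X in mxisd _ _ X]addr0; apply: mxisdD H _; exact: mxisd_cst.
Qed.

(** Chain rule for a function of x + l y: every y-derivative brings a factor l. *)
Lemma pdE i j l : (i + j <= K)%N -> pd i j (fun x y => v x y l - 1%:M) =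
  fun x y => (l ^+ j)%:C *: wder (i + j) l (x + l * y).
Proof.
elim: j => [|j IH] ij.
  rewrite /pd /= addn0 (@iter_Dx _ l _ (fun s => v s 0 l - 1%:M)); last by move=> x y; rewrite v_travel.
  by apply/funext => x; apply/funext => y; rewrite expr0 scale1r.
rewrite /pd iterS -/(pd i j _) IH; last by rewrite (leq_trans _ ij)// leq_add2l.
apply/funext => x; apply/funext => y; rewrite /Dy; apply: mxisd_der.
have := mxisdZ (l ^+ j)%:C (mxisd_affine (@wder_isd (i + j) l (x + l * y) _)).
rewrite -addnS => /(_ ij); rewrite scalerA.
by rewrite exprSr rmorphM.
Qed.

Lemma vderE i j p l : (i + j <= K)%N -> vder i j p l = (l ^+ j)%:C *: wder (i + j) l (p.1 + l * p.2).
Proof. by move=> ij; rewrite /vder pdE. Qed.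

Lemma vder0 p l : vder 0 0 p l = v p.1 p.2 l - 1%:M. Proof. by []. Qed.

Definition slope b (l : R) : R := if b then 1 else l.

Lemma vder_sh b i j p l h : (i + j <= K)%N ->
  vder i j (sh b h p) l = (l ^+ j)%:C *: wder (i + j) l (p.1 + l * p.2 + slope b l * h).
Proof.
by move=> ij; rewrite vderE//; congr (_ *: wder _ _ _); rewrite /sh /slope; case: b => /=; ring.
Qed.

Lemma vder_isd b i j p l h : (i + j < K)%N ->
  mxisd (fun h => vder i j (sh b h p) l) h (vder (incx b i) (incy b j) (sh b h p) l).
Proof.
move=> ij.
have -> : vder (incx b i) (incy b j) (sh b h p) l =
    (l ^+ j)%:C *: ((slope b l)%:C *: wder (i + j).+1 l (p.1 + l * p.2 + slope b l * h)).
  rewrite vder_sh incxy// scalerA -rmorphM; congr (_%:C *: _).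
  by rewrite /slope /incy; case: b; rewrite ?mulr1 ?exprSr.
apply: (@mxisd_ext _ _ (fun r => (l ^+ j)%:C *: wder (i + j) l (p.1 + l * p.2 + slope b l * r))).
  by move=> r; rewrite vder_sh// ltnW.
by apply: mxisdZ; apply: mxisd_affine; exact: wder_isd.
Qed.

Lemma vder_meas i j p : (i + j <= K)%N -> mxmeasurable (vder i j p).
Proof. by move=> ij; exact: (scat_meas hv). Qed.

Lemma wder_meas m s : (m <= K)%N -> mxmeasurable (fun l => wder m l s).
Proof.
move=> mK; have := @vder_meas m 0 (s, 0) ltac:(by rewrite addn0).
congr mxmeasurable; apply/funext => l; rewrite vderE ?addn0//= expr0 scale1r.
by rewrite mulr0 addr0.
Qed.

(** Below the top order the derivatives are continuous in s, so [cara_measurable] applies. At order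
    K only existence is known, and the function is a limit of difference quotients of the preceding
    order. *)
Lemma wder_joint m a d : (m <= K)%N ->
  measurable_fun setT (fun w : R * R => Re (wder m w.2 w.1 a d)) /\
  measurable_fun setT (fun w : R * R => Im (wder m w.2 w.1 a d)).
Proof.
have step r : (r < K)%N -> measurable_fun setT (fun w : R * R => Re (wder r w.2 w.1 a d)) /\
    measurable_fun setT (fun w : R * R => Im (wder r w.2 w.1 a d)).
  move=> rK; split.
    apply: (@cara_measurable _ (fun s l => Re (wder r l s a d))).
      by move=> l s; exact: is_derive_cont ((wder_isd l s rK) a d).1.
    by move=> s; exact: (wder_meas s (ltnW rK) a d).1.
  apply: (@cara_measurable _ (fun s l => Im (wder r l s a d))).
    by move=> l s; exact: is_derive_cont ((wder_isd l s rK) a d).2.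
  by move=> s; exact: (wder_meas s (ltnW rK) a d).2.
rewrite leq_eqVlt => /orP[/eqP mK|]; last exact: step.
have [r rm] : exists r, m = r.+1.
  by exists m.-1; rewrite prednK// mK /K; lia.
have rK : (r < K)%N by rewrite -mK rm.
have [s1 s2] := step r rK; rewrite rm.
have msh (c : R) : measurable_fun setT (fun w : R * R => (w.1 + c, w.2)).
  by apply: measurable_fun_pair => //; apply: measurable_funD.
have e0 m' : eps m' != 0 :> R by rewrite gt_eqF ?eps_gt0.
split.
  apply: (@measurable_fun_cvg _ _ _ _ (fun m' (w : R * R) =>
     (eps m')^-1 * (Re (wder r w.2 (w.1 + eps m') a d) - Re (wder r w.2 w.1 a d)))).
    move=> m'; apply: measurable_funM => //; apply: measurable_funB => //.
    exact: (measurableT_comp s1 (msh (eps m'))).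
  move=> w _; exact: (deriv_seq ((wder_isd w.2 w.1 rK) a d).1 e0 (@eps_cvg R)).
apply: (@measurable_fun_cvg _ _ _ _ (fun m' (w : R * R) =>
   (eps m')^-1 * (Im (wder r w.2 (w.1 + eps m') a d) - Im (wder r w.2 w.1 a d)))).
  move=> m'; apply: measurable_funM => //; apply: measurable_funB => //.
  exact: (measurableT_comp s2 (msh (eps m'))).
move=> w _; exact: (deriv_seq ((wder_isd w.2 w.1 rK) a d).2 e0 (@eps_cvg R)).
Qed.

Lemma ae_cont_le (f : R -> R) (C : R) : continuous f -> {ae mu, forall s, f s <= C} -> forall s, f s <= C.
Proof.
move=> cf h s; rewrite leNgt; apply/negP => hs.
have /cvgrPdist_lt/(_ (f s - C)) := cf s; rewrite subr_gt0 => /(_ hs)/nbhs_ballP[r /= r0 hr].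
have r4 : 0 < r / 2 by lra.
have [U [oU NU Ur]] := null_cover h r4.
pose J := `](s - r / 2), (s + r / 2)[%classic.
have sub : J `<=` U.
  move=> t; rewrite /J/= in_itv/= => /andP[t1 t2]; apply: NU => /=; apply/negP; rewrite -ltNge.
  have : `|f s - f t| < f s - C by apply: hr; rewrite /ball/= ltr_norml; apply/andP; split; lra.
  by rewrite ltr_norml => /andP[_]; lra.
have mU : measurable (U : set (measurableTypeR R)) by exact: open_measurable.
have mJ : measurable (J : set (measurableTypeR R)) by exact: measurable_itv.
have : (mu J <= mu U)%E by apply: le_measure; rewrite ?inE.
move=> /le_trans/(_ Ur); rewrite /J lebesgue_measure_itv/= lte_fin ifT; last by lra.
by rewrite -EFinD lee_fin; lra.
Qed.

(** [ae_swap] puts the null set of l first, leaving a bound for almost all s; continuity or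
    [ae_deriv_bound] extends it to all s. *)
Lemma vder_ae_entry (C : R) (f g : R -> R -> R) (m : nat) : 0 <= C ->
  measurable_fun setT (fun w : R * R => g w.1 w.2) ->
  (forall s, {ae mu, forall l, `|g s l| <= C}) ->
  ((forall l, continuous (g^~ l)) \/ (forall l s, is_derive s (1:R) (f^~ l) (g s l))) ->
  {ae mu, forall l, forall s, `|g s l| <= C}.
Proof.
move=> C0 mg h cd; have mn : measurable_fun setT (fun w : R * R => `|g w.1 w.2|) by exact: measurableT_comp.
have := ae_swap mn h; apply: aeS => l hl s; case: cd => [cg|df].
  by apply: (ae_cont_le _ hl) => r; apply: cvg_norm; exact: cg.
exact: (ae_deriv_bound C0 (df l) hl).
Qed.

(** The L_oo bounds hold, for each (x, y), off a null set of l depending on (x, y). Mean value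
    arguments at fixed l need one null set for all points. *)
Lemma vder_ae : exists2 C : R, 0 <= C & {ae mu, forall l, forall i j, (i + j <= K)%N ->
  forall p, q (vder i j p l) <= C}.
Proof.
have [C C0 hC] : exists2 C : R, 0 <= C & forall i j, (i + j <= K)%N ->
    {ae mu, forall l, forall s, q ((l ^+ j)%:C *: wder (i + j) l s) <= C}.
  apply: unif_bound.
    by move=> i j c c' cc'; apply: aeS => l h s; exact: le_trans (h s) cc'.
  move=> i j ij; have [c hc] := @scat_bounded _ _ _ _ hv i j ij +oo%E ltac:(by rewrite !inE eqxx !orbT).
  pose C := `|c|; have C0 : 0 <= C by rewrite normr_ge0.
  have B s : {ae mu, forall l, q ((l ^+ j)%:C *: wder (i + j) l s) <= C ^+ 2}.
    have := mxLoo_ae (hc s 0); apply: aeS => l.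
    rewrite -/(vder i j (s, 0) l) vderE//= mulr0 addr0 => h; apply: (le_trans h).
    by rewrite /C real_normK// num_real.
  have nr (x : R) : x ^+ 2 <= C ^+ 2 -> `|x| <= C.
    by move=> h; rewrite -(@ler_pXn2r _ 2)// ?nnegrE// real_normK ?num_real.
  have mm a d : measurable_fun setT (fun w : R * R => Re (((w.2 ^+ j)%:C *: wder (i + j) w.2 w.1) a d)) /\
      measurable_fun setT (fun w : R * R => Im (((w.2 ^+ j)%:C *: wder (i + j) w.2 w.1) a d)).
    have [j1 j2] := wder_joint a d ij.
    have mp : measurable_fun setT (fun w : R * R => w.2 ^+ j) by apply: measurable_funX.
    split; first by under eq_fun do rewrite mxE cReM /= mul0r subr0; exact: measurable_funM.
    by under eq_fun do rewrite mxE cImM /= mul0r addr0; exact: measurable_funM.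
  have K0 : (0 < K)%N by rewrite /K; lia.
  have isd r : (r < K)%N -> forall l s, mxisd (fun s => (l ^+ j)%:C *: wder r l s) s ((l ^+ j)%:C *: wder r.+1 l s).
    by move=> rK l s; apply: mxisdZ; exact: wder_isd.
  have E1 a d : {ae mu, forall l, forall s, `|Re (((l ^+ j)%:C *: wder (i + j) l s) a d)| <= C}.
    apply: (@vder_ae_entry C (fun s l => Re (((l ^+ j)%:C *: wder (i + j).-1 l s) a d))
      (fun s l => Re (((l ^+ j)%:C *: wder (i + j) l s) a d)) 0%N C0 (mm a d).1).
      by move=> s; move: (B s); apply: aeS => l h; apply: nr; apply: le_trans h; exact: q_Re.
    (* Order 0 is differentiable, hence continuous, in s; a higher order is the derivative of the
       preceding one, and at order K nothing more is available. *)
    case: (i + j)%N ij isd => [|r] rK isd.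
      by left => l s; exact: is_derive_cont (isd 0%N K0 l s a d).1.
    by right => l s; exact: (isd r rK l s a d).1.
  have E2 a d : {ae mu, forall l, forall s, `|Im (((l ^+ j)%:C *: wder (i + j) l s) a d)| <= C}.
    apply: (@vder_ae_entry C (fun s l => Im (((l ^+ j)%:C *: wder (i + j).-1 l s) a d))
      (fun s l => Im (((l ^+ j)%:C *: wder (i + j) l s) a d)) 0%N C0 (mm a d).2).
      by move=> s; move: (B s); apply: aeS => l h; apply: nr; apply: le_trans h; exact: q_Im.
    case: (i + j)%N ij isd => [|r] rK isd.
      by left => l s; exact: is_derive_cont (isd 0%N K0 l s a d).2.
    by right => l s; exact: (isd r rK l s a d).2.
  exists (\sum_(a < n) \sum_(b < n) (C ^+ 2 + C ^+ 2)).
  have F1 : {ae mu, forall l, forall a d s, `|Re (((l ^+ j)%:C *: wder (i + j) l s) a d)| <= C}.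
    by apply: ae_fin => a; apply: ae_fin => d; exact: E1.
  have F2 : {ae mu, forall l, forall a d s, `|Im (((l ^+ j)%:C *: wder (i + j) l s) a d)| <= C}.
    by apply: ae_fin => a; apply: ae_fin => d; exact: E2.
  move: F1 F2; apply: aeS2 => l f1 f2 s; rewrite qE; do 2 apply: ler_sum => ? _.
  have sq (x : R) : `|x| <= C -> x ^+ 2 <= C ^+ 2.
    by move=> h; rewrite -(real_normK (num_real x)) lerXn2r ?nnegrE.
  by apply: lerD; apply: sq; [exact: f1|exact: f2].
exists C => //.
have : {ae mu, forall l, forall i, forall j, (i + j <= K)%N -> forall s, q ((l ^+ j)%:C *: wder (i + j) l s) <= C}.
  apply: ae_foralln => i; apply: ae_foralln => j.
  have [ij|ij] := boolP (i + j <= K)%N; first by move: (hC i j ij); apply: aeS.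
  by apply: aeT.
by apply: aeS => l h i j ij p; rewrite vderE//; exact: h.
Qed.

End ScatteringData.

(** * Mean value estimates for matrix functions *)

Section MatrixMeanValue.
Context {R : realType} {n : nat}.
Local Notation mu := (@lebesgue_measure R).
Local Notation intg f := (mu.-integrable setT (EFin \o f)).
Local Notation Re := complex.Re.
Local Notation Im := complex.Im.
Local Notation M := 'M[R[i]]_n.
Implicit Types (u : nat -> R).

Definition hseq u := (forall m, u m != 0) /\ u m @[m --> \oo] --> (0 : R).

(** This is 2 n^2, written as a double sum so that it can be compared termwise with [qE]. *)
Definition entry_count : R := (\sum_(a < n) \sum_(d < n) (1 + 1)).

Lemma entry_count_ge0 : 0 <= entry_count.
Proof. by do 2 apply: sumr_ge0 => ? _; rewrite addr_ge0. Qed.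

Lemma q_le_entries (A : M) (c : R) : (forall a d, Re (A a d) ^+ 2 <= c) ->
  (forall a d, Im (A a d) ^+ 2 <= c) -> q A <= entry_count * c.
Proof.
move=> h1 h2; rewrite qE /entry_count mulr_suml; apply: ler_sum => a _; rewrite mulr_suml.
by apply: ler_sum => d _; rewrite mulrDl !mul1r lerD.
Qed.

Lemma mx_lip (F G : R -> M) (C h : R) : (forall s, mxisd F s (G s)) -> (forall s, q (G s) <= C) ->
  q (F h - F 0) <= entry_count * (h ^+ 2 * C).
Proof.
move=> dF GC; apply: q_le_entries => a d; rewrite !mxE ?cReB ?cImB.
  have [y _] := deriv_mvt 0 h (fun s => (dF s a d).1); rewrite add0r => ->.
  by rewrite exprMn ler_wpM2l ?sqr_ge0// (le_trans (q_Re _ _ _)).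
have [y _] := deriv_mvt 0 h (fun s => (dF s a d).2); rewrite add0r => ->.
by rewrite exprMn ler_wpM2l ?sqr_ge0// (le_trans (q_Im _ _ _)).
Qed.

Lemma cvg_sum0 (I : Type) (r : seq I) (a : I -> nat -> R) :
  (forall i, a i m @[m --> \oo] --> (0 : R)) -> \sum_(i <- r) a i m @[m --> \oo] --> (0 : R).
Proof.
move=> h; elim: r => [|i r IH].
  by under eq_fun do rewrite big_nil; exact: cvg_cst.
rewrite (_ : (fun m => _) = (fun m => a i m + \sum_(i <- r) a i m)).
  by rewrite -[X in _ --> X](addr0 (0 : R)); apply: cvgD.
by apply/funext => m; rewrite big_cons.
Qed.

Lemma mxisd_seq (F : R -> M) s A u : mxisd F s A -> hseq u ->
  q ((u m)^-1%:C *: (F (s + u m) - F s) - A) @[m --> \oo] --> (0 : R).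
Proof.
move=> dF [u0 cu].
rewrite (_ : (fun m => _) = fun m => \sum_(a < n) \sum_(d < n)
   (((u m)^-1 * (Re (F (s + u m) a d) - Re (F s a d)) - Re (A a d)) ^+ 2 +
    ((u m)^-1 * (Im (F (s + u m) a d) - Im (F s a d)) - Im (A a d)) ^+ 2)); last first.
  apply/funext => m; rewrite qE; apply: eq_bigr => a _; apply: eq_bigr => d _.
  by rewrite !mxE ?cReB ?cImB ?cReM ?cImM ?cReB ?cImB /= !mul0r subr0 addr0.
apply: cvg_sum0 => a; apply: cvg_sum0 => d; have [h1 h2] := dF a d.
have sq (w : nat -> R) (l : R) : w m @[m --> \oo] --> l -> (w m - l) ^+ 2 @[m --> \oo] --> (0 : R).
  move=> cw; have : w m - l @[m --> \oo] --> (0 : R).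
    by rewrite -[X in _ --> X](subrr l); apply: cvgB => //; exact: cvg_cst.
  move=> c; rewrite -[X in _ --> X](mulr0 (0 : R)); under eq_fun do rewrite expr2; exact: cvgM.
rewrite -[X in _ --> X](addr0 (0 : R)); apply: cvgD; apply: sq; exact: deriv_seq.
Qed.

Lemma mxisd_seq0 (F : R -> M) A u : mxisd F 0 A -> hseq u ->
  q ((u m)^-1%:C *: (F (u m) - F 0) - A) @[m --> \oo] --> (0 : R).
Proof.
move=> dF hu; have := mxisd_seq dF hu.
by apply: cvg_trans; apply: near_eq_cvg; apply: nearW => m; rewrite add0r.
Qed.

Lemma is_derive_seq0 (f : R -> R) (d : R) : (forall u, hseq u ->
   (u m)^-1 * (f (u m) - f 0) @[m --> \oo] --> d) -> is_derive 0 (1:R) f d.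
Proof.
move=> H; apply: is_derive_seq => u u0 cu; have := H u (conj u0 cu).
by apply: cvg_trans; apply: near_eq_cvg; apply: nearW => m; rewrite add0r.
Qed.

Section ParametricMatrix.
Variables (F G : R -> R -> M) (B : R).
Hypothesis dF : forall l s, mxisd (F^~ l) s (G s l).
Hypothesis GB : {ae mu, forall l, forall s, q (G s l) <= B}.
Hypothesis mF : forall s, mxmeasurable (F s).
Hypothesis mG : forall s, mxmeasurable (G s).

Lemma entry_bound (x c : R) : x ^+ 2 <= c -> `|x| <= Num.sqrt c.
Proof.
move=> h; have c0 : 0 <= c := le_trans (sqr_ge0 _) h.
rewrite -(@ler_pXn2r _ 2)// ?nnegrE ?sqrtr_ge0//.
by rewrite sqr_sqrtr// real_normK ?num_real.
Qed.

Lemma mN2_mvt (h K : R) : 0 <= K -> (forall s, `|s| <= `|h| -> (mN2 (G s) <= K%:E)%E) ->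
  (mN2 (fun l => F h l - F 0 l)%R <= (entry_count * (h ^+ 2 * K))%:E)%E.
Proof.
move=> K0 hK; rewrite mN2_sum; last exact: mxmeasurableB.
rewrite /entry_count mulr_suml -sumEFin; apply: lee_sum => a _.
rewrite mulr_suml -sumEFin; apply: lee_sum => d _; rewrite mulrDl !mul1r EFinD.
have m1 s := (mF s a d).1; have m2 s := (mF s a d).2.
have g1 s := (mG s a d).1; have g2 s := (mG s a d).2.
apply: leeD.
  apply: (@le_trans _ _ (N2 (fun l => Re (F h l a d) - Re (F 0 l a d)))).
    by rewrite le_eqVlt; apply/orP; left; apply/eqP; apply: eq_integral => l _; rewrite !mxE cReB.
  apply: (@N2_mvt _ (fun s l => Re (F s l a d)) (fun s l => Re (G s l a d)) (Num.sqrt B)) => //.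
  - by move=> l s; exact: (dF l s a d).1.
  - by move: GB; apply: aeS => l hl s; apply: entry_bound; apply: le_trans (hl s); exact: q_Re.
  - by move=> s hs; apply: le_trans (hK s hs); exact: (N2_entry a d (mG s)).1.
apply: (@le_trans _ _ (N2 (fun l => Im (F h l a d) - Im (F 0 l a d)))).
  by rewrite le_eqVlt; apply/orP; left; apply/eqP; apply: eq_integral => l _; rewrite !mxE cImB.
apply: (@N2_mvt _ (fun s l => Im (F s l a d)) (fun s l => Im (G s l a d)) (Num.sqrt B)) => //.
- by move=> l s; exact: (dF l s a d).2.
- by move: GB; apply: aeS => l hl s; apply: entry_bound; apply: le_trans (hl s); exact: q_Im.
- by move=> s hs; apply: le_trans (hK s hs); exact: (N2_entry a d (mG s)).2.
Qed.

End ParametricMatrix.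

Lemma mN2Z (z : R[i]) (F : R -> M) : mxmeasurable F ->
  mN2 (fun t => z *: F t) = ((Re z ^+ 2 + Im z ^+ 2)%:E * mN2 F)%E.
Proof.
move=> mF; rewrite /mN2 -ge0_integralZl_EFin//; last 3 first.
- by move=> t _; rewrite lee_fin q_ge0.
- by apply/measurable_EFinP; exact: measurable_q.
- by rewrite addr_ge0 ?sqr_ge0.
by apply: eq_integral => t _; rewrite qZ.
Qed.

Lemma mN2Zr (c : R) (F : R -> M) : mxmeasurable F ->
  mN2 (fun t => c%:C *: F t) = ((c ^+ 2)%:E * mN2 F)%E.
Proof. by move=> mF; rewrite mN2Z//= expr0n addr0. Qed.

End MatrixMeanValue.

(** * Differentiating v and its integral in the spectral parameter *)

Section ScatteringEstimates.
Context {R : realType} {n : nat}.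
Local Notation mu := (@lebesgue_measure R).
Local Notation intg f := (mu.-integrable setT (EFin \o f)).
Local Notation Re := complex.Re.
Local Notation Im := complex.Im.
Local Notation M := 'M[R[i]]_n.
Implicit Types (p : R * R) (b : bool) (u : nat -> R).
Variables (k : nat) (v : R -> R -> R -> M).
Hypotheses (hk : (7 <= k)%N) (hv : scatdata k v).
Let K := (k - 4)%N.
Local Notation V i j p := (vder v i j p).

Lemma vder_L2 : exists2 C : R, 0 <= C & forall i j, (i + j <= K)%N -> forall p,
  mL2 (V i j p) /\ (mN2 (V i j p) <= C%:E)%E.
Proof.
have [C C0 hC] : exists2 C : R, 0 <= C & forall i j, (i + j <= K)%N -> forall p, (mN2 (V i j p) <= C%:E)%E.
  apply: unif_bound.
    by move=> i j c c' cc' h p; apply: le_trans (h p) _; rewrite lee_fin.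
  move=> i j ij; have [c hc] := @scat_bounded _ _ _ _ hv i j ij 2%:E ltac:(by rewrite !inE eqxx !orbT).
  by exists (c ^+ 2) => p; apply: mxL2_mN2; exact: hc.
exists C => // i j ij p; split; last exact: hC.
by split; [exact: (vder_meas hv)|exact: le_lt_trans (hC i j ij p) (ltry _)].
Qed.

Lemma vder_mL2 i j p : (i + j <= K)%N -> mL2 (V i j p).
Proof. by move=> ij; have [C _ h] := vder_L2; exact: (h i j ij p).1. Qed.

Lemma vder_vanish i j : (i + j <= K)%N -> vanish_unif (fun x y => mN2 (V i j (x, y))).
Proof.
move=> ij e e0; have [B hB] := @scat_decay12 _ _ _ _ hv i j ij 2%:E ltac:(by rewrite !inE eqxx !orbT)
  (Num.sqrt e) ltac:(by rewrite sqrtr_gt0).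
exists B => x y /hB/mxL2_mN2; by rewrite sqr_sqrtr ?(ltW e0).
Qed.

Lemma vder_intg i j p : (i + j <= K)%N -> mxintegrable (V i j p).
Proof.
move=> ij; have [c hc] := @scat_bounded _ _ _ _ hv i j ij 1%E ltac:(by rewrite !inE eqxx).
exact: (mxL1_entry (vder_meas hv p ij) (hc p.1 p.2)).1.
Qed.

Lemma q_mxintegral_le (F : R -> M) (c : R) : 0 <= c -> mxintegrable F ->
  (forall a d, \int[mu]_t `|Re (F t a d)| <= c /\ \int[mu]_t `|Im (F t a d)| <= c) ->
  q (mxintegral F) <= @entry_count R n * c ^+ 2.
Proof.
move=> c0 iF h; have E (f : R -> R) : intg f -> \int[mu]_t `|f t| <= c -> (\int[mu]_t f t) ^+ 2 <= c ^+ 2.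
  move=> fi fc; rewrite -(real_normK (num_real _)) lerXn2r ?nnegrE//.
  exact: (le_trans (le_normr_Rintegral _ fi)).
by apply: q_le_entries => a d; rewrite mxE /=; have [i1 i2] := iF a d; have [h1 h2] := h a d; exact: E.
Qed.

Lemma vder_int_bound i j : (i + j <= K)%N -> exists C : R, forall p, q (mxintegral (V i j p)) <= C.
Proof.
move=> ij; have [c hc] := @scat_bounded _ _ _ _ hv i j ij 1%E ltac:(by rewrite !inE eqxx).
exists (@entry_count R n * `|c| ^+ 2) => p; have [h1 h2] := mxL1_entry (vder_meas hv p ij) (hc p.1 p.2).
apply: q_mxintegral_le => // a d; have [h3 h4] := h2 a d.
by split; [apply: le_trans h3 _|apply: le_trans h4 _]; exact: ler_norm.
Qed.

Lemma vder_int_vanish i j : (i + j <= K)%N ->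
  vanish_unif (fun x y => (q (mxintegral (V i j (x, y))))%:E).
Proof.
move=> ij e e0; pose N := @entry_count R n + 1; have N0 : 0 < N by rewrite ltr_wpDl// entry_count_ge0.
have [B hB] := @scat_decay12 _ _ _ _ hv i j ij 1%E ltac:(by rewrite !inE eqxx)
  (Num.sqrt (e / N)) ltac:(by rewrite sqrtr_gt0 divr_gt0).
exists B => x y /hB hxy; have [h1 h2] := mxL1_entry (vder_meas hv (x, y) ij) hxy.
rewrite lee_fin; apply: le_trans (q_mxintegral_le (sqrtr_ge0 _) h1 h2) _.
rewrite sqr_sqrtr; last by rewrite divr_ge0// ltW.
by rewrite mulrA ler_pdivrMr// mulrC ler_wpM2l ?(ltW e0)// /N lerDl.
Qed.

Lemma vder_bdd : exists2 C : R, 0 <= C & forall i j, (i + j <= K)%N -> forall p, mbdd C (V i j p).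
Proof.
have [C C0 h] := vder_ae hk hv; exists C => // i j ij p; split; first exact: (vder_meas hv).
by move: h; apply: aeS => l hl; exact: hl.
Qed.

Lemma vder_lip : exists2 C : R, 0 <= C & {ae mu, forall l, forall i j, (i + j < K)%N ->
  forall p b h, q (V i j (sh b h p) l - V i j p l) <= C * h ^+ 2}.
Proof.
have [C C0 hC] := vder_ae hk hv; exists (@entry_count R n * C); first by rewrite mulr_ge0// entry_count_ge0.
move: hC; apply: aeS => l hl i j ij p b h.
have := @mx_lip _ _ (fun r => V i j (sh b r p) l) (fun r => V (incx b i) (incy b j) (sh b r p) l) C h
  (fun s => vder_isd hv b p l s ij) _.
rewrite sh0 => H; rewrite -mulrA [C * _]mulrC; apply: H => s.
by apply: hl; rewrite incxy.
Qed.

Lemma vder_pt b i j p l u : (i + j < K)%N -> hseq u ->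
  q ((u m)^-1%:C *: (V i j (sh b (u m) p) l - V i j p l) - V (incx b i) (incy b j) p l) @[m --> \oo] --> (0 : R).
Proof. by move=> ij hu; have := mxisd_seq0 (vder_isd hv b p l 0 ij) hu; rewrite !sh0. Qed.

Lemma vder_lmul i j p l : (0 < i)%N -> (i + j <= K)%N -> l%:C *: V i j p l = V i.-1 j.+1 p l.
Proof.
case: i => // i _ ij; have ij' : (i + j.+1 <= K)%N by rewrite addnS -addSn.
by rewrite (vderE hv _ _ ij) (vderE hv _ _ ij')/= scalerA -rmorphM exprS addnS.
Qed.

Lemma measurable_rc : measurable_fun setT (fun l : R => Re (l%:C)) /\ measurable_fun setT (fun l : R => Im (l%:C)).
Proof. by split => /=; [exact: measurable_id|exact: measurable_cst]. Qed.

Lemma mxmeasurable_lZ (F : R -> M) : mxmeasurable F -> mxmeasurable (fun l : R => l%:C *: F l).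
Proof. by have [h1 h2] := measurable_rc; exact: mxmeasurableZ. Qed.

Lemma mxmeasurable_cZ (c : R[i]) (F : R -> M) : mxmeasurable F -> mxmeasurable (fun l => c *: F l).
Proof. exact: mxmeasurableZ. Qed.

Definition vquot b i j p u m l : M := (u m)^-1%:C *: (V i j (sh b (u m) p) l - V i j p l).

Lemma vquot_meas b i j p u m : (i + j <= K)%N -> mxmeasurable (vquot b i j p u m).
Proof. by move=> ij; apply: mxmeasurable_cZ; apply: mxmeasurableB; exact: (vder_meas hv). Qed.

(* The weight l improves the decay because l d_x = d_y on functions of x + l y. *)
Lemma vder_L2d_bi b i j p u : (i + j < K)%N -> (0 < incx b i)%N -> hseq u ->
  tends0 (fun m => mN2 (fun l => vquot b i j p u m l - V (incx b i) (incy b j) p l)).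
Proof.
move=> ij bi0 hu; have [u0 cu] := hu; have [C C0 hC] := vder_ae hk hv.
have ij' : (incx b i + incy b j <= K)%N by rewrite incxy.
have ij'' : ((incx b i).-1 + (incy b j).+1 <= K)%N by rewrite addnS -addSn prednK.
(* Bounds for the quotient and for its limit, plain ([D1], [D3]) and after multiplication by l
   ([D2], [D4]), add up to domination by B/(l^2 + 1). *)
pose B := 2 * (@entry_count R n * C + @entry_count R n * C) + 2 * (C + C).
apply: (@mN2_dominated _ _ _ (fun l => B * pk 1 l)).
- by move=> m; apply: mxmeasurableB; [exact: vquot_meas (ltnW ij)|exact: (vder_meas hv)].
- apply: intg_cM; apply/integrableP; split; first by apply/measurable_EFinP; exact: measurable_pk.
  rewrite (_ : (\int[mu]_x _)%E = (pi : R)%:E) ?ltry//.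
  rewrite -(integral_pk 0 (ltr01 : (0:R) < 1)); apply: eq_integral => t _.
  by rewrite /= subr0 ger0_norm ?pk_ge0.
- by apply: aeT => l; exact: vder_pt.
move: hC; apply: aeS => l hl m; have um2 : 0 < u m ^+ 2 by rewrite exprn_even_gt0//= u0.
have D1 : q (vquot b i j p u m l) <= @entry_count R n * C.
  have := @mx_lip _ _ (fun r => V i j (sh b r p) l) (fun r => V (incx b i) (incy b j) (sh b r p) l) C (u m)
    (fun s => vder_isd hv b p l s ij) (fun s => hl _ _ ij' _).
  rewrite sh0 => H; rewrite /vquot qZ /= expr0n addr0 exprVn ler_pdivrMl//.
  by apply: le_trans H _; rewrite mulrCA.
have D2 : l ^+ 2 * q (vquot b i j p u m l) <= @entry_count R n * C.
  have := @mx_lip _ _ (fun r => l%:C *: V i j (sh b r p) l) (fun r => V (incx b i).-1 (incy b j).+1 (sh b r p) l) C (u m) _ (fun s => hl _ _ ij'' _).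
  rewrite sh0 => H; have -> : l ^+ 2 * q (vquot b i j p u m l) = q (l%:C *: vquot b i j p u m l).
    by rewrite [in RHS]qZ /= expr0n addr0.
  rewrite /vquot scalerA mulrC -scalerA scalerBr qZ /= expr0n addr0 exprVn ler_pdivrMl//.
  rewrite mulrCA; apply: H => s; rewrite -vder_lmul//.
  by apply: mxisdZ; exact: (vder_isd hv).
have D3 : q (V (incx b i) (incy b j) p l) <= C by exact: hl.
have D4 : l ^+ 2 * q (V (incx b i) (incy b j) p l) <= C.
  have -> : l ^+ 2 * q (V (incx b i) (incy b j) p l) = q (l%:C *: V (incx b i) (incy b j) p l).
    by rewrite [in RHS]qZ /= expr0n addr0.
  by rewrite vder_lmul//; exact: hl.
have D := den_gt0 l (ltr01 : (0:R) < 1).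
rewrite /pk mul1r ler_pdivlMr// expr1n; apply: (@le_trans _ _ ((2 * q (vquot b i j p u m l) + 2 * q (V (incx b i) (incy b j) p l)) * (l ^+ 2 + 1))).
  by rewrite ler_wpM2r ?qB// addr_ge0 ?sqr_ge0.
by rewrite /B; lra.
Qed.

Lemma tends0_hseq u (c : R) (a : nat -> \bar R) : 0 <= c -> hseq u ->
  (forall m, (a m <= (u m ^+ 2 * c)%:E)%E) -> tends0 a.
Proof.
move=> c0 [u0 cu] h; apply: tends0_le h _.
have : u m ^+ 2 * c @[m --> \oo] --> (0 ^+ 2 * c : R).
  by apply: cvgMl; rewrite expr2; under eq_fun do rewrite expr2; exact: cvgM.
rewrite expr0n mul0r => /cvgrPdist_le h e e0; have [N _ hN] := h e e0.
exists N => m /hN /=; rewrite sub0r normrN ger0_norm ?lee_fin//.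
by rewrite mulr_ge0// sqr_ge0.
Qed.

Lemma mxisd_lin (A : M) s : mxisd (fun r : R => r%:C *: A) s A.
Proof.
have E (c : R) : is_derive s (1:R) (fun r : R => r * c) c.
  rewrite (_ : (fun r => _) = c \*: (id : R -> R)); last by apply/funext => r; rewrite /= mulrC.
  apply: (is_derive_eq (is_deriveZ c (is_derive_id s (1:R)))).
  by rewrite [_ *: _]mulr1.
move=> a d; split.
  by rewrite (_ : (fun r => _) = fun r => r * Re (A a d))//; apply/funext => r; rewrite mxE cReM /= mul0r subr0.
by rewrite (_ : (fun r => _) = fun r => r * Im (A a d))//; apply/funext => r; rewrite mxE cImM /= mul0r addr0.
Qed.

(** No integrable majorant is available here, so [mN2_mvt] is used twice, first for the increment of
    the derivative and then for the Taylor remainder F. This bounds the squared error by a multiple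
    of (u m)^2 and uses one order more. *)
Lemma vder_L2d_0 j p u : (j.+1 < K)%N -> hseq u ->
  tends0 (fun m => mN2 (fun l => vquot false 0 j p u m l - V 0 j.+1 p l)).
Proof.
move=> jK hu; have [u0 cu] := hu; have [B B0 hB] := vder_ae hk hv; have [C C0 hC] := vder_L2.
have j0 : (0 + j < K)%N by rewrite add0n ltnW.
have j1 : (0 + j.+1 < K)%N by rewrite add0n.
have j2 : (0 + j.+2 <= K)%N by rewrite add0n.
pose N := @entry_count R n; have N0 : 0 <= N := @entry_count_ge0 R n.
apply: (@tends0_hseq u (N * (N * C))) => //; first by rewrite !mulr_ge0.
move=> m.
have step1 s : (mN2 (fun l => V 0 j.+1 (sh false s p) l - V 0 j.+1 p l)%R <= (N * (s ^+ 2 * C))%:E)%E.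
  have H : {ae mu, forall l, forall s, q (V 0 j.+2 (sh false s p) l) <= B}.
    by move: hB; apply: aeS => l hl r; exact: hl.
  have := @mN2_mvt _ _ (fun s => V 0 j.+1 (sh false s p)) (fun s => V 0 j.+2 (sh false s p)) B
    (fun l s => vder_isd hv false p l s j1) H (fun s => vder_meas hv _ (ltnW j1)) (fun s => vder_meas hv _ j2) s C C0
    (fun s _ => (hC 0%N j.+2 j2 _).2).
  by rewrite sh0.
pose F s l := V 0 j (sh false s p) l + (-1) *: (s%:C *: V 0 j.+1 p l).
pose G s l := V 0 j.+1 (sh false s p) l + (-1) *: V 0 j.+1 p l.
have dF l s : mxisd (F^~ l) s (G s l).
  apply: mxisdD; first exact: (vder_isd hv false p l s j0).
  by apply: mxisdZ; exact: mxisd_lin.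
have GB : {ae mu, forall l, forall s, q (G s l) <= 2 * B + 2 * B}.
  move: hB; apply: aeS => l hl s; rewrite /G scaleN1r; apply: le_trans (qB _ _) _.
  by apply: lerD; rewrite ler_wpM2l//; apply: hl; exact: ltnW.
have mF s : mxmeasurable (F s).
  apply: mxmeasurableD; first exact: (vder_meas hv _ (ltnW j0)).
  by do 2 apply: mxmeasurable_cZ; exact: (vder_meas hv _ (ltnW j1)).
have mG s : mxmeasurable (G s).
  apply: mxmeasurableD; first exact: (vder_meas hv _ (ltnW j1)).
  by apply: mxmeasurable_cZ; exact: (vder_meas hv _ (ltnW j1)).
have GK s : `|s| <= `|u m| -> (mN2 (G s) <= (N * (u m ^+ 2 * C))%:E)%E.
  move=> hs; rewrite (_ : G s = fun l => V 0 j.+1 (sh false s p) l - V 0 j.+1 p l).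
    apply: le_trans (step1 s) _; rewrite lee_fin ler_wpM2l// ler_wpM2r//.
    by rewrite -(real_normK (num_real s)) -(real_normK (num_real (u m))) lerXn2r ?nnegrE.
  by apply/funext => l; rewrite /G scaleN1r.
have H := mN2_mvt dF GB mF mG (_ : 0 <= N * (u m ^+ 2 * C)) GK.
have {H} := H (mulr_ge0 N0 (mulr_ge0 (sqr_ge0 _) C0)).
have -> : (fun l => F (u m) l - F 0 l) = (fun l => (u m)%:C *: (vquot false 0 j p u m l - V 0 j.+1 p l)).
  have uc : (u m)%:C * ((u m)^-1)%:C = 1 :> R[i] by rewrite -rmorphM divff.
  apply/funext => l; rewrite /F /vquot sh0 scale0r scaler0 addr0 scalerBr [X in _ = X - _]scalerA uc scale1r.
  by rewrite scaleN1r addrAC.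
rewrite mN2Zr; last by apply: mxmeasurableB; [exact: vquot_meas (ltnW j0)|exact: (vder_meas hv _ (ltnW j1))].
have um : 0 < u m ^+ 2 by rewrite exprn_even_gt0//= u0.
have -> : (N * (u m ^+ 2 * (N * (u m ^+ 2 * C))))%:E = ((u m ^+ 2)%:E * (u m ^+ 2 * (N * (N * C)))%:E)%E.
  by rewrite -EFinM; congr EFin; ring.
by rewrite lee_pmul2l// lte_fin.
Qed.

(* For i = 0 there is no x-derivative to trade for decay in l, and differentiability in L_2
   costs one order more. *)
Definition L2_diff_order r i j := (r + i + j + (i == 0) <= K)%N.

Lemma vder_L2d b i j p u : L2_diff_order 1 i j -> hseq u ->
  tends0 (fun m => mN2 (fun l => vquot b i j p u m l - V (incx b i) (incy b j) p l)).
Proof.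
rewrite /L2_diff_order => g hu; have [h|h] := ltnP 0 (incx b i); first by apply: vder_L2d_bi => //; lia.
case: b i h g => [//|] [|//] _ g; rewrite /incx /incy; apply: vder_L2d_0 => //; lia.
Qed.

Lemma sqr_cvg0 (w : nat -> R) : (forall e, 0 < e -> exists N, forall m, (N <= m)%N -> w m ^+ 2 <= e) ->
  w m @[m --> \oo] --> (0 : R).
Proof.
move=> h; apply/cvgrPdist_le => e e0; have [N hN] := h (e ^+ 2) ltac:(by rewrite exprn_gt0).
exists N => // m Nm /=; rewrite sub0r normrN -(@ler_pXn2r _ 2)// ?nnegrE ?(ltW e0)//.
by rewrite real_normK ?num_real// hN.
Qed.

(** The parameter r is taken so large that the bounded weighted norm D contributes at most e/2; the
    threshold e/(2 P r) then makes the other term exactly e/2. *)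
Lemma weight_alg (P D e r : R) : 0 < P -> 0 <= D -> 0 < e -> r = 2 * P * (D + 1) / e ->
  P * r * (e / (2 * P * r)) + P / r * D <= e.
Proof.
move=> P0 D0 e0 rE; have D1 : 0 < D + 1 by lra.
have r0 : 0 < r by rewrite rE divr_gt0// mulr_gt0// mulr_gt0.
have -> : P * r * (e / (2 * P * r)) = e / 2 by field; rewrite (gt_eqF P0) (gt_eqF r0).
have -> : P / r * D = e / 2 * (D / (D + 1)).
  by rewrite rE; field; rewrite (gt_eqF P0) (gt_eqF e0) (gt_eqF D1).
have : D / (D + 1) <= 1 by rewrite ler_pdivrMr; lra.
by move=> hD; have : e / 2 * (D / (D + 1)) <= e / 2 by [rewrite ler_piMr//; lra]; lra.
Qed.

(** [pr] stands for the real or the imaginary part, so that the scalar limit arguments for an entry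
    (a, d) are made once for both. *)
Section Projection.
Variables (pr : R[i] -> R) (a d : 'I_n).
Hypotheses (prB : forall z w, pr (z - w) = pr z - pr w)
  (prZ : forall (c : R) z, pr (c%:C * z) = c * pr z)
  (prq : forall A : M, pr (A a d) ^+ 2 <= q A)
  (prm : forall F : R -> M, mxmeasurable F -> measurable_fun setT (fun l => pr (F l a d)))
  (prd : forall (F : R -> M) s A, mxisd F s A -> is_derive s (1:R) (fun r => pr (F r a d)) (pr (A a d)))
  (pri : forall F : R -> M, mxintegrable F -> intg (fun l => pr (F l a d)))
  (prL1 : forall i j, (i + j <= K)%N -> exists C : R, forall p, \int[mu]_l `|pr (V i j p l a d)| <= C).

Lemma prlin (c : R) (A B D : M) :
  pr ((c%:C *: (A - B) - D) a d) = c * (pr (A a d) - pr (B a d)) - pr (D a d).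
Proof. by rewrite !mxE prB prZ prB. Qed.

Lemma prZm (c : R) (A : M) : pr ((c%:C *: A) a d) = c * pr (A a d).
Proof. by rewrite mxE prZ. Qed.

Lemma N2_pr F : mxmeasurable F -> (N2 (fun l => pr (F l a d)) <= mN2 F)%E.
Proof.
move=> mF; apply: ge0_le_int.
- by move=> t; rewrite lee_fin sqr_ge0.
- by apply: measurable_sqr; exact: prm.
- by apply/measurable_EFinP; exact: measurable_q.
- by move=> t; rewrite lee_fin prq.
Qed.

Lemma pr_intgB i j p p' : (i + j <= K)%N ->
  intg (fun l => pr (V i j p l a d) - pr (V i j p' l a d)).
Proof. by move=> ij; apply: intg_B; apply: pri; exact: vder_intg. Qed.

(** Convergence in L_2 does not control integrals by itself, but l times the error stays bounded in
    L_2, since the weight trades an x-derivative for a y-derivative. [Rint_weighted] combines the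
    two facts. *)
Lemma vder_int_bi b i j p u : (i + j < K)%N -> (0 < incx b i)%N -> hseq u ->
  \int[mu]_l pr ((vquot b i j p u m l - V (incx b i) (incy b j) p l) a d) @[m --> \oo] --> (0 : R).
Proof.
move=> ij bi0 hu; have [u0 cu] := hu; have [C C0 hC] := vder_L2; have [B B0 hB] := vder_ae hk hv.
have ij' : (incx b i + incy b j <= K)%N by rewrite incxy.
have ij'' : ((incx b i).-1 + (incy b j).+1 <= K)%N by rewrite addnS -addSn prednK.
pose X m l := vquot b i j p u m l - V (incx b i) (incy b j) p l.
have mX m : mxmeasurable (X m) by apply: mxmeasurableB; [exact: vquot_meas (ltnW ij)|exact: (vder_meas hv)].
have mdq m : mxmeasurable (vquot b i j p u m) by exact: vquot_meas (ltnW ij).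
pose D : R := 2 * (@entry_count R n * C) + 2 * C.
have D0 : 0 <= D by rewrite addr_ge0// mulr_ge0// mulr_ge0// entry_count_ge0.
have LX m : (mN2 (fun l => l%:C *: X m l) <= D%:E)%E.
  have -> : (fun l => l%:C *: X m l) = (fun l => l%:C *: vquot b i j p u m l - l%:C *: V (incx b i) (incy b j) p l).
    by apply/funext => l; rewrite /X scalerBr.
  apply: le_trans (mN2B (mxmeasurable_lZ (mdq m)) (mxmeasurable_lZ (vder_meas hv p ij'))) _.
  have -> : D%:E = (2%:E * (@entry_count R n * C)%:E + 2%:E * C%:E)%E by rewrite -!EFinM -EFinD.
  apply: leeD; apply: lee_wpmul2l => //.
    pose F s l := l%:C *: V i j (sh b s p) l; pose G s l := V (incx b i).-1 (incy b j).+1 (sh b s p) l.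
    have dF l s : mxisd (F^~ l) s (G s l).
      by rewrite /G -vder_lmul//; apply: mxisdZ; exact: (vder_isd hv).
    have GB : {ae mu, forall l, forall s, q (G s l) <= B} by move: hB; apply: aeS => l hl s; exact: hl.
    have mF s : mxmeasurable (F s) by apply: mxmeasurable_lZ; exact: (vder_meas hv _ (ltnW ij)).
    have mG s : mxmeasurable (G s) by exact: (vder_meas hv).
    have GK s : `|s| <= `|u m| -> (mN2 (G s) <= C%:E)%E by move=> _; exact: (hC _ _ ij'' _).2.
    have H := mN2_mvt dF GB mF mG C0 GK.
    have -> : (fun l => l%:C *: vquot b i j p u m l) = (fun l => ((u m)^-1)%:C *: (F (u m) l - F 0 l)).
      by apply/funext => l; rewrite /vquot /F sh0 -scalerBr !scalerA mulrC.
    rewrite mN2Zr; last exact: mxmeasurableB.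
    apply: (@le_trans _ _ (((u m)^-1 ^+ 2)%:E * (entry_count * (u m ^+ 2 * C))%:E)%E).
      by apply: lee_wpmul2l; [rewrite lee_fin sqr_ge0|exact: H].
    by rewrite -EFinM lee_fin exprVn mulrCA mulKf// sqrf_eq0.
  have -> : (fun l => l%:C *: V (incx b i) (incy b j) p l) = V (incx b i).-1 (incy b j).+1 p.
    by apply/funext => l; exact: vder_lmul.
  exact: (hC _ _ ij'' _).2.
have L1 m : L2 (fun l => pr (X m l a d)).
  split; first exact: prm.
  apply: le_lt_trans (N2_pr (mX m)) _.
  by apply: (mL2B (mL2Z _ (mL2B (vder_mL2 _ (ltnW ij)) (vder_mL2 _ (ltnW ij)))) (vder_mL2 _ ij')).2.
have plZ m l : l * pr (X m l a d) = pr ((l%:C *: X m l) a d) by rewrite prZm.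
have N2l m : (N2 (fun l => l * pr (X m l a d))%R <= D%:E)%E.
  under [X in N2 X]funext do rewrite plZ.
  by apply: le_trans (N2_pr (mxmeasurable_lZ (mX m))) _.
have L2l m : L2 (fun l => l * pr (X m l a d)).
  split; last by apply: le_lt_trans (N2l m) (ltry _).
  by apply: measurable_funM => //; exact: prm.
apply: sqr_cvg0 => e e0.
have pp : (0 : R) < pi by exact: pi_gt0.
pose r : R := 2 * pi * (D + 1) / e; have r0 : 0 < r.
  by rewrite /r divr_gt0// mulr_gt0// ?mulr_gt0//; lra.
have er : 0 < e / (2 * pi * r) by rewrite divr_gt0// mulr_gt0// mulr_gt0.
have [N hN] := vder_L2d_bi p ij bi0 hu er.
exists N => m /hN h.
apply: (le_trans (Rint_weighted r0 (prm (mX m)) (L1 m) (L2l m))).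
have h1 : \int[mu]_t (pr (X m t a d) ^+ 2) <= e / (2 * pi * r).
  rewrite -lee_fin N2_Rintegral//; apply: le_trans (N2_pr (mX m)) _; exact: h.
have h2 : \int[mu]_t ((t * pr (X m t a d)) ^+ 2) <= D by rewrite -lee_fin N2_Rintegral.
apply: (@le_trans _ _ (pi * r * (e / (2 * pi * r)) + pi / r * D)).
  have a1 : 0 <= pi * r by rewrite mulr_ge0 ?ltW.
  have a2 : 0 <= pi / r by rewrite divr_ge0 ?ltW.
  by apply: lerD; rewrite ler_wpM2l.
exact: weight_alg pp D0 e0 (erefl _).
Qed.

(** The y-derivative of the integral of v - 1, where no x-derivative can be traded. The L_1 bound on
    the second y-derivative replaces the weight: two mean value estimates against the indicator of
    [-n', n'] bound the error by C |u m|, uniformly in n'. *)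
Lemma vder_int_00 p u : hseq u ->
  \int[mu]_l pr ((vquot false 0 0 p u m l - V 0 1 p l) a d) @[m --> \oo] --> (0 : R).
Proof.
move=> hu; have [u0 cu] := hu; have [B B0 hB] := vder_ae hk hv.
have k0 : (0 + 0 < K)%N by rewrite /K; lia.
have k1 : (0 + 1 < K)%N by rewrite /K; lia.
have k2 : (0 + 2 <= K)%N by rewrite /K; lia.
have [C0 hC0] := prL1 k2; pose C := `|C0|.
have hC s : \int[mu]_l `|pr (V 0 2 (sh false s p) l a d)| <= C by apply: le_trans (hC0 _) (ler_norm _).
pose f1 s l := pr (V 0 1 (sh false s p) l a d); pose g1 s l := pr (V 0 2 (sh false s p) l a d).
have df1 l s : is_derive s (1:R) (f1^~ l) (g1 s l) by apply: prd; exact: (vder_isd hv false p l s k1).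
have prB' i j : (i + j <= K)%N -> {ae mu, forall l, forall s, `|pr (V i j (sh false s p) l a d)| <= Num.sqrt B}.
  by move=> ij; move: hB; apply: aeS => l hl s; apply: entry_bound; apply: le_trans (prq _) (hl _ _ ij _).
have mm i j (ij : (i + j <= K)%N) s : measurable_fun setT (fun l => pr (V i j (sh false s p) l a d)).
  by apply: prm; exact: (vder_meas hv).
have T1 s n' : `|\int[mu]_l ((f1 s l - f1 0 l) * trunc n' (fun=> 1) l)| <= `|s| * C.
  apply: (trunc_mvt df1 (prB' _ _ k2) (mm _ _ (ltnW k1)) (mm _ _ k2)) => r _.
  apply: (le_trans (Rint_trunc_abs _ _) (hC r)); apply: pri; exact: vder_intg.
(* The Taylor remainder up to the constant f 0; its derivative is the increment of [f1], which [T1]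
   has just estimated. *)
pose f s l := pr (V 0 0 (sh false s p) l a d) - s * pr (V 0 1 p l a d).
pose g s l := f1 s l - f1 0 l.
have df l s : is_derive s (1:R) (f^~ l) (g s l).
  have h1 := prd (vder_isd hv false p l s k0).
  have h2 := is_deriveZ (pr (V 0 1 p l a d)) (is_derive_id s (1:R)).
  have := is_deriveB h1 h2; rewrite /g /f1 sh0 => h.
  rewrite (_ : f^~ l = (fun r => pr (V 0 0 (sh false r p) l a d)) - pr (V 0 1 p l a d) \*: (id : R -> R)).
    by apply: (is_derive_eq h); rewrite [_ *: (1:R)]mulr1.
  by apply/funext => r; rewrite /f /= mulrC.
have gB : {ae mu, forall l, forall s, `|g s l| <= Num.sqrt B + Num.sqrt B}.
  by move: (prB' _ _ (ltnW k1)); apply: aeS => l hl s; apply: (le_trans (ler_normB _ _)); apply: lerD; exact: hl.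
have mf s : measurable_fun setT (f s).
  apply: measurable_funB; first exact: mm (ltnW k0) s.
  by apply: measurable_funM => //; apply: prm; exact: (vder_meas hv _ (ltnW k1)).
have mg s : measurable_fun setT (g s) by apply: measurable_funB; exact: mm (ltnW k1) _.
have T2 m n' : `|\int[mu]_l ((f (u m) l - f 0 l) * trunc n' (fun=> 1) l)| <= `|u m| * (`|u m| * C).
  apply: (trunc_mvt df gB mf mg) => s hs; apply: le_trans (T1 s n') _.
  by rewrite ler_wpM2r// /C normr_ge0.
have E m l : pr ((vquot false 0 0 p u m l - V 0 1 p l) a d) = (u m)^-1 * (f (u m) l - f 0 l).
  rewrite /vquot prlin /f sh0 mul0r subr0; by field; exact: u0.
have iR m : intg (fun l => pr ((vquot false 0 0 p u m l - V 0 1 p l) a d)).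
  have i1 := intg_cM (u m)^-1 (pr_intgB (sh false (u m) p) p (ltnW k0)).
  have i2 := pri (vder_intg p (ltnW k1)).
  have := intg_B i1 i2; apply: eq_integrable => // l _.
  by rewrite /= /vquot prlin.
have bnd m : `|\int[mu]_l pr ((vquot false 0 0 p u m l - V 0 1 p l) a d)| <= C * `|u m|.
  apply: Rint_trunc_le => // n'.
  have -> : \int[mu]_l (pr ((vquot false 0 0 p u m l - V 0 1 p l) a d) * trunc n' (fun=> 1) l) =
      (u m)^-1 * \int[mu]_l ((f (u m) l - f 0 l) * trunc n' (fun=> 1) l).
    rewrite -RintegralZl//; first by apply: eq_Rintegral => l _; rewrite E mulrA.
    have i1 := intg_cM (u m) (iR m).
    have i2 : intg (fun l => f (u m) l - f 0 l).
      by move: i1; apply: eq_integrable => // l _; rewrite /= E mulrA divff ?mul1r.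
    apply: (@intg_bM _ (trunc n' (fun=> 1)) _ 1) => //; first by apply: measurable_trunc.
    by move=> l; exact: trunc1_le.
  rewrite normrM normfV ler_pdivrMl ?normr_gt0//; apply: le_trans (T2 m n') _.
  by rewrite [C * _]mulrC.
apply/cvgrPdist_le => e e0; have C1 : 0 <= C by rewrite /C normr_ge0.
have c1 : 0 < C + 1 by rewrite ltr_wpDl.
have /cvgrPdist_le/(_ (e / (C + 1)) ltac:(by rewrite divr_gt0))[N _ hN] := cu.
exists N => // m /hN /=; rewrite !sub0r !normrN => h; apply: (le_trans (bnd m)).
apply: (@le_trans _ _ ((C + 1) * `|u m|)); first by rewrite ler_wpM2r// lerDl.
by rewrite mulrC -ler_pdivlMr.
Qed.

Lemma vder_int_pr b i j p u : (i + j < K)%N -> (0 < incx b i)%N \/ (i = 0%N /\ j = 0%N) -> hseq u ->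
  (u m)^-1 * (\int[mu]_l pr (V i j (sh b (u m) p) l a d) - \int[mu]_l pr (V i j p l a d)) @[m --> \oo] -->
  \int[mu]_l pr (V (incx b i) (incy b j) p l a d).
Proof.
move=> ij cases hu; have ij' : (incx b i + incy b j <= K)%N by rewrite incxy.
have c : \int[mu]_l pr ((vquot b i j p u m l - V (incx b i) (incy b j) p l) a d) @[m --> \oo] --> (0 : R).
  have [h|h] := ltnP 0 (incx b i); first exact: vder_int_bi.
  case: cases => [|[i0 j0]]; first by rewrite ltnNge h.
  by move: h; rewrite {}i0 {}j0; case: b {ij ij'} => // _; exact: vder_int_00.
have i1 p' : intg (fun l => pr (V i j p' l a d)) by apply: pri; apply: vder_intg; exact: ltnW.
have i2 : intg (fun l => pr (V (incx b i) (incy b j) p l a d)) by apply: pri; exact: vder_intg.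
have E m : (u m)^-1 * (\int[mu]_l pr (V i j (sh b (u m) p) l a d) - \int[mu]_l pr (V i j p l a d)) =
    \int[mu]_l pr ((vquot b i j p u m l - V (incx b i) (incy b j) p l) a d) + \int[mu]_l pr (V (incx b i) (incy b j) p l a d).
  rewrite -RintegralB// -RintegralZl//; last exact: intg_B.
  rewrite -RintegralD//.
    by apply: eq_Rintegral => l _; rewrite /vquot prlin subrK.
  have := intg_B (intg_cM (u m)^-1 (intg_B (i1 (sh b (u m) p)) (i1 p))) i2.
  by apply: eq_integrable => // l _; rewrite /= /vquot prlin.
rewrite (_ : (fun m => _) = (fun m => \int[mu]_l pr ((vquot b i j p u m l - V (incx b i) (incy b j) p l) a d) +
    \int[mu]_l pr (V (incx b i) (incy b j) p l a d))); last by apply/funext.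
by rewrite -[X in _ --> X]add0r; apply: cvgD => //; exact: cvg_cst.
Qed.

End Projection.

Lemma vder_int_isd b i j p : (i + j < K)%N -> (0 < incx b i)%N \/ (i = 0%N /\ j = 0%N) ->
  mxisd (fun h => mxintegral (V i j (sh b h p))) 0 (mxintegral (V (incx b i) (incy b j) p)).
Proof.
move=> ij cases a d; rewrite mxE /=.
have L1 i' j' : (i' + j' <= K)%N -> exists C : R, forall p, \int[mu]_l `|Re (V i' j' p l a d)| <= C /\
    \int[mu]_l `|Im (V i' j' p l a d)| <= C.
  move=> ij'; have [c hc] := @scat_bounded _ _ _ _ hv i' j' ij' 1%E ltac:(by rewrite !inE eqxx).
  by exists c => p'; exact: ((mxL1_entry (vder_meas hv p' ij') (hc p'.1 p'.2)).2 a d).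
split; apply: is_derive_seq0 => u hu; rewrite sh0.
  rewrite (_ : (fun m => _) = (fun m => (u m)^-1 * (\int[mu]_l Re (V i j (sh b (u m) p) l a d) -
     \int[mu]_l Re (V i j p l a d)))); last by apply/funext => m; rewrite !mxE.
  apply: vder_int_pr => //.
  - exact: cReB.
  - by move=> c z; rewrite cReM /= mul0r subr0.
  - by move=> A; exact: q_Re.
  - by move=> F mF; exact: (mF a d).1.
  - by move=> F s A dF; exact: (dF a d).1.
  - by move=> F iF; exact: (iF a d).1.
  - by move=> i' j' /L1[C hC]; exists C => p'; exact: (hC p').1.
rewrite (_ : (fun m => _) = (fun m => (u m)^-1 * (\int[mu]_l Im (V i j (sh b (u m) p) l a d) -
   \int[mu]_l Im (V i j p l a d)))); last by apply/funext => m; rewrite !mxE.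
apply: vder_int_pr => //.
- exact: cImB.
- by move=> c z; rewrite cImM /= mul0r addr0.
- by move=> A; exact: q_Im.
- by move=> F mF; exact: (mF a d).2.
- by move=> F s A dF; exact: (dF a d).2.
- by move=> F iF; exact: (iF a d).2.
- by move=> i' j' /L1[C hC]; exists C => p'; exact: (hC p').2.
Qed.

End ScatteringEstimates.

(** * Smoothness of the solution *)

Section SmoothnessClasses.
Context {R : realType} {n : nat}.
Local Notation mu := (@lebesgue_measure R).
Local Notation intg f := (mu.-integrable setT (EFin \o f)).
Local Notation Re := complex.Re.
Local Notation Im := complex.Im.
Local Notation M := 'M[R[i]]_n.
Implicit Types (p : R * R) (b : bool) (u : nat -> R) (F G : R * R -> R -> M).

Definition quot (h : R) (A B : M) : M := h^-1%:C *: (A - B).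

Definition bdd2 F := (forall p, mL2 (F p)) /\
  exists2 C : R, 0 <= C & forall p, (mN2 (F p) <= C%:E)%E.

Definition L2d F b G := forall p u, hseq u ->
  tends0 (fun m => mN2 (fun l => quot (u m) (F (sh b (u m) p) l) (F p l) - G p l)).

(** Up to r derivatives in L_2, in any order of directions, all bounded uniformly in (x, y). The
    derivative families are existential, being determined almost everywhere only. *)
Fixpoint L2smooth (r : nat) F : Prop := bdd2 F /\
  match r with 0%N => True | r'.+1 => exists G : bool -> R * R -> R -> M,
    forall b, L2d F b (G b) /\ L2smooth r' (G b) end.

Lemma L2smooth_bdd r F : L2smooth r F -> bdd2 F.
Proof. by case: r => [|r] []. Qed.

Lemma L2smooth_S r F : L2smooth r.+1 F -> L2smooth r F.
Proof.
elim: r F => [|r IH] F [bF [G hG]]; first by split.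
by split=> //; exists G => b; have [h1 h2] := hG b; split=> //; exact: IH.
Qed.

Lemma tends0_mN2D (X Y : nat -> R -> M) : (forall m, mxmeasurable (X m)) -> (forall m, mxmeasurable (Y m)) ->
  tends0 (fun m => mN2 (X m)) -> tends0 (fun m => mN2 (Y m)) -> tends0 (fun m => mN2 (fun l => X m l + Y m l)).
Proof.
move=> mX mY tX tY; apply: (@tends0_le _ _ (fun m => 2%:E * mN2 (X m) + 2%:E * mN2 (Y m))%E).
  by move=> m; exact: mN2D.
by apply: tends0D; apply: tends0Z => // m; exact: mN2_ge0.
Qed.

Lemma tends0_mN2_eqae (X Y : nat -> R -> M) : (forall m, mxmeasurable (X m)) -> (forall m, mxmeasurable (Y m)) ->
  (forall m, {ae mu, forall l, X m l = Y m l}) -> tends0 (fun m => mN2 (Y m)) -> tends0 (fun m => mN2 (X m)).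
Proof. by move=> mX mY XY; apply: tends0_le => m; rewrite (mN2_eqae (mX m) (mY m) (XY m)). Qed.

Lemma tends0_mN2_scale (X Y : nat -> R -> M) (c : R) : 0 <= c -> (forall m, (mN2 (X m) <= c%:E * mN2 (Y m))%E) ->
  tends0 (fun m => mN2 (Y m)) -> tends0 (fun m => mN2 (X m)).
Proof.
move=> c0 XY tY; apply: (tends0_le XY); apply: tends0Z => // m; exact: mN2_ge0.
Qed.

Lemma q_intg (X : R -> M) : mL2 X -> intg (fun l => q (X l)).
Proof.
move=> [mX X2]; apply/integrableP; split; first by apply/measurable_EFinP; exact: measurable_q.
apply: le_lt_trans X2; rewrite le_eqVlt; apply/orP; left; apply/eqP.
by apply: eq_integral => l _; rewrite /= ger0_norm ?q_ge0.
Qed.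

Lemma mxmeasurable_quot (h : R) (X Y : R -> M) : mxmeasurable X -> mxmeasurable Y ->
  mxmeasurable (fun l => quot h (X l) (Y l)).
Proof. by move=> mX mY; apply: mxmeasurable_cZ; exact: mxmeasurableB. Qed.

Lemma mL2_quot (h : R) (X Y : R -> M) : mL2 X -> mL2 Y -> mL2 (fun l => quot h (X l) (Y l)).
Proof. by move=> mX mY; apply: mL2Z; exact: mL2B. Qed.

Lemma bdd2D F G : bdd2 F -> bdd2 G -> bdd2 (fun p l => F p l + G p l).
Proof.
move=> [mF [C C0 hC]] [mG [D D0 hD]]; split; first by move=> p; exact: mL2D.
exists (2 * C + 2 * D); first by rewrite addr_ge0// mulr_ge0.
move=> p; apply: (le_trans (mN2D (mF p).1 (mG p).1));
have -> : (2 * C + 2 * D)%:E = (2%:E * C%:E + 2%:E * D%:E)%E by rewrite -!EFinM -EFinD.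
by apply: leeD; apply: lee_wpmul2l.
Qed.

Lemma L2dD F G b F' G' : (forall p, mxmeasurable (F p)) -> (forall p, mxmeasurable (G p)) ->
  (forall p, mxmeasurable (F' p)) -> (forall p, mxmeasurable (G' p)) ->
  L2d F b F' -> L2d G b G' -> L2d (fun p l => F p l + G p l) b (fun p l => F' p l + G' p l).
Proof.
move=> mF mG mF' mG' hF hG p u hu.
apply: (tends0_mN2_eqae _ _ _ (tends0_mN2D _ _ (hF p u hu) (hG p u hu))).
- by move=> m; apply: mxmeasurableB; [apply: mxmeasurable_quot|]; exact: mxmeasurableD.
- by move=> m; apply: mxmeasurableD; apply: mxmeasurableB => //; exact: mxmeasurable_quot.
- by move=> m; apply: aeT => l; rewrite /quot opprD addrACA scalerDr opprD addrACA.
- by move=> m; apply: mxmeasurableB => //; exact: mxmeasurable_quot.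
- by move=> m; apply: mxmeasurableB => //; exact: mxmeasurable_quot.
Qed.

Lemma L2smoothD r F G : L2smooth r F -> L2smooth r G -> L2smooth r (fun p l => F p l + G p l).
Proof.
elim: r F G => [|r IH] F G [bF hF] [bG hG]; first by split=> //; exact: bdd2D.
split; first exact: bdd2D.
have [F' hF'] := hF; have [G' hG'] := hG; exists (fun b p l => F' b p l + G' b p l) => b.
have [f1 f2] := hF' b; have [g1 g2] := hG' b; split; last exact: IH.
apply: L2dD => // p; [exact: (bF.1 p).1|exact: (bG.1 p).1| |].
  exact: ((L2smooth_bdd f2).1 p).1.
exact: ((L2smooth_bdd g2).1 p).1.
Qed.

End SmoothnessClasses.

(** The discrete Leibniz rule; each summand on the right contains one error that tends to 0. *)
Lemma product_quot (R : realType) n (c : R[i]) (A B D E G H : 'M[R[i]]_n) :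
  c *: (A *m E - B *m G) - (D *m G + B *m H) =
  (c *: (A - B) - D) *m E + (D *m (E - G) + B *m (c *: (E - G) - H)).
Proof.
rewrite !(mulmxBl, mulmxBr, mulmxDl, mulmxDr) -?scalemxAl -?scalemxAr !(mulmxBl, mulmxBr).
by apply/matrixP => i j; rewrite !mxE; ring.
Qed.

Lemma T_quot (R : realType) n (c : R[i]) (A B D E G H J : 'M[R[i]]_n) :
  c *: (A - D) - (G + J) =
  (c *: (A - B) - E) + ((E - G) + (c *: (B - D) - H + (H - J))).
Proof. by apply/matrixP => i j; rewrite !mxE; ring. Qed.

(** * Difference quotients through the resolvent *)

Section TmQuotients.
Context {R : realType} {n : nat}.
Local Notation mu := (@lebesgue_measure R).
Local Notation M := 'M[R[i]]_n.
Variables (C : R) (v : R -> M) (Psi : R[i] -> M) (P Mm : R -> M).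
Hypothesis rh : rhdata C v Psi P Mm.
Implicit Types (X Y Z A B D : R -> M).

Lemma Tm_quot (h : R) X Y Z : mL2 X -> mL2 Y -> mL2 Z ->
  {ae mu, forall l, Tm Mm (fun r => quot h (X r) (Y r) - Z r) l = quot h (Tm Mm X l) (Tm Mm Y l) - Tm Mm Z l}.
Proof.
move=> hX hY hZ; have e1 := TB rh (mL2_quot h hX hY) hZ.
have e2 := TZ rh h^-1 (mL2B hX hY); have e3 := TB rh hX hY.
move: e1 (aeS2 (fun t h h' => conj h h') e2 e3); apply: aeS2 => l h1 [h2 h3].
by apply: (etrans h1); congr (_ - _); apply: (etrans h2); congr (_ *: _).
Qed.

Lemma Tm_quot2 (h : R) A B (dv : R -> M) :
  mL2 (fun r => A r *m dv r) -> mL2 (fun r => (A r - B r) *m (h^-1%:C *: dv r)) ->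
  mL2 (fun r => B r *m (h^-1%:C *: dv r)) ->
  {ae mu, forall l, A l - B l = Tm Mm (fun r => A r *m dv r) l} ->
  {ae mu, forall l, quot h (A l) (B l) = Tm Mm (fun r => (A r - B r) *m (h^-1%:C *: dv r)) l +
     Tm Mm (fun r => B r *m (h^-1%:C *: dv r)) l}.
Proof.
move=> h1 h2 h3 e1; have e2 := TZ rh h^-1 h1; have e3 := TD rh h2 h3.
move: e1 (aeS2 (fun t h h' => conj h h') e2 e3); apply: aeS2 => l a1 [a2 a3].
rewrite /quot a1; apply: (etrans (esym a2)); apply: (etrans _ a3); congr (Tm _ _ l).
by apply/funext => r; rewrite -mulmxDl subrK scalemxAr.
Qed.

End TmQuotients.

(** * Smoothness of the boundary values in x and y *)

Section RHFamily.
Context {R : realType} {n : nat}.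
Local Notation mu := (@lebesgue_measure R).
Local Notation intg f := (mu.-integrable setT (EFin \o f)).
Local Notation M := 'M[R[i]]_n.
Implicit Types (p : R * R) (b : bool) (u : nat -> R) (F G g : R * R -> R -> M).
Variables (k : nat) (v : R -> R -> R -> M).
Hypotheses (hk : (7 <= k)%N) (hv : scatdata k v).
Let K := (k - 4)%N.
Local Notation V i j p := (vder v i j p).

Lemma vder_smooth r i j : L2_diff_order k r i j -> L2smooth r (fun p => V i j p).
Proof.
have [C C0 hC] := vder_L2 hv.
have bV i' j' : (i' + j' <= K)%N -> bdd2 (fun p => V i' j' p).
  move=> ij; split; first by move=> p; exact: (hC _ _ ij p).1.
  by exists C => // p; exact: (hC _ _ ij p).2.
elim: r i j => [|r IH] i j; rewrite /L2_diff_order => g.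
  by split=> //; apply: bV; move: g; rewrite /K; case: (i == _) => /=; lia.
split; first by apply: bV; move: g; rewrite /K; case: (i == _) => /=; lia.
exists (fun b p => V (incx b i) (incy b j) p) => b; split.
  have g1 : L2_diff_order k 1 i j by rewrite /L2_diff_order; apply: leq_trans g; rewrite !leq_add2r.
  by move=> p u hu; exact: (vder_L2d hk hv b p g1 hu).
by apply: IH; move: g; rewrite /L2_diff_order; case: b; rewrite /incx /incy; case: i => [|i] /=; lia.
Qed.

Lemma bdd2_MV F i j : bdd2 F -> (i + j <= K)%N -> bdd2 (fun p l => F p l *m V i j p l).
Proof.
move=> [mF [D D0 hD]] ij; have [B B0 hB] := vder_bdd hk hv; split.
  by move=> p; apply: mL2_Mr B0 (mF p) (hB i j ij p).
exists (2 * n%:R * B * D); first by rewrite mulr_ge0// mulr_ge0// mulr_ge0.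
move=> p; apply: le_trans (mN2_Mr B0 (mF p).1 (hB i j ij p)) _.
by rewrite [X in (_ <= X)%E]EFinM lee_wpmul2l ?lee_fin// mulr_ge0// mulr_ge0.
Qed.

Lemma vquotE b i j p u m l : vquot v b i j p u m l = quot (u m) (V i j (sh b (u m) p) l) (V i j p l).
Proof. by []. Qed.

Lemma vquot_ae : exists2 C : R, 0 <= C & forall b i j p u, (i + j < K)%N -> hseq u ->
  forall m, mbdd C (vquot v b i j p u m).
Proof.
have [C C0 hC] := vder_lip hk hv; exists C => // b i j p u ij [u0 cu] m.
split; first by apply: (vquot_meas hv); exact: ltnW.
move: hC; apply: aeS => l hl; have := hl i j ij p b (u m).
rewrite /vquot qZ /= expr0n addr0 exprVn => h.
have um2 : 0 < u m ^+ 2 by rewrite exprn_even_gt0//= u0.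
by rewrite ler_pdivrMl// mulrC.
Qed.

(** As X is merely in L_2, L_2 convergence of the quotients would control the product only in L_1.
    They also converge pointwise and are uniformly bounded, so dominated convergence with a multiple
    of [q (X l)] applies. *)
Lemma mN2_pt (X : R -> M) b i j p u : mL2 X -> (i + j < K)%N -> hseq u ->
  tends0 (fun m => mN2 (fun l => X l *m (vquot v b i j p u m l - V (incx b i) (incy b j) p l))).
Proof.
move=> hX ij hu; have [C C0 hC] := vquot_ae; have [B B0 hB] := vder_bdd hk hv.
have ij' : (incx b i + incy b j <= K)%N by rewrite incxy.
pose c : R := 2 * n%:R * (2 * C + 2 * B).
apply: (@mN2_dominated _ _ _ (fun l => c * q (X l))).
- move=> m; apply: mxmeasurableM; first exact: hX.1.
  by apply: mxmeasurableB; [exact: (hC b i j p u ij hu m).1|exact: (hB _ _ ij' p).1].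
- by apply: intg_cM; exact: q_intg.
- apply: aeT => l; have h := vder_pt hv b p l ij hu.
  have h2 : 2 * n%:R * (q (X l) * q ((u m)^-1%:C *: (V i j (sh b (u m) p) l - V i j p l)
     - V (incx b i) (incy b j) p l)) @[m --> \oo] --> (2 * n%:R * (q (X l) * 0) : R).
    by apply: cvgMr; apply: cvgMr.
  rewrite !mulr0 in h2; apply: (squeeze_cvgr _ (cvg_cst 0) h2).
  by apply: nearW => m; rewrite q_ge0 qM.
have : {ae mu, forall l, forall m, q (vquot v b i j p u m l) <= C}.
  by apply: ae_foralln => m; exact: (hC b i j p u ij hu m).2.
move: (hB _ _ ij' p).2; apply: aeS2 => l hl h m.
apply: (le_trans (qM _ _)); rewrite /c -[leRHS]mulrA ler_wpM2l ?mulr_ge0// [leRHS]mulrC ler_wpM2l ?q_ge0//.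
by apply: (le_trans (qB _ _)); apply: lerD; rewrite ler_wpM2l.
Qed.

Lemma mN2_dV (X : R -> M) b i j p u : mL2 X -> (i + j < K)%N -> hseq u ->
  tends0 (fun m => mN2 (fun l => X l *m (V i j (sh b (u m) p) l - V i j p l))).
Proof.
move=> hX ij hu; have [C C0 hC] := vquot_ae; have [u0 cu] := hu.
have X2 : mN2 X \is a fin_num by rewrite ge0_fin_numE ?mN2_ge0//; exact: hX.2.
apply: (@tends0_hseq _ u (2 * n%:R * C * fine (mN2 X))) => //.
  by rewrite mulr_ge0 ?fine_ge0 ?mN2_ge0// mulr_ge0// mulr_ge0.
move=> m.
have E : (fun l => X l *m (V i j (sh b (u m) p) l - V i j p l)) = (fun l => (u m)%:C *: (X l *m vquot v b i j p u m l)).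
  apply/funext => l; rewrite /vquot -scalemxAr scalerA -rmorphM divff// scale1r.
  by [].
rewrite E mN2Zr; last by apply: mxmeasurableM; [exact: hX.1|exact: (hC b i j p u ij hu m).1].
rewrite !EFinM fineK// lee_wpmul2l ?lee_fin ?sqr_ge0// -!EFinM.
exact: mN2_Mr C0 hX.1 (hC b i j p u ij hu m).
Qed.

(** The three errors of [product_quot] are small for different reasons: convergence of the quotients
    of F, continuity of the derivative of v, and [mN2_pt]. *)
Lemma L2d_MV F F' b i j : bdd2 F -> bdd2 F' -> L2d F b F' -> (i + j < K)%N ->
  L2d (fun p l => F p l *m V i j p l) b (fun p l => F' p l *m V i j p l + F p l *m V (incx b i) (incy b j) p l).
Proof.
move=> bF bF' hF ij p u hu; have [B B0 hB] := vder_bdd hk hv.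
have ij' : (incx b i + incy b j <= K)%N by rewrite incxy.
have mV i' j' p' : (i' + j' <= K)%N -> mxmeasurable (V i' j' p') by exact: (vder_meas hv).
have mF p' := (bF.1 p').1; have mF' p' := (bF'.1 p').1.
pose X1 m l := (quot (u m) (F (sh b (u m) p) l) (F p l) - F' p l) *m V i j (sh b (u m) p) l.
pose X2 m l := F' p l *m (V i j (sh b (u m) p) l - V i j p l).
pose X3 m l := F p l *m (vquot v b i j p u m l - V (incx b i) (incy b j) p l).
have mX m : mxmeasurable (fun l => quot (u m) (F (sh b (u m) p) l) (F p l) - F' p l).
  by apply: mxmeasurableB => //; exact: mxmeasurable_quot.
have m1 m : mxmeasurable (X1 m) by apply: mxmeasurableM => //; exact: mV (ltnW ij).
have m2 m : mxmeasurable (X2 m) by apply: mxmeasurableM => //; apply: mxmeasurableB; exact: mV (ltnW ij).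
have m3 m : mxmeasurable (X3 m).
  by apply: mxmeasurableM => //; apply: mxmeasurableB; [exact: vquot_meas (ltnW ij)|exact: mV].
have t1 : tends0 (fun m => mN2 (X1 m)).
  apply: (tends0_mN2_scale (_ : 0 <= 2 * n%:R * B) _ (hF p u hu)); first by rewrite mulr_ge0// mulr_ge0.
  by move=> m; apply: (mN2_Mr B0 (mX m)); exact: hB (ltnW ij) _.
have t2 : tends0 (fun m => mN2 (X2 m)) := mN2_dV b p (bF'.1 p) ij hu.
have t3 : tends0 (fun m => mN2 (X3 m)) := mN2_pt b p (bF.1 p) ij hu.
have m23 m : mxmeasurable (fun l => X2 m l + X3 m l) by exact: mxmeasurableD.
apply: (tends0_mN2_eqae _ _ _ (tends0_mN2D m1 m23 t1 (tends0_mN2D m2 m3 t2 t3))).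
- move=> m; apply: mxmeasurableB; first by apply: mxmeasurable_quot; apply: mxmeasurableM => //; exact: mV (ltnW ij).
  by apply: mxmeasurableD; apply: mxmeasurableM => //; [exact: mV (ltnW ij)|exact: mV].
- by move=> m; exact: mxmeasurableD.
move=> m; apply: aeT => l; rewrite /X1 /X2 /X3 vquotE /quot.
move: (F (sh b (u m) p) l) (F p l) (F' p l) (V i j (sh b (u m) p) l) (V i j p l) (V (incx b i) (incy b j) p l) => A B' D E G H.
exact: product_quot.
Qed.

Lemma L2smooth_MV r F i j : L2smooth r F -> (r + i + j <= K)%N ->
  L2smooth r (fun p l => F p l *m V i j p l).
Proof.
elim: r F i j => [|r IH] F i j sF rij; first by split=> //; apply: bdd2_MV; [exact: L2smooth_bdd sF|].
split; first by apply: bdd2_MV; [exact: L2smooth_bdd sF|lia].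
have sF' := L2smooth_S sF; have [bF [F' hF']] := sF.
exists (fun b p l => F' b p l *m V i j p l + F p l *m V (incx b i) (incy b j) p l) => b.
have [f1 f2] := hF' b; split.
  by apply: L2d_MV => //; [exact: L2smooth_bdd f2|lia].
by apply: L2smoothD; apply: IH => //; [lia|case: b {f1 f2}; rewrite /incx /incy; lia].
Qed.

Variables (C : R) (Psi : R * R -> R[i] -> M) (P MM : R * R -> R -> M).
Hypothesis rh : forall p, rhdata C (fun l => v p.1 p.2 l) (Psi p) (P p) (MM p).
Let CB : R := 2 * n%:R * @Mbound R n C.
Let CT := CB * (2 * CB).

Lemma C_ge0 : 0 <= C. Proof. exact: rhd_C0 (rh (0, 0)). Qed.
Lemma CB_ge0 : 0 <= CB.
Proof. by rewrite mulr_ge0 ?Mbound_ge0 ?C_ge0// mulr_ge0. Qed.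
Lemma CT_ge0 : 0 <= CT.
Proof. by have h := CB_ge0; rewrite mulr_ge0// mulr_ge0. Qed.

Lemma TT_mN2 p (X : R -> M) : mL2 X -> (mN2 (Tm (MM p) X) <= CT%:E * mN2 X)%E.
Proof. exact: (mN2_T (rh p)). Qed.

Lemma TT_mL2 p (X : R -> M) : mL2 X -> mL2 (Tm (MM p) X).
Proof. exact: (mL2_T (rh p)). Qed.

Lemma TT_diff p p' (X : R -> M) : mL2 X -> {ae mu, forall l, Tm (MM p') X l - Tm (MM p) X l =
  Tm (MM p) (fun r => Tm (MM p') X r *m (V 0 0 p' r - V 0 0 p r)) l}.
Proof.
move=> hX; have := T_diff (rh p) (rh p') hX.
rewrite (_ : (fun r => Tm (MM p') X r *m (v p'.1 p'.2 r - v p.1 p.2 r)) =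
  (fun r => Tm (MM p') X r *m (V 0 0 p' r - V 0 0 p r)))//.
by apply/funext => r; rewrite !vder0 opprB addrA subrK.
Qed.

Lemma MM_diff p p' : {ae mu, forall l, MM p' l - MM p l =
  Tm (MM p) (fun r => MM p' r *m (V 0 0 p' r - V 0 0 p r)) l}.
Proof.
have := M_diff (rh p) (rh p').
rewrite (_ : (fun r => MM p' r *m (v p'.1 p'.2 r - v p.1 p.2 r)) =
  (fun r => MM p' r *m (V 0 0 p' r - V 0 0 p r)))//.
by apply/funext => r; rewrite !vder0 opprB addrA subrK.
Qed.

Lemma K_gt2 : (2 < K)%N. Proof. by rewrite /K; lia. Qed.

Lemma tends0_mN2_Mr (X Y : nat -> R -> M) (c : R) : 0 <= c -> (forall m, mxmeasurable (X m)) ->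
  (forall m, mbdd c (Y m)) -> tends0 (fun m => mN2 (X m)) -> tends0 (fun m => mN2 (fun l => X m l *m Y m l)).
Proof.
move=> c0 mX bY; apply: (tends0_mN2_scale (_ : 0 <= 2 * n%:R * c)); first by rewrite mulr_ge0// mulr_ge0.
by move=> m; exact: mN2_Mr c0 (mX m) (bY m).
Qed.

Lemma tends0_mN2_T p (X : nat -> R -> M) : (forall m, mL2 (X m)) -> tends0 (fun m => mN2 (X m)) ->
  tends0 (fun m => mN2 (Tm (MM p) (X m))).
Proof. by move=> hX; apply: (tends0_mN2_scale CT_ge0) => m; exact: TT_mN2. Qed.

Lemma mL2_MVd (X : R -> M) p p' : mL2 X -> mL2 (fun l => X l *m (V 0 0 p' l - V 0 0 p l)).
Proof.
move=> hX; have [B B0 hB] := vder_bdd hk hv.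
have h p'' := mL2_Mr B0 hX (hB 0%N 0%N (leq0n _) p'').
by have := mL2B (h p') (h p); congr mL2; apply/funext => l; exact: (esym (mulmxBr _ _ _)).
Qed.

(** [TT_diff] exhibits the factor v(p') - v(p), which is u m times a bounded quotient. *)
Lemma TT_cont b p u (X : R -> M) : mL2 X -> hseq u ->
  tends0 (fun m => mN2 (fun l => Tm (MM (sh b (u m) p)) X l - Tm (MM p) X l)).
Proof.
move=> hX hu; have [c c0 hc] := vquot_ae; have [u0 cu] := hu; have k0 : (0 + 0 < K)%N by have := K_gt2; lia.
have X2 : mN2 X \is a fin_num by rewrite ge0_fin_numE ?mN2_ge0//; exact: hX.2.
pose Y m l := Tm (MM (sh b (u m) p)) X l *m (V 0 0 (sh b (u m) p) l - V 0 0 p l).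
have hY m : mL2 (Y m) by apply: mL2_MVd; exact: TT_mL2.
apply: (tends0_mN2_eqae (Y := fun m => Tm (MM p) (Y m))).
- by move=> m; apply: mxmeasurableB; [exact: (TT_mL2 _ hX).1|exact: (TT_mL2 _ hX).1].
- by move=> m; exact: (TT_mL2 _ (hY m)).1.
- by move=> m; exact: TT_diff.
apply: tends0_mN2_T => //.
apply: (@tends0_hseq _ u (2 * n%:R * c * (CT * fine (mN2 X)))) => //.
  have ct := CT_ge0; rewrite mulr_ge0//; first by rewrite mulr_ge0// mulr_ge0.
  by rewrite mulr_ge0// fine_ge0// mN2_ge0.
move=> m; have hT := TT_mL2 (sh b (u m) p) hX.
have E : Y m = (fun l => (u m)%:C *: (Tm (MM (sh b (u m) p)) X l *m vquot v b 0 0 p u m l)).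
  by apply/funext => l; rewrite /Y /vquot -scalemxAr scalerA -rmorphM divff// scale1r.
rewrite E mN2Zr; last by apply: mxmeasurableM; [exact: hT.1|exact: (hc b 0%N 0%N p u k0 hu m).1].
rewrite [X in (_ <= X)%E]EFinM lee_wpmul2l ?lee_fin ?sqr_ge0//.
apply: (le_trans (mN2_Mr c0 hT.1 (hc b 0%N 0%N p u k0 hu m))).
rewrite [X in (_ <= X)%E]EFinM lee_wpmul2l ?lee_fin//; first by rewrite mulr_ge0// mulr_ge0.
by rewrite EFinM fineK//; exact: TT_mN2.
Qed.

(** Leibniz: T acts on d_b g, and by the resolvent identity the derivative of T itself sends g to T
    ((T g) d_b v). *)
Lemma L2d_T b (g g' : R * R -> R -> M) : bdd2 g -> bdd2 g' -> L2d g b g' ->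
  L2d (fun p => Tm (MM p) (g p)) b
    (fun p => Tm (MM p) (fun l => g' p l + Tm (MM p) (g p) l *m V (incx b 0) (incy b 0) p l)).
Proof.
move=> bg bg' hg p u hu; have [c c0 hc] := vquot_ae; have [u0 cu] := hu.
have [B B0 hB] := vder_bdd hk hv.
have k0 : (0 + 0 < K)%N by have := K_gt2; lia.
have k1 : (incx b 0 + incy b 0 <= K)%N by rewrite incxy; have := K_gt2; lia.
pose p' m := sh b (u m) p; pose T m := Tm (MM (p' m)); pose T0 := Tm (MM p).
pose V' := V (incx b 0) (incy b 0) p; pose D m := vquot v b 0 0 p u m.
have Lg p'' : mL2 (g p'') := bg.1 p''; have Lg' : mL2 (g' p) := bg'.1 p.
have LT0 : mL2 (T0 (g p)) by exact: TT_mL2.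
have LTg m : mL2 (T m (g p)) by exact: TT_mL2.
have LX1 m : mL2 (fun l => quot (u m) (g (p' m) l) (g p l) - g' p l).
  by apply: mL2B => //; exact: mL2_quot.
have bD m : mbdd c (D m) by exact: hc.
have LTV : mL2 (fun l => T0 (g p) l *m V' l) by exact: mL2_Mr B0 LT0 (hB _ _ k1 p).
have LG : mL2 (fun l => g' p l + T0 (g p) l *m V' l) by exact: mL2D.
have LTT m : mL2 (fun l => T m (g p) l - T0 (g p) l) by exact: (mL2B (LTg m) LT0).
have L3 m : mL2 (fun l => (T m (g p) l - T0 (g p) l) *m D m l) by exact: mL2_Mr c0 (LTT m) (bD m).
have L0D m : mL2 (fun l => T0 (g p) l *m D m l) by exact: mL2_Mr c0 LT0 (bD m).
have L4 m : mL2 (fun l => T0 (g p) l *m (D m l - V' l)).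
  have := mL2B (L0D m) LTV; congr mL2; apply/funext => l; exact: (esym (mulmxBr _ _ _)).
(* The errors: [X1] for the quotient of g, [X2] and [X3] for replacing T at the shifted point by T
   at p, [X4] for the quotient of v. *)
pose X1 m := T m (fun l => quot (u m) (g (p' m) l) (g p l) - g' p l).
pose X2 m l := T m (g' p) l - T0 (g' p) l.
pose X3 m := T0 (fun l => (T m (g p) l - T0 (g p) l) *m D m l).
pose X4 m := T0 (fun l => T0 (g p) l *m (D m l - V' l)).
have m1 m : mxmeasurable (X1 m) by exact: (TT_mL2 _ (LX1 m)).1.
have m2 m : mxmeasurable (X2 m) by exact: (mxmeasurableB (TT_mL2 _ Lg').1 (TT_mL2 _ Lg').1).
have m3 m : mxmeasurable (X3 m) by exact: (TT_mL2 _ (L3 m)).1.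
have m4 m : mxmeasurable (X4 m) by exact: (TT_mL2 _ (L4 m)).1.
have t1 : tends0 (fun m => mN2 (X1 m)).
  by apply: (tends0_mN2_scale CT_ge0 _ (hg p u hu)) => m; exact: TT_mN2.
have t2 : tends0 (fun m => mN2 (X2 m)) by exact: TT_cont.
have t3 : tends0 (fun m => mN2 (X3 m)).
  apply: tends0_mN2_T => //; apply: (tends0_mN2_Mr c0 _ bD); first by move=> m; exact: (LTT m).1.
  exact: TT_cont.
have t4 : tends0 (fun m => mN2 (X4 m)) by apply: tends0_mN2_T => //; exact: mN2_pt.
have m34 m := mxmeasurableD (m3 m) (m4 m).
have m234 m := mxmeasurableD (m2 m) (m34 m).
apply: (tends0_mN2_eqae _ _ _ (tends0_mN2D m1 m234 t1 (tends0_mN2D m2 m34 t2 (tends0_mN2D m3 m4 t3 t4)))).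
- move=> m; apply: mxmeasurableB; last exact: (TT_mL2 _ LG).1.
  exact: (mxmeasurable_quot _ (TT_mL2 _ (Lg _)).1 (TT_mL2 _ (Lg _)).1).
- by move=> m; exact: (mxmeasurableD (m1 m) (m234 m)).
move=> m.
have A1 : {ae mu, forall l, X1 m l = quot (u m) (T m (g (p' m)) l) (T m (g p) l) - T m (g' p) l}.
  exact: (Tm_quot (rh (p' m)) (u m) (Lg (p' m)) (Lg p) Lg').
have A2 : {ae mu, forall l, quot (u m) (T m (g p) l) (T0 (g p) l) = X3 m l + T0 (fun r => T0 (g p) r *m D m r) l}.
  have Ld := mL2_MVd p (p' m) (LTg m).
  exact: (Tm_quot2 (rh p) Ld (L3 m) (L0D m) (TT_diff p (p' m) (Lg p))).
have A3 : {ae mu, forall l, X4 m l = T0 (fun r => T0 (g p) r *m D m r) l - T0 (fun r => T0 (g p) r *m V' r) l}.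
  have := TB (rh p) (L0D m) LTV; apply: aeS => l <-.
  by rewrite /X4; congr (Tm _ _ l); apply/funext => r; exact: mulmxBr.
have A4 := TD (rh p) Lg' LTV.
move: (aeS2 (fun t h h' => conj h h') A1 A2) (aeS2 (fun t h h' => conj h h') A3 A4).
apply: aeS2 => l [a1 a2] [a3 a4].
apply: (etrans (congr1 (fun X => _ - X) a4)); rewrite a1 a3 /X2.
have a2' : X3 m l = quot (u m) (T m (g p) l) (T0 (g p) l) - T0 (fun r => T0 (g p) r *m D m r) l.
  by rewrite a2 addrK.
rewrite a2' /quot -/(T0 (g p)) -/(T0 (g' p)).
exact: T_quot.
Qed.

Lemma bdd2_T g : bdd2 g -> bdd2 (fun p => Tm (MM p) (g p)).
Proof.
move=> [Lg [D D0 hD]]; split; first by move=> p; exact: TT_mL2.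
exists (CT * D); first by rewrite mulr_ge0 ?CT_ge0.
move=> p; apply: le_trans (TT_mN2 p (Lg p)) _.
by rewrite [X in (_ <= X)%E]EFinM lee_wpmul2l ?lee_fin ?CT_ge0.
Qed.

(** The derivative of T g contains T g again, which the induction hypothesis covers at the lower
    order r. *)
Lemma L2smooth_T r g : L2smooth r g -> (r <= K)%N -> L2smooth r (fun p => Tm (MM p) (g p)).
Proof.
elim: r g => [|r IH] g sg rK; first by split=> //; apply: bdd2_T; exact: L2smooth_bdd sg.
split; first by apply: bdd2_T; exact: L2smooth_bdd sg.
have sg' := L2smooth_S sg; have [bg [g' hg]] := sg.
exists (fun b p => Tm (MM p) (fun l => g' b p l + Tm (MM p) (g p) l *m V (incx b 0) (incy b 0) p l)) => b.
have [g1 g2] := hg b; split; first by apply: L2d_T => //; exact: L2smooth_bdd g2.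
apply: (@IH _ _); last exact: ltnW.
apply: L2smoothD => //; apply: (L2smooth_MV (F := fun p => Tm (MM p) (g p))); first by apply: IH => //; exact: ltnW.
by rewrite -addnA incxy addn1.
Qed.

Lemma vder_N2lip : exists2 D : R, 0 <= D & forall b i j p h, (i + j < K)%N ->
  (mN2 (fun l => V i j (sh b h p) l - V i j p l)%R <= (h ^+ 2 * D)%:E)%E.
Proof.
have [D D0 hD] := vder_L2 hv; have [B B0 hB] := vder_ae hk hv.
exists (@entry_count R n * D); first by rewrite mulr_ge0 ?entry_count_ge0.
move=> b i j p h ij; have ij' : (incx b i + incy b j <= K)%N by rewrite incxy.
have H : {ae mu, forall l, forall s, q (V (incx b i) (incy b j) (sh b s p) l) <= B}.
  by move: hB; apply: aeS => l hl s; exact: hl.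
have := @mN2_mvt _ _ (fun s => V i j (sh b s p)) (fun s => V (incx b i) (incy b j) (sh b s p)) B
  (fun l s => vder_isd hv b p l s ij) H (fun s => vder_meas hv _ (ltnW ij)) (fun s => vder_meas hv _ ij') h D D0
  (fun s _ => (hD _ _ ij' _).2).
by rewrite sh0 mulrCA.
Qed.

Lemma MM_bdd p : mbdd (@Mbound R n C) (MM p). Proof. exact: M_bdd (rh p). Qed.

Lemma mL2_MMl p (X : R -> M) : mL2 X -> mL2 (fun l => MM p l *m X l).
Proof. move=> hX; exact: (mL2_Ml (Mbound_ge0 C_ge0) hX (MM_bdd p)). Qed.

Lemma mN2_MMl p (X : R -> M) : mL2 X -> (mN2 (fun l => MM p l *m X l)%R <= CB%:E * mN2 X)%E.
Proof. move=> hX; exact: (mN2_Ml (Mbound_ge0 C_ge0) hX.1 (MM_bdd p)). Qed.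

Lemma mL2_MMB p p' : mL2 (fun l => MM p' l - MM p l).
Proof.
by have := mL2B (rhd_M (rh p')) (rhd_M (rh p)); congr mL2; apply/funext => l; rewrite opprB addrA subrK.
Qed.

Lemma MM_cont b p u : hseq u -> tends0 (fun m => mN2 (fun l => MM (sh b (u m) p) l - MM p l)).
Proof.
move=> hu; have [u0 cu] := hu; have [D D0 hD] := vder_N2lip.
have k0 : (0 + 0 < K)%N by have := K_gt2; lia.
pose p' m := sh b (u m) p; pose dv m l := V 0 0 (p' m) l - V 0 0 p l.
have Ldv m : mL2 (dv m) by exact: (mL2B (vder_mL2 hv (p' m) (ltnW k0)) (vder_mL2 hv p (ltnW k0))).
have h1 m := mL2_MMl (p' m) (Ldv m).
apply: (tends0_mN2_eqae (Y := fun m => Tm (MM p) (fun l => MM (p' m) l *m dv m l))).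
- by move=> m; exact: (mL2_MMB p (p' m)).1.
- by move=> m; exact: (TT_mL2 p (h1 m)).1.
- by move=> m; exact: (MM_diff p (p' m)).
apply: (tends0_mN2_T p h1); apply: (tends0_mN2_scale CB_ge0 (fun m => mN2_MMl (p' m) (Ldv m))).
by apply: (@tends0_hseq _ u D) => // m; exact: hD.
Qed.

Lemma mulmx_sub1E (A B : M) : A *m B = B + (A - 1%:M) *m B.
Proof. by rewrite mulmxBl mul1mx addrC subrK. Qed.

(** This is T (M d_b v). M is written as 1 + (M - 1) because only M - 1 is in L_2 and belongs to the
    smoothness classes. *)
Definition Mder b p := Tm (MM p) (fun l => V (incx b 0) (incy b 0) p l + (MM p l - 1%:M) *m V (incx b 0) (incy b 0) p l).

Lemma L2d_M b : L2d (fun p l => MM p l - 1%:M) b (Mder b).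
Proof.
move=> p u hu; have [c c0 hc] := vquot_ae; have [u0 cu] := hu.
have k0 : (0 + 0 < K)%N by have := K_gt2; lia.
have k1 : (incx b 0 + incy b 0 <= K)%N by rewrite incxy; have := K_gt2; lia.
have g1 : L2_diff_order k 1 0 0 by rewrite /L2_diff_order /=; have := K_gt2; rewrite /K; lia.
pose p' m := sh b (u m) p; pose V' := V (incx b 0) (incy b 0) p; pose dv m l := V 0 0 (p' m) l - V 0 0 p l.
pose Dm m := vquot v b 0 0 p u m.
have LV' : mL2 V' by exact: (vder_mL2 hv p k1).
have Ldv m : mL2 (dv m) by exact: (mL2B (vder_mL2 hv (p' m) (ltnW k0)) (vder_mL2 hv p (ltnW k0))).
have LD m : mL2 (Dm m) by exact: (mL2Z _ (Ldv m)).
have LMM m : mL2 (fun l => MM (p' m) l - MM p l) := mL2_MMB p (p' m).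
have h1 m := mL2_MMl (p' m) (Ldv m).
have bD m : mbdd c (Dm m) by exact: hc.
have h2 m : mL2 (fun l => (MM (p' m) l - MM p l) *m Dm m l) := mL2_Mr c0 (LMM m) (bD m).
have h3 m : mL2 (fun l => MM p l *m Dm m l) := mL2_MMl p (LD m).
have LMV : mL2 (fun l => MM p l *m V' l) := mL2_MMl p LV'.
have LX m : mL2 (fun l => Dm m l - V' l) := mL2B (LD m) LV'.
have L2' m : mL2 (fun l => MM p l *m (Dm m l - V' l)) := mL2_MMl p (LX m).
pose X1 m := Tm (MM p) (fun l => (MM (p' m) l - MM p l) *m Dm m l).
pose X2 m := Tm (MM p) (fun l => MM p l *m (Dm m l - V' l)).
have t0 : tends0 (fun m => mN2 (fun l => MM (p' m) l - MM p l)) := MM_cont b p hu.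
have t1 : tends0 (fun m => mN2 (X1 m)).
  by apply: (tends0_mN2_T p h2); apply: (tends0_mN2_Mr c0 _ bD t0) => m; exact: (LMM m).1.
have t2 : tends0 (fun m => mN2 (X2 m)).
  apply: (tends0_mN2_T p L2'); apply: (tends0_mN2_scale CB_ge0 (fun m => mN2_MMl p (LX m))).
  exact: (vder_L2d hk hv b p g1 hu).
have m1 m : mxmeasurable (X1 m) := (TT_mL2 p (h2 m)).1.
have m2 m : mxmeasurable (X2 m) := (TT_mL2 p (L2' m)).1.
have EM : (fun l => V' l + (MM p l - 1%:M) *m V' l) = (fun l => MM p l *m V' l).
  by apply/funext => l; exact: (esym (mulmx_sub1E _ _)).
apply: (tends0_mN2_eqae _ _ _ (tends0_mN2D m1 m2 t1 t2)).
- move=> m; apply: mxmeasurableB; first by apply: mxmeasurable_quot; [exact: (rhd_M (rh (p' m))).1|exact: (rhd_M (rh p)).1].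
  by rewrite /Mder -/V' EM; exact: (TT_mL2 p LMV).1.
- by move=> m; exact: (mxmeasurableD (m1 m) (m2 m)).
move=> m; rewrite /Mder -/V' EM.
have A1 := Tm_quot2 (rh p) (h1 m) (h2 m) (h3 m) (MM_diff p (p' m)).
have A2 := TB (rh p) (h3 m) LMV.
move: A1 A2; apply: aeS2 => l a1 a2.
have -> : X2 m l = Tm (MM p) (fun r => MM p r *m Dm m r) l - Tm (MM p) (fun r => MM p r *m V' r) l.
  by apply: (etrans _ a2); congr (Tm _ _ l); apply/funext => r; exact: mulmxBr.
have -> : quot (u m) (MM (p' m) l - 1%:M) (MM p l - 1%:M) = quot (u m) (MM (p' m) l) (MM p l).
  by rewrite /quot opprB addrA subrK.
by apply: (etrans (congr1 (fun X => X - _) a1)); exact: (esym (addrA _ _ _)).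
Qed.

Hypothesis bM : bdd2 (fun p l => MM p l - 1%:M).

Lemma Mder_smooth b r : L2smooth r (fun p l => MM p l - 1%:M) -> L2_diff_order k r (incx b 0) (incy b 0) ->
  (r.+1 <= K)%N -> L2smooth r (Mder b).
Proof.
move=> sM g rK; apply: L2smooth_T; last exact: ltnW.
apply: L2smoothD; first exact: vder_smooth.
by apply: L2smooth_MV => //; rewrite -addnA incxy addn1.
Qed.

(** Each order of M needs a derivative of d_b v in L_2. The direction y sets the limit: there i = 0,
    and [L2_diff_order] charges one extra order, whence k - 5. *)
Lemma M_smooth r : (r <= k - 5)%N -> L2smooth r (fun p l => MM p l - 1%:M).
Proof.
elim: r => [|r IH] rk; first by split.
split=> //; exists Mder => b; split; first exact: L2d_M.
apply: Mder_smooth; first by apply: IH; exact: ltnW.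
  by rewrite /L2_diff_order; case: b => /=; lia.
by rewrite /K; lia.
Qed.

End RHFamily.

(** * The potential *)

Section ProductIntegrals.
Context {R : realType} {n : nat}.
Local Notation mu := (@lebesgue_measure R).
Local Notation intg f := (mu.-integrable setT (EFin \o f)).
Local Notation Re := complex.Re.
Local Notation Im := complex.Im.
Local Notation M := 'M[R[i]]_n.
Implicit Types (F G : R -> M).

Lemma mxintegralD F G : mxintegrable F -> mxintegrable G ->
  mxintegral (fun t => F t + G t) = mxintegral F + mxintegral G.
Proof.
move=> hF hG; apply/matrixP => i j; rewrite mxintE [RHS]mxE !mxintE.
rewrite -(cintD (hF i j) (hG i j)); apply: eq_cint => t; exact: mxE.
Qed.

Lemma mxintegrableD F G : mxintegrable F -> mxintegrable G -> mxintegrable (fun t => F t + G t).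
Proof.
move=> hF hG i j; apply: (eq_cintg _ (cintgD (hF i j) (hG i j))) => t.
by rewrite mxE.
Qed.

Lemma mxintegralZ (z : R[i]) F : mxintegrable F -> mxintegral (fun t => z *: F t) = z *: mxintegral F.
Proof.
move=> hF; apply/matrixP => i j; rewrite mxintE [RHS]mxE mxintE.
rewrite -(cintZ z (hF i j)); apply: eq_cint => t; exact: mxE.
Qed.

Lemma mxintegrableZ (z : R[i]) F : mxintegrable F -> mxintegrable (fun t => z *: F t).
Proof.
move=> hF i j; apply: (eq_cintg _ (cintgZ z (hF i j))) => t; by rewrite mxE.
Qed.

Lemma mxintegralB F G : mxintegrable F -> mxintegrable G ->
  mxintegral (fun t => F t - G t) = mxintegral F - mxintegral G.
Proof.
move=> hF hG; have h : mxintegrable (fun t => -1 *: G t) := mxintegrableZ _ hG.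
have -> : (fun t => F t - G t) = (fun t => F t + -1 *: G t) by apply/funext => t; rewrite scaleN1r.
by rewrite (mxintegralD hF h) (mxintegralZ _ hG) scaleN1r.
Qed.

Lemma mxintegrable_M F G : mL2 F -> mL2 G -> mxintegrable (fun t => F t *m G t).
Proof.
move=> hF hG i j; apply: (@eq_cintg _ (fun t => \sum_k F t i k * G t k j)).
  by move=> t; rewrite mxE.
by apply: cintg_sum => k; apply: cL2M_cintg; exact: mL2_cL2.
Qed.

Lemma mL2_norm F : mL2 F -> L2 (fun t => mxnorm (F t)).
Proof.
move=> [mF F2]; split=> //.
have -> : (fun t => mxnorm (F t)) = (fun t => Num.sqrt (q (F t))).
  by apply/funext => t; rewrite /q sqrtr_sqr ger0_norm// mxnorm_ge0.
apply: (measurableT_comp (continuous_measurable_fun (@sqrt_continuous R))).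
exact: measurable_q.
Qed.

Lemma q_mxintegral_M : exists2 c : R, 0 <= c & forall F G, mL2 F -> mL2 G ->
  q (mxintegral (fun t => F t *m G t)) <= c * (fine (mN2 F) * fine (mN2 G)).
Proof.
exists (@entry_count R n * (2 * n%:R)); first by rewrite mulr_ge0 ?entry_count_ge0// mulr_ge0.
move=> F G hF hG; pose N : R := fine (mN2 F) * fine (mN2 G).
have N0 : 0 <= N by rewrite mulr_ge0// fine_ge0// mN2_ge0.
pose c := Num.sqrt (2 * n%:R * N).
have c2 : c ^+ 2 = 2 * n%:R * N by rewrite sqr_sqrtr// mulr_ge0// mulr_ge0.
have hf := mL2_norm hF; have hg := mL2_norm hG; have ifg := L2M_integrable hf hg.
have key : (\int[mu]_t (mxnorm (F t) * mxnorm (G t))) ^+ 2 <= N by exact: L2_CS hf hg.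
have iFG := mxintegrable_M hF hG.
have E (f : R -> R) : intg f -> (forall t, f t ^+ 2 <= q (F t *m G t)) -> \int[mu]_t `|f t| <= c.
  move=> fi fq.
  have i1 : intg (fun t => `|f t|) by exact: integrable_abse fi.
  have i2 := intg_cM (Num.sqrt (2 * n%:R)) ifg.
  apply: (@le_trans _ _ (\int[mu]_t (Num.sqrt (2 * n%:R) * (mxnorm (F t) * mxnorm (G t))))).
    apply: le_Rintegral => // t _.
    rewrite -(@ler_pXn2r _ 2)// ?nnegrE ?mulr_ge0 ?sqrtr_ge0 ?mxnorm_ge0//.
    rewrite real_normK ?num_real// !exprMn sqr_sqrtr ?mulr_ge0//.
    exact: le_trans (fq t) (qM _ _).
  rewrite RintegralZl//.
  have I0 : 0 <= \int[mu]_t (mxnorm (F t) * mxnorm (G t)).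
    by apply: Rintegral_ge0 => t _; rewrite mulr_ge0 ?mxnorm_ge0.
  rewrite -(@ler_pXn2r _ 2)// ?nnegrE ?mulr_ge0 ?sqrtr_ge0//.
  by rewrite c2 exprMn sqr_sqrtr ?mulr_ge0// ler_wpM2l// mulr_ge0.
rewrite -/N -mulrA -c2; apply: q_mxintegral_le => //; first exact: sqrtr_ge0.
by move=> a d; have [h1 h2] := iFG a d; split; apply: E => // t; [exact: q_Re|exact: q_Im].
Qed.

Lemma fine_le_mN2 F (c : R) : mL2 F -> (mN2 F <= c%:E)%E -> fine (mN2 F) <= c.
Proof.
move=> hF h; have f : mN2 F \is a fin_num by rewrite ge0_fin_numE ?mN2_ge0//; exact: hF.2.
by rewrite -lee_fin fineK.
Qed.

Lemma qint_cvg0 (X Y : nat -> R -> M) (C : R) : 0 <= C -> (forall m, mL2 (X m)) -> (forall m, mL2 (Y m)) ->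
  (forall m, fine (mN2 (Y m)) <= C) -> tends0 (fun m => mN2 (X m)) ->
  q (mxintegral (fun t => X m t *m Y m t)) @[m --> \oo] --> (0 : R) /\
  q (mxintegral (fun t => Y m t *m X m t)) @[m --> \oo] --> (0 : R).
Proof.
move=> C0 hX hY YC tX; have [c c0 hc] := q_mxintegral_M.
have f0 (F : R -> M) : 0 <= fine (mN2 F) by rewrite fine_ge0// mN2_ge0.
have H (Z : nat -> M) : (forall m, q (Z m) <= c * (fine (mN2 (X m)) * fine (mN2 (Y m)))) ->
   q (Z m) @[m --> \oo] --> (0 : R).
  move=> hZ; apply/cvgrPdist_le => e e0.
  have d0 : 0 < e / (c * C + 1) by rewrite divr_gt0// ltr_wpDl// mulr_ge0.
  have [N hN] := tX _ d0; exists N => // m Nm /=.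
  rewrite sub0r normrN ger0_norm ?q_ge0//; apply: (le_trans (hZ m)).
  have h := fine_le_mN2 (hX m) (hN m Nm).
  apply: (@le_trans _ _ (c * (e / (c * C + 1) * C))).
    by rewrite ler_wpM2l// ler_pM.
  have -> : c * (e / (c * C + 1) * C) = e * (c * C / (c * C + 1)) by ring.
  rewrite ler_piMr// ?(ltW e0)// ler_pdivrMr ?mul1r; last by rewrite ltr_wpDl// mulr_ge0.
  by rewrite lerDl.
split; apply: H => m; first exact: hc.
by rewrite [X in c * X]mulrC; exact: hc.
Qed.

Lemma mxisd_of_seq (F : R -> M) (A : M) : (forall u, hseq u ->
   q ((u m)^-1%:C *: (F (u m) - F 0) - A) @[m --> \oo] --> (0 : R)) -> mxisd F 0 A.
Proof.
move=> h i j; split; apply: is_derive_seq0 => u hu; apply/subr_cvg0; apply: sqr_cvg0 => e e0;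
  have /cvgrPdist_le/(_ e e0)[N _ hN] := h u hu; exists N => m Nm; have := hN m Nm;
  rewrite /= sub0r normrN ger0_norm ?q_ge0//; apply: le_trans.
- have := q_Re ((u m)^-1%:C *: (F (u m) - F 0) - A) i j.
  by rewrite !mxE cReB cReM cReB /= mul0r subr0.
- have := q_Im ((u m)^-1%:C *: (F (u m) - F 0) - A) i j.
  by rewrite !mxE cImB cImM cImB /= mul0r addr0.
Qed.

Lemma q3_cvg0 (X I1 I2 I3 : nat -> M) : q (I1 m) @[m --> \oo] --> (0 : R) -> q (I2 m) @[m --> \oo] --> (0 : R) ->
  q (I3 m) @[m --> \oo] --> (0 : R) -> (forall m, X m = I1 m + (I2 m + I3 m)) -> q (X m) @[m --> \oo] --> (0 : R).
Proof.
move=> t1 t2 t3 E.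
have t : 2 * q (I1 m) + 2 * (2 * q (I2 m) + 2 * q (I3 m)) @[m --> \oo] --> (2 * 0 + 2 * (2 * 0 + 2 * 0) : R).
  apply: cvgD; first exact: cvgMr.
  by apply: cvgMr; apply: cvgD; exact: cvgMr.
move: t; rewrite !(mulr0, addr0) => t; apply: (squeeze_cvgr _ (cvg_cst 0) t); apply: nearW => m.
rewrite q_ge0 /= E; apply: (le_trans (qD _ _)); rewrite lerD2l ler_wpM2l//; exact: qD.
Qed.

End ProductIntegrals.

(** * Bounded functions of x and y that vanish at infinity *)

Section ClassK.
Context {R : realType} {n : nat}.
Local Notation mu := (@lebesgue_measure R).
Local Notation M := 'M[R[i]]_n.
Implicit Types (p : R * R) (b : bool) (u : nat -> R) (F : R * R -> R -> M) (Q : R * R -> M).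

Definition bdd_vanish Q := (exists C : R, forall p, q (Q p) <= C) /\ vanish_unif (fun x y => (q (Q (x, y)))%:E).

(** The counterpart of [L2smooth] for integrated quantities: pointwise derivatives up to order r,
    each bounded and vanishing at infinity. *)
Fixpoint decaying (r : nat) Q : Prop := bdd_vanish Q /\
  match r with 0%N => True | r'.+1 => exists G : bool -> R * R -> M,
    forall b, (forall p, mxisd (fun h => Q (sh b h p)) 0 (G b p)) /\ decaying r' (G b) end.

Lemma decaying_bdd_vanish r Q : decaying r Q -> bdd_vanish Q.
Proof. by case: r => [|r] []. Qed.

Lemma bdd_vanishD Q Q' : bdd_vanish Q -> bdd_vanish Q' -> bdd_vanish (fun p => Q p + Q' p).
Proof.
move=> [[C hC] v1] [[C' hC'] v2]; split.
  by exists (2 * C + 2 * C') => p; apply: (le_trans (qD _ _)); rewrite lerD// ler_wpM2l.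
move=> e e0; have e4 : 0 < e / 4 by lra.
have [B1 h1] := v1 _ e4; have [B2 h2] := v2 _ e4; exists (Num.max B1 B2) => x y hxy.
have := h1 x y; have := h2 x y; rewrite !lee_fin => h2' h1'; apply: (le_trans (qD _ _)).
have g1 : q (Q (x, y)) <= e / 4 by apply: h1'; case: hxy; rewrite ge_max => /andP[? ?]; [left|right].
have g2 : q (Q' (x, y)) <= e / 4 by apply: h2'; case: hxy; rewrite ge_max => /andP[? ?]; [left|right].
lra.
Qed.

Lemma qZc (z : R[i]) (A : M) : q (z *: A) = (complex.Re z ^+ 2 + complex.Im z ^+ 2) * q A.
Proof. exact: qZ. Qed.

Lemma bdd_vanishZ (z : R[i]) Q : bdd_vanish Q -> bdd_vanish (fun p => z *: Q p).
Proof.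
set c := complex.Re z ^+ 2 + complex.Im z ^+ 2.
have c0 : 0 <= c by rewrite addr_ge0 ?sqr_ge0.
move=> [[C hC] v1]; split; first by exists (c * C) => p; rewrite qZc ler_wpM2l.
move=> e e0; have c1 : 0 < c + 1 by rewrite ltr_wpDl.
have [B h] := v1 (e / (c + 1)) ltac:(by rewrite divr_gt0); exists B => x y /h.
rewrite !lee_fin qZc -/c => hq; apply: (@le_trans _ _ (c * (e / (c + 1)))); first by rewrite ler_wpM2l.
rewrite mulrCA ler_piMr// ?(ltW e0)// ler_pdivrMr// mul1r; lra.
Qed.

Lemma decayingD r Q Q' : decaying r Q -> decaying r Q' -> decaying r (fun p => Q p + Q' p).
Proof.
elim: r Q Q' => [|r IH] Q Q' [b1 h1] [b2 h2]; first by split=> //; exact: bdd_vanishD.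
split; first exact: bdd_vanishD.
have [G hG] := h1; have [G' hG'] := h2; exists (fun b p => G b p + G' b p) => b.
have [d1 k1] := hG b; have [d2 k2] := hG' b; split; last exact: IH.
by move=> p; exact: (mxisdD (d1 p) (d2 p)).
Qed.

Lemma decayingZ (z : R[i]) r Q : decaying r Q -> decaying r (fun p => z *: Q p).
Proof.
elim: r Q => [|r IH] Q [b1 h1]; first by split=> //; exact: bdd_vanishZ.
split; first exact: bdd_vanishZ.
have [G hG] := h1; exists (fun b p => z *: G b p) => b; have [d1 k1] := hG b; split; last exact: IH.
by move=> p; exact: (mxisdZ z (d1 p)).
Qed.

Variables (k : nat) (v : R -> R -> R -> M).
Hypotheses (hk : (7 <= k)%N) (hv : scatdata k v).
Let K := (k - 4)%N.
Local Notation V i j p := (vder v i j p).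

Lemma vder_int_bdd_vanish i j : (i + j <= K)%N -> bdd_vanish (fun p => mxintegral (V i j p)).
Proof.
move=> ij; split; last exact: (vder_int_vanish hv ij).
exact: (vder_int_bound hv ij).
Qed.

(** The condition 0 < i survives differentiation in either direction, so the weighted case of
    [vder_int_isd] applies at every step without loss of order. *)
Lemma decaying_vder r i j : (0 < i)%N -> (r + i + j <= K)%N -> decaying r (fun p => mxintegral (V i j p)).
Proof.
elim: r i j => [|r IH] i j i0 rij; first by split=> //; exact: vder_int_bdd_vanish.
split; first by apply: vder_int_bdd_vanish; lia.
exists (fun b p => mxintegral (V (incx b i) (incy b j) p)) => b; split; last first.
  by apply: IH; [case: b; rewrite /incx|rewrite -addnA incxy; lia].
move=> p; apply: (vder_int_isd hk hv); first by rewrite -/K; lia.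
by left; case: b; rewrite /incx.
Qed.

Lemma Mvder_int_bdd_vanish F i j : bdd2 F -> (i + j <= K)%N -> bdd_vanish (fun p => mxintegral (fun l => F p l *m V i j p l)).
Proof.
move=> [mF [D D0 hD]] ij; have [c c0 hc] := @q_mxintegral_M R n; have [C C0 hC] := vder_L2 hv.
have f0 (G : R -> M) : 0 <= fine (mN2 G) by rewrite fine_ge0// mN2_ge0.
have mV p : mL2 (V i j p) := vder_mL2 hv p ij.
have B p : q (mxintegral (fun l => F p l *m V i j p l)) <= c * (D * fine (mN2 (V i j p))).
  apply: (le_trans (hc _ _ (mF p) (mV p))); rewrite ler_wpM2l// ler_wpM2r//.
  exact: fine_le_mN2.
split.
  exists (c * (D * C)) => p; apply: (le_trans (B p)); rewrite ler_wpM2l// ler_wpM2l//.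
  by apply: (fine_le_mN2 (mV p)); exact: (hC i j ij p).2.
move=> e e0; have d0 : 0 < e / (c * D + 1) by rewrite divr_gt0// ltr_wpDl// mulr_ge0.
have [A hA] := vder_vanish hv ij d0; exists A => x y /hA h; rewrite lee_fin.
apply: (le_trans (B (x, y))); have h' := fine_le_mN2 (mV (x, y)) h.
apply: (@le_trans _ _ (c * (D * (e / (c * D + 1))))); first by do 2 rewrite ler_wpM2l//.
have -> : c * (D * (e / (c * D + 1))) = e * (c * D / (c * D + 1)) by ring.
rewrite ler_piMr// ?(ltW e0)// ler_pdivrMr ?mul1r; last by rewrite ltr_wpDl// mulr_ge0.
by rewrite lerDl.
Qed.

(** In each term of [product_quot] one factor tends to 0 in L_2 and the other is bounded there, so
    by Cauchy-Schwarz the integral tends to 0. *)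
Lemma Mvder_int_isd F F' b i j p : bdd2 F -> bdd2 F' -> L2d F b F' -> L2_diff_order k 1 i j ->
  mxisd (fun h => mxintegral (fun l => F (sh b h p) l *m V i j (sh b h p) l)) 0
    (mxintegral (fun l => F' p l *m V i j p l) + mxintegral (fun l => F p l *m V (incx b i) (incy b j) p l)).
Proof.
move=> [mF _] [mF' _] hF g; have [C C0 hC] := vder_L2 hv.
have ij : (i + j < K)%N by move: g; rewrite /L2_diff_order -/K; case: (i == _) => /=; lia.
have ij0 := ltnW ij.
have ij' : (incx b i + incy b j <= K)%N by rewrite incxy.
have mV p' : mL2 (V i j p') := vder_mL2 hv p' ij0.
have mV' : mL2 (V (incx b i) (incy b j) p) := vder_mL2 hv p ij'.
have f0 (G : R -> M) : 0 <= fine (mN2 G) by rewrite fine_ge0// mN2_ge0.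
apply: mxisd_of_seq => u hu; rewrite sh0.
have mX1 m : mL2 (fun l => quot (u m) (F (sh b (u m) p) l) (F p l) - F' p l).
  by apply: (mL2B _ (mF' p)); exact: (mL2_quot _ (mF _) (mF p)).
have mdV m : mL2 (fun l => V i j (sh b (u m) p) l - V i j p l) := mL2B (mV _) (mV p).
have mdq m : mL2 (vquot v b i j p u m) by exact: (mL2_quot _ (mV _) (mV p)).
have mX3 m : mL2 (fun l => vquot v b i j p u m l - V (incx b i) (incy b j) p l) := mL2B (mdq m) mV'.
pose I1 m := mxintegral (fun l => (quot (u m) (F (sh b (u m) p) l) (F p l) - F' p l) *m V i j (sh b (u m) p) l).
pose I2 m := mxintegral (fun l => F' p l *m (V i j (sh b (u m) p) l - V i j p l)).
pose I3 m := mxintegral (fun l => F p l *m (vquot v b i j p u m l - V (incx b i) (incy b j) p l)).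
have t1 : q (I1 m) @[m --> \oo] --> (0 : R).
  apply: (proj1 (qint_cvg0 C0 mX1 (fun m => mV _) _ (hF p u hu))) => m.
  by apply: (fine_le_mN2 (mV _)); exact: (hC i j ij0 _).2.
have tdV : tends0 (fun m => mN2 (fun l => V i j (sh b (u m) p) l - V i j p l)).
  have [D D0 hD] := vder_N2lip hk hv.
  by apply: (@tends0_hseq _ u D) => // m; exact: hD.
have t2 : q (I2 m) @[m --> \oo] --> (0 : R).
  exact: (proj2 (qint_cvg0 (f0 (F' p)) mdV (fun m => mF' p) (fun m => lexx _) tdV)).
have t3 : q (I3 m) @[m --> \oo] --> (0 : R).
  exact: (proj2 (qint_cvg0 (f0 (F p)) mX3 (fun m => mF p) (fun m => lexx _) (vder_L2d hk hv b p g hu))).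
have E m : (u m)^-1%:C *: (mxintegral (fun l => F (sh b (u m) p) l *m V i j (sh b (u m) p) l) -
     mxintegral (fun l => F p l *m V i j p l)) - (mxintegral (fun l => F' p l *m V i j p l) +
     mxintegral (fun l => F p l *m V (incx b i) (incy b j) p l)) = I1 m + (I2 m + I3 m).
  have i1 := mxintegrable_M (mX1 m) (mV (sh b (u m) p)).
  have i2 := mxintegrable_M (mF' p) (mdV m); have i3 := mxintegrable_M (mF p) (mX3 m).
  have a1 := mxintegrable_M (mF (sh b (u m) p)) (mV (sh b (u m) p)); have a2 := mxintegrable_M (mF p) (mV p).
  have a3 := mxintegrable_M (mF' p) (mV p); have a4 := mxintegrable_M (mF p) mV'.
  rewrite /I1 /I2 /I3; apply: esym.
  apply: (etrans (congr1 (fun X => _ + X) (esym (mxintegralD i2 i3)))).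
  apply: (etrans (esym (mxintegralD i1 (mxintegrableD i2 i3)))).
  apply: esym; apply: (etrans (congr1 (fun X => _ *: X - _) (esym (mxintegralB a1 a2)))).
  apply: (etrans (congr1 (fun X => _ - X) (esym (mxintegralD a3 a4)))).
  have a12 : mxintegrable (fun l => F (sh b (u m) p) l *m V i j (sh b (u m) p) l - F p l *m V i j p l).
    have := mxintegrableD a1 (mxintegrableZ (-1) a2); congr mxintegrable.
    by apply/funext => l; rewrite scaleN1r.
  apply: (etrans (congr1 (fun X => X - _) (esym (mxintegralZ (u m)^-1%:C a12)))).
  apply: (etrans (esym (mxintegralB (mxintegrableZ _ a12) (mxintegrableD a3 a4)))).
  by congr mxintegral; apply/funext => l; exact: product_quot.
exact: q3_cvg0 t1 t2 t3 E.
Qed.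

Lemma decaying_Mvder r F i j : L2smooth r F -> L2_diff_order k r i j -> decaying r (fun p => mxintegral (fun l => F p l *m V i j p l)).
Proof.
elim: r F i j => [|r IH] F i j sF g.
  split=> //; apply: Mvder_int_bdd_vanish; first exact: L2smooth_bdd sF.
  by move: g; rewrite /L2_diff_order -/K; case: (i == _) => /=; lia.
have [bF [F' hF']] := sF; have sF' := L2smooth_S sF.
have g' b : L2_diff_order k r (incx b i) (incy b j).
  by move: g; rewrite /L2_diff_order; case: b; rewrite /incx /incy; case: i => [|i] /=; lia.
have g0 : L2_diff_order k r i j by apply: leq_trans g; rewrite !leq_add2r.
have g1 : L2_diff_order k 1 i j by apply: leq_trans g; rewrite !leq_add2r.
split; first by apply: Mvder_int_bdd_vanish => //; move: g; rewrite /L2_diff_order -/K; case: (i == _) => /=; lia.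
exists (fun b p => mxintegral (fun l => F' b p l *m V i j p l) +
  mxintegral (fun l => F p l *m V (incx b i) (incy b j) p l)) => b.
have [d s] := hF' b; split; last by apply: decayingD; exact: IH.
by move=> p; apply: Mvder_int_isd => //; exact: L2smooth_bdd s.
Qed.

End ClassK.

(** * Integrals of functions equal almost everywhere *)

Section AlmostEverywhereIntegrals.
Context {R : realType} {n : nat}.
Local Notation mu := (@lebesgue_measure R).
Local Notation intg f := (mu.-integrable setT (EFin \o f)).
Local Notation M := 'M[R[i]]_n.
Implicit Types (F G : R -> M).

Lemma intg_eqae (f g : R -> R) : measurable_fun setT g -> {ae mu, forall t, f t = g t} -> intg f -> intg g.
Proof.
move=> mg fg fi; have mf := intg_mf fi; apply/integrableP; split; first exact/measurable_EFinP.
have /integrableP[_] := fi; apply: le_lt_trans.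
apply: ae_ge0_le_integral => //.
- by apply: measurableT_comp => //; exact/measurable_EFinP.
- by apply: measurableT_comp => //; exact/measurable_EFinP.
by move: fg; apply: aeS => t /= -> _.
Qed.

Lemma mxintegrable_eqae F G : mxmeasurable G -> {ae mu, forall t, F t = G t} -> mxintegrable F -> mxintegrable G.
Proof.
move=> mG FG hF i j; have [m1 m2] := mG i j; have [h1 h2] := hF i j.
by split; [apply: intg_eqae h1|apply: intg_eqae h2] => //; move: FG; apply: aeS => t ->.
Qed.

Lemma mxintegral_eqae F G : mxmeasurable F -> mxmeasurable G -> {ae mu, forall t, F t = G t} ->
  mxintegral F = mxintegral G.
Proof.
move=> mF mG FG; apply/matrixP => i j; rewrite !mxintE; have [f1 f2] := mF i j; have [g1 g2] := mG i j.
by apply: complex_ext; apply: Rint_eqae => //; move: FG; apply: aeS => t ->.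
Qed.

Lemma mxintegral_adj F : mxintegrable F -> mxintegral (fun t => (F t)^t*) = (mxintegral F)^t*.
Proof.
move=> hF; apply/matrixP => i j; rewrite mxintE [RHS]adjE mxintE -(cint_conj (hF j i)).
by apply: eq_cint => t; rewrite adjE.
Qed.

End AlmostEverywhereIntegrals.

(** * Jacobi's formula for the derivative of a determinant *)

Section Jacobi.
Context {R : realType}.
Local Notation Re := complex.Re.
Local Notation Im := complex.Im.
Implicit Types (f g : R -> R[i]) (s : R).

Definition cisd f s (d : R[i]) :=
  is_derive s (1:R) (fun r => Re (f r)) (Re d) /\ is_derive s (1:R) (fun r => Im (f r)) (Im d).

Lemma cisd_cst (c : R[i]) s : cisd (fun=> c) s 0.
Proof. by split; exact: is_derive_cst. Qed.

Lemma cisdD f g s d e : cisd f s d -> cisd g s e -> cisd (fun r => f r + g r) s (d + e).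
Proof.
move=> [f1 f2] [g1 g2]; split.
  rewrite cReD (_ : (fun r => _) = (fun r => Re (f r)) + (fun r => Re (g r))); first exact: is_deriveD.
  by apply/funext => r; rewrite cReD.
rewrite cImD (_ : (fun r => _) = (fun r => Im (f r)) + (fun r => Im (g r))); first exact: is_deriveD.
by apply/funext => r; rewrite cImD.
Qed.

Lemma cisdM f g s d e : cisd f s d -> cisd g s e -> cisd (fun r => f r * g r) s (d * g s + f s * e).
Proof.
move=> [f1 f2] [g1 g2]; split.
  rewrite (_ : (fun r => _) = (fun r => Re (f r)) * (fun r => Re (g r)) - (fun r => Im (f r)) * (fun r => Im (g r))).
    apply: (is_derive_eq (is_deriveB (is_deriveM f1 g1) (is_deriveM f2 g2))).
    by rewrite cReD !cReM /GRing.scale /=; ring.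
  by apply/funext => r; rewrite cReM.
rewrite (_ : (fun r => _) = (fun r => Re (f r)) * (fun r => Im (g r)) + (fun r => Im (f r)) * (fun r => Re (g r))).
  apply: (is_derive_eq (is_deriveD (is_deriveM f1 g2) (is_deriveM f2 g1))).
  by rewrite cImD !cImM /GRing.scale /=; ring.
by apply/funext => r; rewrite cImM.
Qed.

Lemma cisd_sum (I : Type) (t : seq I) (f : I -> R -> R[i]) s (d : I -> R[i]) :
  (forall i, cisd (f i) s (d i)) -> cisd (fun r => \sum_(i <- t) f i r) s (\sum_(i <- t) d i).
Proof.
move=> h; elim: t => [|i t IH].
  rewrite big_nil; have := cisd_cst 0 s; congr cisd.
  by apply/funext => r; rewrite big_nil.
rewrite big_cons; have := cisdD (h i) IH; congr cisd.
by apply/funext => r; rewrite big_cons.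
Qed.

Lemma cisd_prod (I : eqType) (t : seq I) (f : I -> R -> R[i]) s (d : I -> R[i]) : uniq t ->
  (forall i, cisd (f i) s (d i)) -> cisd (fun r => \prod_(i <- t) f i r) s
    (\sum_(i <- t) \prod_(j <- t) (if j == i then d j else f j s)).
Proof.
move=> ut h; elim: t ut => [_|i t IH /= /andP[it ut]].
  rewrite big_nil; have := cisd_cst 1 s; congr cisd.
  by apply/funext => r; rewrite big_nil.
have := cisdM (h i) (IH ut); rewrite big_cons big_cons eqxx.
have -> : \prod_(j <- t) (if j == i then d j else f j s) = \prod_(j <- t) f j s.
  by apply: eq_big_seq => j jt; case: eqP => // ji; rewrite -ji jt in it.
have -> : \sum_(i0 <- t) \prod_(j <- (i :: t)) (if j == i0 then d j else f j s) =
   f i s * \sum_(i0 <- t) \prod_(j <- t) (if j == i0 then d j else f j s).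
  rewrite mulr_sumr; apply: eq_big_seq => j jt; rewrite big_cons.
  by case: eqP => // ji; rewrite ji jt in it.
congr cisd; by apply/funext => r; rewrite big_cons.
Qed.

(** Differentiate the Leibniz expansion factor by factor; collecting by rows gives the determinants
    in which one row of A is replaced by that of D, and expansion along this row produces the
    adjugate. *)
Lemma cisd_det n (A : R -> 'M[R[i]]_n) (D : 'M[R[i]]_n) s : mxisd A s D ->
  cisd (fun r => \det (A r)) s (\tr (D *m \adj (A s))).
Proof.
move=> hA.
have h : cisd (fun r => \det (A r)) s (\sum_(w : {perm 'I_n}) (-1) ^+ w *
    \sum_(i <- index_enum 'I_n) \prod_(j <- index_enum 'I_n) (if j == i then D j (w j) else A s j (w j))).
  apply: cisd_sum => w; have := cisdM (cisd_cst ((-1) ^+ w) s)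
    (cisd_prod (index_enum_uniq 'I_n) (fun j => hA j (w j) : cisd (fun r => A r j (w j)) s _)).
  by rewrite mul0r add0r.
have -> // : \tr (D *m \adj (A s)) = \sum_(w : {perm 'I_n}) (-1) ^+ w *
    \sum_(i <- index_enum 'I_n) \prod_(j <- index_enum 'I_n) (if j == i then D j (w j) else A s j (w j)).
pose B i : 'M[R[i]]_n := \matrix_(r, c) if r == i then D r c else A s r c.
transitivity (\sum_i \det (B i)).
  apply: eq_bigr => i _; rewrite (expand_det_row _ i) mxE; apply: eq_bigr => j _.
  rewrite !mxE eqxx; congr (_ * _); rewrite /cofactor; congr (_ * \det _).
  by apply/matrixP => a b; rewrite !mxE eq_sym (negbTE (neq_lift _ _)).
rewrite /determinant exchange_big/=; apply: eq_bigr => w _; rewrite mulr_sumr; apply: eq_bigr => i _.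
by congr (_ * _); apply: eq_bigr => j _; rewrite mxE.
Qed.

Lemma cisd_unique f s d e : cisd f s d -> cisd f s e -> d = e.
Proof.
move=> [f1 f2] [g1 g2]; apply: complex_ext.
  by rewrite -(@derive_val _ _ _ _ _ _ _ f1) -(@derive_val _ _ _ _ _ _ _ g1).
by rewrite -(@derive_val _ _ _ _ _ _ _ f2) -(@derive_val _ _ _ _ _ _ _ g2).
Qed.

Lemma mxisd_adj n (F : R -> 'M[R[i]]_n) s A : mxisd F s A -> mxisd (fun r => (F r)^t*) s (A^t*).
Proof.
move=> h i j; have [h1 h2] := h j i; rewrite adjE cRe_conj cIm_conj; split.
  by rewrite (_ : (fun r => _) = (fun r => Re (F r j i)))//; apply/funext => r; rewrite adjE cRe_conj.
rewrite (_ : (fun r => _) = - (fun r => Im (F r j i))); first exact: is_deriveN.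
by apply/funext => r; rewrite adjE cIm_conj.
Qed.

Lemma mxisd_unique n (F : R -> 'M[R[i]]_n) s A B : mxisd F s A -> mxisd F s B -> A = B.
Proof. by move=> /mxisd_der <- /mxisd_der <-. Qed.

End Jacobi.

Section MatrixIdentities.
Context {R : realType} {n : nat}.
Implicit Types (A B S T W D X : 'M[R[i]]_n).

Lemma twopii_adj X : (twopii^-1 *: X)^t* = - (twopii^-1 *: X^t*).
Proof.
apply/matrixP => i j; rewrite adjE [in RHS]mxE [in RHS]mxE adjE mxE.
by apply: complex_ext; rewrite ?cRe_conj ?cIm_conj ?cReN ?cImN ?ReMt_inv ?ImMt_inv ?cRe_conj ?cIm_conj ?mulrN ?opprK.
Qed.

Lemma quot_sandwich (w : R[i]) A B S T W D : w *: (A *m (S - T) *m D) - B *m W *m D =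
  ((A - B) *m (w *: (S - T)) + B *m (w *: (S - T) - W)) *m D.
Proof.
rewrite scalemxAl -mulmxBl scalemxAr; congr (_ *m D); move: (w *: (S - T)) => X; mxexpand.
Qed.

End MatrixIdentities.

(** * The derivatives of Q and of Psi *)

Section Potential.
Context {R : realType} {n : nat}.
Local Notation mu := (@lebesgue_measure R).
Local Notation M := 'M[R[i]]_n.
Implicit Types (p : R * R) (b : bool) (u : nat -> R).
Variables (k : nat) (v : R -> R -> R -> M).
Hypotheses (hk : (7 <= k)%N) (hv : scatdata k v).
Let K := (k - 4)%N.
Local Notation V i j p := (vder v i j p).
Variables (C : R) (Psi : R * R -> R[i] -> M) (P MM : R * R -> R -> M).
Hypothesis rh : forall p, rhdata C (fun l => v p.1 p.2 l) (Psi p) (P p) (MM p).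
Hypothesis bM : bdd2 (fun p l => MM p l - 1%:M).

Let k0 : (0 + 0 <= K)%N. Proof. by []. Qed.
Let k1 b : (incx b 0 + incy b 0 <= K)%N. Proof. by rewrite incxy /K; lia. Qed.
Let Vb b p := V (incx b 0) (incy b 0) p.
Let Md b := Mder v MM b.

Definition pot p : M := twopii^-1 *: mxintegral (fun l => MM p l *m V 0 0 p l).
(** Termwise derivative of the split form [potE], in which each product is a pairing of two L_2
    functions. *)
Definition dpot b p : M := twopii^-1 *: (mxintegral (Vb b p) +
  (mxintegral (fun l => Md b p l *m V 0 0 p l) + mxintegral (fun l => (MM p l - 1%:M) *m Vb b p l))).

Lemma potE p : pot p = twopii^-1 *: (mxintegral (V 0 0 p) + mxintegral (fun l => (MM p l - 1%:M) *m V 0 0 p l)).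
Proof.
congr (_ *: _); have i1 := vder_intg hv p k0; have i2 := mxintegrable_M (rhd_M (rh p)) (vder_mL2 hv p k0).
apply: (etrans _ (mxintegralD i1 i2)); congr mxintegral; apply/funext => l; exact: mulmx_sub1E.
Qed.

Lemma Md_smooth0 b : L2smooth 0 (Md b).
Proof.
apply: (Mder_smooth hk hv rh).
- by split.
- by rewrite /L2_diff_order; case: b => /=; lia.
- by lia.
Qed.

(** The order does not drop: d_x v has i = 1, so no extra order is charged, and d_x M inherits all k
    - 5 orders of M. *)
Lemma Md_smooth : L2smooth (k - 5) (Md true).
Proof.
apply: (Mder_smooth hk hv rh).
- exact: (M_smooth hk hv rh bM (leqnn _)).
- by rewrite /L2_diff_order /=; lia.
- by lia.
Qed.

Lemma pot_isd b p : mxisd (fun h => pot (sh b h p)) 0 (dpot b p).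
Proof.
have g1 : L2_diff_order k 1 0 0 by rewrite /L2_diff_order /=; lia.
have i1 : mxisd (fun h => mxintegral (V 0 0 (sh b h p))) 0 (mxintegral (Vb b p)).
  by apply: (vder_int_isd hk hv); [lia|right].
have i2 := Mvder_int_isd hk hv p bM (Md_smooth0 b).1 (L2d_M hk hv rh b) g1.
have := mxisdZ twopii^-1 (mxisdD i1 i2); apply: mxisd_ext => h.
exact: (esym (potE _)).
Qed.

Lemma pot_bdd_vanish : bdd_vanish pot.
Proof.
have h := bdd_vanishZ twopii^-1 (bdd_vanishD (vder_int_bdd_vanish hv k0) (Mvder_int_bdd_vanish hv bM k0)).
by have -> : pot = _ := funext potE.
Qed.

Lemma dpot_bdd_vanish b : bdd_vanish (dpot b).
Proof.
apply: bdd_vanishZ; apply: bdd_vanishD; first exact: (vder_int_bdd_vanish hv (k1 b)).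
by apply: bdd_vanishD; [exact: (Mvder_int_bdd_vanish hv (Md_smooth0 b).1 k0)|exact: (Mvder_int_bdd_vanish hv bM (k1 b))].
Qed.

Lemma dpot_x_decaying : decaying (k - 5) (dpot true).
Proof.
apply: decayingZ; apply: decayingD; first by apply: (decaying_vder hk hv) => //; rewrite /incx /incy; lia.
apply: decayingD; apply: (decaying_Mvder hk hv).
- exact: Md_smooth.
- by rewrite /L2_diff_order /=; lia.
- exact: (M_smooth hk hv rh bM (leqnn _)).
- by rewrite /L2_diff_order /=; lia.
Qed.

(** The density M (d_b v) M^*, from which both d_b Q and d_b Psi are computed. *)
Definition MVM b p l : M := MM p l *m Vb b p l *m (MM p l)^t*.

Lemma MVM_mL2 b p : mL2 (MVM b p).
Proof. exact: (mL2_adjM (rh p) (mL2_MMl rh p (vder_mL2 hv p (k1 b)))). Qed.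

Lemma MdE b p l : Md b p l = Cb (-1) (MVM b p) l *m MM p l.
Proof.
have E : (fun r => (Vb b p r + (MM p r - 1%:M) *m Vb b p r) *m (MM p r)^t*) = MVM b p.
  by apply/funext => r; exact: (congr1 (mulmx^~ _) (esym (mulmx_sub1E _ _))).
exact: (congr1 (fun X => Cb (-1) X l *m MM p l) E).
Qed.

(* The term absorbed by [cross] integrates to 0, by the antisymmetry of the Hilbert transform. *)
Lemma MVM_ae b p : {ae mu, forall l, (Vb b p l + (Md b p l *m V 0 0 p l + (MM p l - 1%:M) *m Vb b p l)) -
  cross (MVM b p) (fun t => MM p t *m V 0 0 p t) l = MVM b p l}.
Proof.
have A1 := M_ae (rh p); have A2 := unit_ae (rh p).
move: A1 A2; apply: aeS2 => l a1 [_ _ a2].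
rewrite /cross MdE -CbE.
have -> : Cb (-1) (fun t => MM p t *m V 0 0 p t) l = MM p l - 1%:M by exact: esym a1.
have hv1 : v p.1 p.2 l = 1%:M + V 0 0 p l by rewrite vder0 addrC subrK.
rewrite hv1 in a2; have hB : MVM b p l = MM p l *m Vb b p l *m (MM p l)^t* by [].
move: (Cb _ _ l) hB a2; move: (MM p l) (V 0 0 p l) (Vb b p l) (MVM b p l) => A S D B X hB a2.
(* A, S, D and B are M, v - 1, d_b v and the density M (d_b v) M^*; this is M^*M v = 1 multiplied on
   the left by M d_b v. *)
have e : B *m A + B *m A *m S = A *m D.
  rewrite hB; have -> : A *m D *m A^t* *m A + A *m D *m A^t* *m A *m S = A *m D *m (A^t* *m A *m (1%:M + S)).
    by mxexpand.
  by rewrite a2 mulmx1.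
have -> : D + (X *m A *m S + (A - 1%:M) *m D) = A *m D + X *m A *m S by mxexpand.
by rewrite -e; mxexpand.
Qed.

(** The density is a priori known in L_2. By [MVM_ae] it is almost everywhere a difference of
    integrable functions, and the cross term among them integrates to 0. *)
Lemma MVM_intg b p : mxintegrable (MVM b p) /\ dpot b p = twopii^-1 *: mxintegral (MVM b p).
Proof.
pose phi t := MM p t *m V 0 0 p t; have ph : mL2 phi := phi_mL2 (rh p).
have hB := MVM_mL2 b p.
have j1 := vder_intg hv p (k1 b); have j2 := mxintegrable_M ((Md_smooth0 b).1.1 p) (vder_mL2 hv p k0).
have j3 := mxintegrable_M (rhd_M (rh p)) (vder_mL2 hv p (k1 b)); have j23 := mxintegrableD j2 j3.
have j4 := mxintegrableD j1 j23; have jc := cross_intg hB ph.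
pose L l := (Vb b p l + (Md b p l *m V 0 0 p l + (MM p l - 1%:M) *m Vb b p l)) - cross (MVM b p) phi l.
have jL : mxintegrable L.
  have := mxintegrableD j4 (mxintegrableZ (-1) jc); congr mxintegrable.
  by apply/funext => l; rewrite scaleN1r.
have mL : mxmeasurable L.
  move=> i j; have [h1 h2] := jL i j; split; exact: intg_mf.
split; first exact: (mxintegrable_eqae hB.1 (MVM_ae b p) jL).
rewrite -(mxintegral_eqae mL hB.1 (MVM_ae b p)); congr (_ *: _); apply: esym.
apply: (etrans (mxintegralB j4 jc)); rewrite (mxintegral_cross hB ph) subr0.
by apply: (etrans (mxintegralD j1 j23)); congr (_ + _); exact: (mxintegralD j2 j3).
Qed.

Lemma Vb_adj b p l : (Vb b p l)^t* = Vb b p l.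
Proof.
have h := vder_isd hv b p l 0 (_ : (0 + 0 < k - 4)%N); have {}h := h ltac:(lia).
have h2 := mxisd_adj h; rewrite sh0 in h h2.
apply: (mxisd_unique (s := 0) h2); apply: mxisd_ext h => r.
have [vh _] := rhd_v (rh (sh b r p)) l.
by rewrite !vder0 adjB adj1 vh.
Qed.

Lemma Vb_tr b p l : \tr (Vb b p l *m \adj (v p.1 p.2 l)) = 0.
Proof.
have h := vder_isd hv b p l 0 (_ : (0 + 0 < k - 4)%N); have {}h := h ltac:(lia).
have h1 : mxisd (fun r => v (sh b r p).1 (sh b r p).2 l) 0 (Vb b p l).
  have := mxisdD h (mxisd_cst 1%:M 0); rewrite sh0 addr0; apply: mxisd_ext => r.
  by rewrite vder0 subrK.
have := cisd_det h1; rewrite sh0 => /cisd_unique; apply.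
rewrite (_ : (fun r => _) = (fun=> 1)); first exact: cisd_cst.
apply/funext => r; by have [_ ->] := rhd_v (rh (sh b r p)) l.
Qed.

(** By cyclicity the trace is that of d_b v M^*M, and M^*M is the adjugate of v, so [Vb_tr]
    applies. *)
Lemma MVM_tr b p : {ae mu, forall l, \tr (MVM b p l) = 0}.
Proof.
move: (unit_ae (rh p)); apply: aeS => l [_ _ a2].
have [_ dv] := rhd_v (rh p) l.
have E : (MM p l)^t* *m MM p l = \adj (v p.1 p.2 l).
  have e : v p.1 p.2 l *m \adj (v p.1 p.2 l) = 1%:M by rewrite mul_mx_adj dv.
  by rewrite -[LHS]mulmx1 -e mulmxA a2 mul1mx.
rewrite /MVM -mulmxA mxtrace_mulC -mulmxA E; exact: Vb_tr.
Qed.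

Lemma dpot_su b p : su (dpot b p).
Proof.
have [iB ->] := MVM_intg b p; split.
  have E : (fun t => (MVM b p t)^t*) = MVM b p.
    by apply/funext => t; rewrite /MVM !adjM adjK Vb_adj mulmxA.
  have h := mxintegral_adj iB; rewrite E in h.
  by rewrite twopii_adj -h.
rewrite mxtraceZ; transitivity (twopii^-1 * 0 : R[i]); last by rewrite mulr0.
congr (_ * _).
transitivity (cint (fun t => \tr (MVM b p t))).
  by rewrite (cint_sum _ (fun i => iB i i)); apply: eq_bigr => i _; rewrite mxintE.
have cB : cintg (fun t => \tr (MVM b p t)) by exact: (cintg_sum _ (fun i => iB i i)).
rewrite -[RHS](cint0 (R := R)); apply: complex_ext; apply: Rint_eqae => //.
- exact: (intg_mf cB.1).
- by move: (MVM_tr b p); apply: aeS => t ->.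
- exact: (intg_mf cB.2).
- by move: (MVM_tr b p); apply: aeS => t ->.
Qed.

Lemma Psi_unit p z : complex.Im z != 0 -> (Psi p (z^*))^t* *m Psi p z = 1%:M.
Proof.
move=> z0; apply: mulmx1C; rewrite (Psi_adj (rh p) (rh p) z0).
rewrite (_ : (fun t => _) = (fun=> 0)) ?Cau0 ?addr0//.
by apply/funext => t; rewrite subrr mulmx0 mul0mx.
Qed.

(** Multiplying [Psi_adj] on the right by Psi z gives Psi' = Psi + Cau G Psi. After division by u m
    the density converges in L_2, and [Cau_bound] evaluates the limit at z. *)
Lemma Psi_isd b p z : complex.Im z != 0 -> mxisd (fun h => Psi (sh b h p) z) 0 (Cau (MVM b p) z *m Psi p z).
Proof.
move=> z0; apply: mxisd_of_seq => u hu; rewrite sh0; have [u0 cu] := hu.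
have kk : (0 + 0 < k - 4)%N by lia.
have g1 : L2_diff_order k 1 0 0 by rewrite /L2_diff_order /=; lia.
have [Kz_ Kz0 hK] := @Cau_bound R n z z0; have [c c0 hc] := vquot_ae hk hv.
pose p' m := sh b (u m) p; pose D m := vquot v b 0 0 p u m.
have mV p' : mL2 (V 0 0 p') := vder_mL2 hv p' k0.
have LD m : mL2 (D m) by exact: (mL2_quot _ (mV _) (mV p)).
have LX m : mL2 (fun l => D m l - Vb b p l) := mL2B (LD m) (vder_mL2 hv p (k1 b)).
have bD m : mbdd c (D m) by exact: hc.
have L1 m : mL2 (fun l => (MM (p' m) l - MM p l) *m D m l) := mL2_Mr c0 (mL2_MMB rh p (p' m)) (bD m).
have L2 m : mL2 (fun l => MM p l *m (D m l - Vb b p l)) := mL2_MMl rh p (LX m).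
pose Y m l := (MM (p' m) l - MM p l) *m D m l + MM p l *m (D m l - Vb b p l).
have LY m : mL2 (Y m) := mL2D (L1 m) (L2 m).
have t1 : tends0 (fun m => mN2 (fun l => (MM (p' m) l - MM p l) *m D m l)).
  by apply: (tends0_mN2_Mr c0 _ bD (MM_cont hk hv rh b p hu)) => m; exact: (mL2_MMB rh p (p' m)).1.
have t2 : tends0 (fun m => mN2 (fun l => MM p l *m (D m l - Vb b p l))).
  apply: (tends0_mN2_scale (CB_ge0 rh) (fun m => mN2_MMl rh p (LX m))).
  exact: (vder_L2d hk hv b p g1 hu).
have tY : tends0 (fun m => mN2 (Y m)) := tends0_mN2D (fun m => (L1 m).1) (fun m => (L2 m).1) t1 t2.
have LZ m : mL2 (fun l => Y m l *m (MM p l)^t*) := mL2_adjM (rh p) (LY m).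
have tZ : tends0 (fun m => mN2 (fun l => Y m l *m (MM p l)^t*)).
  apply: (tends0_mN2_Mr (Mbound_ge0 (C_ge0 rh)) (fun m => (LY m).1) _ tY) => m.
  exact: (bdd_adj (M_bdd (rh p))).
pose G m l := MM (p' m) l *m (v (p' m).1 (p' m).2 l - v p.1 p.2 l) *m (MM p l)^t*.
have LG m : mL2 (G m) := mL2_adjM (rh p) (mL2_Mdv (rh p) (rh (p' m))).
have E m : (u m)^-1%:C *: (Psi (p' m) z - Psi p z) - Cau (MVM b p) z *m Psi p z =
    Cau (fun l => Y m l *m (MM p l)^t*) z *m Psi p z.
  have h := Psi_adj (rh p) (rh (p' m)) z0.
  have hP : Psi (p' m) z = Psi p z + Cau (G m) z *m Psi p z.
    by rewrite -[LHS]mulmx1 -(Psi_unit p z0) mulmxA h mulmxDl mul1mx.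
  rewrite hP [Psi p z + _]addrC addrK scalemxAl -mulmxBl; congr (_ *m _).
  have d1 := Cdom_mL2 z0 (LG m).
  apply: (etrans (congr1 (fun X => X - _) (esym (CauZ (u m)^-1%:C d1)))).
  apply: (etrans (esym (CauB (CdomZ _ d1) (Cdom_mL2 z0 (MVM_mL2 b p))))).
  congr (Cau _ z); apply/funext => l; rewrite /Y /G /D /MVM /vquot.
  have -> : v (p' m).1 (p' m).2 l - v p.1 p.2 l = V 0 0 (p' m) l - V 0 0 p l.
    by rewrite !vder0 opprB addrA subrK.
  exact: quot_sandwich.
have cZ : q (Cau (fun l => Y m l *m (MM p l)^t*) z) @[m --> \oo] --> (0 : R).
  apply/cvgrPdist_le => e e0; have d0 : 0 < e / (Kz_ + 1) by rewrite divr_gt0// ltr_wpDl.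
  have [N hN] := tZ _ d0; exists N => // m Nm /=.
  rewrite sub0r normrN ger0_norm ?q_ge0//; apply: (le_trans (hK _ (LZ m))).
  have h := fine_le_mN2 (LZ m) (hN m Nm).
  apply: (@le_trans _ _ (Kz_ * (e / (Kz_ + 1)))); first by rewrite ler_wpM2l.
  rewrite mulrCA ler_piMr// ?(ltW e0)// ler_pdivrMr ?mul1r; first by rewrite lerDl.
  by rewrite ltr_wpDl.
have h0 : 2 * n%:R * (q (Cau (fun l => Y m l *m (MM p l)^t*) z) * q (Psi p z)) @[m --> \oo] -->
   (2 * n%:R * (0 * q (Psi p z)) : R).
  by apply: cvgMr; exact: cvgMl.
rewrite mul0r mulr0 in h0; apply: (squeeze_cvgr _ (cvg_cst 0) h0); apply: nearW => m.
by rewrite q_ge0 /= E; exact: qM.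
Qed.

Lemma V01 p l : Vb false p l = l%:C *: Vb true p l.
Proof. by apply: esym; apply: (vder_lmul hv); rewrite //=; lia. Qed.

(** Since d_y v = t d_x v, the two densities differ by the factor t, and (t - z)/(t - z) = 1 removes
    the kernel: what remains is the integral defining d_x Q. *)
Lemma Psi_Lax p z : complex.Im z != 0 ->
  Cau (MVM false p) z *m Psi p z - z *: (Cau (MVM true p) z *m Psi p z) = dpot true p *m Psi p z.
Proof.
move=> z0; have [iB ->] := MVM_intg true p; rewrite scalemxAl -mulmxBl; congr (_ *m _).
have d0 := Cdom_mL2 z0 (MVM_mL2 false p); have d1 := Cdom_mL2 z0 (MVM_mL2 true p).
apply: (etrans (congr1 (fun X => _ - X) (esym (CauZ z d1)))).
apply: (etrans (esym (CauB d0 (CdomZ z d1)))).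
rewrite /Cau; congr (_ *: mxintegral _); apply/funext => t.
have -> : MVM false p t = t%:C *: MVM true p t by rewrite /MVM V01 -scalemxAr -scalemxAl.
rewrite -scalerBl scalerA mulVf ?scale1r//.
apply: contraNneq z0 => h; have := congr1 (fun w : R[i] => complex.Im w) h.
by rewrite cImB /= sub0r => /eqP; rewrite oppr_eq0.
Qed.

Lemma Psi_vanish z : complex.Im z != 0 -> vanish_unif (fun x y => (q (Psi (x, y) z - 1%:M))%:E).
Proof.
move=> z0 e e0; have [Kz_ Kz0 hK] := @Cau_bound R n z z0; have cb := CB_ge0 rh.
set c := 2 * n%:R * Mbound C in cb.
have d0 : 0 < e / (Kz_ * c + 1) by rewrite divr_gt0// ltr_wpDl// mulr_ge0.
have [A hA] := vder_vanish hv k0 d0; exists A => x y /hA h; pose p := (x, y).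
have ph : mL2 (fun t => MM p t *m V 0 0 p t) := phi_mL2 (rh p).
have mV : mL2 (V 0 0 p) := vder_mL2 hv p k0.
rewrite lee_fin (PsiE (rh (x, y)) z0) addrC addKr; apply: (le_trans (hK _ ph)).
have h' : fine (mN2 (fun t => MM p t *m V 0 0 p t)) <= c * (e / (Kz_ * c + 1)).
  apply: (fine_le_mN2 ph); apply: (le_trans (mN2_MMl rh p mV)).
  by rewrite [leRHS]EFinM lee_wpmul2l ?lee_fin.
apply: (@le_trans _ _ (Kz_ * (c * (e / (Kz_ * c + 1))))); first by rewrite ler_wpM2l.
have -> : Kz_ * (c * (e / (Kz_ * c + 1))) = e * (Kz_ * c / (Kz_ * c + 1)) by ring.
rewrite ler_piMr// ?(ltW e0)// ler_pdivrMr ?mul1r; last by rewrite ltr_wpDl// mulr_ge0.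
by rewrite lerDl.
Qed.

End Potential.

(** * From one-variable derivatives at 0 to functions on the plane *)

Section Plane.
Context {R : realType} {n : nat}.
Local Notation mu := (@lebesgue_measure R).
Local Notation M := 'M[R[i]]_n.
Implicit Types (p : R * R) (b : bool) (u : nat -> R) (Q G : R * R -> M) (F : R -> R -> M).

Definition curry2 Q : R -> R -> M := fun x y => Q (x, y).

Lemma mxisd_shift (F : R -> M) (x : R) A : mxisd (fun h => F (x + h)) 0 A -> mxisd F x A.
Proof.
move=> h; have := @mxisd_affine _ _ (fun h => F (x + h)) (- x) 1 x A.
rewrite mul1r addNr scale1r => /(_ h); apply: mxisd_ext => r.
by rewrite mul1r addNKr.
Qed.

Lemma mxisd_x Q x y A : mxisd (fun h => Q (sh true h (x, y))) 0 A -> mxisd (fun x' => curry2 Q x' y) x A.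
Proof. by move=> h; apply: mxisd_shift. Qed.

Lemma mxisd_y Q x y A : mxisd (fun h => Q (sh false h (x, y))) 0 A -> mxisd (fun y' => curry2 Q x y') y A.
Proof. by move=> h; apply: mxisd_shift. Qed.

Lemma Dx_curry Q G : (forall p, mxisd (fun h => Q (sh true h p)) 0 (G p)) -> Dx (curry2 Q) = curry2 G.
Proof.
by move=> h; apply/funext => x; apply/funext => y; apply: mxisd_der; apply: mxisd_x; exact: h.
Qed.

Lemma Dy_curry Q G : (forall p, mxisd (fun h => Q (sh false h p)) 0 (G p)) -> Dy (curry2 Q) = curry2 G.
Proof.
by move=> h; apply/funext => x; apply/funext => y; apply: mxisd_der; apply: mxisd_y; exact: h.
Qed.

Lemma derivable_curry Q x y A B : mxisd (fun h => Q (sh true h (x, y))) 0 A ->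
  mxisd (fun h => Q (sh false h (x, y))) 0 B -> derivable_x (curry2 Q) x y /\ derivable_y (curry2 Q) x y.
Proof.
by move=> h1 h2; split; [exact: mxisd_derivable (mxisd_x h1)|exact: mxisd_derivable (mxisd_y h2)].
Qed.

Lemma measurable_sh b (h : R) : measurable_fun setT (sh b h : R * R -> R * R).
Proof.
have m1 := @measurable_fst _ _ R R; have m2 := @measurable_snd _ _ R R.
by case: b; rewrite /sh; apply/measurable_fun_pairP; split => //; exact: measurable_funD.
Qed.

Lemma measurable_seq_cvg (f : R * R -> R) (g : nat -> R * R -> R) : (forall m, measurable_fun setT (g m)) ->
  (forall p, g m p @[m --> \oo] --> f p) -> measurable_fun setT f.
Proof. by move=> mg gf; apply: (@measurable_fun_cvg _ _ _ _ g) => // p _; exact: gf. Qed.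

Lemma mxmeasurable_deriv b Q G : mxmeasurable Q -> (forall p, mxisd (fun h => Q (sh b h p)) 0 (G p)) ->
  mxmeasurable G.
Proof.
move=> mQ hG; pose u m : R := (m.+1%:R)^-1.
have u0 m : u m != 0 by rewrite invr_eq0 pnatr_eq0.
have cu : u m @[m --> \oo] --> (0 : R) by exact: cvg_harmonic.
have c (f : R * R -> R) (g : R * R -> R) : measurable_fun setT f ->
    (forall p, is_derive (0:R) (1:R) (fun h => f (sh b h p)) (g p)) -> measurable_fun setT g.
  move=> mf hg; apply: (@measurable_seq_cvg _ (fun m p => (u m)^-1 * (f (sh b (u m) p) - f p))).
    move=> m; apply: measurable_funM; first exact: measurable_cst.
    by apply: measurable_funB => //; apply: measurableT_comp => //; exact: measurable_sh.
  move=> p; have := deriv_seq (hg p) u0 cu; rewrite sh0.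
  by under eq_fun do rewrite add0r.
move=> i j; have [m1 m2] := mQ i j; split.
  by apply: (c _ _ m1) => p; exact: (hG p i j).1.
by apply: (c _ _ m2) => p; exact: (hG p i j).2.
Qed.

(** Partial derivatives give separate continuity, and a separately continuous function is jointly
    measurable by [cara_measurable]. *)
Lemma mxmeasurable_isd Q (G : bool -> R * R -> M) : (forall b p, mxisd (fun h => Q (sh b h p)) 0 (G b p)) ->
  mxmeasurable Q.
Proof.
move=> h; have hx y := fun x => mxisd_x (h true (x, y)); have hy x := fun y => mxisd_y (h false (x, y)).
have c (f g g' : R -> R -> R) : (forall x y, is_derive x (1:R) (f^~ y) (g x y)) ->
    (forall x y, is_derive y (1:R) (f x) (g' x y)) -> measurable_fun setT (fun p : R * R => f p.1 p.2).
  move=> h1 h2; apply: cara_measurable.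
    by move=> l s; exact: is_derive_cont (h1 s l).
  by move=> s; apply: continuous_measurable_fun => l; exact: is_derive_cont (h2 s l).
have E (t : R * R -> R) : (fun p => t p) = (fun p => t (p.1, p.2)) by apply/funext => -[].
move=> i j; split; rewrite E.
  exact: (c (fun x y => complex.Re (Q (x, y) i j)) _ _ (fun x y => (hx y x i j).1) (fun x y => (hy x y i j).1)).
exact: (c (fun x y => complex.Im (Q (x, y) i j)) _ _ (fun x y => (hx y x i j).2) (fun x y => (hy x y i j).2)).
Qed.

(** Measurability is carried along because each derivative is known only as a limit of difference
    quotients; the order drops by one for every derivative taken. *)
Lemma decaying_pd r i j Q : mxmeasurable Q -> decaying (r + i + j) Q ->
  exists Q', [/\ pd i j (curry2 Q) = curry2 Q', mxmeasurable Q' & decaying r Q'].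
Proof.
have stepx m : forall r Q, mxmeasurable Q -> decaying (r + m) Q ->
    exists Q', [/\ iter m Dx (curry2 Q) = curry2 Q', mxmeasurable Q' & decaying r Q'].
  elim: m => [|m IH] r' Q' mQ; first by rewrite addn0 => kQ; exists Q'.
  rewrite addnS => -[_ [G hG]]; have [d kG] := hG true.
  have [Q2 [e mQ2 k2]] := IH r' (G true) (mxmeasurable_deriv mQ d) kG.
  by exists Q2; split=> //; rewrite iterSr (Dx_curry d).
have stepy m : forall r Q, mxmeasurable Q -> decaying (r + m) Q ->
    exists Q', [/\ iter m Dy (curry2 Q) = curry2 Q', mxmeasurable Q' & decaying r Q'].
  elim: m => [|m IH] r' Q' mQ; first by rewrite addn0 => kQ; exists Q'.
  rewrite addnS => -[_ [G hG]]; have [d kG] := hG false.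
  have [Q2 [e mQ2 k2]] := IH r' (G false) (mxmeasurable_deriv mQ d) kG.
  by exists Q2; split=> //; rewrite iterSr (Dy_curry d).
move=> mQ; rewrite addnAC => kQ; have [Q1 [e1 m1 k1]] := stepx i _ _ mQ kQ.
have [Q2 [e2 m2 k2]] := stepy j _ _ m1 k1; exists Q2; split=> //.
by rewrite /pd e1.
Qed.

Lemma decaying_pdiff r Q : mxmeasurable Q -> decaying r Q -> pdiff r (curry2 Q).
Proof.
move=> mQ kQ i j ij x y; have := @decaying_pd (r - (i + j)) i j Q mQ.
rewrite -addnA subnK ?(ltnW ij)// => /(_ kQ)[Q' [-> _]].
have -> : (r - (i + j) = (r - (i + j)).-1.+1)%N by rewrite prednK// subn_gt0.
by move=> [_ [G hG]]; apply: (derivable_curry ((hG true).1 _) ((hG false).1 _)).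
Qed.

Lemma bdd_vanish_plane Q : bdd_vanish Q -> vanish_plane (curry2 Q).
Proof.
move=> [_ h] e e0; have [B hB] := h (e ^+ 2) ltac:(by rewrite exprn_gt0).
exists B => x y /hB; rewrite !lee_fin /q ler_pXn2r// nnegrE ?mxnorm_ge0 ?ltW//.
Qed.

Lemma bdd_vanish_Linfty Q : mxmeasurable Q -> bdd_vanish Q -> Linfty_plane (curry2 Q).
Proof.
move=> mQ [[C hC] _]; split.
  by rewrite (_ : (fun p => _) = Q)//; apply/funext => -[].
rewrite unlock; case: ifPn => // _.
apply: (@le_lt_trans _ _ (Num.sqrt C)%:E); last exact: ltry.
apply/ess_supP; apply: nearW => p /=; rewrite lee_fin /curry2 ger0_norm ?mxnorm_ge0//.
rewrite -(ger0_norm (mxnorm_ge0 _)) -sqrtr_sqr ler_wsqrtr//; exact: hC.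
Qed.

Lemma vanish_cvg F (A : M) x : vanish_unif (fun x y => (q (F x y - A))%:E) ->
  mxnorm (F x y - A) @[y --> -oo] --> (0 : R).
Proof.
move=> h; apply/cvgrPdist_le => e e0; have [B hB] := h (e ^+ 2) ltac:(by rewrite exprn_gt0).
near=> y; rewrite sub0r normrN ger0_norm ?mxnorm_ge0//.
have : B <= `|y|.
  by apply: (@le_trans _ _ (- y)); [rewrite lerNr; near: y; exact: nbhs_ninfty_le (num_real _)|rewrite -normrN ler_norm].
move=> yB; have := hB x y (or_intror yB); rewrite lee_fin /q ler_pXn2r// nnegrE ?mxnorm_ge0 ?ltW//.
Unshelve. all: by end_near. Qed.

End Plane.

Theorem theorem1p4 (R : realType) (n k : nat) (hn : (1 <= n)%N) (hk : (7 <= k)%N)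
    (v : R -> R -> R -> 'M[R[i]]_n) (hv : scatdata k v)
    (Psi : R -> R -> R[i] -> 'M[R[i]]_n) (Psip Psim : R -> R -> R -> 'M[R[i]]_n)
    (hPsi : forall x y, rh_solution (v x y) (Psi x y) (Psip x y) (Psim x y))
    (hPsip : L2_class Psip) (hPsim : L2_class Psim) :
  let Q := potential v Psim in
  [/\ (forall x y, derivable_x Q x y /\ derivable_y Q x y) /\
        pdiff (k - 5) (Dx Q),
      forall (l : R[i]), complex.Im l != 0 -> forall x y,
        [/\ derivable_x (fun x y => Psi x y l) x y,
            derivable_y (fun x y => Psi x y l) x y &
            Dy (fun x y => Psi x y l) x y - l *: Dx (fun x y => Psi x y l) x y
              = Dx Q x y *m Psi x y l],
      forall (x : R) (l : R[i]), complex.Im l != 0 ->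
        mxnorm (Psi x y l - 1%:M) @[y --> -oo] --> (0 : R),
      forall x y, su (Dx Q x y) &
      [/\ forall i j, (i + j <= k - 4)%N -> (0 < i)%N ->
            Linfty_plane (pd i j Q) /\ vanish_plane (pd i j Q),
          Linfty_plane (Dy Q) /\ vanish_plane (Dy Q) &
          Linfty_plane Q /\ vanish_plane Q]].
Proof.
have [C C0 bV] := vder_bdd hk hv; have k00 : (0 + 0 <= k - 4)%N by [].
have [[mM1 [D hD]] _] := hPsim; have [[mP1 _] _] := hPsip.
have mM p : mL2 (fun t => Psim p.1 p.2 t - 1%:M).
  split; first exact: mM1.
  by apply: le_lt_trans (mxL2_mN2 (hD _ _)) _; exact: ltry.
have rh p : rhdata C (fun l => v p.1 p.2 l) (Psi p.1 p.2) (Psip p.1 p.2) (Psim p.1 p.2).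
  split=> //; first exact: (mxmeasurable_sub1 (mP1 p.1 p.2)).
  - exact: (vder_mL2 hv p k00).
  - exact: (bV 0%N 0%N k00 p).
  - move=> t; split; last exact: (scat_det hv).
    by have [] := scat_pos hv p.1 p.2 t.
have bM : bdd2 (fun p l => Psim p.1 p.2 l - 1%:M).
  by split=> //; exists (D ^+ 2); [exact: sqr_ge0|move=> p; exact: mxL2_mN2].
pose MM p := Psim p.1 p.2; pose q0 := pot v MM; pose qd b := dpot v MM b.
have dQ b p : mxisd (fun h => q0 (sh b h p)) 0 (qd b p) := pot_isd hk hv rh bM b p.
have mq0 : mxmeasurable q0 := mxmeasurable_isd dQ.
have mqd b : mxmeasurable (qd b) := mxmeasurable_deriv mq0 (dQ b).
have kx : decaying (k - 5) (qd true) := dpot_x_decaying hk hv rh bM.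
(* [vder v 0 0] is v - 1 by computation, so the two expressions of the potential agree
   definitionally. *)
move=> Q; have -> : Q = curry2 q0 by [].
rewrite (Dx_curry (dQ true)) (Dy_curry (dQ false)); split.
- split; last exact: (decaying_pdiff (mqd true) kx).
  by move=> x y; exact: (derivable_curry (dQ true _) (dQ false _)).
- move=> l l0 x y; pose Ps p := Psi p.1 p.2 l.
  pose G b p := Cau (MVM v MM b p) l *m Ps p.
  have dP b p : mxisd (fun h => Ps (sh b h p)) 0 (G b p) := Psi_isd hk hv rh b p l0.
  have hP : (fun x y => Psi x y l) = curry2 Ps by [].
  rewrite hP; have [d1 d2] := derivable_curry (dP true (x, y)) (dP false (x, y)); split=> //.
  by rewrite (Dx_curry (dP true)) (Dy_curry (dP false)); exact: (Psi_Lax hk hv rh bM (x, y) l0).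
- move=> x l l0; exact: (@vanish_cvg _ _ (fun x y => Psi x y l) 1%:M x (Psi_vanish hv rh l0)).
- by move=> x y; exact: (dpot_su hk hv rh bM true (x, y)).
- have L r (S : R * R -> 'M[R[i]]_n) : mxmeasurable S -> decaying r S -> Linfty_plane (curry2 S) /\ vanish_plane (curry2 S).
    by move=> mS /decaying_bdd_vanish bS; split; [exact: bdd_vanish_Linfty|exact: bdd_vanish_plane].
  split.
  + move=> [//|i] j ij _.
    (* The condition of at least one x-derivative lets d_x Q absorb the first one; at most k - 5
       derivatives then remain. *)
    have -> : pd i.+1 j (curry2 q0) = pd i j (curry2 (qd true)).
      by rewrite /pd iterSr (Dx_curry (dQ true)).
    have e : (k - 5 = (k - 5 - (i + j)) + i + j)%N by lia.
    rewrite e in kx; have [Q' [-> mQ' kQ']] := decaying_pd (mqd true) kx; exact: L kQ'.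
  + have bdy : bdd_vanish (qd false) := dpot_bdd_vanish hk hv rh bM false.
    exact: (L 0%N (qd false) (mqd false) (conj bdy I)).
  + exact: (L 0%N q0 mq0 (conj (pot_bdd_vanish hv rh bM) I)).
Qed.
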